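(* Let $X=(X_s)_{s\in[0,T]}$ be a centered continuous Gaussian process generated by a linear bounded operator $u:H\to C([0,T])$ on a separable Hilbert space $H$, let $A=\{a_1,\dots,a_N\}\subset C([0,T])^*$ be a finite set of conditions, and let $\{e_1,\dots,e_N\}$ be an orthonormal basis of the detached subspace $H_{(A)}$. Assume: (i) the supremum of all $s\in[0,T]$ for which there exist $e_i'\in H^{(A)}$, $1\le i\le N$, with $(ue_i')(x)=(ue_i)(x)$ for all $0\le x\le s$, equals $T$; (ii) there are a standard linear Brownian motion $W=(W_s)_{s\in[0,T]}$, a real number $\alpha\ne0$ and a progressively measurable functional $\beta$ on $C([0,T])$ with $\int_0^S|\beta(x,X)|\,dx<\infty$ almost surely for all $S<T$, such that $X$ is a (strong) solution of $$dX_s=\alpha\,dW_s+\beta(s,X)\,ds,\qquad X_0=0,\qquad 0\le s<T.$$ Let $X^{(A)}$ be the conditioned process of $X$ with respect to $A$ and $\mathbb P_{X^{(A)}}$ its law on $(C([0,T]),\mathcal C)$. Then there is a Brownian motion $W'=(W'_s)_{s\in[0,T]}$ defined on the probability space $(C([0,T]),\mathcal C,\mathbb P_{X^{(A)}})$ and a progressively measurable functional $\delta$ on $C([0,T])$ with $$\int_0^S|\delta(x,X^{(A)})|\,dx<\infty\qquad \mathbb P_{X^{(A)}}\text{-almost surely for all }S<T,$$ such that $X^{(A)}$ (realized as the coordinate process $X^{(A)}_s(f)=f(s)$ on this space) is a (strong) solution of $$dX^{(A)}_s=\alpha\,dW'_s+\delta(s,X^{(A)})\,ds,\qquad X^{(A)}_0=0,\qquad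 0\le s<T.$$
   Context: $C([0,T])$ is the Banach space of continuous real functions on $[0,T]$ with the supremum norm, $\mathcal C$ its Borel $\sigma$-algebra; $\mathcal F_s\subset\mathcal C$ is the smallest $\sigma$-algebra making all point evaluations $f\mapsto f(r)$, $0\le r\le s$, measurable. A progressively measurable functional on $C([0,T])$ is a map $\beta:[0,T]\times C([0,T])\to\mathbb R$ whose restriction to $[0,s]\times C([0,T])$ is $\mathcal B([0,s])\otimes\mathcal F_s$-measurable for each $0\le s\le T$. A strong solution is one adapted to the completed natural filtration of the driving Brownian motion. A condition is an element $a$ of $C([0,T])^*$ (a finite signed Borel measure, $a(f)=\int f\,da$). ''$X$ is generated by $u$'' means that for every orthonormal basis $(h_i)_{i\ge1}$ of $H$ and independent standard normal $(\omega_i)_{i\ge1}$, the series $\sum_i\omega_i(uh_i)$ converges almost surely in $C([0,T])$ and has the law of $X$. Reduced Hilbert space: $H^{(A)}=\{h\in H: a(uh)=0\text{ for all }a\in A\}$. Detached subspace: $H_{(A)}=H\ominus H^{(A)}=\operatorname{span}\{u^*a:a\in A\}$ with $u^*$ the adjoint of $u$; if $\dim H_{(A)}<N$, an orthonormal basis of it is padded with zero vectors to a list $e_1,\dots,e_N$. The conditioned process $X^{(A)}$ (defined only in law) is a continuous Gaussian process such that for all $b_1,\dots,b_n\in C([0,T])^*$ the law of $(b_1(X^{(A)}),\dots,b_n(X^{(A)}))$ is the conditional law of the Gaussian vector $(b_1(X),\dots,b_n(X))$ given $a(X)=0$ for all $a\in A$ in the sense of Gaussian conditioning, i.e. the law of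 $\big(b_k(X)-\mathbb E[b_k(X)\mid a(X),a\in A]\big)_{k=1}^n$. *)

(* Defs.v *)
From HB Require Import structures.
From mathcomp Require Import all_boot all_order all_algebra.
From mathcomp Require Import all_classical all_reals all_analysis.

Set Implicit Arguments.
Unset Strict Implicit.
Unset Printing Implicit Defensive.

Import Order.TTheory GRing.Theory Num.Theory.
Import numFieldNormedType.Exports.

Local Open Scope classical_set_scope.
Local Open Scope ring_scope.

(* C([0,T]): a continuous function on [0,T] is represented by its extension
   by zero to the whole of R, so that equality in this type is equality on
   [0,T] and evaluation takes a real argument. *)
Definition is_path {R : realType} (T : R) (f : R -> R) : Prop :=
  {within `[0, T], continuous f} /\ f \_ `[0, T] = f.

Definition is_pathb {R : realType} (T : R) : {pred (R -> R)} :=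
  fun f => `[< is_path T f >].

Lemma is_path_submod (R : realType) (T : R) :
  GRing.submod_closed (is_pathb T : {pred (R -> R)}).
Proof.
split=> [|a f g /asboolP[cf f0] /asboolP[cg g0]]; apply/asboolP; split.
- by move=> x; exact: cvg_cst.
- by apply/funext => x; rewrite patchE; case: ifP.
- move=> x; have := @cvgD _ R^o _ _ _ _ _ _ _
    (@cvgM _ _ _ _ _ _ _ _ (@cvg_cst _ a _ _ _) (cf x)) (cg x).
  exact.
- apply/funext => x; rewrite -f0 -g0 patchE; case: ifPn => // xT.
  rewrite !fctE !patchE (negbTE xT) addr0.
  by rewrite scaler0.
Qed.

HB.instance Definition _ (R : realType) (T : R) :=
  GRing.isSubmodClosed.Build R (R -> R) (is_pathb T) (is_path_submod T).

Record path_space {R : realType} (T : R) := PathSpace {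
  path_fun :> R -> R ;
  path_funP : path_fun \in is_pathb T }.

HB.instance Definition _ (R : realType) (T : R) :=
  [isSub for @path_fun R T].
HB.instance Definition _ (R : realType) (T : R) :=
  [Choice of path_space T by <:].
HB.instance Definition _ (R : realType) (T : R) :=
  [SubChoice_isSubLmodule of path_space T by <:].

Section sup_norm.
Context {R : realType} (T : R).
Implicit Types f g : path_space T.

Definition sup_norm f : R := sup [set `|f x| | x in `[0, T]].

Lemma path_out f x : x \notin `[0, T] -> f x = 0.
Proof.
have /asboolP[_ <-] := path_funP f.
by move=> xT; rewrite patchE mem_setE (negbTE xT).
Qed.

Lemma path_bounded f : exists M, forall x, `|f x| <= M.
Proof.
have /asboolP[cf _] := path_funP f.
have [T0|T0] := ltP T 0.
  exists 0 => x; rewrite path_out ?normr0// in_itv/= negb_and -!ltNge.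
  by case: (ltP x 0) => //= x0; rewrite (lt_le_trans T0).
have cnf : {within `[0, T], continuous (fun x => `|f x|)}.
  by move=> x; apply: cvg_norm; exact: cf.
have [c _ H] := EVT_max T0 cnf.
exists `|f c| => x; have [xT|xT] := boolP (x \in `[0, T]); first exact: H.
by rewrite path_out ?normr0.
Qed.

Lemma sup_norm_ub f x : x \in `[0, T] -> `|f x| <= sup_norm f.
Proof.
move=> xT; have [M fM] := path_bounded f.
by apply: ub_le_sup; [exists M => _ [y _ <-]|exists x].
Qed.

Lemma sup_norm_le f M :
  0 <= M -> (forall x, x \in `[0, T] -> `|f x| <= M) -> sup_norm f <= M.
Proof.
move=> M0 fM; rewrite /sup_norm.
have [->|/set0P ne] := eqVneq [set `|f x| | x in `[0, T]] set0.
  by rewrite sup0.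
by apply: ge_sup => // _ [x xT <-]; exact: fM.
Qed.

Lemma sup_norm_ge0 f : 0 <= sup_norm f.
Proof.
rewrite /sup_norm; have [->|/set0P[_ [x xT _]]] :=
    eqVneq [set `|f x| | x in `[0, T]] set0; first by rewrite sup0.
exact: le_trans (normr_ge0 _) (sup_norm_ub f xT).
Qed.

Lemma sup_norm_triangle f g : sup_norm (f + g) <= sup_norm f + sup_norm g.
Proof.
apply: sup_norm_le => [|x xT]; first by rewrite addr_ge0// sup_norm_ge0.
by apply: (le_trans (ler_normD _ _)); rewrite lerD// sup_norm_ub.
Qed.

Lemma sup_normZ (l : R) f : sup_norm (l *: f) = `|l| * sup_norm f.
Proof.
have le (k : R) g : sup_norm (k *: g) <= `|k| * sup_norm g.
  apply: sup_norm_le => [|x xT]; first by rewrite mulr_ge0// sup_norm_ge0.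
  by rewrite [leLHS]normrM ler_wpM2l// sup_norm_ub.
have [->|l0] := eqVneq l 0.
  by apply/eqP; rewrite eq_le le/= normr0 mul0r sup_norm_ge0.
apply/eqP; rewrite eq_le le/= mulrC -ler_pdivlMr ?normr_gt0//.
by rewrite -{1}[f](scalerK l0) (le_trans (le _ _))// normfV mulrC.
Qed.

Lemma sup_norm0_eq0 f : sup_norm f = 0 -> f = 0.
Proof.
move=> f0; apply/val_inj/funext => x /=.
have [xT|xT] := boolP (x \in `[0, T]); last by rewrite path_out.
by apply/eqP; rewrite -normr_le0 -f0 sup_norm_ub.
Qed.

HB.instance Definition _ := @Lmodule_isNormed.Build R (path_space T)
  sup_norm sup_norm_triangle sup_normZ sup_norm0_eq0.

(* the Borel sigma-algebra of C([0,T]) *)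
HB.instance Definition _ := @isMeasurable.Build
  (sigma_display (@open (path_space T))) (path_space T)
  <<s (@open (path_space T)) >> (@sigma_algebra0 _ setT _)
  (@sigma_algebraC _ _) (@sigma_algebra_bigcup _ setT _).

End sup_norm.

Section hilbert.
Context {R : realType} {H : completeNormedModType R} (ip : {dot H for idfun}).

(* Orthonormal basis of the closed subspace V.  A finite basis is encoded as a
   sequence padded at its tail with zero vectors. *)
Definition orthonormal_basis (V : set H) (h : nat -> H) : Prop :=
  [/\ forall i, V (h i),
      forall i j, i != j -> ip (h i) (h j) = 0,
      forall i, h i != 0 -> ip (h i) (h i) = 1,
      forall i, h i = 0 -> h i.+1 = 0 &
      V `<=` closure
        [set x | exists n (c : nat -> R), x = \sum_(i < n) c i *: h i]].

End hilbert.

Section probability_notions.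
Context {R : realType} {d} {Omega : measurableType d} (P : probability Omega R).

Definition mutually_independent {I : eqType} (X : I -> Omega -> R) : Prop :=
  forall s : seq I, uniq s ->
  forall B : I -> set R, (forall i, measurable (B i)) ->
    P (\bigcap_(i in [set` s]) (X i @^-1` B i)) =
    (\prod_(i <- s) P (X i @^-1` B i))%E.

(* X has law N(m, sd ^+ 2); normal_prob is not meant for sd = 0 *)
Definition has_normal_law (m sd : R) (X : Omega -> R) : Prop :=
  forall B : set R, measurable B ->
    P (X @^-1` B) = if sd == 0 then \d_m B else normal_prob m sd B.

(* Y is a version of E[X | G], for a sub-sigma-algebra G *)
Definition conditional_expectation (G : set (set Omega)) (X Y : Omega -> R) :
    Prop :=
  [/\ P.-integrable setT (EFin \o Y),
      forall B, measurable B -> G (Y @^-1` B) &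
      forall E, G E -> (\int[P]_(w in E) (Y w)%:E = \int[P]_(w in E) (X w)%:E)%E].

(* completion of the sigma-algebra G by the P-negligible sets *)
Definition completed (G : set (set Omega)) : set (set Omega) :=
  [set E | exists2 F, G F & P.-negligible (E `+` F)].

End probability_notions.

Section processes.
Context {R : realType} {T : R}.
Local Notation C := (path_space T).
Local Notation lambda := (@lebesgue_measure R).

(* generating family of the sigma-algebra sigma(X_r, 0 <= r <= s) *)
Definition past {Omega : Type} (X : Omega -> C) (s : R) : set (set Omega) :=
  \bigcup_(r in `[0, s]) preimage_set_system setT (fun w => X w r) measurable.

(* The values of beta outside of [0,T] are irrelevant. *)
Definition progressively_measurable (beta : R -> C -> R) : Prop :=
  forall s, 0 <= s <= T ->
    measurable_fun (`[0, s] `*` setT)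
      (fun p : R * g_sigma_algebraType (past (@idfun C) s) => beta p.1 p.2).

Context {d} {Omega : measurableType d} (P : probability Omega R).

Definition gaussian_process (X : Omega -> C) : Prop :=
  forall n (t c : 'I_n -> R), (forall i, 0 <= t i <= T) ->
    exists m sd, has_normal_law P m sd (fun w => \sum_i c i * X w (t i)).

Definition centered (X : Omega -> C) : Prop :=
  forall s, 0 <= s <= T -> ('E_P[fun w => X w s] = 0)%E.

Definition brownian_motion (W : Omega -> C) : Prop :=
  [/\ {ae P, forall w, W w 0 = 0},
      forall s t, 0 <= s -> s < t -> t <= T ->
        has_normal_law P 0 (Num.sqrt (t - s)) (fun w => W w t - W w s) &
      forall n (t : nat -> R), 0 <= t 0 -> t n <= T ->
        (forall i, (i < n)%N -> t i <= t i.+1) ->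
        mutually_independent P (fun (i : 'I_n) w => W w (t i.+1) - W w (t i))].

Definition locally_integrable_drift (beta : R -> C -> R) (X : Omega -> C) :
    Prop :=
  {ae P, forall w, forall S, 0 <= S < T ->
    (\int[lambda]_(x in `[0%R, S]) `|beta x (X w)|%:E < +oo)%E}.

(* X is a strong solution of dX = alpha dW + beta(s, X) ds, X_0 = 0, 0 <= s < T;
   alpha being constant, the equation in integral form involves no stochastic
   integral. *)
Definition strong_solution (W : Omega -> C) (alpha : R) (beta : R -> C -> R)
    (X : Omega -> C) : Prop :=
  [/\ {ae P, forall w, X w 0 = 0},
      {ae P, forall w, forall s, 0 <= s < T ->
        X w s = alpha * W w s + \int[lambda]_(x in `[0, s]) beta x (X w)} &
      forall s, 0 <= s < T -> forall B : set R, measurable B ->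
        completed P <<s past W s >> ((fun w => X w s) @^-1` B)].

Definition generated_by {H : completeNormedModType R} (ip : {dot H for idfun})
    (u : H -> C) (X : {mfun Omega >-> C}) : Prop :=
  forall h : nat -> H, orthonormal_basis ip setT h ->
  forall d' (Omega' : measurableType d') (P' : probability Omega' R)
    (g : nat -> {RV P' >-> R}),
    (forall i, has_normal_law P' 0 1 (g i)) -> mutually_independent P' g ->
  exists S : {RV P' >-> C},
    {ae P', forall w, series (fun i => g i w *: u (h i)) @ \oo --> S w} /\
    forall B, measurable B -> distribution P' S B = distribution P X B.

End processes.

(* XA, defined on a possibly different probability space, is the process X
   conditioned on a_i(X) = 0 for all i *)
Definition conditioned_process {R : realType} {T : R}
    {d} {Omega : measurableType d} (P : probability Omega R)
    (X : Omega -> path_space T) {N} (a : 'I_N -> {scalar path_space T})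
    {d'} {Omega' : measurableType d'} (P' : probability Omega' R)
    (XA : Omega' -> path_space T) : Prop :=
  gaussian_process P' XA /\
  forall n (b : 'I_n -> {scalar path_space T}), (forall k, continuous (b k)) ->
  exists2 Y : 'I_n -> Omega -> R,
    forall k, conditional_expectation P
      (g_sigma_preimage (fun i => a i \o X)) (b k \o X) (Y k) &
    forall B : set (n.-tuple R), measurable B ->
      P' ((fun w => [tuple b k (XA w) | k < n]) @^-1` B) =
      P ((fun w => [tuple b k (X w) - Y k w | k < n]) @^-1` B).

Section conditions.
Context {R : realType} {T : R} {H : completeNormedModType R}.
Variables (ip : {dot H for idfun}) (u : H -> path_space T).
Context {N : nat} (a : 'I_N -> {scalar path_space T}).

Definition reduced_space : set H := [set h | forall i, a i (u h) = 0].

Definition detached_space : set H :=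
  [set h | forall k, reduced_space k -> ip h k = 0].

End conditions.

(* Main.v *)
(** Everything takes place in the Gaussian space of [X], the closed span in [L^2] of the functionals [b(X)], where
    uncorrelated means independent.  The noise [w_t(f) = (f(t) - int_0^t delta(x,f) dx) / alpha] can be read off a path,
    and a process [Y] solves the SDE as soon as [w(Y)] has covariance [min(s,t)] and, for each [t < T], the variables
    [w_r(Y)] and the variables [Y_r], [r <= t], have the same closed span.

    For [Y = X] the point is that [w_t(X)] lies in the Gaussian space although [beta] is not linear.  For an independent
    copy [X'] and [c^2 + s^2 = 1], the process [c X + s X'] is distributed as [X], and
    [w_t(c X + s X') - c w_t(X) - s w_t(X')] is a square-integrable martingale of bounded variation, hence zero.  So
    [b(X) + x w_t(X)] is stable under rotations and therefore Gaussian, and jointly Gaussian variables that are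
    measurable with respect to a family belong to its span.

    The conditions are imposed one at a time.  Conditioning [Y] on a unit vector [eta] of its Gaussian space means passing to
    [Y - eta v] with [v(r) = E(eta Y_r)].  Since [Y_t, t < T] spans, [eta] is a Wiener integral [int phi dW] with
    [W = w(Y)]; put [m_t = int_0^t phi dW] and [gamma(t) = 1 - int_0^t phi^2].  Hypothesis (i) says that [eta] keeps a
    positive distance from the past of each [s < T]; this makes the law of [Y - eta v] on [[0,s]] absolutely continuous with
    respect to that of [Y] and keeps [gamma] positive.  Evaluated on the path [Y - eta v], [w_t] becomes
    [W_t - eta E(eta W_t)] and the limit defining [m_t] becomes [m_t - (1 - gamma(t)) eta], so for the drift
    [delta - alpha (phi/gamma) m] the noise of [Y - eta v] is the innovation [W_t - int_0^t (phi/gamma) (eta - m_x) dx].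

    The conditioned process has the law of the process obtained in this way, and the Brownian path is recovered from a
    trajectory as the uniformly continuous extension of [w_t] from rational times. *)

Require Import Defs.
From HB Require Import structures.
From mathcomp Require Import all_boot all_order all_algebra.
From mathcomp Require Import all_classical all_reals all_analysis measurable_realfun.
From mathcomp Require Import ring lra.

Set Implicit Arguments.
Unset Strict Implicit.
Unset Printing Implicit Defensive.

Import Order.TTheory GRing.Theory Num.Theory.
Import numFieldNormedType.Exports.

Local Open Scope classical_set_scope.
Local Open Scope ring_scope.

(** The drift is nonlinear and its properties are known only almost surely under the law of [X],
    whereas conditioned paths live under another law. Absolute continuity on [[0,s]], [s < T], is
    what makes the old drift meaningful on the new paths and carries almost sure identities over. It
    cannot hold up to [T]: [eta] lies in the span of the noise before [T] and has norm 1, so the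
    integral of [phi^2] over [[0,T]] is 1, [gamma] tends to 0, and the new drift may explode at [T],
    as for a Brownian bridge. The invariant [good] speaks of covariances and closed spans only, and
    a closed span is defined by duality. Thus each claim about the conditioned process is tested
    against a single [h] in [L^2]: subtracting [eta v] from the process amounts to removing from [h]
    its component along [eta]. The hard point is that the innovation loses no information; in this
    form it says that a linear Volterra equation with zero data has only the zero solution, which is
    an energy estimate. No Brownian motion is carried along: it is a function of the path, and the
    given [W] reappears at the end only as a model whose law the noise must have. *)

(* A limit that is measurable in a parameter; its value is junk where [u] diverges. *)
Definition flim {R : realType} (u : nat -> R) : R :=
  fine (limn_esup (fun n => (u n)%:E)).

Lemma flimE {R : realType} (u : nat -> R) (l : R) :
  u n @[n --> \oo] --> l -> flim u = l.
Proof.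
move=> ul; rewrite /flim.
have ul' : (u n)%:E @[n --> \oo] --> l%:E by apply: cvg_EFin => //; exact: nearW.
by rewrite is_cvg_limn_esupE; [rewrite (cvg_lim _ ul')|apply/cvg_ex; exists l%:E].
Qed.

Lemma measurable_flim {d} {T : measurableType d} {R : realType} (D : set T)
  (h : nat -> T -> R) : measurable D -> (forall n, measurable_fun D (h n)) ->
  measurable_fun D (fun x => flim (h ^~ x)).
Proof.
move=> mD mh; rewrite /flim; apply: (measurableT_comp (fine_measurable measurableT)).
by apply: measurable_fun_limn_esup => n; exact/measurable_EFinP.
Qed.

(** Finite linear combinations are lists of coefficient and index pairs, with repetitions allowed:
    sums become concatenations and multiples become maps. *)
Definition lc {R : realType} {T : Type} {I : eqType} (V : I -> T -> R)
  (s : seq (R * I)) (w : T) := \sum_(x <- s) x.1 * V x.2 w.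

Definition inS {R : realType} {I : eqType} (S : I -> Prop) (s : seq (R * I)) :=
  forall x, x \in s -> S x.2.

(** * Square-integrable random variables and orthogonal projections *)

Section expectation.
Context {d} {Om : measurableType d} {R : realType} (P : probability Om R).
Implicit Types Z Y : Om -> R.

Definition Ex Z : R := \int[P]_w Z w.
Definition int1 Z := P.-integrable setT (EFin \o Z).

Lemma int1_meas Z : int1 Z -> measurable_fun setT Z.
Proof. by move=> /integrableP[/measurable_EFinP]. Qed.

Lemma int1D Z Y : int1 Z -> int1 Y -> int1 (fun w => Z w + Y w).
Proof. by move=> iZ iY; rewrite /int1; exact: (integrableD measurableT iZ iY). Qed.

Lemma int1Z c Z : int1 Z -> int1 (fun w => c * Z w).
Proof. by move=> iZ; rewrite /int1; exact: (integrableZl measurableT c iZ). Qed.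

Lemma int1B Z Y : int1 Z -> int1 Y -> int1 (fun w => Z w - Y w).
Proof. by move=> iZ iY; rewrite /int1; exact: (integrableB measurableT iZ iY). Qed.

Lemma int1_le Z Y : measurable_fun setT Z -> (forall w, `|Z w| <= Y w) ->
  int1 Y -> int1 Z.
Proof.
move=> mZ ZY; apply: le_integrable => //; first exact/measurable_EFinP.
by move=> w _; rewrite /= lee_fin (le_trans (ZY w))// ler_norm.
Qed.

Lemma int1_cst c : int1 (fun=> c).
Proof. exact: finite_measure_integrable_cst. Qed.

Lemma int1_bdd M Z : measurable_fun setT Z -> (forall w, `|Z w| <= M) -> int1 Z.
Proof. by move=> mZ ZM; apply: int1_le mZ ZM _; exact: int1_cst. Qed.

Lemma int1_abs Z : int1 Z -> int1 (fun w => `|Z w|).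
Proof. exact: integrable_norm. Qed.

Lemma int1_sum I (s : seq I) (F : I -> Om -> R) : (forall i, int1 (F i)) ->
  int1 (fun w => \sum_(i <- s) F i w).
Proof.
move=> iF; elim: s => [|i s IH].
  by under eq_fun do rewrite big_nil; exact: int1_cst.
by under eq_fun do rewrite big_cons; exact: int1D.
Qed.

Lemma ExD Z Y : int1 Z -> int1 Y -> Ex (fun w => Z w + Y w) = Ex Z + Ex Y.
Proof. by move=> iZ iY; rewrite /Ex RintegralD. Qed.

Lemma ExB Z Y : int1 Z -> int1 Y -> Ex (fun w => Z w - Y w) = Ex Z - Ex Y.
Proof. by move=> iZ iY; rewrite /Ex RintegralB. Qed.

Lemma ExZ c Z : int1 Z -> Ex (fun w => c * Z w) = c * Ex Z.
Proof. by move=> iZ; rewrite /Ex RintegralZl. Qed.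

Lemma Ex_cst c : Ex (fun=> c) = c.
Proof.
by rewrite /Ex Rintegral_cst//= probability_setT mulr1.
Qed.

Lemma Ex_sum I (s : seq I) (F : I -> Om -> R) : (forall i, int1 (F i)) ->
  Ex (fun w => \sum_(i <- s) F i w) = \sum_(i <- s) Ex (F i).
Proof.
move=> iF; elim: s => [|i s IH].
  by rewrite big_nil -[RHS]Ex_cst; apply: eq_Rintegral => w _; rewrite big_nil.
rewrite big_cons -IH -ExD//; last exact: int1_sum.
by apply: eq_Rintegral => w _; rewrite big_cons.
Qed.

Lemma Ex_ge0 Z : (forall w, 0 <= Z w) -> 0 <= Ex Z.
Proof. by move=> Z0; apply: Rintegral_ge0. Qed.

Lemma Ex_le Z Y : int1 Z -> int1 Y -> (forall w, Z w <= Y w) -> Ex Z <= Ex Y.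
Proof. by move=> iZ iY ZY; apply: le_Rintegral. Qed.

Lemma Ex_abs Z : int1 Z -> `|Ex Z| <= Ex (fun w => `|Z w|).
Proof. by move=> iZ; apply: le_normr_Rintegral. Qed.

Lemma EFin_Ex Z : int1 Z -> (Ex Z)%:E = (\int[P]_w (Z w)%:E)%E.
Proof. by move=> iZ; rewrite /Ex /Rintegral fineK//; exact: integrable_fin_num. Qed.

Lemma Ex_ae Z Y : measurable_fun setT Z -> measurable_fun setT Y ->
  {ae P, forall w, Z w = Y w} -> Ex Z = Ex Y.
Proof.
move=> mZ mY ZY; rewrite /Ex /Rintegral; congr fine.
apply: ae_eq_integral => //; [exact/measurable_EFinP|exact/measurable_EFinP|].
by apply: filterS ZY => w -> .
Qed.

Lemma int1_ae Z Y : measurable_fun setT Z ->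
  {ae P, forall w, Z w = Y w} -> int1 Y -> int1 Z.
Proof.
move=> mZ ZY /integrableP[mY iY]; apply/integrableP; split.
  exact/measurable_EFinP.
rewrite (ge0_ae_eq_integral (g := fun w => `|(EFin \o Y) w|%E))//.
- by apply: measurableT_comp => //; apply/measurable_EFinP.
- by apply: measurableT_comp.
- by apply: filterS ZY => w /= ->.
Qed.

Lemma Ex_eq0 Z : int1 Z -> (forall w, 0 <= Z w) -> Ex Z = 0 ->
  {ae P, forall w, Z w = 0}.
Proof.
move=> iZ Z0 EZ.
have mZ := int1_meas iZ.
have : (\int[P]_(x in setT) `|(EFin \o Z) x| = 0)%E.
  under eq_integral => w _ do rewrite /= ger0_norm//.
  by rewrite -EFin_Ex// EZ.
move/(ae_eq_integral_abs P measurableT (proj2 (measurable_EFinP _ _) mZ)).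
by apply: filterS => w /= /(_ I) [].
Qed.

Lemma Ex_dct (Z_ : nat -> Om -> R) Z G : (forall n, measurable_fun setT (Z_ n)) ->
  measurable_fun setT Z ->
  {ae P, forall w, Z_ n w @[n --> \oo] --> Z w} -> int1 G ->
  (forall n w, `|Z_ n w| <= G w) ->
  Ex (Z_ n) @[n --> \oo] --> Ex Z.
Proof.
move=> mZ_ mZ ZZ iG ZG.
have [iZ _ H] := @dominated_convergence _ _ _ P setT measurableT
  (fun n => EFin \o Z_ n) (EFin \o Z) (EFin \o G)
  (fun n => proj2 (measurable_EFinP _ _) (mZ_ n))
  (proj2 (measurable_EFinP _ _) mZ)
  ltac:(by apply: filterS ZZ => w Zw _; apply: cvg_EFin => //; exact: nearW)
  iG ltac:(by apply: nearW => w n _; rewrite lee_fin).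
rewrite /Ex /Rintegral; apply: fine_cvg.
rewrite fineK; last exact: integrable_fin_num.
exact: H.
Qed.

Definition L2 Z := measurable_fun setT Z /\ int1 (fun w => Z w ^+ 2).

Lemma L2_mul Z Y : L2 Z -> L2 Y -> int1 (fun w => Z w * Y w).
Proof.
move=> [mZ iZ] [mY iY].
apply: (@int1_le _ (fun w => Z w ^+ 2 + Y w ^+ 2)); last exact: int1D.
  exact: measurable_funM.
move=> w; rewrite ler_norml; apply/andP; split.
  by have := sqr_ge0 (Z w + Y w); have := sqr_ge0 (Z w); have := sqr_ge0 (Y w); nra.
by have := sqr_ge0 (Z w - Y w); have := sqr_ge0 (Z w); have := sqr_ge0 (Y w); nra.
Qed.

Lemma L2_bdd M Z : measurable_fun setT Z -> (forall w, `|Z w| <= M) -> L2 Z.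
Proof.
move=> mZ ZM; split => //; apply: (@int1_bdd (M ^+ 2)).
  exact: measurable_funX.
by move=> w; rewrite normrX lerXn2r ?nnegrE// (le_trans (normr_ge0 (Z w))).
Qed.

Lemma L2_cst c : L2 (fun=> c).
Proof. exact: (@L2_bdd `|c|). Qed.

Lemma L2_int1 Z : L2 Z -> int1 Z.
Proof.
move=> LZ; have := L2_mul LZ (L2_cst 1).
by under eq_fun do rewrite mulr1.
Qed.

Lemma L2Z c Z : L2 Z -> L2 (fun w => c * Z w).
Proof.
move=> [mZ iZ]; split; first exact: measurable_funM.
by under eq_fun do rewrite exprMn; exact: int1Z.
Qed.

Lemma L2D Z Y : L2 Z -> L2 Y -> L2 (fun w => Z w + Y w).
Proof.
move=> LZ LY; split.
  by case: LZ LY => mZ _ [mY _]; exact: measurable_funD.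
under eq_fun do rewrite sqrrD.
apply: int1D; last exact: LY.2.
apply: int1D; first exact: LZ.2.
by under eq_fun do rewrite -mulr_natl; apply: int1Z; exact: L2_mul.
Qed.

Lemma L2B Z Y : L2 Z -> L2 Y -> L2 (fun w => Z w - Y w).
Proof.
move=> LZ LY; have := L2D LZ (L2Z (-1) LY).
by under eq_fun do rewrite mulN1r.
Qed.

Lemma L2_sum I (s : seq I) (F : I -> Om -> R) : (forall i, L2 (F i)) ->
  L2 (fun w => \sum_(i <- s) F i w).
Proof.
move=> iF; elim: s => [|i s IH].
  by under eq_fun do rewrite big_nil; exact: L2_cst.
by under eq_fun do rewrite big_cons; exact: L2D.
Qed.

Lemma L2_ae Z Y : measurable_fun setT Z -> {ae P, forall w, Z w = Y w} ->
  L2 Y -> L2 Z.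
Proof.
move=> mZ ZY [mY iY]; split => //; apply: int1_ae iY.
  exact: measurable_funX.
by apply: filterS ZY => w ->.
Qed.

Definition ip Z Y := Ex (fun w => Z w * Y w).

Lemma ipC Z Y : ip Z Y = ip Y Z.
Proof. by apply: eq_Rintegral => w _; rewrite mulrC. Qed.

Lemma ip_sqr Z : ip Z Z = Ex (fun w => Z w ^+ 2).
Proof. by apply: eq_Rintegral => w _; rewrite expr2. Qed.

Lemma ip_ge0 Z : 0 <= ip Z Z.
Proof. by apply: Ex_ge0 => w; rewrite -expr2 sqr_ge0. Qed.

Lemma ipDl Z Y X : L2 Z -> L2 Y -> L2 X ->
  ip (fun w => Z w + Y w) X = ip Z X + ip Y X.
Proof.
move=> LZ LY LX; rewrite /ip -ExD; [|exact: L2_mul..].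
by apply: eq_Rintegral => w _; rewrite mulrDl.
Qed.

Lemma ipBl Z Y X : L2 Z -> L2 Y -> L2 X ->
  ip (fun w => Z w - Y w) X = ip Z X - ip Y X.
Proof.
move=> LZ LY LX; rewrite /ip -ExB; [|exact: L2_mul..].
by apply: eq_Rintegral => w _; rewrite mulrBl.
Qed.

Lemma ipZl c Z X : L2 Z -> L2 X -> ip (fun w => c * Z w) X = c * ip Z X.
Proof.
move=> LZ LX; rewrite /ip -ExZ; last exact: L2_mul.
by apply: eq_Rintegral => w _; rewrite mulrA.
Qed.

Lemma ipDr Z Y X : L2 Z -> L2 Y -> L2 X ->
  ip X (fun w => Z w + Y w) = ip X Z + ip X Y.
Proof. by move=> *; rewrite ipC ipDl// !(ipC X). Qed.

Lemma ipBr Z Y X : L2 Z -> L2 Y -> L2 X ->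
  ip X (fun w => Z w - Y w) = ip X Z - ip X Y.
Proof. by move=> *; rewrite ipC ipBl// !(ipC X). Qed.

Lemma ipZr c Z X : L2 Z -> L2 X -> ip X (fun w => c * Z w) = c * ip X Z.
Proof. by move=> *; rewrite ipC ipZl// !(ipC X). Qed.

Lemma ip_suml I (s : seq I) (F : I -> Om -> R) X : (forall i, L2 (F i)) -> L2 X ->
  ip (fun w => \sum_(i <- s) F i w) X = \sum_(i <- s) ip (F i) X.
Proof.
move=> LF LX; rewrite /ip -Ex_sum; last by move=> i; exact: L2_mul.
by apply: eq_Rintegral => w _; rewrite mulr_suml.
Qed.

Lemma ip_ae Z Z' Y Y' : measurable_fun setT Z -> measurable_fun setT Z' ->
  measurable_fun setT Y -> measurable_fun setT Y' ->
  {ae P, forall w, Z w = Z' w} -> {ae P, forall w, Y w = Y' w} ->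
  ip Z Y = ip Z' Y'.
Proof.
move=> mZ mZ' mY mY' ZZ YY; apply: Ex_ae; [exact: measurable_funM..|].
by apply: filterS2 ZZ YY => w -> ->.
Qed.

Lemma ip0_ae Z : L2 Z -> ip Z Z = 0 -> {ae P, forall w, Z w = 0}.
Proof.
move=> LZ; rewrite ip_sqr => /(Ex_eq0 LZ.2 (fun w => sqr_ge0 _)).
by apply: filterS => w /eqP; rewrite sqrf_eq0 => /eqP.
Qed.

(** The discriminant criterion, in which [c] may have any sign. It is the common source of the
    Cauchy-Schwarz inequalities for random variables, for the Hilbert space and for integrals over
    time. *)
Lemma quad_ge0 (a b c : R) : 0 <= a -> (forall t, 0 <= a + t * b *+ 2 + t ^+ 2 * c) ->
  b ^+ 2 <= a * c.
Proof.
move=> a0 H; have [c0|c0] := leP c 0.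
  have [bE|b0] := eqVneq b 0.
    rewrite bE; have [->|a1] := eqVneq a 0; first by rewrite mul0r expr0n.
    have [->|cn] := eqVneq c 0; first by rewrite mulr0 expr0n.
    have {}c0 : c < 0 by rewrite lt_neqAle cn.
    have ap : 0 < a by rewrite lt_neqAle eq_sym a1.
    (* For this [t >= 1] one has [t^2 c = - t (a - c)], so the quadratic is at most [c < 0]. *)
    have Ha := H ((a - c) / (- c)).
    have h1 : 1 <= (a - c) / (- c).
      by rewrite ler_pdivlMr ?oppr_gt0//; lra.
    have h2 : (a - c) / (- c) * c = c - a by field; lra.
    have h3 : ((a - c) / (- c)) ^+ 2 * c = (a - c) / (- c) * (c - a).
      by rewrite -h2; ring.
    exfalso; move: Ha; rewrite h3 bE mulr0 mul0rn addr0.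
    have : 0 <= ((a - c) / - c - 1) * (a - c) by rewrite mulr_ge0// subr_ge0// ltW//; lra.
    by lra.
  have Hb := H (- (a + 1) / b / 2).
  have h1 : (- (a + 1) / b / 2) * b *+ 2 = - (a + 1) by field.
  exfalso; move: Hb; rewrite h1.
  have := sqr_ge0 (- (a + 1) / b / 2); nra.
have := H (- b / c).
have -> : a + - b / c * b *+ 2 + (- b / c) ^+ 2 * c = (a * c - b ^+ 2) / c.
  by field; lra.
by rewrite pmulr_lge0 ?invr_gt0// subr_ge0.
Qed.

Lemma ip_quad Z Y t : L2 Z -> L2 Y ->
  ip (fun w => Z w + t * Y w) (fun w => Z w + t * Y w) =
  ip Z Z + t * ip Z Y *+ 2 + t ^+ 2 * ip Y Y.
Proof.
move=> LZ LY; have LtY := L2Z t LY.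
rewrite ipDl ?ipDr ?ipZl ?ipZr//; last exact: L2D.
by rewrite (ipC Y Z); ring.
Qed.

Lemma ip_CS Z Y : L2 Z -> L2 Y -> ip Z Y ^+ 2 <= ip Z Z * ip Y Y.
Proof.
move=> LZ LY; apply: quad_ge0; first exact: ip_ge0.
by move=> t; rewrite -ip_quad//; exact: ip_ge0.
Qed.

Lemma ip_tri Z Y : L2 Z -> L2 Y ->
  ip (fun w => Z w + Y w) (fun w => Z w + Y w) <= ip Z Z *+ 2 + ip Y Y *+ 2.
Proof.
move=> LZ LY.
have h t := ip_quad t LZ LY.
have := ip_ge0 (fun w => Z w + (-1) * Y w); rewrite h => h1.
have := h 1; have -> : (fun w => Z w + 1 * Y w) = (fun w => Z w + Y w).
  by apply/funext => w; rewrite mul1r.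
by move=> ->; lra.
Qed.

Lemma ip_sqrB Z Y : L2 Z -> L2 Y ->
  ip (fun w => Z w - Y w) (fun w => Z w - Y w) = ip Z Z - ip Z Y *+ 2 + ip Y Y.
Proof.
move=> LZ LY; have := ip_quad (-1) LZ LY.
have -> : (fun w => Z w + -1 * Y w) = (fun w => Z w - Y w).
  by apply/funext => w; rewrite mulN1r.
by move=> ->; ring.
Qed.

(** The parallelogram law for [X - Z] and [X - Y]: two near minimisers of the distance to [X] are
    close to each other. *)
Lemma ip_half Z Y X : L2 Z -> L2 Y -> L2 X ->
  ip (fun w => Z w - Y w) (fun w => Z w - Y w) +
  4 * ip (fun w => X w - 2^-1 * (Z w + Y w)) (fun w => X w - 2^-1 * (Z w + Y w)) =
  ip (fun w => X w - Z w) (fun w => X w - Z w) *+ 2 +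
  ip (fun w => X w - Y w) (fun w => X w - Y w) *+ 2.
Proof.
move=> LZ LY LX; have LZY := L2D LZ LY; have LH := L2Z 2^-1 LZY.
rewrite !ip_sqrB// ipZl// !ipZr// ipDl// !ipDr// (ipC Y Z).
by field.
Qed.

(** Fatou's lemma for the squares, which have an almost sure limit; the limit inferior of the
    expectations is at most [c]. *)
Lemma fatou_L2 (Z_ : nat -> Om -> R) Z c : (forall n, L2 (Z_ n)) ->
  measurable_fun setT Z -> {ae P, forall w, Z_ n w @[n --> \oo] --> Z w} ->
  (forall n, ip (Z_ n) (Z_ n) <= c) -> L2 Z /\ ip Z Z <= c.
Proof.
move=> LZ mZ ZZ Zc.
have mZ2 n : measurable_fun setT (fun w => (Z_ n w ^+ 2)%:E).
  by apply/measurable_EFinP/measurable_funX; have [] := LZ n.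
have H : (\int[P]_w (Z w ^+ 2)%:E <= c%:E)%E.
  have h := @fatou _ _ _ P setT measurableT (fun n w => (Z_ n w ^+ 2)%:E) mZ2
    ltac:(by move=> n w _; rewrite lee_fin sqr_ge0).
  have -> : (\int[P]_w (Z w ^+ 2)%:E =
      \int[P]_(x in setT) limn_einf (fun n => (Z_ n x ^+ 2)%:E))%E.
    apply: ae_eq_integral => //.
    - exact/measurable_EFinP/measurable_funX.
    - apply: (eq_measurable_fun (fun x => - limn_esup (fun n => - (Z_ n x ^+ 2)%:E))%E).
        by move=> x _; rewrite (@limn_esupN _ (fun n => (Z_ n x ^+ 2)%:E)) oppeK.
      apply: measurableT_comp => //; apply: measurable_fun_limn_esup => n.
      by apply: measurableT_comp => //; exact: mZ2.
    apply: filterS ZZ => w Zw _.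
    have Zw2 : (Z_ n w ^+ 2)%:E @[n --> \oo] --> (Z w ^+ 2)%:E.
      apply: cvg_EFin; first exact: nearW.
      by under eq_fun do rewrite expr2; rewrite expr2; exact: cvgM.
    rewrite is_cvg_limn_einfE; first by rewrite (cvg_lim _ Zw2).
    by apply/cvg_ex; exists (Z w ^+ 2)%:E.
  apply: (le_trans h); rewrite limn_einf_lim.
  apply: lime_le; first exact: is_cvg_einfs.
  apply: nearW => n; apply: le_trans (_ : (\int[P]_x (Z_ n x ^+ 2)%:E <= _)%E).
    by apply: ereal_inf_lbound; exists n => /=.
  by rewrite -EFin_Ex ?lee_fin -?ip_sqr//; exact: (LZ n).2.
have iZ : int1 (fun w => Z w ^+ 2).
  apply/integrableP; split; first exact/measurable_EFinP/measurable_funX.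
  under eq_integral => w _ do rewrite /= ger0_norm ?sqr_ge0//.
  by rewrite (le_lt_trans H)// ltry.
by split; [split|rewrite ip_sqr -lee_fin EFin_Ex].
Qed.

(** Riesz-Fischer for a rapidly convergent sequence: squared increments of size [4^-n] give
    increments of mean [2^-n], which are almost surely summable. *)
Lemma L2_complete (Z_ : nat -> Om -> R) : (forall n, L2 (Z_ n)) ->
  (forall n, ip (fun w => Z_ n.+1 w - Z_ n w) (fun w => Z_ n.+1 w - Z_ n w)
     <= 4^-1 ^+ n) ->
  exists Z, [/\ L2 Z, {ae P, forall w, Z_ n w @[n --> \oo] --> Z w} &
    forall n, ip (fun w => Z_ n w - Z w) (fun w => Z_ n w - Z w) <= 4 * 4^-1 ^+ n].
Proof.
move=> LZ Zc; pose D n w := Z_ n.+1 w - Z_ n w.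
have LD n : L2 (D n) by exact: L2B.
have mD n : measurable_fun setT (fun w => `|D n w|%:E).
  by apply/measurable_EFinP/measurableT_comp => //; have [] := LD n.
have ED n : (\int[P]_w `|D n w|%:E <= (2^-1 ^+ n)%:E)%E.
  have iD : int1 (fun w => `|D n w|) by apply/int1_abs/L2_int1.
  rewrite -EFin_Ex// lee_fin.
  have p2 : (0 : R) < 2 ^+ n by rewrite exprn_gt0.
  (* From [|y| <= 2^-n / 2 + 2^n y^2 / 2]: since the mean of [y^2] is at most [4^-n], each half
     contributes [2^-n / 2]. *)
  have -> : 2^-1 ^+ n = Ex (fun w => 2^-1 ^+ n * 2^-1) + 2 ^+ n / 2 * 4^-1 ^+ n.
    rewrite Ex_cst -[4]/(2 * 2)%:R natrM invfM exprMn.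
    have := divff (lt0r_neq0 p2); rewrite -exprVn; set a := 2 ^+ n; set b := 2^-1 ^+ n.
    move=> ab; have -> : a / 2 * (b * b) = (a * b) * b / 2 by field.
    by rewrite ab; field.
  apply: (le_trans (y := Ex (fun w => 2^-1 ^+ n * 2^-1) + 2 ^+ n / 2 * ip (D n) (D n))).
    rewrite ip_sqr -ExZ; last exact: (LD n).2.
    rewrite -ExD; [|exact: int1_cst|by apply: int1Z; exact: (LD n).2].
    apply: Ex_le => //; first by apply: int1D; [exact: int1_cst|apply: int1Z; exact: (LD n).2].
    move=> w; rewrite exprVn -(real_normK (num_real (D n w))).
    set y := `|_|; have := sqr_ge0 (2 ^+ n * y - 1); set a := 2 ^+ n in p2 *.
    move=> h; rewrite -(ler_pM2l p2) mulrDr mulrA divff ?gt_eqF//.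
    by nra.
  by rewrite lerD2l ler_pM2l ?divr_gt0//; exact: Zc.
have sumD : (\int[P]_w (\sum_(n <oo) `|D n w|%:E) < +oo)%E.
  rewrite integral_nneseries//.
  apply: (@le_lt_trans _ _ (\sum_(n <oo) (2^-1 ^+ n)%:E)%E).
    by apply: lee_nneseries => n *; [exact: integral_ge0|exact: ED].
  have -> : (\sum_(n <oo) (2^-1 ^+ n)%:E)%E = 2%:E :> \bar R.
    apply/cvg_lim => //; apply: cvg_EFin.
      by apply: nearW => n; rewrite sumEFin.
    have -> : fine \o (fun n => (\sum_(0 <= i < n) (2^-1 ^+ i)%:E)%E) = series (geometric 1 (2^-1 : R)).
      by apply/funext => n /=; rewrite sumEFin/= /series/=; apply: eq_bigr => i _; rewrite mul1r.
    have h2 : `|2^-1| < 1 :> R by rewrite gtr0_norm ?invr_gt0// invf_lt1 ?ltr1n.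
    by have := @cvg_geometric_series R 1 _ h2; have -> : 1 / (1 - 2^-1) = 2 :> R by field.
  by rewrite ltry.
have aeD : {ae P, forall w, (\sum_(n <oo) `|D n w|%:E < +oo)%E}.
  have : P.-integrable setT (fun w => \sum_(n <oo) `|D n w|%:E)%E.
    apply/integrableP; split.
      by apply: ge0_emeasurable_sum => //.
    under eq_integral => w _ do rewrite gee0_abs ?nneseries_ge0//.
    exact: sumD.
  move/(integrable_ae measurableT); apply: filterS => w /(_ I).
  by rewrite fin_numElt => /andP[].
pose Z w := flim (Z_ ^~ w).
have ZZ : {ae P, forall w, Z_ n w @[n --> \oo] --> Z w}.
  apply: filterS aeD => w Dw.
  have cvD : cvgn (series (fun n => D n w)).
    apply: normed_cvg; apply: nondecreasing_is_cvgn.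
      by apply: nondecreasing_series => n _ _ /=.
    exists (fine (\sum_(n <oo) `|D n w|%:E)) => _ [n _ <-] /=.
    rewrite -lee_fin fineK; last first.
      by rewrite ge0_fin_numE// nneseries_ge0.
    rewrite -sumEFin; exact: nneseries_lim_ge.
  have /cvg_ex[l cl] : cvgn (Z_ ^~ w).
    have -> : Z_ ^~ w = (fun n => Z_ 0%N w + series (fun n => D n w) n).
      by apply/funext => n; rewrite /series/= telescope_sumr// addrC subrK.
    by apply: is_cvgD => //; exact: is_cvg_cst.
  by rewrite /Z (flimE cl).
have mZ : measurable_fun setT Z by apply: measurable_flim => // n; have [] := LZ n.
(* The constant [4] reproduces itself under the inequality [ip_tri]:
   [2 * 4^-n + 2 * (4 * 4^-(n+1)) = 4 * 4^-n]. *)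
have Znm m n : ip (fun w => Z_ n w - Z_ (n + m)%N w) (fun w => Z_ n w - Z_ (n + m)%N w) <= 4 * 4^-1 ^+ n.
  elim: m n => [|m IH] n.
    rewrite addn0 (_ : (fun w => _) = fun=> 0); last by apply/funext => w; rewrite subrr.
    by rewrite /ip mulr0 Ex_cst mulr_ge0// exprn_ge0.
  rewrite (_ : (fun w => _) = fun w => -1 * D n w + (Z_ n.+1 w - Z_ (n.+1 + m)%N w)); last first.
    by apply/funext => w; rewrite /D addnS addSn; ring.
  have LnD := L2Z (-1) (LD n); have LB := L2B (LZ n.+1) (LZ (n.+1 + m)%N).
  apply: (le_trans (ip_tri LnD LB)).
  rewrite ipZl// ipZr//; have := Zc n; have := IH n.+1.
  rewrite -/(D n) exprS; set a := 4^-1 ^+ n.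
  set x := ip (D n) (D n); set y := ip _ _; lra.
have key n : L2 (fun w => Z_ n w - Z w) /\ ip (fun w => Z_ n w - Z w) (fun w => Z_ n w - Z w) <= 4 * 4^-1 ^+ n.
  apply: (@fatou_L2 (fun m w => Z_ n w - Z_ (n + m)%N w)) => //.
  - by move=> m; exact: L2B.
  - by apply: measurable_funB => //; have [] := LZ n.
  apply: filterS ZZ => w Zw; apply: cvgB; first exact: cvg_cst.
  have -> : (fun m => Z_ (n + m)%N w) = (fun m => Z_ (m + n)%N w).
    by apply/funext => m; rewrite addnC.
  by move: Zw; rewrite -(cvg_shiftn n).
exists Z; split => //; last by move=> n; exact: (key n).2.
have := L2B (LZ 0%N) (key 0%N).1.
by under eq_fun do rewrite opprB addrC subrK.
Qed.

Lemma L2_cauchy_cvg (Z_ : nat -> Om -> R) Z Y : (forall n, L2 (Z_ n)) -> L2 Z -> L2 Y ->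
  ip (fun w => Z_ n w - Z w) (fun w => Z_ n w - Z w) @[n --> \oo] --> 0 ->
  ip (Z_ n) Y @[n --> \oo] --> ip Z Y.
Proof.
move=> LZ_ LZ LY H; apply/cvgrPdist_lt => e e0.
have e2 : 0 < e ^+ 2 / (ip Y Y + 1) by rewrite divr_gt0 ?exprn_gt0// ltr_wpDl ?ip_ge0.
move/cvgrPdist_lt : H => /(_ _ e2); apply: filterS => n.
rewrite sub0r normrN ger0_norm ?ip_ge0// distrC -ipBl//.
rewrite ltr_pdivlMr ?ltr_wpDl ?ip_ge0// => h.
have := ip_CS (L2B (LZ_ n) LZ) LY.
rewrite -(real_normK (num_real (ip _ Y))) => h1.
rewrite -(@ltr_pXn2r _ 2)// ?nnegrE ?(ltW e0)//; apply: le_lt_trans h1 _.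
apply: le_lt_trans h; rewrite ler_wpM2l ?ip_ge0//; lra.
Qed.

Lemma geo4_cvg0 (c : R) : c * 4^-1 ^+ n @[n --> \oo] --> 0.
Proof.
rewrite -(mulr0 c); apply: cvgM; first exact: cvg_cst.
by apply: cvg_expr; rewrite gtr0_norm ?invr_gt0// invf_lt1 ?ltr1n.
Qed.

(** [L] is a subspace that need not be closed, so the projection is a limit of a minimising sequence
    in [L]. The sequence is returned with its almost sure convergence: later it is evaluated along
    other paths than the one it was built for. *)
Theorem L2_projection (L : (Om -> R) -> Prop) Z :
  (forall Y, L Y -> L2 Y) -> L (fun=> 0) ->
  (forall c Y X, L Y -> L X -> L (fun w => c * Y w + X w)) -> L2 Z ->
  exists p, [/\ L2 p,
    exists2 p_ : nat -> Om -> R, (forall n, L (p_ n)) &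
      {ae P, forall w, p_ n w @[n --> \oo] --> p w} /\
      (forall n, ip (fun w => p_ n w - p w) (fun w => p_ n w - p w) <= 4 * 4^-1 ^+ n) &
    forall Y, L Y -> ip (fun w => Z w - p w) Y = 0].
Proof.
move=> LL L0 Llin LZ.
pose D Y := ip (fun w => Z w - Y w) (fun w => Z w - Y w).
pose S := [set D Y | Y in L].
have S0 : S !=set0 by exists (D (fun=> 0)), (fun=> 0).
have lbS : has_lbound S by exists 0 => _ [Y _ <-]; exact: ip_ge0.
pose m := inf S.
have mD Y : L Y -> m <= D Y by move=> LY; apply: ge_inf => //; exists Y.
(* The tolerance makes consecutive near minimisers differ by at most [4^-n] in squared norm, as
   [L2_complete] asks. *)
have /choice[p_ p_P] : forall n, exists Y, L Y /\ D Y <= m + 4^-1 * 4^-1 ^+ n.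
  move=> n; have e0 : (0 : R) < 4^-1 * 4^-1 ^+ n by rewrite mulr_gt0 ?exprn_gt0 ?invr_gt0.
  have [_ [Y LY <-] h] := inf_adherent e0 (conj S0 lbS).
  by exists Y; split => //; exact: ltW.
have Lp n : L2 (p_ n) by apply: LL; have [] := p_P n.
have half n k : ip (fun w => p_ n w - p_ k w) (fun w => p_ n w - p_ k w) <=
    (4^-1 * 4^-1 ^+ n) *+ 2 + (4^-1 * 4^-1 ^+ k) *+ 2.
  have := ip_half (Lp n) (Lp k) LZ.
  have := mD _ (Llin 2^-1 _ _ (Llin 1 _ _ (p_P n).1 (p_P k).1) L0).
  rewrite /D (_ : (fun w => _ - _) = fun w => Z w - 2^-1 * (p_ n w + p_ k w)); last first.
    by apply/funext => w; rewrite addr0 mul1r.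
  by move: (p_P n).2 (p_P k).2; rewrite /D; set a := ip _ _; set b := ip _ _; set c := ip _ _; lra.
have [n|p [L2p aep pn]] := L2_complete Lp.
  by apply: (le_trans (half n.+1 n)); rewrite exprS; have := @exprn_ge0 R n 4^-1 ltac:(by []); lra.
exists p; split => //.
  by exists p_ => //; move=> n; have [] := p_P n.
move=> Y LY; have L2Y := LL _ LY.
(* Moving from [p_n] along [Y] cannot gain more than the tolerance; the discriminant of the
   resulting quadratic bounds the inner product. *)
have key n : ip (fun w => Z w - p_ n w) Y ^+ 2 <= 4^-1 * 4^-1 ^+ n * ip Y Y.
  apply: quad_ge0; first by rewrite mulr_ge0 ?exprn_ge0 ?invr_ge0.
  move=> t; have := mD _ (Llin (- t) _ _ LY (p_P n).1); rewrite /D.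
  rewrite (_ : (fun w => _ - _) = fun w => (Z w - p_ n w) + t * Y w); last first.
    by apply/funext => w; ring.
  rewrite ip_quad//; last exact: L2B.
  by have := (p_P n).2; rewrite /D; lra.
have c1 : ip (fun w => Z w - p_ n w) Y @[n --> \oo] --> 0.
  apply/cvgrPdist_lt => e e0.
  have e2 : 0 < e ^+ 2 by rewrite exprn_gt0.
  have /cvgrPdist_lt/(_ _ e2) := geo4_cvg0 (4^-1 * ip Y Y).
  apply: filterS => n; rewrite !sub0r !normrN => h.
  rewrite -(@ltr_pXn2r _ 2)// ?nnegrE ?(ltW e0)// real_normK ?num_real//.
  by apply: le_lt_trans (key n) _; apply: le_lt_trans h; rewrite mulrAC ler_norm.
have c2 : ip (fun w => Z w - p_ n w) Y @[n --> \oo] --> ip (fun w => Z w - p w) Y.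
  apply: L2_cauchy_cvg => //; [by move=> n; exact: L2B|exact: L2B|].
  apply: (squeeze_cvgr _ (@cvg_cst _ 0 _ _ _) (geo4_cvg0 4)).
  apply: nearW => n; rewrite ip_ge0/=; apply: le_trans (pn n).
  by rewrite le_eqVlt; apply/orP; left; apply/eqP; apply: eq_Rintegral => w _; ring.
by apply: cvg_unique c2 c1.
Qed.

Section span.
Context {I : eqType} (V : I -> Om -> R) (S : I -> Prop).

(** The closed linear span, by duality: [Z] is orthogonal to whatever is orthogonal to the
    generators. Membership is then tested on one [h] at a time, and [ospan_approx] recovers
    approximation by finite combinations. *)
Definition ospan Z := L2 Z /\
  forall h, L2 h -> (forall i, S i -> ip h (V i) = 0) -> ip h Z = 0.

Hypothesis LV : forall i, S i -> L2 (V i).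

Lemma L2_lc s : inS S s -> L2 (lc V s).
Proof.
rewrite /lc; elim: s => [|x s IH] sS.
  by under eq_fun do rewrite big_nil; exact: L2_cst.
under eq_fun do rewrite big_cons; apply: L2D.
  by apply/L2Z/LV/sS; rewrite inE eqxx.
by apply: IH => y ys; apply: sS; rewrite inE ys orbT.
Qed.

Lemma ip_lc_eq0 h s : inS S s -> L2 h -> (forall i, S i -> ip h (V i) = 0) ->
  ip h (lc V s) = 0.
Proof.
move=> + Lh hV; elim: s => [|x s IH] sS.
  rewrite /ip -[RHS]Ex_cst; apply: eq_Rintegral => w _.
  by rewrite /lc big_nil mulr0.
have sS' : inS S s by move=> y ys; apply: sS; rewrite inE ys orbT.
have xS : S x.2 by apply: sS; rewrite inE eqxx.
rewrite (_ : lc V _ = fun w => x.1 * V x.2 w + lc V s w); last first.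
  by apply/funext => w; rewrite /lc big_cons.
rewrite ipDr ?ipZr ?hV ?mulr0 ?add0r ?IH//.
- exact: LV.
- by apply: L2Z; exact: LV.
- exact: L2_lc.
Qed.

Theorem ospan_projection Z : L2 Z -> exists p, [/\ L2 p,
    exists2 s : nat -> seq (R * I), (forall n, inS S (s n)) &
      {ae P, forall w, lc V (s n) w @[n --> \oo] --> p w} /\
      (forall n, ip (fun w => lc V (s n) w - p w) (fun w => lc V (s n) w - p w) <= 4 * 4^-1 ^+ n) &
    forall i, S i -> ip (fun w => Z w - p w) (V i) = 0].
Proof.
move=> LZ; pose L Y := exists2 s, inS S s & Y = lc V s.
have [|||p [Lp [p_ Lp_ [aep pn]] pL]] := @L2_projection L Z _ _ _ LZ.
- by move=> _ [s sS ->]; exact: L2_lc.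
- by exists [::] => //; apply/funext => w; rewrite /lc big_nil.
- move=> c _ _ [s sS ->] [s' sS' ->]; exists ([seq (c * x.1, x.2) | x <- s] ++ s').
    by move=> x; rewrite mem_cat => /orP[/mapP[y ys ->]|/sS'//]; exact: (sS y).
  apply/funext => w; rewrite /lc big_cat big_map mulr_sumr; congr (_ + _).
  by apply: eq_bigr => x _; rewrite mulrA.
exists p; split => //.
  have /choice[s sP] : forall n, exists s, inS S s /\ p_ n = lc V s.
    by move=> n; have [s sS ->] := Lp_ n; exists s.
  by exists s => [n|]; [have [] := sP n|split; [apply: filterS aep => w|move=> n; have := pn n];
    under eq_fun do rewrite (sP _).2].
move=> i Si; apply: pL; exists [:: (1, i)].
  by move=> x; rewrite inE => /eqP ->.
by apply/funext => w; rewrite /lc big_seq1 mul1r.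
Qed.

(** With [p] the projection of [Z], the difference [Z - p] is orthogonal to the generators, hence to
    [Z] by duality and to [p] by passing to the limit. So it vanishes, and the combinations
    approximating [p] approximate [Z]. *)
Lemma ospan_approx Z : ospan Z ->
  exists2 s : nat -> seq (R * I), (forall n, inS S (s n)) &
      {ae P, forall w, lc V (s n) w @[n --> \oo] --> Z w} /\
      (forall n, ip (fun w => lc V (s n) w - Z w) (fun w => lc V (s n) w - Z w) <= 4 * 4^-1 ^+ n).
Proof.
move=> [LZ oZ]; have [p [Lp [s sS [aes sn]] pV]] := ospan_projection LZ.
have LB := L2B LZ Lp.
have Ls n : L2 (lc V (s n)) by exact: L2_lc.
have hZ := oZ _ LB pV.
have hp : ip (fun w => Z w - p w) p = 0.
  have : ip (lc V (s n)) (fun w => Z w - p w) @[n --> \oo] --> ip p (fun w => Z w - p w).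
    apply: L2_cauchy_cvg => //.
    apply: (squeeze_cvgr _ (@cvg_cst _ 0 _ _ _) (geo4_cvg0 4)).
    by apply: nearW => n; rewrite ip_ge0/=.
  rewrite (_ : (fun n => _) = fun=> 0); last first.
    by apply/funext => n; rewrite ipC; exact: ip_lc_eq0.
  by move=> h; rewrite ipC; apply: cvg_unique h (@cvg_cst _ 0 _ _ _).
have Zp : {ae P, forall w, Z w = p w}.
  have : ip (fun w => Z w - p w) (fun w => Z w - p w) = 0 by rewrite ipBr// hZ hp subrr.
  by move/(ip0_ae LB); apply: filterS => w /subr0_eq.
exists s => //; split.
  by apply: filterS2 Zp aes => w ->.
move=> n; apply: le_trans (sn n); rewrite le_eqVlt; apply/orP; left; apply/eqP.
have [mZ _] := LZ; have [mp _] := Lp; have [ms _] := Ls n.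
apply: ip_ae; try exact: measurable_funB.
all: by apply: filterS Zp => w ->.
Qed.

End span.

End expectation.

(** * Integrals over time and their exchange with the expectation *)

Lemma FTC2_R {R : realType} (f F : R -> R) (a b : R) : a <= b -> continuous f ->
  (forall x : R, is_derive x 1 F (f x)) ->
  \int[@lebesgue_measure R]_(x in `[a, b]) f x = F b - F a.
Proof.
rewrite le_eqVlt => /predU1P[<-|ab] cf dF.
  by rewrite set_itv1 Rintegral_set1 subrr.
have cF : continuous F.
  by move=> x; apply: differentiable_continuous; apply/derivable1_diffP; case: (dF x).
rewrite /Rintegral (@continuous_FTC2 _ f F a b ab) -?EFinB//.
- by apply: continuous_subspaceT => x; exact: cf.
- split; [by move=> x _; case: (dF x)|by apply: cvg_at_right_filter; exact: cF|by apply: cvg_at_left_filter; exact: cF].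
- by move=> x _; rewrite derive1E; case: (dF x) => _ ->.
Qed.

Lemma lam_itv_lty {R : realType} (a b : R) : (@lebesgue_measure R `[a, b]%classic < +oo)%E.
Proof. by rewrite lebesgue_measure_itv/=; case: ifP => _; rewrite ?ltry// -EFinB ltry. Qed.

Lemma lam_integrable_bdd {R : realType} (f : R -> R) (a b K : R) : measurable_fun `[a, b] f ->
  (forall x, `|f x| <= K) -> (@lebesgue_measure R).-integrable `[a, b] (EFin \o f).
Proof.
move=> mf fK; apply: measurable_bounded_integrable => //.
  exact: lam_itv_lty.
exists K; split; first exact: num_real.
by move=> x Kx y _ /=; apply: le_trans (fK _) (ltW Kx).
Qed.

Section fubini.
Context {d} {Om : measurableType d} {R : realType} (P : probability Om R).
Local Notation lam := (@lebesgue_measure R).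

(** The integral over [D] has its true value only for almost every [w] and is a default value
    elsewhere; hence the third clause, which gives integrability of any measurable version of it. *)
Lemma Ex_fubini (D : set R) (G : Om * R -> R) : measurable D ->
  measurable_fun setT G ->
  (\int[lam]_(x in D) \int[P]_w `|G (w, x)|%:E < +oo)%E ->
  [/\ {ae P, forall w, lam.-integrable D (fun x => (G (w, x))%:E)},
      lam.-integrable D (fun x => (Ex P (fun w => G (w, x)))%:E),
      (forall Z, measurable_fun setT Z ->
         {ae P, forall w, Z w = \int[lam]_(x in D) G (w, x)} -> int1 P Z) &
      Ex P (fun w => \int[lam]_(x in D) G (w, x)) =
        \int[lam]_(x in D) Ex P (fun w => G (w, x))].
Proof.
move=> mD mG Gfin.
have afine (z : \bar R) : (`|(fine z)%:E| <= `|z|)%E.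
  by case: z => //= *; rewrite normr0 leey.
pose g (p : Om * R) : \bar R := (G p * \1_D p.2)%:E.
have mg : measurable_fun setT g.
  apply/measurable_EFinP/measurable_funM => //.
  by apply: measurableT_comp => //; exact: measurable_indic.
have gP w x : g (w, x) = ((fun x => (G (w, x))%:E) \_ D) x.
  by rewrite /g patchE indicE/=; case: (x \in D); rewrite ?mulr1 ?mulr0.
have fin21 : (\int[lam]_y \int[P]_x `|g (x, y)| < +oo)%E.
  apply: le_lt_trans Gfin; rewrite le_eqVlt; apply/orP; left; apply/eqP.
  rewrite [RHS]integral_mkcond; apply: eq_integral => x _.
  rewrite patchE; case: ifPn => xD.
    by apply: eq_integral => w _; rewrite /g indicE xD mulr1.
  by apply: integral0_eq => w _; rewrite /g indicE (negbTE xD) mulr0 abse0.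
have ig : (P \x lam)%E.-integrable setT g by apply/integrable21ltyP.
have ae1 := ae_integrable1 ig.
have ae2 := ae_integrable2 ig.
have iF := integrable_fubini_F ig.
have ig' : (lam \x P)%E.-integrable setT (fun q => g (q.2, q.1)).
  have mswap : measurable_fun setT (fun q : R * Om => g (q.2, q.1)).
    by apply: (measurableT_comp mg); apply: measurable_fun_pair.
  by apply/integrable12ltyP.
have iG : lam.-integrable setT (fubini_G P g) := integrable_fubini_F ig'.
have F12 := Fubini ig.
have gD w : (fun x => g (w, x)) = (fun x => (G (w, x))%:E) \_ D by apply/funext => x; exact: gP.
have iD w : lam.-integrable setT (fun y => g (w, y)) -> lam.-integrable D (fun x => (G (w, x))%:E).
  move=> h; apply: (@eq_integrable _ _ _ lam D mD (fun x => g (w, x))).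
    by move=> x xD; rewrite gP patchE xD.
  exact: integrableS h.
have intD w : \int[lam]_(x in D) G (w, x) = fine (\int[lam]_x g (w, x))%E.
  by rewrite /Rintegral integral_mkcond gD.
have intP x : D x -> (\int[P]_w g (w, x) = \int[P]_w (G (w, x))%:E)%E.
  by move=> Dx; apply: eq_integral => w _; rewrite /g indicE mem_set// mulr1.
have aeF : {ae P, forall w, (fubini_F lam g w) \is a fin_num}.
  by apply: filterS (integrable_ae measurableT iF) => w; apply.
have mFi : measurable_fun setT (fun w => \int[lam]_(x in D) G (w, x)).
  under eq_fun do rewrite intD.
  by apply: (measurableT_comp (fine_measurable measurableT)); exact: measurable_fubini_F ig.
have i1 : int1 P (fun w => \int[lam]_(x in D) G (w, x)).
  apply/integrableP; split; first exact/measurable_EFinP.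
  have /integrableP[_] := iF.
  apply: le_lt_trans; apply: ge0_le_integral => //=.
  - by apply/measurable_EFinP/measurableT_comp.
  - by apply: measurableT_comp => //; exact: measurable_fubini_F ig.
  - by move=> w _; rewrite intD; exact: afine.
split.
- by apply: filterS ae1 => w /iD.
- rewrite /Ex /Rintegral.
  have iGD : lam.-integrable D (fun x => fubini_G P g x).
    exact: integrableS iG.
  apply/integrableP; split.
    apply/measurable_EFinP.
    have /measurable_funTS : measurable_fun setT (fun x => fine (fubini_G P g x)).
      by apply: (measurableT_comp (fine_measurable measurableT)); exact: measurable_fubini_G ig.
    move=> /(_ D); apply: eq_measurable_fun => x; rewrite inE => Dx.
    by rewrite /fubini_G intP.
  have /integrableP[mG' ] := iGD.
  apply: le_lt_trans; apply: ge0_le_integral => //=.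
  + apply/measurable_EFinP/measurableT_comp => //.
    have /measurable_funTS : measurable_fun setT (fun x => fine (fubini_G P g x)).
      by apply: (measurableT_comp (fine_measurable measurableT)); exact: measurable_fubini_G ig.
    move=> /(_ D); apply: eq_measurable_fun => x; rewrite inE => Dx.
    by rewrite /fubini_G intP.
  + exact: measurableT_comp.
  + by move=> x Dx; rewrite /fubini_G intP//; exact: afine.
- by move=> Z mZ ZE; apply: int1_ae i1.
rewrite /Ex.
have -> : \int[P]_w (\int[lam]_(x in D) G (w, x)) = fine (\int[P]_w \int[lam]_x g (w, x))%E.
  rewrite /Rintegral; congr fine; apply: ae_eq_integral => //.
  - exact/measurable_EFinP.
  - exact: measurable_fubini_F ig.
  by apply: filterS aeF => w Fw _; rewrite -/(Rintegral _ _ _) intD fineK.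
rewrite F12 {1}/Rintegral; congr fine.
rewrite [RHS]integral_mkcond; apply: ae_eq_integral => //.
- exact: measurable_fubini_G ig.
- apply/(measurable_restrictT _ mD).
  apply/measurable_EFinP.
  have /measurable_funTS : measurable_fun setT (fun x => fine (fubini_G P g x)).
    by apply: (measurableT_comp (fine_measurable measurableT)); exact: measurable_fubini_G ig.
  move=> /(_ D); apply: eq_measurable_fun => x; rewrite inE => Dx.
  by rewrite /fubini_G intP.
apply: filterS (integrable_ae measurableT iG) => x /(_ I) fx _.
rewrite patchE; case: ifPn => xD.
  by rewrite /Rintegral -intP ?fineK//; exact: set_mem.
by apply: integral0_eq => w _; rewrite /g indicE (negbTE xD) mulr0.
Qed.

Lemma Ex_fubini_bdd (D : set R) (G : Om * R -> R) M : measurable D ->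
  (lam D < +oo)%E -> measurable_fun setT G -> (forall p, `|G p| <= M) ->
  Ex P (fun w => \int[lam]_(x in D) G (w, x)) =
        \int[lam]_(x in D) Ex P (fun w => G (w, x)).
Proof.
move=> mD Doo mG GM; have [|//] := Ex_fubini mD mG.
have M0 : 0 <= M by apply: le_trans (normr_ge0 _) (GM (point, 0)).
apply: (@le_lt_trans _ _ (\int[lam]_(x in D) M%:E)%E).
  apply: ge0_le_integral => //.
  - by move=> x _; apply: integral_ge0.
  - apply: measurable_funTS.
    apply: (@measurable_fun_fubini_tonelli_G _ _ _ _ _ P (fun p => `|G p|%:E)) => //.
    by apply/measurable_EFinP/measurableT_comp.
  - move=> x _; apply: (@le_trans _ _ (\int[P]_w M%:E)%E).
      apply: ge0_le_integral => //.
      + apply/measurable_EFinP/measurableT_comp => //.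
        by apply: measurableT_comp mG _; exact: measurable_pair2.
      + by move=> w _; rewrite lee_fin.
    by rewrite integral_cst//= probability_setT mule1.
by rewrite integral_cst//= lte_mul_pinfty ?lee_fin.
Qed.

End fubini.

Section derive_helpers.
Context {R : realType}.
Implicit Types f g : R -> R.

Lemma is_deriveMd f g (x a b : R) : is_derive x 1 f a -> is_derive x 1 g b ->
  is_derive x 1 (fun t => f t * g t) (a * g x + f x * b).
Proof.
move=> df dg; have := is_deriveM df dg.
by rewrite -[f x *: b]/(f x * b) -[g x *: a]/(g x * a) addrC (mulrC (g x)).
Qed.

Lemma is_derive_ext f g (x a b : R) : is_derive x 1 f a -> f = g -> a = b ->
  is_derive x 1 g b.
Proof. by move=> h <- <-. Qed.

Lemma is_derive_compd f g (x a b : R) : is_derive x 1 f a -> is_derive (f x) 1 g b ->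
  is_derive x 1 (fun t => g (f t)) (b * a).
Proof. by move=> df dg; exact: is_derive1_comp. Qed.

End derive_helpers.

(** * Weighted laws and characteristic functions *)

Section weighted_dynkin.
Context {d1 d2} {O1 : measurableType d1} {O2 : measurableType d2} {R : realType}
  (P1 : probability O1 R) (P2 : probability O2 R).
Context (V1 : O1 -> R) (V2 : O2 -> R) (M : R).
Hypotheses (mV1 : measurable_fun setT V1) (mV2 : measurable_fun setT V2)
  (V1M : forall w, `|V1 w| <= M) (V2M : forall w, `|V2 w| <= M).

(** The pi-lambda argument with signed weights: boundedness gives dominated convergence along
    increasing unions, where positivity would give monotone convergence. Weights are used to process
    coordinates one at a time and, with the weight zero on one side, to express orthogonality to
    events. *)
Lemma weighted_dynkin (E : Type) (G : set (set E)) (X1 : O1 -> E) (X2 : O2 -> E) :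
  setI_closed G ->
  (forall A, G A -> measurable (X1 @^-1` A) /\ measurable (X2 @^-1` A)) ->
  Ex P1 (fun w => V1 w * 1) = Ex P2 (fun w => V2 w * 1) ->
  (forall A, G A -> Ex P1 (fun w => V1 w * \1_A (X1 w)) = Ex P2 (fun w => V2 w * \1_A (X2 w))) ->
  forall A, <<s G >> A -> Ex P1 (fun w => V1 w * \1_A (X1 w)) = Ex P2 (fun w => V2 w * \1_A (X2 w)).
Proof.
move=> GI mG e1 eG A sA.
pose H : set (set E) := [set A | [/\ measurable (X1 @^-1` A), measurable (X2 @^-1` A) &
  Ex P1 (fun w => V1 w * \1_A (X1 w)) = Ex P2 (fun w => V2 w * \1_A (X2 w))]].
have i1 (dd : measure_display) (O : measurableType dd) (P : probability O R) (V : O -> R) (X : O -> E) B :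
    measurable_fun setT V -> (forall w, `|V w| <= M) -> measurable (X @^-1` B) ->
    int1 P (fun w => V w * \1_B (X w)).
  move=> mV VM mB; apply: (@int1_bdd _ _ _ _ (M * 1)).
    by apply: measurable_funM => //; exact: (measurable_indic mB).
  by move=> w; rewrite normrM ler_pM// indicE; case: (_ \in _); rewrite ?normr1 ?normr0.
suff : <<s G >> `<=` H by move=> /(_ _ sA)[].
apply: lambda_system_subset => //; last first.
  by move=> B GB; have [mB1 mB2] := mG _ GB; split => //; exact: eG.
split => //.
- split; [exact: measurableT|exact: measurableT|].
  have e (O : Type) (V : O -> R) (X : O -> E) : (fun w => V w * \1_setT (X w)) = (fun w => V w * 1).
    by apply/funext => w; rewrite indicT.
  by rewrite !e.
- move=> B C CB [mB1 mB2 eB] [mC1 mC2 eC].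
  have e (O : Type) (V : O -> R) (X : O -> E) :
      (fun w => V w * \1_(B `\` C) (X w)) = (fun w => V w * \1_B (X w) - V w * \1_C (X w)).
    apply/funext => w; rewrite -mulrBr; congr (_ * _); rewrite !indicE in_setD.
    case: (boolP (X w \in C)) => xC; last by rewrite andbT subr0.
    by rewrite (mem_set (CB _ (set_mem xC)))/= subrr.
  split; [exact: (measurableD mB1 mC1)|exact: (measurableD mB2 mC2)|].
  by rewrite !e !ExB ?eB ?eC//; apply: i1.
move=> F ndF HF; split.
- by rewrite preimage_bigcup; apply: bigcup_measurable => n _; have [] := HF n.
- by rewrite preimage_bigcup; apply: bigcup_measurable => n _; have [] := HF n.
have L (dd : measure_display) (O : measurableType dd) (P : probability O R) (V : O -> R) (X : O -> E) :
    measurable_fun setT V -> (forall w, `|V w| <= M) -> (forall n, measurable (X @^-1` (F n))) ->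
    Ex P (fun w => V w * \1_(F n) (X w)) @[n --> \oo] --> Ex P (fun w => V w * \1_(\bigcup_n F n) (X w)).
  move=> mV VM mF; apply: (@Ex_dct _ _ _ P _ _ (fun=> M * 1)).
  - by move=> n; apply: (@int1_meas _ _ _ P); exact: i1.
  - by apply: (@int1_meas _ _ _ P); apply: i1 => //; rewrite preimage_bigcup; exact: bigcup_measurable.
  - apply: aeW => w; apply: cvgM; first exact: cvg_cst.
    apply/cvgrPdist_lt => e e0.
    have [[n _ Fn]|nF] := pselect ((\bigcup_n F n) (X w)).
      exists n => // m /= nm; rewrite !indicE.
      have Fm : F m (X w) by have /subsetPset := ndF _ _ nm; apply.
      by rewrite !mem_set ?subrr ?normr0//; exists n.
    apply: nearW => n; rewrite !indicE !memNset ?subrr ?normr0//.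
    by move=> Fn; apply: nF; exists n.
  - exact: int1_cst.
  - by move=> n w; rewrite normrM ler_pM// indicE; case: (_ \in _); rewrite ?normr1 ?normr0.
apply: (cvg_unique _ (L _ _ P1 V1 X1 mV1 V1M _)); first exact: Rhausdorff.
  by move=> n; have [] := HF n.
rewrite /= (_ : (fun n => _) = fun n => Ex P2 (fun w => V2 w * \1_(F n) (X2 w))).
  by apply: L => // n; have [] := HF n.
by apply/funext => n; have [] := HF n.
Qed.

End weighted_dynkin.

Section oneD.
Context {d1 d2} {O1 : measurableType d1} {O2 : measurableType d2} {R : realType}
  (P1 : probability O1 R) (P2 : probability O2 R).
Context (V1 Z1 : O1 -> R) (V2 Z2 : O2 -> R) (M : R).
Hypotheses (mV1 : measurable_fun setT V1) (mV2 : measurable_fun setT V2)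
  (mZ1 : measurable_fun setT Z1) (mZ2 : measurable_fun setT Z2)
  (V1M : forall w, `|V1 w| <= M) (V2M : forall w, `|V2 w| <= M).
Local Notation lam := (@lebesgue_measure R).

Definition agree (f : R -> R) :=
  Ex P1 (fun w => V1 w * f (Z1 w)) = Ex P2 (fun w => V2 w * f (Z2 w)).

Let M0 : 0 <= M. Proof. by apply: le_trans (normr_ge0 _) (V1M point). Qed.

Let int1_Vf {d} {O : measurableType d} (P : probability O R) (V Z : O -> R) (f : R -> R) (K : R) :
  measurable_fun setT V -> measurable_fun setT Z -> (forall w, `|V w| <= M) ->
  measurable_fun setT f -> (forall x, `|f x| <= K) ->
  int1 P (fun w => V w * f (Z w)).
Proof.
move=> mV mZ VM mf fK; apply: (@int1_bdd _ _ _ _ (M * K)).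
  by apply: measurable_funM => //; exact: measurableT_comp.
by move=> w; rewrite normrM ler_pM.
Qed.

Lemma agreeZ c (f : R -> R) (K : R) : measurable_fun setT f -> (forall x, `|f x| <= K) ->
  agree f -> agree (fun x => c * f x).
Proof.
move=> mf fK; rewrite /agree.
have e (O : Type) (V Z : O -> R) : (fun w => V w * (c * f (Z w))) = (fun w => c * (V w * f (Z w))).
  by apply/funext => w; rewrite mulrCA.
by rewrite !e !ExZ; [move=> ->|exact: (@int1_Vf _ _ _ _ _ _ K)..].
Qed.

Lemma agreeD (f g : R -> R) (K : R) : measurable_fun setT f -> (forall x, `|f x| <= K) ->
  measurable_fun setT g -> (forall x, `|g x| <= K) ->
  agree f -> agree g -> agree (fun x => f x + g x).
Proof.
move=> mf fK mg gK; rewrite /agree => af ag.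
have e (O : Type) (V Z : O -> R) :
    (fun w => V w * (f (Z w) + g (Z w))) = (fun w => V w * f (Z w) + V w * g (Z w)).
  by apply/funext => w; rewrite mulrDr.
by rewrite !e !ExD ?af ?ag//; exact: (@int1_Vf _ _ _ _ _ _ K).
Qed.

Lemma agree_lim (f_ : nat -> R -> R) (f : R -> R) (K : R) : (forall n, measurable_fun setT (f_ n)) ->
  (forall n x, `|f_ n x| <= K) -> (forall x, f_ n x @[n --> \oo] --> f x) ->
  (forall n, agree (f_ n)) -> agree f.
Proof.
move=> mf fK ff af.
have mlim : measurable_fun setT f.
  by apply: (@measurable_fun_cvg _ _ _ _ f_) => // x _; exact: ff.
have L (dd : measure_display) (O : measurableType dd) (P : probability O R) (V Z : O -> R) :
    measurable_fun setT V -> measurable_fun setT Z -> (forall w, `|V w| <= M) ->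
    Ex P (fun w => V w * f_ n (Z w)) @[n --> \oo] --> Ex P (fun w => V w * f (Z w)).
  move=> mV mZ VM; apply: (@Ex_dct _ _ _ _ _ _ (fun=> M * K)) => //.
  - by move=> n; apply: measurable_funM => //; exact: measurableT_comp.
  - by apply: measurable_funM => //; exact: measurableT_comp.
  - by apply: aeW => w; apply: cvgM; [exact: cvg_cst|exact: ff].
  - exact: int1_cst.
  - by move=> n w; rewrite normrM ler_pM.
apply: (cvg_unique _ (L _ _ P1 V1 Z1 mV1 mZ1 V1M)); first exact: Rhausdorff.
rewrite /= (_ : (fun n => _) = fun n => Ex P2 (fun w => V2 w * f_ n (Z2 w))); first exact: L.
by apply/funext => n; exact: af.
Qed.

Lemma agree_int (f : R * R -> R) (a b K : R) : measurable_fun setT f ->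
  (forall p, `|f p| <= K) -> (forall t, agree (fun x => f (x, t))) ->
  agree (fun x => \int[lam]_(t in `[a, b]) f (x, t)).
Proof.
move=> mf fK af.
have L (dd : measure_display) (O : measurableType dd) (P : probability O R) (V Z : O -> R) :
    measurable_fun setT V -> measurable_fun setT Z -> (forall w, `|V w| <= M) ->
    Ex P (fun w => V w * \int[lam]_(t in `[a, b]) f (Z w, t)) =
    \int[lam]_(t in `[a, b]) Ex P (fun w => V w * f (Z w, t)).
  move=> mV mZ VM.
  rewrite -(@Ex_fubini_bdd _ _ _ _ _ (fun p => V p.1 * f (Z p.1, p.2)) (M * K))//.
  - apply: eq_Rintegral => w _; rewrite -RintegralZl//=.
    apply: (@lam_integrable_bdd _ _ _ _ K) => //.
    by apply: measurable_funTS; apply: measurableT_comp mf _; exact: measurable_pair1.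
  - exact: lam_itv_lty.
  - apply: measurable_funM; first exact: measurableT_comp.
    apply: measurableT_comp mf _; apply: measurable_fun_pair => //.
    exact: measurableT_comp.
  - by move=> p; rewrite normrM ler_pM.
rewrite /agree !L//; apply: eq_Rintegral => t _; exact: af.
Qed.

Hypotheses (Hcos : forall c, agree (fun x => cos (c * x)))
  (Hsin : forall c, agree (fun x => sin (c * x))).

Let bcos (x : R) : `|cos x| <= 1. Proof. by rewrite ler_norml cos_geN1 cos_le1. Qed.
Let bsin (x : R) : `|sin x| <= 1. Proof. by rewrite ler_norml sin_geN1 sin_le1. Qed.

Let mcos c e : measurable_fun setT (fun x : R => cos (c * x + e)).
Proof.
apply: continuous_measurable_fun => x.
apply: (@continuous_comp _ _ _ (fun x : R => c * x + e) cos); last exact: continuous_cos.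
by apply: cvgD; [apply: cvgM; [exact: cvg_cst|exact: cvg_id]|exact: cvg_cst].
Qed.

Let agree_cos c e : agree (fun x => cos (c * x + e)).
Proof.
have -> : (fun x : R => cos (c * x + e)) = fun x => cos e * cos (c * x) + (- sin e) * sin (c * x).
  by apply/funext => x; rewrite cosD; ring.
have m1 : measurable_fun setT (fun x : R => cos (c * x)).
  by have := mcos c 0; under eq_fun do rewrite addr0.
have m2 : measurable_fun setT (fun x : R => sin (c * x)).
  have := mcos c (- (pi / 2)).
  by under eq_fun do rewrite cosBpihalf.
apply: (@agreeD _ _ 1); try by apply: measurable_funM.
- by move=> x; rewrite normrM; apply: le_trans (ler_pM _ _ (bcos _) (bcos _)) _; rewrite ?mulr1.
- by move=> x; rewrite normrM normrN; apply: le_trans (ler_pM _ _ (bsin _) (bsin _)) _; rewrite ?mulr1.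
- exact: (agreeZ _ m1 (fun x => bcos _)).
- exact: (agreeZ _ m2 (fun x => bsin _)).
Qed.

(** The antiderivative in [t] of [exp(-t) cos(t z)] that vanishes at infinity; hence the Laplace
    transform of the cosine at 1 is [1 / (1 + z^2)]. *)
Let Fexp (z t : R) := expR (- t) * (z * sin (t * z) - cos (t * z)) * (1 + z ^+ 2)^-1.

Let intexp (z : R) n : \int[lam]_(t in `[0, n%:R]) (expR (- t) * cos (t * z)) =
  Fexp z n%:R + (1 + z ^+ 2)^-1.
Proof.
have z2 : 1 + z ^+ 2 != 0 :> R by rewrite gt_eqF// ltr_wpDr// sqr_ge0.
rewrite (_ : (\int[lam]_(t in _) _) = Fexp z n%:R - Fexp z 0).
  by rewrite /Fexp oppr0 expR0 mul0r sin0 cos0; field.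
apply: (@FTC2_R _ (fun t => expR (- t) * cos (t * z))) => //.
  move=> t; apply: cvgM.
    by apply: (@continuous_comp _ _ _ -%R expR); [exact: cvgN|exact: continuous_expR].
  apply: (@continuous_comp _ _ _ (fun t : R => t * z) (@cos R)); last exact: continuous_cos.
  by apply: cvgM; [exact: cvg_id|exact: cvg_cst].
move=> t.
have d0 : is_derive t 1 (fun t : R => t * z) z.
  by have := is_deriveMd (is_derive_id t 1) (is_derive_cst z t 1); rewrite mul1r mulr0 addr0.
have ds := is_derive_compd d0 (is_derive_sin (t * z)).
have dc := is_derive_compd d0 (is_derive_cos (t * z)).
have de := is_derive_compd (is_deriveN (is_derive_id t 1)) (is_derive_expR (- t)).
have dzs := is_deriveMd (is_derive_cst z t 1) ds.
have := is_deriveMd (is_deriveMd de (is_deriveB dzs dc)) (is_derive_cst (1 + z ^+ 2)^-1 t 1).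
by move=> h; apply: (is_derive_ext h) => //=; rewrite !fctE/=; field.
Qed.

Let agree_poisson (c y : R) : agree (fun x => (1 + (c * x + y) ^+ 2)^-1).
Proof.
pose f n (x : R) := \int[lam]_(t in `[0, n%:R]) (expR (- t) * cos (t * (c * x + y))).
have bf (z : R) : `|z * z / (1 + z ^+ 2)| <= 1 /\ `|(1 + z ^+ 2)^-1| <= 1 /\ `|z / (1 + z ^+ 2)| <= 1.
  have p : 0 < 1 + z ^+ 2 by rewrite ltr_wpDr// sqr_ge0.
  rewrite !normrM !normfV (gtr0_norm p) !ler_pdivrMr// mul1r.
  split; first by rewrite -normrM -expr2 ger0_norm ?sqr_ge0// lerDr.
  split; first by rewrite invf_le1// lerDl sqr_ge0.
  by rewrite -(real_normK (num_real z)); have := sqr_ge0 (`|z| - 1); have := sqr_ge0 `|z|; lra.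
have bF z n : `|Fexp z n%:R| <= 2 * expR (- n%:R).
  rewrite /Fexp -mulrA normrM ger0_norm ?expR_ge0// mulrC ler_wpM2r ?expR_ge0//.
  have [_ [h1 h2]] := bf z.
  rewrite mulrBl (_ : z * _ / _ = z / (1 + z ^+ 2) * sin (n%:R * z)); last by ring.
  apply: (le_trans (ler_normB _ _)); rewrite [leRHS](_ : _ = 1 * 1 + 1 * 1); last by ring.
  by rewrite lerD// normrM ler_pM.
have e1 n : expR (- n%:R) <= 1 :> R by rewrite -expR0 ler_expR oppr_le0.
have cE : expR (- n%:R) @[n --> \oo] --> (0 : R).
  under eq_fun do rewrite -mulN1r expRM_natr.
  by apply: cvg_expr; rewrite ger0_norm ?expR_ge0// -expR0 ltr_expR.
(* The bound consists of [2] for [Fexp] and [1] for the kernel. *)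
apply: (@agree_lim f _ 3).
- move=> n; rewrite /f.
  under eq_fun do rewrite intexp.
  have mz : measurable_fun setT (fun x : R => c * x + y) by apply: measurable_funD => //; exact: measurable_funM.
  apply: measurable_funD; last first.
    apply: (@measurableT_comp _ _ _ _ _ _ (fun z : R => (1 + z ^+ 2)^-1) _ (fun x : R => c * x + y)) => //.
    apply: continuous_measurable_fun => z; apply: cvgV.
      by rewrite gt_eqF// ltr_wpDr// sqr_ge0.
    by apply: cvgD; [exact: cvg_cst|exact: exprn_continuous].
  apply: (@measurableT_comp _ _ _ _ _ _ (fun z : R => Fexp z n%:R) _ (fun x : R => c * x + y)) => //.
  apply: continuous_measurable_fun => z; apply: cvgM; last first.
    apply: cvgV; first by rewrite gt_eqF// ltr_wpDr// sqr_ge0.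
    by apply: cvgD; [exact: cvg_cst|exact: exprn_continuous].
  apply: cvgM; first exact: cvg_cst.
  have cn : {for z, continuous (fun z : R => n%:R * z)} by apply: cvgM; [exact: cvg_cst|exact: cvg_id].
  apply: cvgB.
    apply: cvgM; first exact: cvg_id.
    by apply: (@continuous_comp _ _ _ (fun z : R => n%:R * z) sin) => //; exact: continuous_sin.
  by apply: (@continuous_comp _ _ _ (fun z : R => n%:R * z) cos) => //; exact: continuous_cos.
- move=> n x; rewrite /f intexp.
  have := bF (c * x + y) n; have := e1 n; have [_ [h _]] := bf (c * x + y).
  have := ler_normD (Fexp (c * x + y) n%:R) (1 + (c * x + y) ^+ 2)^-1; lra.
- move=> x; rewrite /f; under eq_fun do rewrite intexp.
  suff h : Fexp (c * x + y) n%:R @[n --> \oo] --> 0.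
    by have := cvgD h (@cvg_cst _ (1 + (c * x + y) ^+ 2)^-1 _ _ _); rewrite add0r; exact.
  apply/norm_cvg0P; apply: (squeeze_cvgr _ (@cvg_cst _ 0 _ _ _)).
    by apply: nearW => n; rewrite normr_ge0/=; exact: bF.
  by rewrite -(mulr0 2); apply: cvgM => //; exact: cvg_cst.
move=> n; rewrite /f.
pose g (p : R * R) := (expR (- p.2) * \1_(`[0, n%:R]) p.2) * cos (p.2 * (c * p.1 + y)).
have -> : (fun x => \int[lam]_(t in `[0, n%:R]) (expR (- t) * cos (t * (c * x + y)))) =
   (fun x => \int[lam]_(t in `[0, n%:R]) g (x, t)).
  apply/funext => x; apply: eq_Rintegral => t tn.
  by rewrite /g/= indicE tn mulr1.
apply: (@agree_int _ _ _ 1).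
- apply: measurable_funM.
    apply: measurable_funM; last first.
      by apply: measurableT_comp => //; exact: measurable_indic.
    by apply: measurableT_comp => //; exact: measurableT_comp.
  apply: measurableT_comp; first by apply: continuous_measurable_fun; exact: continuous_cos.
  apply: measurable_funM => //; apply: measurable_funD => //; exact: measurable_funM.
- move=> p; rewrite /g normrM -[leRHS]mulr1 ler_pM// indicE.
  case: (boolP (p.2 \in _)) => /=; rewrite ?mulr0 ?normr0// mulr1 inE/= in_itv/= => /andP[p0 _].
  by rewrite ger0_norm ?expR_ge0// -expR0 ler_expR oppr_le0.
move=> t; rewrite /g/=.
apply: (@agreeZ _ (fun x => cos (t * (c * x + y))) 1) => //.
  by have := mcos (t * c) (t * y); under eq_fun do rewrite -mulrA -mulrDr.
have := agree_cos (t * c) (t * y).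
by under [in X in X -> _]eq_fun do rewrite -mulrA -mulrDr.
Qed.

Let agree_cst (c : R) : agree (fun=> c).
Proof.
have := @agree_cos 0 0; under [X in agree X -> _]eq_fun do rewrite mul0r addr0 cos0.
move=> /(@agreeZ c _ 1); have -> : (fun=> c * 1) = (fun=> c) :> (R -> R).
  by apply/funext => x; rewrite mulr1.
by apply => // x; rewrite normr1.
Qed.

Let batan (x : R) : `|atan x| <= pi / 2.
Proof. by rewrite ler_norml (ltW (atan_gtNpi2 x)) (ltW (atan_ltpi2 x)). Qed.

Let matan (c b : R) : measurable_fun setT (fun x : R => atan (c * (b - x))).
Proof.
apply: continuous_measurable_fun => x.
apply: (@continuous_comp _ _ _ (fun x : R => c * (b - x)) atan); last exact: continuous_atan.
by apply: cvgM; [exact: cvg_cst|apply: cvgB; [exact: cvg_cst|exact: cvg_id]].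
Qed.

(* The Poisson kernel is a Laplace transform of cosines and integrates to [atan]; [atan (c x)] tends to [pi/2 sg x]. *)
Let agree_atan_diff (c a b : R) : a <= b ->
  agree (fun x => atan (c * (b - x)) - atan (c * (a - x))).
Proof.
move=> ab.
pose g (p : R * R) := c * (1 + (- c * p.1 + c * p.2) ^+ 2)^-1.
have gE x t : g (x, t) = c / (1 + (c * (t - x)) ^+ 2).
  by rewrite /g /=; congr (_ / (1 + _ ^+ 2)); ring.
have z2 (z : R) : 1 + z ^+ 2 != 0 :> R by rewrite gt_eqF// ltr_wpDr// sqr_ge0.
have b1 (z : R) : `|(1 + z ^+ 2)^-1| <= 1.
  have p : 0 < 1 + z ^+ 2 by rewrite ltr_wpDr// sqr_ge0.
  by rewrite normfV (gtr0_norm p) invf_le1// lerDl sqr_ge0.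
have m1 : measurable_fun setT (fun z : R => (1 + z ^+ 2)^-1).
  apply: continuous_measurable_fun => z; apply: cvgV => //.
  by apply: cvgD; [exact: cvg_cst|exact: exprn_continuous].
have -> : (fun x => atan (c * (b - x)) - atan (c * (a - x))) =
   (fun x => \int[lam]_(t in `[a, b]) g (x, t)).
  apply/funext => x; apply/esym; apply: (@FTC2_R _ _ (fun t => atan (c * (t - x)))) => //.
    have -> : (fun t => g (x, t)) = (fun t => c / (1 + (c * (t - x)) ^+ 2)).
      by apply/funext => t; exact: gE.
    move=> t.
    apply: cvgM; first exact: cvg_cst.
    apply: cvgV => //; apply: cvgD; first exact: cvg_cst.
    apply: (@continuous_comp _ _ _ (fun t : R => c * (t - x)) (fun z => z ^+ 2)); last exact: exprn_continuous.
    by apply: cvgM; [exact: cvg_cst|apply: cvgB; [exact: cvg_id|exact: cvg_cst]].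
  move=> t; rewrite gE.
  have dl : is_derive t 1 (fun t : R => c * (t - x)) c.
    have := is_deriveMd (is_derive_cst c t 1) (is_deriveB (is_derive_id t 1) (is_derive_cst x t 1)).
    by move=> h; apply: (is_derive_ext h) => //=; rewrite mul0r add0r subr0 mulr1.
  have da : is_derive (c * (t - x)) 1 atan (1 + (c * (t - x)) ^+ 2)^-1.
    by apply: DeriveDef; [exact: derivable_atan|rewrite -derive1E derive1_atan].
  by apply: (is_derive_ext (is_derive_compd dl da)) => //; rewrite mulrC.
apply: (@agree_int _ _ _ `|c|).
- rewrite /g; apply: measurable_funM => //; apply: (measurableT_comp m1).
  by apply: measurable_funD => //; exact: measurable_funM.
- by move=> p; rewrite /g normrM -[leRHS]mulr1 ler_pM.
move=> t; apply: (@agreeZ _ _ 1) => //=.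
by apply: (measurableT_comp m1); apply: measurable_funD => //; exact: measurable_funM.
Qed.

Let cvg_atan_pm (c e : R) : 0 < c -> atan (c * n%:R + e) @[n --> \oo] --> pi / 2.
Proof.
move=> c0; suff h : c * n%:R + e @[n --> \oo] --> +oo%R by exact: cvg_comp _ _ h (@cvgy_atan R).
apply/cvgryPge => A; near=> n.
rewrite -lerBlDr -ler_pdivrMl//.
by near: n; exact: nbhs_infty_ger.
Unshelve. all: by end_near. Qed.

Let agree_atan (c b : R) : 0 < c -> agree (fun x => atan (c * (b - x))).
Proof.
move=> c0.
have h : agree (fun x => atan (c * (b - x)) + pi / 2).
  (* The left endpoint [b - n] goes to minus infinity, where the second arctangent tends to
     [- pi / 2]. *)
  apply: (@agree_lim (fun n x => atan (c * (b - x)) - atan (c * (b - n%:R - x))) _ (pi / 2 + pi / 2)).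
  - by move=> n; exact: measurable_funB.
  - move=> n x; apply: (le_trans (ler_normB _ _)); exact: lerD.
  - move=> x; apply: cvgD; first exact: cvg_cst.
    under eq_fun do rewrite -atanN.
    rewrite (_ : (fun n => _) = fun n => atan (c * n%:R + c * (x - b))); first exact: cvg_atan_pm.
    by apply/funext => n; congr atan; ring.
  - by move=> n; apply: agree_atan_diff; rewrite gerBl.
have := @agreeD _ _ (pi / 2 + pi / 2) _ _ _ _ h (agree_cst (- (pi / 2))).
have -> : (fun x => atan (c * (b - x)) + pi / 2 + - (pi / 2)) = (fun x => atan (c * (b - x))).
  by apply/funext => x; rewrite addrK.
apply.
- exact: measurable_funD.
- move=> x; apply: (le_trans (ler_normD _ _)); apply: lerD => //.
  by rewrite ger0_norm// divr_ge0// pi_ge0.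
- exact: measurable_cst.
- by move=> _; rewrite normrN ger0_norm ?lerDl divr_ge0// pi_ge0.
Qed.

Let agree_sg (b : R) : agree (fun x => pi / 2 * Num.sg (b - x)).
Proof.
apply: (@agree_lim (fun n x => atan (n.+1%:R * (b - x))) _ (pi / 2)) => //.
  move=> x; case: (ltgtP b x) => bx.
  - rewrite ltr0_sg ?subr_lt0// mulrN1.
    under eq_fun do rewrite -[atan _]opprK -atanN.
    apply: cvgN.
    rewrite (_ : (fun n => _) = fun n => atan ((x - b) * n%:R + (x - b))).
      by apply: cvg_atan_pm; rewrite subr_gt0.
    by apply/funext => n; congr atan; rewrite -natr1; ring.
  - rewrite gtr0_sg ?subr_gt0// mulr1.
    rewrite (_ : (fun n => _) = fun n => atan ((b - x) * n%:R + (b - x))).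
      by apply: cvg_atan_pm; rewrite subr_gt0.
    by apply/funext => n; congr atan; rewrite -natr1; ring.
  - rewrite bx subrr sgr0 mulr0; under eq_fun do rewrite mulr0 atan0.
    exact: cvg_cst.
by move=> n; apply: agree_atan.
Qed.

Lemma agree_indic (A : set R) : measurable A -> agree \1_A.
Proof.
have msg b : measurable_fun setT (fun x : R => Num.sg (b - x)).
  have -> : (fun x : R => Num.sg (b - x)) = (fun x => \1_(`]-oo, b[) x - \1_(`]b, +oo[) x).
    apply/funext => x; rewrite !indicE !mem_setE/= !in_itv/=.
    case: (ltgtP b x) => bx; rewrite ?andbT.
    + by rewrite ltr0_sg ?subr_lt0//= sub0r.
    + by rewrite gtr0_sg ?subr_gt0//= subr0.
    + by rewrite bx subrr sgr0 subrr.
  by apply: measurable_funB; exact: measurable_indic.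
have bsg (x : R) : `|Num.sg x| <= 1.
  by rewrite normr_sg; case: (x == 0).
have p2 : (pi : R) / 2 != 0 by rewrite mulf_neq0// gt_eqF// pi_gt0.
have asg b : agree (fun x => Num.sg (b - x)).
  have := @agreeZ (pi / 2)^-1 _ (pi / 2) _ _ (agree_sg b).
  have -> : (fun x => (pi / 2)^-1 * (pi / 2 * Num.sg (b - x))) = fun x => Num.sg (b - x).
    by apply/funext => x; rewrite mulrA mulVf// mul1r.
  apply; first exact: measurable_funM.
  by move=> x; rewrite normrM -[leRHS]mulr1 ler_pM// ger0_norm// divr_ge0// pi_ge0.
pose G := [set A | exists x : R, A = `]x, +oo[%classic].
have GI : setI_closed G.
  move=> _ _ [x ->] [y ->]; exists (Num.max x y).
  by apply/seteqP; split => z /=; rewrite !in_itv/= !andbT gt_max => /andP.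
have half B : G B -> agree \1_B.
  move=> [b ->].
  (* The sign is 0 at its jump. Placing the jump at [b + 1/(n+1)] and letting it move left to [b]
     yields exactly the indicator of the open half-line, the generator chosen for the Borel sets. *)
  apply: (@agree_lim (fun n x => 2^-1 * (1 + - 1 * Num.sg (b + n.+1%:R^-1 - x))) _ 1).
  - by move=> n; apply: measurable_funM => //; apply: measurable_funD => //; exact: measurable_funM.
  - move=> n x; have := bsg (b + n.+1%:R^-1 - x); rewrite !ler_norml => /andP[]; lra.
  - move=> x; rewrite indicE mem_setE/= in_itv/= andbT; case: ltP => bx.
      apply/cvgrPdist_lt => e e0; near=> n.
      rewrite ltr0_sg; last first.
        rewrite subr_lt0 -ltrBrDl invf_plt ?posrE ?subr_gt0 ?ltr0n//.
        apply: (@lt_trans _ _ n%:R); last by rewrite ltr_nat.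
        by near: n; exact: nbhs_infty_gtr.
      rewrite (_ : true%:R - _ = 0) ?normr0// mulN1r opprK /=.
      by field.
    rewrite (_ : (fun n => _) = fun=> 0); first exact: cvg_cst.
    apply/funext => n; rewrite gtr0_sg ?mulr1 ?subrr ?mulr0// subr_gt0.
    by rewrite (le_lt_trans bx)// ltrDl invr_gt0.
  move=> n; apply: (@agreeZ _ _ 2); last 1 first.
  - apply: (@agreeD _ _ 1) => //; first by move=> _; rewrite normr1.
    + exact: measurable_funM.
    + by move=> x; rewrite mulN1r normrN.
    + by apply: (@agreeZ _ _ 1).
  - by apply: measurable_funD => //; exact: measurable_funM.
  - move=> x; have := bsg (b + n.+1%:R^-1 - x); rewrite !ler_norml => /andP[]; lra.
move=> mA.
have mi B : measurable B -> measurable_fun setT (\1_B : R -> R) by move=> mB; exact: measurable_indic.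
have bi B (x : R) : `|\1_B x : R| <= 1.
  by rewrite indicE; case: (x \in B); rewrite ?normr1 ?normr0.
apply: (@weighted_dynkin _ _ _ _ _ P1 P2 V1 V2 M mV1 mV2 V1M V2M R G Z1 Z2) => //.
- move=> B [x ->]; rewrite -[X in measurable X]setTI; split; [exact: mZ1|].
  by rewrite -[X in measurable X]setTI; exact: mZ2.
- by have := agree_cst 1; rewrite /agree/=.
- have : (@RGenOInfty.G R).-sigma.-measurable A by rewrite -(RGenOInfty.measurableE R).
  exact.
Unshelve. all: by end_near. Qed.

End oneD.

Section weighted_law_eq.
Context {R : realType} {I : eqType} {E : Type} (p : I -> E -> R) (S : set I).

(** Finite-dimensional cylinders are presented inductively so that a proof can peel off one
    coordinate at a time. *)
Inductive cyl : set E -> Prop :=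
| cylT : cyl setT
| cylI i B A : S i -> measurable B -> cyl A -> cyl ((p i @^-1` B) `&` A).

Lemma cyl_setI : setI_closed cyl.
Proof.
by move=> A B; elim=> [|i C D Si mC _ IH] cB; rewrite ?setTI// -setIA; exact: cylI (IH cB).
Qed.

Lemma cyl_measurable d (O : measurableType d) (X : O -> E) A :
  (forall i, S i -> measurable_fun setT (p i \o X)) -> cyl A -> measurable (X @^-1` A).
Proof.
move=> mX; elim=> [|i B D Si mB _ IH]; first exact: measurableT.
apply: measurableI => //; rewrite -[X in measurable X]setTI.
exact: (mX i Si measurableT B mB).
Qed.

Lemma cyl_sigma :
  <<s \bigcup_(i in S) preimage_set_system setT (p i) measurable >> `<=` <<s cyl >>.
Proof.
apply: sub_sigma_algebra2 => A [i Si [B mB <-]]; rewrite setTI -[_ @^-1` _]setIT.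
by apply: cylI => //; exact: cylT.
Qed.

Context {d1 d2} {O1 : measurableType d1} {O2 : measurableType d2}
  (P1 : probability O1 R) (P2 : probability O2 R) (X1 : O1 -> E) (X2 : O2 -> E).
Hypotheses (mX1 : forall i, S i -> measurable_fun setT (p i \o X1))
  (mX2 : forall i, S i -> measurable_fun setT (p i \o X2)).
Local Notation lc1 := (lc (fun i w => p i (X1 w))).
Local Notation lc2 := (lc (fun i w => p i (X2 w))).

Let same_chf (V1 : O1 -> R) (V2 : O2 -> R) := forall s, inS S s ->
  Ex P1 (fun w => V1 w * cos (lc1 s w)) = Ex P2 (fun w => V2 w * cos (lc2 s w)) /\
  Ex P1 (fun w => V1 w * sin (lc1 s w)) = Ex P2 (fun w => V2 w * sin (lc2 s w)).

Let mlc d (O : measurableType d) (X : O -> E) s :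
  (forall i, S i -> measurable_fun setT (p i \o X)) -> inS S s ->
  measurable_fun setT (lc (fun i w => p i (X w)) s).
Proof.
move=> mX; elim: s => [|x s IH] sS.
  by rewrite /lc; under eq_fun do rewrite big_nil; exact: measurable_cst.
rewrite /lc; under eq_fun do rewrite big_cons; apply: measurable_funD.
  by apply: measurable_funM => //; apply: mX; apply: sS; rewrite inE eqxx.
by apply: IH => y ys; apply: sS; rewrite inE ys orbT.
Qed.

Let bcos (x : R) : `|cos x| <= 1. Proof. by rewrite ler_norml cos_geN1 cos_le1. Qed.
Let bsin (x : R) : `|sin x| <= 1. Proof. by rewrite ler_norml sin_geN1 sin_le1. Qed.
Let mcos : measurable_fun setT (@cos R).
Proof. by apply: continuous_measurable_fun; exact: continuous_cos. Qed.
Let msin : measurable_fun setT (@sin R).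
Proof. by apply: continuous_measurable_fun; exact: continuous_sin. Qed.

Let int_Vt d (O : measurableType d) (P : probability O R) (V : O -> R) M (f : R -> R) (L : O -> R) :
  measurable_fun setT V -> (forall w, `|V w| <= M) -> measurable_fun setT f ->
  (forall x, `|f x| <= 1) -> measurable_fun setT L -> int1 P (fun w => V w * f (L w)).
Proof.
move=> mV VM mf f1 mL; apply: (@int1_bdd _ _ _ _ (M * 1)).
  by apply: measurable_funM => //; exact: measurableT_comp.
by move=> w; rewrite normrM ler_pM.
Qed.

Let prodcos (a b : R) : cos b * cos a = 2^-1 * cos (a + b) + 2^-1 * cos (- a + b).
Proof. by rewrite !cosD cosN sinN; field. Qed.
Let prodsin (a b : R) : cos b * sin a = 2^-1 * sin (a + b) + - 2^-1 * sin (- a + b).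
Proof. by rewrite !sinD cosN sinN; field. Qed.
Let prodsincos (a b : R) : sin b * cos a = 2^-1 * sin (a + b) + 2^-1 * sin (- a + b).
Proof. by rewrite !sinD cosN sinN; field. Qed.
Let prodsinsin (a b : R) : sin b * sin a = 2^-1 * cos (- a + b) + - 2^-1 * cos (a + b).
Proof. by rewrite !cosD cosN sinN; field. Qed.

Let Ex_comb d (O : measurableType d) (P : probability O R) (V : O -> R) M (f g h k : R -> R)
    (Z L : O -> R) (c a b : R) :
  measurable_fun setT V -> (forall w, `|V w| <= M) ->
  measurable_fun setT h -> (forall x, `|h x| <= 1) ->
  measurable_fun setT k -> (forall x, `|k x| <= 1) ->
  measurable_fun setT Z -> measurable_fun setT L ->
  (forall x y, f y * g x = a * h (x + y) + b * k (- x + y)) ->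
  Ex P (fun w => V w * f (L w) * g (c * Z w)) =
  a * Ex P (fun w => V w * h (c * Z w + L w)) + b * Ex P (fun w => V w * k ((- c) * Z w + L w)).
Proof.
move=> mV VM mh h1 mk k1 mZ mL fg.
have mcZ e : measurable_fun setT (fun w => e * Z w + L w).
  by apply: measurable_funD => //; exact: measurable_funM.
have i1 := int_Vt P mV VM mh h1 (mcZ c).
have i2 := int_Vt P mV VM mk k1 (mcZ (- c)).
rewrite -!ExZ// -ExD; [|exact: int1Z..].
by apply: eq_Rintegral => w _; rewrite -mulrA fg mulNr; ring.
Qed.

(** Induction on the cylinder with the weights universally quantified: the indicator of the first
    coordinate is absorbed into the weight. The new weights again have equal characteristic
    functions. For this, one-dimensional inversion is applied in that coordinate with the cosine or
    sine of the remaining combination as part of the weight, and the product formulas reduce its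
    hypotheses to combinations with one more term. *)
Lemma weighted_law_cyl A : cyl A -> forall (V1 : O1 -> R) (V2 : O2 -> R) (M : R),
  measurable_fun setT V1 -> measurable_fun setT V2 ->
  (forall w, `|V1 w| <= M) -> (forall w, `|V2 w| <= M) -> same_chf V1 V2 ->
  Ex P1 (fun w => V1 w * \1_A (X1 w)) = Ex P2 (fun w => V2 w * \1_A (X2 w)).
Proof.
elim=> [|i B D Si mB _ IH] V1 V2 M mV1 mV2 V1M V2M H.
  have [|+ _] := H [::]; first by move=> x; rewrite in_nil.
  have e (O : Type) (V : O -> R) (X : O -> E) :
      (fun w => V w * cos (lc (fun i w => p i (X w)) [::] w)) = (fun w => V w * \1_setT (X w)).
    by apply/funext => w; rewrite /lc big_nil cos0 indicT.
  by rewrite !e.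
have e (O : Type) (V : O -> R) (X : O -> E) :
    (fun w => V w * \1_((p i @^-1` B) `&` D) (X w)) =
    (fun w => V w * \1_B (p i (X w)) * \1_D (X w)).
  apply/funext => w; rewrite indicI -mulrA; congr (_ * _).
rewrite !e; apply: (IH _ _ M).
- by apply: measurable_funM => //; apply: (measurableT_comp (measurable_indic mB)); exact: mX1.
- by apply: measurable_funM => //; apply: (measurableT_comp (measurable_indic mB)); exact: mX2.
- by move=> w; rewrite normrM indicE; case: (_ \in _); rewrite ?normr1 ?normr0 ?mulr1 ?mulr0//; exact: le_trans (V1M w).
- by move=> w; rewrite normrM indicE; case: (_ \in _); rewrite ?normr1 ?normr0 ?mulr1 ?mulr0//; exact: le_trans (V2M w).
move=> s sS.
have m1 := mlc mX1 sS; have m2 := mlc mX2 sS.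
have cS c : inS S ((c, i) :: s).
  by move=> x; rewrite inE => /orP[/eqP ->//|]; exact: sS.
have lcc (O : Type) (X : O -> E) c w : c * p i (X w) + lc (fun i w => p i (X w)) s w =
   lc (fun i w => p i (X w)) ((c, i) :: s) w by rewrite /lc big_cons.
have pull (O : Type) (V : O -> R) (X : O -> E) (f : R -> R) :
    (fun w => V w * \1_B (p i (X w)) * f (lc (fun i w => p i (X w)) s w)) =
    (fun w => V w * f (lc (fun i w => p i (X w)) s w) * \1_B (p i (X w))).
  by apply/funext => w; rewrite mulrAC.
have E1 (f : R -> R) : measurable_fun setT f -> (forall x, `|f x| <= 1) ->
    (forall c, Ex P1 (fun w => V1 w * f (lc1 s w) * cos (c * p i (X1 w))) =
               Ex P2 (fun w => V2 w * f (lc2 s w) * cos (c * p i (X2 w)))) ->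
    (forall c, Ex P1 (fun w => V1 w * f (lc1 s w) * sin (c * p i (X1 w))) =
               Ex P2 (fun w => V2 w * f (lc2 s w) * sin (c * p i (X2 w)))) ->
    Ex P1 (fun w => V1 w * \1_B (p i (X1 w)) * f (lc1 s w)) =
    Ex P2 (fun w => V2 w * \1_B (p i (X2 w)) * f (lc2 s w)).
  move=> mf f1 Hc Hs; rewrite !pull.
  apply: (@agree_indic _ _ _ _ _ P1 P2 (fun w => V1 w * f (lc1 s w)) (fun w => p i (X1 w))
    (fun w => V2 w * f (lc2 s w)) (fun w => p i (X2 w)) (M * 1)) => //.
  - by apply: measurable_funM => //; exact: measurableT_comp.
  - by apply: measurable_funM => //; exact: measurableT_comp.
  - exact: mX1.
  - exact: mX2.
  - by move=> w; rewrite normrM ler_pM.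
  - by move=> w; rewrite normrM ler_pM.
have EE (f g h k : R -> R) (a b : R) : measurable_fun setT h -> (forall x, `|h x| <= 1) ->
    measurable_fun setT k -> (forall x, `|k x| <= 1) ->
    (forall x y, f y * g x = a * h (x + y) + b * k (- x + y)) ->
    (forall s, inS S s -> Ex P1 (fun w => V1 w * h (lc1 s w)) = Ex P2 (fun w => V2 w * h (lc2 s w))) ->
    (forall s, inS S s -> Ex P1 (fun w => V1 w * k (lc1 s w)) = Ex P2 (fun w => V2 w * k (lc2 s w))) ->
    forall c, Ex P1 (fun w => V1 w * f (lc1 s w) * g (c * p i (X1 w))) =
               Ex P2 (fun w => V2 w * f (lc2 s w) * g (c * p i (X2 w))).
  move=> mh h1 mk k1 fg Hh Hk c.
  rewrite (Ex_comb P1 c mV1 V1M mh h1 mk k1 (mX1 Si) m1 fg).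
  rewrite (Ex_comb P2 c mV2 V2M mh h1 mk k1 (mX2 Si) m2 fg).
  have cE (f' : R -> R) c' : (forall s, inS S s -> Ex P1 (fun w => V1 w * f' (lc1 s w)) = Ex P2 (fun w => V2 w * f' (lc2 s w))) ->
    Ex P1 (fun w => V1 w * f' (c' * (p i \o X1) w + lc1 s w)) = Ex P2 (fun w => V2 w * f' (c' * (p i \o X2) w + lc2 s w)).
    move=> /(_ _ (cS c')) h'; under eq_fun do rewrite /= lcc.
    by rewrite h'; apply: eq_Rintegral => w _; rewrite /= lcc.
  by rewrite (cE h)// (cE k).
have Hc s' : inS S s' -> _ := fun h => (H s' h).1.
have Hs s' : inS S s' -> _ := fun h => (H s' h).2.
split; apply: E1 => //.
- exact: (EE _ _ _ _ _ _ mcos bcos mcos bcos prodcos).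
- exact: (EE _ _ _ _ _ _ msin bsin msin bsin prodsin).
- exact: (EE _ _ _ _ _ _ msin bsin msin bsin prodsincos).
- apply: (EE _ _ _ _ (- 2^-1) 2^-1 mcos bcos mcos bcos) => // x y.
  by rewrite prodsinsin addrC.
Qed.

Theorem weighted_law_eq (V1 : O1 -> R) (V2 : O2 -> R) (M : R) :
  measurable_fun setT V1 -> measurable_fun setT V2 ->
  (forall w, `|V1 w| <= M) -> (forall w, `|V2 w| <= M) -> same_chf V1 V2 ->
  forall A, <<s \bigcup_(i in S) preimage_set_system setT (p i) measurable >> A ->
  Ex P1 (fun w => V1 w * \1_A (X1 w)) = Ex P2 (fun w => V2 w * \1_A (X2 w)).
Proof.
move=> mV1 mV2 V1M V2M H A /cyl_sigma.
apply: (weighted_dynkin mV1 mV2 V1M V2M cyl_setI).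
- by move=> B cB; split; exact: cyl_measurable cB.
- have := weighted_law_cyl cylT mV1 mV2 V1M V2M H.
  have e (O : Type) (V : O -> R) (X : O -> E) : (fun w => V w * \1_setT (X w)) = (fun w => V w * 1).
    by apply/funext => w; rewrite indicT.
  by rewrite !e.
- by move=> B cB; exact: weighted_law_cyl cB _ _ _ mV1 mV2 V1M V2M H.
Qed.

End weighted_law_eq.

Section agree_bdd.
Import HBNNSimple.
Context {d1 d2} {O1 : measurableType d1} {O2 : measurableType d2} {R : realType}
  (P1 : probability O1 R) (P2 : probability O2 R).
Context (V1 Z1 : O1 -> R) (V2 Z2 : O2 -> R) (M : R).
Hypotheses (mV1 : measurable_fun setT V1) (mV2 : measurable_fun setT V2)
  (mZ1 : measurable_fun setT Z1) (mZ2 : measurable_fun setT Z2)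
  (V1M : forall w, `|V1 w| <= M) (V2M : forall w, `|V2 w| <= M).
Hypothesis Hind : forall A : set R, measurable A -> agree P1 P2 V1 Z1 V2 Z2 \1_A.

Lemma agree_bdd (f : R -> R) (K : R) : measurable_fun setT f ->
  (forall x, `|f x| <= K) -> agree P1 P2 V1 Z1 V2 Z2 f.
Proof.
move=> mf fK.
have K0 : 0 <= K := le_trans (normr_ge0 _) (fK 0).
have bi (B : set R) (x : R) : `|\1_B x : R| <= 1.
  by rewrite indicE; case: (x \in B); rewrite ?normr1 ?normr0.
have sumlem (m : nat) (a : nat -> R) (B : nat -> set R) : (forall i, measurable (B i)) ->
    agree P1 P2 V1 Z1 V2 Z2 (fun x => \sum_(i < m) a i * \1_(B i) x).
  move=> mB; elim: m => [|m IH].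
    rewrite /agree; under eq_fun do rewrite big_ord0 mulr0.
    by under [in RHS]eq_fun do rewrite big_ord0 mulr0; rewrite !Ex_cst.
  have -> : (fun x => \sum_(i < m.+1) a i * \1_(B i) x) =
      (fun x => \sum_(i < m) a i * \1_(B i) x + a m * \1_(B m) x) :> (R -> R).
    by apply/funext => x; rewrite big_ord_recr.
  pose N := \sum_(i < m) `|a i| + `|a m|.
  apply: (agreeD mV1 mV2 mZ1 mZ2 V1M V2M (K := N)) => //.
  - apply: measurable_sum => i; apply: measurable_funM => //; exact: measurable_indic.
  - move=> x; apply: (le_trans (ler_norm_sum _ _ _)); rewrite -[leLHS]addr0 lerD//.
    by apply: ler_sum => i _; rewrite normrM -[leRHS]mulr1 ler_pM.
  - by apply: measurable_funM => //; exact: measurable_indic.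
  - move=> x; rewrite -[leLHS]add0r lerD//; first exact: sumr_ge0.
    by rewrite normrM -[leRHS]mulr1 ler_pM.
  - by apply: (agreeZ mV1 mV2 mZ1 mZ2 V1M V2M (a m) (K := 1)) => //; first [exact: Hind|exact: measurable_indic].
(* Adding the bound [K] makes the function nonnegative, so that it is an increasing limit of simple
   functions. *)
pose F x := (f x + K)%:E.
have mF : measurable_fun setT F by apply/measurable_EFinP; exact: measurable_funD.
have F0 x : setT x -> (0 <= F x)%E.
  by move=> _; rewrite lee_fin -lerBlDr sub0r lerNl; have := fK x; rewrite ler_norml => /andP[]; lra.
have h : agree P1 P2 V1 Z1 V2 Z2 (fun x => f x + K).
  have cF x : nnsfun_approx measurableT mF n x @[n --> \oo] --> f x + K.
    by have /fine_cvg := cvg_nnsfun_approx measurableT mF F0 (x := x) I.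
  apply: (agree_lim mV1 mV2 mZ1 mZ2 V1M V2M (f_ := fun n x => nnsfun_approx measurableT mF n x) (K := 2 * K)) => //.
  - move=> n x; rewrite ger0_norm//.
    have ndx : nondecreasing_seq (fun n => nnsfun_approx measurableT mF n x).
      by move=> a b ab; have /lefP := nd_nnsfun_approx measurableT mF ab; apply.
    apply: (@le_trans _ _ (f x + K)).
      rewrite -(cvg_lim _ (cF x))//; apply: nondecreasing_cvgn_le => //.
      by apply/cvg_ex; exists (f x + K).
    by have := fK x; rewrite ler_norml => /andP[]; lra.
  - move=> n.
    pose g := nnsfun_approx measurableT mF n.
    have E := fimfunEord g; set sq := fset_set _ in E.
    have := @sumlem (size (finmap.enum_fset sq)) (fun i => (finmap.enum_fset sq)`_i)
      (fun i => g @^-1` [set (finmap.enum_fset sq)`_i]) _.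
    rewrite (_ : (fun x => \sum_(i < _) _) = g); last by apply/funext => x; rewrite E.
    by apply => i; rewrite -[X in measurable X]setTI; exact: (@measurable_funPT _ _ _ _ g).
have := agreeD mV1 mV2 mZ1 mZ2 V1M V2M (K := K + K) (f := fun x => f x + K) (g := fun=> - K).
have -> : (fun x => f x + K + - K) = f by apply/funext => x; rewrite addrK.
apply => //.
- exact: measurable_funD.
- by move=> x; apply: (le_trans (ler_normD _ _)); rewrite lerD// ger0_norm.
- by move=> _; rewrite normrN ger0_norm// lerDl.
have := agreeZ mV1 mV2 mZ1 mZ2 V1M V2M (- K) (K := 1) (f := \1_setT) (measurable_indic measurableT) (bi _) (Hind measurableT).
by have -> : (fun x => - K * \1_setT x) = (fun=> - K) :> (R -> R) by apply/funext => x; rewrite indicT mulr1.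
Qed.

End agree_bdd.

(** * Gaussian variables and Gaussian spaces *)

Section normal.
Context {R : realType} (s : R).
Hypothesis s0 : s != 0.
Local Notation lam := (@lebesgue_measure R).
Local Notation p := (normal_pdf 0 s).
Local Notation q := (normal_pdf 0 (s * Num.sqrt 2)).

Let s2 : 0 < s ^+ 2. Proof. by rewrite exprn_even_gt0. Qed.

Let s20 : s * Num.sqrt 2 != 0.
Proof. by rewrite mulf_neq0// gt_eqF// sqrtr_gt0. Qed.

Let pE x : p x = normal_peak s * expR (- (x ^+ 2 / (s ^+ 2 * 2))).
Proof. by rewrite normal_pdfE// /normal_fun subr0 mulNr mulr_natr. Qed.

Let qE x : q x = normal_peak (s * Num.sqrt 2) * expR (- (x ^+ 2 / (s ^+ 2 * 4))).
Proof.
rewrite normal_pdfE// /normal_fun subr0 mulNr; congr (_ * expR (- (_ / _))).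
by rewrite exprMn sqr_sqrtr//; ring.
Qed.

(** [C] is chosen so that [|x| p(x)] is at most [C] times a Gaussian of twice the variance. This
    integrable majorant, [G] below, dominates the derivative of [cos(c x) p(x)] in [c], uniformly in
    [c]. *)
Let C := (2^-1 + 2 * s ^+ 2) * normal_peak s.

Let xp_le x : `|x| * p x <= C * expR (- (x ^+ 2 / (s ^+ 2 * 4))).
Proof.
rewrite pE /C; set y := x ^+ 2 / (s ^+ 2 * 4).
have y0 : 0 <= y by rewrite divr_ge0 ?sqr_ge0// mulr_ge0// ltW.
have yE : x ^+ 2 = 4 * s ^+ 2 * y by rewrite /y; field; rewrite ?s0 ?gt_eqF.
have -> : x ^+ 2 / (s ^+ 2 * 2) = y + y by rewrite /y; field; rewrite ?s0 ?gt_eqF.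
rewrite opprD expRD; set e := expR (- y).
have -> : `|x| * (normal_peak s * (e * e)) = normal_peak s * e * (`|x| * e) by ring.
have -> : (2^-1 + 2 * s ^+ 2) * normal_peak s * e = normal_peak s * e * (2^-1 + 2 * s ^+ 2) by ring.
rewrite ler_wpM2l ?mulr_ge0 ?normal_peak_ge0 ?expR_ge0//.
rewrite /e expRN ler_pdivrMr ?expR_gt0//.
have e1 : 1 + y <= expR y := expR_ge1Dx y.
have : `|x| <= 2^-1 + x ^+ 2 / 2.
  by rewrite -(real_normK (num_real x)); have := sqr_ge0 (`|x| - 1); rewrite sqrrB1; lra.
rewrite yE => h; apply: (le_trans h).
apply: (@le_trans _ _ ((2^-1 + 2 * s ^+ 2) * (1 + y))); last first.
  by rewrite ler_wpM2l// addr_ge0// mulr_ge0// ltW.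
have := mulr_ge0 (ltW s2) y0; nra.
Qed.

Let ip_ : lam.-integrable setT (EFin \o p). Proof. exact: integrable_normal_pdf. Qed.

Let integrable_le (f : R -> R) (K : R) : measurable_fun setT f ->
  (forall x, `|f x| <= K * p x) -> lam.-integrable setT (EFin \o f).
Proof.
move=> mf fK; apply: (@le_integrable _ _ _ lam setT measurableT _ (EFin \o (fun x => K * p x))) => //.
- exact/measurable_EFinP.
- by move=> x _; rewrite /= lee_fin (le_trans (fK x))// ler_norm.
exact: (integrableZl measurableT K ip_).
Qed.

Let G x := C * expR (- (x ^+ 2 / (s ^+ 2 * 4))).

Let iG : lam.-integrable setT (EFin \o G).
Proof.
have := integrableZl measurableT (C / normal_peak (s * Num.sqrt 2)) (@integrable_normal_pdf R 0 (s * Num.sqrt 2)).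
apply: eq_integrable => // x _; rewrite /= -EFinM qE /G; congr (_%:E).
by rewrite mulrA divfK// gt_eqF// normal_peak_gt0.
Qed.

Let integrable_leG (f : R -> R) : measurable_fun setT f ->
  (forall x, `|f x| <= G x) -> lam.-integrable setT (EFin \o f).
Proof.
move=> mf fG; apply: le_integrable iG => //; first exact/measurable_EFinP.
by move=> x _; rewrite /= lee_fin (le_trans (fG x))// ler_norm.
Qed.

Let mp : measurable_fun setT p. Proof. exact: measurable_normal_pdf. Qed.
Let p0 x : 0 <= p x. Proof. exact: normal_pdf_ge0. Qed.

Let mtrig (c : R) : measurable_fun setT (fun x : R => cos (c * x)) /\ measurable_fun setT (fun x : R => sin (c * x)).
Proof.
have ml : measurable_fun setT (fun x : R => c * x) by exact: measurable_funM.
split; (apply: measurableT_comp ml; apply: continuous_measurable_fun).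
  exact: continuous_cos.
exact: continuous_sin.
Qed.

Let bcos (x : R) : `|cos x| <= 1. Proof. by rewrite ler_norml cos_geN1 cos_le1. Qed.
Let bsin (x : R) : `|sin x| <= 1. Proof. by rewrite ler_norml sin_geN1 sin_le1. Qed.

Let icos c : lam.-integrable setT (EFin \o (fun x => cos (c * x) * p x)).
Proof.
apply: (@integrable_le _ 1); first by apply: measurable_funM => //; exact: (mtrig c).1.
by move=> x; rewrite normrM (ger0_norm (p0 x)) ler_wpM2r.
Qed.

Let ixsin c : lam.-integrable setT (EFin \o (fun x => x * sin (c * x) * p x)).
Proof.
apply: integrable_leG.
  by apply: measurable_funM => //; apply: measurable_funM => //; exact: (mtrig c).2.
move=> x; apply: le_trans (xp_le x); rewrite mulrAC normrM normrM (ger0_norm (p0 x)).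
by rewrite -[leRHS]mulr1 ler_pM// mulr_ge0.
Qed.

Let dp (x : R) : is_derive x 1 p (- (x / s ^+ 2) * p x).
Proof.
have d2 : is_derive x 1 (fun x : R => x * x) (1 * x + x * 1) by exact: is_deriveMd.
have d3 := is_deriveMd d2 (is_derive_cst (- (s ^+ 2 * 2)^-1) x 1).
have d4 := is_derive_compd d3 (is_derive_expR (x * x * - (s ^+ 2 * 2)^-1)).
have := is_deriveMd (is_derive_cst (normal_peak s) x 1) d4.
move=> h; apply: (is_derive_ext h).
  by apply/funext => y; rewrite pE /= mulrN -expr2.
rewrite pE /= mulrN -expr2 /=; set e := expR _; rewrite !mul0r !mulr0 !add0r !addr0.
by field; rewrite ?s0 ?gt_eqF.
Qed.

Let lin_is_derive (c x : R) : is_derive x 1 (fun x : R => c * x) c.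
Proof.
by have := is_deriveMd (is_derive_cst c x 1) (is_derive_id x 1); rewrite mul0r add0r mulr1.
Qed.

Let h c (x : R) := sin (c * x) * p x.
Let h' c (x : R) := c * (cos (c * x) * p x) + (- (s ^+ 2)^-1) * (x * sin (c * x) * p x).

Let dh (c x : R) : is_derive x 1 (h c) (h' c x).
Proof.
have := is_deriveMd (is_derive_compd (lin_is_derive c x) (is_derive_sin (c * x))) (dp x).
by move=> H; apply: (is_derive_ext H) => //; rewrite /h'; field; rewrite ?s0 ?gt_eqF.
Qed.

Let ih' c : lam.-integrable setT (EFin \o h' c).
Proof.
apply: (@integrableD _ _ _ lam setT measurableT (EFin \o (fun x => c * (cos (c * x) * p x)))
  (EFin \o (fun x => (- (s ^+ 2)^-1) * (x * sin (c * x) * p x)))).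
  exact: (integrableZl measurableT c (icos c)).
exact: (integrableZl measurableT (- (s ^+ 2)^-1) (ixsin c)).
Qed.

Let ch' c : continuous (h' c).
Proof.
have cp : continuous p by exact: continuous_normal_pdf.
have cl x : {for x, continuous (fun x : R => c * x)} by apply: cvgM; [exact: cvg_cst|exact: cvg_id].
move=> x; apply: cvgD; (apply: cvgM; first exact: cvg_cst).
  apply: cvgM; last exact: cp.
  by apply: (@continuous_comp _ _ _ (fun x : R => c * x) (@cos R)) => //; exact: continuous_cos.
apply: cvgM; last exact: cp.
apply: cvgM; first exact: cvg_id.
by apply: (@continuous_comp _ _ _ (fun x : R => c * x) (@sin R)) => //; exact: continuous_sin.
Qed.

(** Integration by parts: [h' c] is the derivative of [sin(c x) p(x)], which vanishes at both ends,
    and its integral is the limit of those over [[-n, n]]. *)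
Let int_h' c : \int[lam]_x h' c x = 0.
Proof.
pose f n x := h' c x * \1_(`[- n.+1%:R, n.+1%:R]) x.
have mh' : measurable_fun setT (h' c) by case/integrableP : (ih' c) => /measurable_EFinP.
have L1 : (\int[lam]_x f n x) @[n --> \oo] --> \int[lam]_x h' c x.
  apply: fine_cvg; rewrite fineK; last exact: (integrable_fin_num measurableT (ih' c)).
  have [] := @dominated_convergence _ _ _ lam setT measurableT (fun n => EFin \o f n) (EFin \o h' c)
    (abse \o (EFin \o h' c)).
  - move=> n; apply/measurable_EFinP; apply: measurable_funM => //; exact: measurable_indic.
  - exact/measurable_EFinP.
  - apply: aeW => x _; apply: cvg_EFin; first exact: nearW.
    rewrite -[X in _ --> X]mulr1; apply: cvgM; first exact: cvg_cst.
    apply/cvgrPdist_lt => e e0; near=> n.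
    rewrite indicE mem_set ?subrr ?normr0//= in_itv/= -ler_norml.
    by apply: (@le_trans _ _ n%:R); [near: n; exact: nbhs_infty_ger|rewrite ler_nat].
  - exact: (integrable_abse (ih' c)).
  - apply: aeW => x n _; rewrite /= lee_fin /f normrM indicE; case: (_ \in _); rewrite ?normr1 ?normr0 ?mulr1 ?mulr0//.
  - by [].
have E n : \int[lam]_x f n x = 2 * h c n.+1%:R.
  have -> : \int[lam]_x f n x = \int[lam]_(x in `[- n.+1%:R, n.+1%:R]) h' c x.
    rewrite [RHS]Rintegral_mkcond; apply: eq_Rintegral => x _.
    by rewrite patchE /f indicE; case: (_ \in _); rewrite ?mulr1 ?mulr0.
  rewrite (_ : (\int[lam]_(x in _) _) = h c n.+1%:R - h c (- n.+1%:R)); last first.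
    apply: (@FTC2_R _ (h' c) (h c)) => //.
    by apply: (@le_trans _ _ 0); rewrite ?oppr_le0 ler0n.
  by rewrite /h mulrN sinN (_ : p (- _) = p n.+1%:R); [ring|rewrite !pE sqrrN].
have L2 : (\int[lam]_x f n x) @[n --> \oo] --> 0.
  under eq_fun do rewrite E.
  rewrite -(mulr0 2); apply: cvgM; first exact: cvg_cst.
  apply/norm_cvg0P.
  have cH : C * n.+1%:R^-1 @[n --> \oo] --> 0.
    by rewrite -(mulr0 C); apply: cvgM; [exact: cvg_cst|exact: cvg_harmonic].
  apply: (squeeze_cvgr _ (@cvg_cst _ 0 _ _ _) cH); apply: nearW => n; rewrite normr_ge0/=.
  rewrite /h normrM (ger0_norm (p0 _)); apply: (@le_trans _ _ (p n.+1%:R)).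
    by rewrite -[leRHS]mul1r ler_wpM2r.
  rewrite ler_pdivlMr// mulrC; have := xp_le n.+1%:R; rewrite ger0_norm// => /le_trans; apply.
  rewrite -[leRHS]mulr1 ler_wpM2l//.
    by rewrite mulr_ge0 ?normal_peak_ge0// addr_ge0// mulr_ge0// ltW.
  by rewrite -expR0 ler_expR oppr_le0 divr_ge0 ?sqr_ge0// mulr_ge0// ltW.
by apply: cvg_unique L1 L2.
Unshelve. all: by end_near. Qed.

Let psi c := \int[lam]_x (cos (c * x) * p x).

Let ibp c : \int[lam]_x (x * sin (c * x) * p x) = s ^+ 2 * c * psi c.
Proof.
have := int_h' c; rewrite /h' RintegralD//; last 2 first.
- exact: (integrableZl measurableT c (icos c)).
- exact: (integrableZl measurableT (- (s ^+ 2)^-1) (ixsin c)).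
rewrite !RintegralZl//.
rewrite -/(psi c); set I := \int[_]_x _ => H.
have -> : I = s ^+ 2 * (c * psi c - (c * psi c + - (s ^+ 2)^-1 * I)) by field; rewrite ?s0 ?gt_eqF.
by rewrite H subr0 mulrA.
Qed.

(** Differentiation under the integral, dominated by [G], brings out [- x sin(c x) p(x)];
    integration by parts turns its integral back into a multiple of [psi]. *)
Let dpsi (c : R) : is_derive c 1 psi (- (s ^+ 2 * c * psi c)).
Proof.
pose f (c x : R) := cos (c * x) * p x.
have df (c' x : R) : is_derive c' 1 (f ^~ x) (- (x * sin (c' * x) * p x)).
  have d0 : is_derive c' 1 (fun c : R => c * x) x.
    by have := is_deriveMd (is_derive_id c' 1) (is_derive_cst x c' 1); rewrite mul1r mulr0 addr0.
  have := is_deriveMd (is_derive_compd d0 (is_derive_cos (c' * x))) (is_derive_cst (p x) c' 1).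
  by move=> H; apply: (is_derive_ext H) => //=; ring.
have Ic : `]c - 1, c + 1[%classic c by rewrite /= in_itv/= ltrBlDr ltrDl ltr01.
have H1 x y : `]c - 1, c + 1[%classic x -> setT y -> derivable (f ^~ y) x 1.
  by move=> _ _; case: (df x y).
have H2 x y : `]c - 1, c + 1[%classic x -> setT y -> `|partial1of2 f x y| <= G y.
  move=> _ _; rewrite partial1of2E; have [_ ->] := df x y.
  rewrite normrN mulrAC normrM normrM (ger0_norm (p0 _)); apply: le_trans (xp_le y).
  by rewrite -[leRHS]mulr1 ler_pM// mulr_ge0.
have G0 y : 0 <= G y.
  by apply: le_trans (xp_le y); rewrite mulr_ge0.
have D1 := @derivable_under_integral _ _ _ lam f setT measurableT c (c - 1) (c + 1) Ic (fun x _ => icos x) H1 G G0 iG H2.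
have D2 := @differentiation_under_integral _ _ _ lam f setT measurableT c (c - 1) (c + 1) Ic (fun x _ => icos x) H1 G G0 iG H2.
apply: DeriveDef; first exact: D1.
rewrite -derive1E [LHS]D2 -ibp -mulN1r -RintegralZl//.
apply: eq_Rintegral => x _; rewrite partial1of2E; have [_ ->] := df c x.
by rewrite mulN1r.
Qed.

(** [psi] solves the linear equation [psi' = - s^2 c psi]. Multiplied by the integrating factor
    [exp(c^2 s^2 / 2)] it is constant, equal to [psi 0 = 1]. *)
Lemma normal_cos c : \int[lam]_x (cos (c * x) * p x) = expR (- (c ^+ 2 * s ^+ 2 / 2)).
Proof.
pose g c := psi c * expR (c * c * (s ^+ 2 / 2)).
have dg (x : R) : is_derive x 1 g 0.
  have d2 : is_derive x 1 (fun x : R => x * x) (1 * x + x * 1) by exact: is_deriveMd.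
  have d3 := is_deriveMd d2 (is_derive_cst (s ^+ 2 / 2) x 1).
  have := is_deriveMd (dpsi x) (is_derive_compd d3 (is_derive_expR (x * x * (s ^+ 2 / 2)))).
  by move=> H; apply: (is_derive_ext H) => //=; field.
have := is_derive_0_is_cst c 0 dg; rewrite /g mul0r mul0r expR0 mulr1.
have -> : psi 0 = 1.
  rewrite /psi /Rintegral; under eq_integral do rewrite mul0r cos0 mul1r.
  by rewrite integral_normal_pdf.
move=> /(congr1 (fun z => z * expR (- (c * c * (s ^+ 2 / 2))))).
rewrite -(mulrA (psi c)) -expRD subrr expR0 mulr1 mul1r -/(psi c) => ->.
by congr expR; rewrite -expr2 mulrA.
Qed.

Lemma normal_sin c : \int[lam]_x (sin (c * x) * p x) = 0.
Proof.
have isin : lam.-integrable setT (EFin \o (fun x => sin (c * x) * p x)).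
  apply: (@integrable_le _ 1); first by apply: measurable_funM => //; exact: (mtrig c).2.
  by move=> x; rewrite normrM (ger0_norm (p0 x)) ler_wpM2r.
pose F x := (sin (c * x) * p x)%:E.
have mF : measurable_fun setT F by case/integrableP : isin.
have E : (\int[lam]_x F x = \int[lam]_x F (- x)%R)%E.
  have mN : measurable_fun setT (-%R : R -> R) by apply: continuous_measurable_fun; exact: opp_continuous.
  have := @integral_pushforward _ _ (measurableTypeR R) (measurableTypeR R) R (-%R : R -> R) mN lam setT F mF _ measurableT.
  rewrite preimage_setT => <-.
    by apply: eq_measure_integral => A mA _; rewrite /= -lebesgue_measureN.
  apply: (@le_integrable _ _ _ lam setT measurableT _ F) => //.
  - exact: measurableT_comp.
  - by move=> x _; rewrite /F /= mulrN sinN (_ : p (- x) = p x) ?mulNr ?normrN// !pE sqrrN.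
rewrite /Rintegral; suff -> : (\int[lam]_x F x = 0)%E by [].
have : (\int[lam]_x F x = - \int[lam]_x F x)%E.
  rewrite {1}E -integralN; last exact: integrable_add_def.
  apply: eq_integral => x _; rewrite /F /= mulrN sinN (_ : p (- x) = p x) ?mulNr ?EFinN//.
  by rewrite !pE sqrrN.
have := integrable_fin_num measurableT isin; rewrite -/F.
case: (\int[lam]_x F x)%E => // r _ /= [] /eqP; rewrite -addr_eq0 -mulr2n mulrn_eq0/= => /eqP ->.
by [].
Qed.

End normal.

Lemma integral_normal_prob {R : realType} (s : R) (f : R -> R) : s != 0 -> measurable_fun setT f ->
  int1 (normal_prob 0 s) f ->
  Ex (normal_prob 0 s) f = \int[@lebesgue_measure R]_x (f x * normal_pdf 0 s x).
Proof.
move=> s0 mf fint; rewrite /Ex /Rintegral; congr fine.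
have dom := @normal_prob_dominates R 0 s.
rewrite -(Radon_Nikodym_change_of_variables dom)//=.
apply: ae_eq_integral => //.
- apply: emeasurable_funM => //; first exact/measurable_EFinP.
- apply/measurable_EFinP; apply: measurable_funM => //; exact: measurable_normal_pdf.
rewrite (_ : (fun x => (f x * normal_pdf 0 s x)%:E) = (fun x => (f x)%:E * (normal_pdf 0 s x)%:E)%E)//.
apply: ae_eqe_mul2l => /=.
rewrite Radon_NikodymE//=.
case: cid => /= h [h1 h2 h3].
apply: integral_ae_eq => //=.
- by apply/measurable_EFinP; exact: measurable_normal_pdf.
- by move=> E E01 mE; rewrite -h3.
Qed.

Section gaussian.
Context {d} {Om : measurableType d} {R : realType} (P : probability Om R).

(** The centred normal law of variance [v], through its characteristic function. Degenerate
    variables are included as [v = 0], and almost sure limits stay in the class. *)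
Definition isG (v : R) (Z : Om -> R) := measurable_fun setT Z /\
  forall c, Ex P (fun w => cos (c * Z w)) = expR (- (c ^+ 2 * v / 2)) /\
            Ex P (fun w => sin (c * Z w)) = 0.

Lemma bcos (x : R) : `|cos x| <= 1. Proof. by rewrite ler_norml cos_geN1 cos_le1. Qed.
Lemma bsin (x : R) : `|sin x| <= 1. Proof. by rewrite ler_norml sin_geN1 sin_le1. Qed.

Lemma mcosf (f : Om -> R) : measurable_fun setT f -> measurable_fun setT (fun x => cos (f x)).
Proof.
by move=> mf; apply: measurableT_comp mf; apply: continuous_measurable_fun; exact: continuous_cos.
Qed.

Lemma msinf (f : Om -> R) : measurable_fun setT f -> measurable_fun setT (fun x => sin (f x)).
Proof.
by move=> mf; apply: measurableT_comp mf; apply: continuous_measurable_fun; exact: continuous_sin.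
Qed.

(** The multiplicative form gives two things at once when [sin(c Z) / c] is compared with [Z]:
    domination by [|Z|], and convergence as [c] tends to 0, because the cosine factor tends to 1. *)
Lemma sin_mvt (x : R) : exists2 y, `|y| <= `|x| & sin x = x * cos y.
Proof.
have cs : continuous (@sin R) by exact: continuous_sin.
case: (ltgtP x 0) => x0.
- have [y] := @MVT R sin cos x 0 x0 (fun y _ => is_derive_sin y) (continuous_subspaceT cs).
  rewrite in_itv/= => /andP[xy y0]; rewrite sin0 !sub0r => /eqP; rewrite mulrN eqr_opp => /eqP ->.
  by exists y; [rewrite !ltr0_norm// lerN2 ltW|rewrite mulrC].
- have [y] := @MVT R sin cos 0 x x0 (fun y _ => is_derive_sin y) (continuous_subspaceT cs).
  rewrite in_itv/= => /andP[xy y0]; rewrite sin0 !subr0 => ->.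
  by exists y; [rewrite !gtr0_norm// ltW|rewrite mulrC].
by exists 0; rewrite ?x0 ?sin0 ?mul0r.
Qed.

(** Integrability has to be extracted from the characteristic function. The bounded variables
    [Y n = 2 sin(c Z / 2) / c] tend to [Z], and their second moments
    [2 (1 - exp(- c^2 v / 2)) / c^2] are explicit; Fatou gives [E Z^2 <= v], and [|Y n| <= |Z|]
    gives the converse. *)
Lemma isG_L2 (v : R) (Z : Om -> R) : isG v Z -> L2 P Z /\ ip P Z Z = v.
Proof.
move=> [mZ GZ].
pose c n : R := n.+1%:R^-1.
have c0 n : 0 < c n by rewrite invr_gt0.
pose Y n w := 2 * sin (c n / 2 * Z w) / c n.
have mY n : measurable_fun setT (Y n).
  by apply: measurable_funM => //; apply: measurable_funM => //; apply: msinf; exact: measurable_funM.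
have LY n : L2 P (Y n).
  apply: (@L2_bdd _ _ _ _ (2 * 1 / c n)) => // w; rewrite /Y !normrM normfV.
  rewrite (gtr0_norm (c0 n)); apply: ler_wpM2r; first by rewrite invr_ge0 ltW.
  by rewrite ger0_norm// ler_pM// bsin.
have YZ w n : exists2 y, `|y| <= c n * `|Z w| & Y n w = Z w * cos y.
  have [y yx sy] := sin_mvt (c n / 2 * Z w).
  exists y; last by rewrite /Y sy; field; rewrite gt_eqF.
  apply: (le_trans yx); rewrite normrM gtr0_norm ?divr_gt0//.
  by rewrite ler_wpM2r// ler_pdivrMr// ler_peMr ?ler1n// ltW.
have cc : c n @[n --> \oo] --> 0 by exact: cvg_harmonic.
have cY w : Y n w @[n --> \oo] --> Z w.
  have /choice[y yP] : forall n, exists y, `|y| <= c n * `|Z w| /\ Y n w = Z w * cos y.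
    by move=> n; have [y] := YZ w n; exists y.
  have y0 : y n @[n --> \oo] --> 0.
    apply/norm_cvg0P; apply: (squeeze_cvgr _ (@cvg_cst _ 0 _ _ _) (_ : c n * `|Z w| @[n --> \oo] --> 0)).
      by apply: nearW => n; rewrite normr_ge0/=; have [] := yP n.
    by rewrite -(mul0r `|Z w|); apply: cvgM => //; exact: cvg_cst.
  have -> : (fun n => Y n w) = (fun n => Z w * cos (y n)) by apply/funext => n; rewrite (yP _).2.
  have h : cos (y n) @[n --> \oo] --> cos (0 : R).
    by apply: (cvg_comp y cos y0); exact: continuous_cos.
  suff : Z w * cos (y n) @[n --> \oo] --> Z w * cos 0 by rewrite cos0 mulr1.
  by apply: cvgM => //; exact: cvg_cst.
have EY n : ip P (Y n) (Y n) = 2 * (1 - expR (- ((c n) ^+ 2 * v / 2))) / (c n) ^+ 2.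
  have m1 : measurable_fun setT (fun w => cos (c n * Z w)) by apply: mcosf; exact: measurable_funM.
  have i1 : int1 P (fun w => cos (c n * Z w)) by apply: (@int1_bdd _ _ _ _ 1) => // w; exact: bcos.
  have -> : 1 - expR (- ((c n) ^+ 2 * v / 2)) = Ex P (fun w => 1 - cos (c n * Z w)).
    by rewrite ExB ?Ex_cst ?(GZ (c n)).1//; exact: int1_cst.
  rewrite mulrAC -ExZ; last by apply: int1B => //; exact: int1_cst.
  apply: eq_Rintegral => w _; rewrite /Y.
  have -> : cos (c n * Z w) = cos (c n / 2 * Z w + c n / 2 * Z w) by congr cos; field.
  rewrite cosD; have := cos2Dsin2 (c n / 2 * Z w); set C := cos _; set S := sin _ => h.
  have -> : 1 - (C * C - S * S) = 2 * S ^+ 2 by have := h; rewrite !expr2; lra.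
  by field; rewrite gt_eqF.
have EYle n : ip P (Y n) (Y n) <= v.
  rewrite EY ler_pdivrMr ?exprn_gt0//.
  by have := expR_ge1Dx (- ((c n) ^+ 2 * v / 2)); lra.
have [|LZ Zv] := fatou_L2 LY mZ _ EYle; first exact: aeW.
split => //; apply/eqP; rewrite eq_le Zv/=.
have YleZ n : ip P (Y n) (Y n) <= ip P Z Z.
  rewrite !ip_sqr; apply: Ex_le; [exact: (LY n).2|exact: LZ.2|] => w.
  have [y _ ->] := YZ w n; rewrite exprMn -[leRHS]mulr1 ler_wpM2l ?sqr_ge0//.
have v0 : 0 <= v by apply: le_trans Zv; exact: ip_ge0.
(* The inequality [exp(-a) <= 1 / (1 + a)] turns the explicit second moment into a lower bound that
   tends to [v]. *)
have low n : v / (1 + (c n) ^+ 2 * v / 2) <= ip P Z Z.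
  apply: le_trans (YleZ n); rewrite EY; set a := (c n) ^+ 2 * v / 2.
  have a0 : 0 <= a by rewrite divr_ge0// mulr_ge0// sqr_ge0.
  have h : expR (- a) <= (1 + a)^-1.
    by rewrite expRN lef_pV2 ?posrE ?expR_gt0 ?expR_ge1Dx// ltr_wpDr.
  have cn2 : 0 < (c n) ^+ 2 by rewrite exprn_gt0.
  rewrite ler_pdivlMr//.
  have -> : v / (1 + a) * (c n) ^+ 2 = 2 * (1 - (1 + a)^-1).
    by rewrite /a; field; rewrite gt_eqF//; rewrite -/a; have := a0; rewrite /a; lra.
  by rewrite ler_wpM2l// lerB.
have cl : v / (1 + (c n) ^+ 2 * v / 2) @[n --> \oo] --> v.
  rewrite -[X in _ --> X]divr1; apply: cvgM; first exact: cvg_cst.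
  have h : 1 + (c n) ^+ 2 * v / 2 @[n --> \oo] --> (1 : R).
    rewrite -[X in _ --> X]addr0; apply: cvgD; first exact: cvg_cst.
    rewrite -(mul0r (2^-1)) -(mul0r v) -(mul0r 0).
    apply: cvgM; last exact: cvg_cst; apply: cvgM; last exact: cvg_cst.
    by under eq_fun do rewrite expr2; exact: cvgM.
  by apply: cvgV => //.
rewrite -[leLHS](cvg_lim _ cl)//; apply: limr_le; last exact: nearW.
by apply/cvg_ex; exists v.
Qed.

Lemma isG_scale (v : R) (Z : Om -> R) c : isG v Z -> isG (c ^+ 2 * v) (fun w => c * Z w).
Proof.
move=> [mZ GZ]; split; first exact: measurable_funM.
move=> e; have [h1 h2] := GZ (e * c); split.
  rewrite (_ : _ / 2 = (e * c) ^+ 2 * v / 2); last by ring.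
  by rewrite -h1; apply: eq_Rintegral => w _; rewrite mulrA.
by rewrite -h2; apply: eq_Rintegral => w _; rewrite mulrA.
Qed.

Lemma isG_lim (Z_ : nat -> Om -> R) (v_ : nat -> R) (Z : Om -> R) (v : R) :
  measurable_fun setT Z -> (forall n, isG (v_ n) (Z_ n)) ->
  v_ n @[n --> \oo] --> v -> {ae P, forall w, Z_ n w @[n --> \oo] --> Z w} -> isG v Z.
Proof.
move=> mZ GZ vv ZZ; split=> // c.
have lim (f : R -> R) : continuous f -> (forall x, `|f x| <= 1) ->
    Ex P (fun w => f (c * Z_ n w)) @[n --> \oo] --> Ex P (fun w => f (c * Z w)).
  move=> cf f1; have mf := continuous_measurable_fun cf.
  apply: (@Ex_dct _ _ _ P _ _ (fun=> 1)) => //.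
  - by move=> n; apply: (measurableT_comp mf); apply: measurable_funM => //; have [] := GZ n.
  - by apply: (measurableT_comp mf); exact: measurable_funM.
  - apply: filterS ZZ => w Zw; apply: (cvg_comp (fun n => c * Z_ n w) f); last exact: cf.
    by apply: cvgM => //; exact: cvg_cst.
  - exact: int1_cst.
split.
  apply: (cvg_unique _ (lim cos (@continuous_cos R) bcos)); first exact: Rhausdorff.
  rewrite /= (_ : (fun n => _) = fun n => expR (- (c ^+ 2 * v_ n / 2))); last first.
    by apply/funext => n; have [_ /(_ c)[]] := GZ n.
  apply: (cvg_comp (fun n => - (c ^+ 2 * v_ n / 2)) expR); last exact: continuous_expR.
  apply: cvgN; apply: cvgM; last exact: cvg_cst.
  by apply: cvgM => //; exact: cvg_cst.
apply: (cvg_unique _ (lim sin (@continuous_sin R) bsin)); first exact: Rhausdorff.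
rewrite /= (_ : (fun n => _) = fun n => 0); first exact: cvg_cst.
by apply/funext => n; have [_ /(_ c)[]] := GZ n.
Qed.

Lemma isG_ae (v : R) (Z Y : Om -> R) : measurable_fun setT Y -> {ae P, forall w, Y w = Z w} -> isG v Z -> isG v Y.
Proof.
move=> mY YZ GZ; apply: (@isG_lim (fun=> Z) (fun=> v)) => //; first exact: cvg_cst.
by apply: filterS YZ => w ->; exact: cvg_cst.
Qed.

End gaussian.

Lemma isG_normal_prob {R : realType} (s : R) : s != 0 -> isG (normal_prob 0 s) (s ^+ 2) id.
Proof.
move=> s0; split => // c.
have mc : measurable_fun setT (fun x : R => cos (c * x)) by apply: mcosf; exact: measurable_funM.
have ms : measurable_fun setT (fun x : R => sin (c * x)) by apply: msinf; exact: measurable_funM.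
split; rewrite integral_normal_prob//.
- by rewrite normal_cos//.
- by apply: (@int1_bdd _ _ _ _ 1) => // x; exact: bcos.
- by rewrite normal_sin.
- by apply: (@int1_bdd _ _ _ _ 1) => // x; exact: bsin.
Qed.

Section ospan_facts.
Context {d} {Om : measurableType d} {R : realType} (P : probability Om R).
Context {I : eqType} (V : I -> Om -> R) (S : I -> Prop).

Lemma ospan_gen i : L2 P (V i) -> S i -> ospan P V S (V i).
Proof. by move=> LV Si; split => // h Lh; apply. Qed.

Lemma ospanD Z Y : ospan P V S Z -> ospan P V S Y -> ospan P V S (fun w => Z w + Y w).
Proof.
move=> [LZ oZ] [LY oY]; split; first exact: L2D.
by move=> h Lh hV; rewrite ipDr// oZ// oY// addr0.
Qed.

Lemma ospanZ c Z : ospan P V S Z -> ospan P V S (fun w => c * Z w).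
Proof.
move=> [LZ oZ]; split; first exact: L2Z.
by move=> h Lh hV; rewrite ipZr// oZ// mulr0.
Qed.

Lemma ospanB Z Y : ospan P V S Z -> ospan P V S Y -> ospan P V S (fun w => Z w - Y w).
Proof.
move=> [LZ oZ] [LY oY]; split; first exact: L2B.
by move=> h Lh hV; rewrite ipBr// oZ// oY// subr0.
Qed.

Lemma ospan0 : ospan P V S (fun=> 0).
Proof.
split; first exact: L2_cst.
by move=> h Lh hV; rewrite /ip -[RHS](Ex_cst P); apply: eq_Rintegral => w _; rewrite mulr0.
Qed.

Lemma ospan_ae Z Y : measurable_fun setT Y -> {ae P, forall w, Y w = Z w} ->
  ospan P V S Z -> ospan P V S Y.
Proof.
move=> mY YZ [LZ oZ]; split; first exact: L2_ae LZ.
move=> h Lh hV; rewrite -(oZ h Lh hV); apply: ip_ae => //.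
- by have [] := Lh.
- by have [] := Lh.
- by have [] := LZ.
- exact: aeW.
Qed.

Lemma ospan_trans {J : eqType} (Y : J -> Om -> R) (T : J -> Prop) Z :
  (forall j, T j -> ospan P V S (Y j)) -> ospan P Y T Z -> ospan P V S Z.
Proof.
move=> oY [LZ oZ]; split => // h Lh hV; apply: oZ => // j Tj.
exact: (oY j Tj).2.
Qed.

Lemma ip_limr (Z_ : nat -> Om -> R) Z : (forall n, L2 P (Z_ n)) -> L2 P Z ->
  ip P (fun w => Z_ n w - Z w) (fun w => Z_ n w - Z w) @[n --> \oo] --> 0 ->
  ip P (Z_ n) (Z_ n) @[n --> \oo] --> ip P Z Z.
Proof.
move=> LZ_ LZ H; have h := L2_cauchy_cvg LZ_ LZ LZ H.
have -> : (fun n => ip P (Z_ n) (Z_ n)) =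
  (fun n => ip P (fun w => Z_ n w - Z w) (fun w => Z_ n w - Z w) + 2 * ip P (Z_ n) Z - ip P Z Z).
  by apply/funext => n; rewrite ip_sqrB//; ring.
suff H' : ip P (fun w => Z_ n w - Z w) (fun w => Z_ n w - Z w) + 2 * ip P (Z_ n) Z - ip P Z Z
    @[n --> \oo] --> 0 + 2 * ip P Z Z - ip P Z Z.
  by move: H'; rewrite (_ : 0 + 2 * _ - _ = ip P Z Z)//; ring.
apply: cvgB; last exact: cvg_cst.
by apply: cvgD => //; apply: cvgM => //; exact: cvg_cst.
Qed.

(** Joint centred normality in the Cramer-Wold form; the variance of a combination is left to be its
    own squared norm. *)
Definition gfam := (forall i, S i -> L2 P (V i)) /\
  forall s, inS S s -> isG P (ip P (lc V s) (lc V s)) (lc V s).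

Lemma gfam_ospan Z : gfam -> ospan P V S Z -> isG P (ip P Z Z) Z.
Proof.
move=> [LV GV] oZ; have [s sS [aes sn]] := ospan_approx LV oZ.
have [LZ _] := oZ.
apply: (@isG_lim _ _ _ _ (fun n => lc V (s n)) (fun n => ip P (lc V (s n)) (lc V (s n)))) => //.
- by have [] := LZ.
- by move=> n; exact: GV.
apply: ip_limr => //; first by move=> n; exact: (L2_lc LV).
apply: (squeeze_cvgr _ (@cvg_cst _ 0 _ _ _) (geo4_cvg0 4)).
by apply: nearW => n; rewrite ip_ge0/=.
Qed.

End ospan_facts.

Lemma Ex_indic {d} {Om : measurableType d} {R : realType} (P : probability Om R) A :
  measurable A -> (Ex P (\1_A))%:E = P A.
Proof. by move=> mA; rewrite EFin_Ex ?integral_indic ?setIT//; exact: integrable_indic. Qed.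

Section gaussian_law.
Context {R : realType} {I : eqType} {E : Type} (p : I -> E -> R) (S : set I).
Context {d1 d2} {O1 : measurableType d1} {O2 : measurableType d2}
  (P1 : probability O1 R) (P2 : probability O2 R) (X1 : O1 -> E) (X2 : O2 -> E).
Hypotheses (mX1 : forall i, S i -> measurable_fun setT (p i \o X1))
  (mX2 : forall i, S i -> measurable_fun setT (p i \o X2)).
Local Notation lc1 := (lc (fun i w => p i (X1 w))).
Local Notation lc2 := (lc (fun i w => p i (X2 w))).

Lemma sigma_preimage_measurable d (O : measurableType d) (X : O -> E) A :
  (forall i, S i -> measurable_fun setT (p i \o X)) ->
  <<s \bigcup_(i in S) preimage_set_system setT (p i) measurable >> A -> measurable (X @^-1` A).
Proof.
move=> mX sA; suff : <<s \bigcup_(i in S) preimage_set_system setT (p i) measurable >> `<=`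
    [set A | measurable (X @^-1` A)] by apply.
apply: smallest_sub.
  split=> [|B mB|F mF]; first by rewrite /= preimage_set0.
    by rewrite /= setTD preimage_setC; exact: measurableC.
  by rewrite /= preimage_bigcup; apply: bigcup_measurable => k _; exact: mF.
move=> B [i Si [C mC <-]]; rewrite /= setTI -[X in measurable X]setTI.
exact: (mX i Si measurableT C mC).
Qed.

(** [E] carries no structure beyond the evaluations [p i], so the statement serves alike for paths,
    pairs of paths, single variables and arbitrary functions of time. *)
Theorem gaussian_law_eq : (forall s, inS S s -> exists2 v, isG P1 v (lc1 s) & isG P2 v (lc2 s)) ->
  forall A, <<s \bigcup_(i in S) preimage_set_system setT (p i) measurable >> A ->
  P1 (X1 @^-1` A) = P2 (X2 @^-1` A).
Proof.
move=> H A sA.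
have mA1 := sigma_preimage_measurable mX1 sA.
have mA2 := sigma_preimage_measurable mX2 sA.
rewrite -!Ex_indic//; congr (_%:E).
have := @weighted_law_eq _ _ _ p S _ _ _ _ P1 P2 X1 X2 mX1 mX2 (fun=> 1) (fun=> 1) 1.
have e (O : Type) (X : O -> E) : (fun w => 1 * \1_A (X w)) = \1_(X @^-1` A) :> (O -> R).
  by apply/funext => w; rewrite mul1r.
rewrite /= => /(_ _ _ _ _ _ A sA); rewrite !e; apply => //; try by move=> _; rewrite normr1.
move=> s sS; have [v [_ G1] [_ G2]] := H s sS.
have e1 (O : Type) (X : O -> E) f : (fun w => 1 * f (lc (fun i w => p i (X w)) s w)) =
   (fun w => f (1 * lc (fun i w => p i (X w)) s w)) :> (O -> R).
  by apply/funext => w; rewrite !mul1r.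
by rewrite !e1 (G1 1).1 (G1 1).2 (G2 1).1 (G2 1).2.
Qed.

End gaussian_law.

Section gaussian_space.
Context {d} {Om : measurableType d} {R : realType} (P : probability Om R).
Context {J : eqType} (U : J -> Om -> R) (SU : J -> Prop).
Hypothesis GU : gfam P U SU.
Context {I : eqType} (V : I -> Om -> R) (S : set I).
Hypothesis VU : forall i, S i -> ospan P U SU (V i).

Lemma ospan_lc s : inS S s -> ospan P U SU (lc V s).
Proof.
rewrite /lc; elim: s => [|x s IH] sS.
  by under eq_fun do rewrite big_nil; exact: ospan0.
under eq_fun do rewrite big_cons; apply: ospanD.
  by apply/ospanZ/VU/sS; rewrite inE eqxx.
by apply: IH => y ys; apply: sS; rewrite inE ys orbT.
Qed.

(* [sin (c Z)] has the same joint characteristic functions with the [V i] as the zero weight; divide by [c] and let [c] tend to [0]. *)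
Lemma orth_weight Z : ospan P U SU Z -> (forall i, S i -> ip P Z (V i) = 0) ->
  forall A, <<s \bigcup_(i in S) preimage_set_system setT (V i) measurable >> A ->
  Ex P (fun w => Z w * \1_A w) = 0.
Proof.
move=> ZU ZV A sA; have [LZ _] := ZU; have [mZ _] := LZ.
have mV i : S i -> measurable_fun setT (V i \o (@id Om)) by move=> /VU [[]].
have mA := sigma_preimage_measurable mV sA.
have sinZ c : Ex P (fun w => sin (c * Z w) * \1_A w) = 0.
  have := @weighted_law_eq _ _ _ V S _ _ _ _ P P id id mV mV (fun w => sin (c * Z w)) (fun=> 0) 1.
  rewrite /= => /(_ _ _ _ _ _ A sA) ->; last 5 first.
  - by apply: msinf; exact: measurable_funM.
  - exact: measurable_cst.
  - by move=> w; exact: bsin.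
  - by move=> _; rewrite normr0.
  - move=> s sS.
    have e f : Ex P (fun w => 0 * f w) = 0.
      by rewrite -[RHS](Ex_cst P); apply: eq_Rintegral => w _; rewrite mul0r.
    rewrite !e; have oL := ospan_lc sS; have [LL _] := oL.
    have GcZL (a b : R) := gfam_ospan GU (ospanD (ospanZ a ZU) (ospanZ b oL)).
    have m1 a b : measurable_fun setT (fun w => a * Z w + b * lc V s w) by have [] := GcZL a b.
    have is_ a b : int1 P (fun w => sin (a * Z w + b * lc V s w)).
      by apply: (@int1_bdd _ _ _ _ 1); [exact: msinf|move=> w; exact: bsin].
    have ic_ a b : int1 P (fun w => cos (a * Z w + b * lc V s w)).
      by apply: (@int1_bdd _ _ _ _ 1); [exact: mcosf|move=> w; exact: bcos].
    have Es a b : Ex P (fun w => sin (a * Z w + b * lc V s w)) = 0.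
      by have [_ /(_ 1)[_ <-]] := GcZL a b; apply: eq_Rintegral => w _; rewrite mul1r.
    have Ec a b : Ex P (fun w => cos (a * Z w + b * lc V s w)) =
        expR (- (1 ^+ 2 * ip P (fun w => a * Z w + b * lc V s w) (fun w => a * Z w + b * lc V s w) / 2)).
      by have [_ /(_ 1)[<- _]] := GcZL a b; apply: eq_Rintegral => w _; rewrite mul1r.
    have ZL : ip P Z (lc V s) = 0.
      by apply: (@ip_lc_eq0 _ _ _ P _ V S) => // i /VU [].
    split.
      transitivity (Ex P (fun w => 2^-1 * sin (c * Z w + 1 * lc V s w) + 2^-1 * sin (c * Z w + -1 * lc V s w))).
        apply: eq_Rintegral => w _; rewrite mul1r mulN1r sinD sinB.
        by field.
      by rewrite ExD ?ExZ ?Es ?mulr0 ?addr0//; exact: int1Z.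
    transitivity (Ex P (fun w => 2^-1 * cos (c * Z w + -1 * lc V s w) - 2^-1 * cos (c * Z w + 1 * lc V s w))).
      apply: eq_Rintegral => w _; rewrite mul1r mulN1r cosB cosD.
      by field.
    rewrite ExB ?ExZ ?Ec//; [|exact: int1Z..].
    have LcZ := L2Z c LZ.
    have L1 b := L2Z b LL.
    have h : ip P (fun w => c * Z w) (lc V s) = 0 by rewrite ipZl// ZL mulr0.
    rewrite !ip_quad// h !mulr0 !mul0rn !addr0 sqrrN.
    by ring.
  by rewrite -[RHS](Ex_cst P); apply: eq_Rintegral => w _; rewrite mul0r.
have cc n : (n.+1%:R : R)^-1 != 0 by rewrite invr_neq0.
have lim : Ex P (fun w => (n.+1%:R)^-1^-1 * sin ((n.+1%:R)^-1 * Z w) * \1_A w) @[n --> \oo] -->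
    Ex P (fun w => Z w * \1_A w).
  apply: (@Ex_dct _ _ _ P _ _ (fun w => `|Z w|)).
  - move=> n; apply: measurable_funM; last exact: measurable_indic.
    by apply: measurable_funM => //; apply: msinf; exact: measurable_funM.
  - by apply: measurable_funM => //; exact: measurable_indic.
  - apply: aeW => w; apply: cvgM; last exact: cvg_cst.
    have /choice[y yP] : forall n, exists y, `|y| <= n.+1%:R^-1 * `|Z w| /\
       (n.+1%:R)^-1^-1 * sin ((n.+1%:R)^-1 * Z w) = Z w * cos y.
      move=> n; have [y yx sy] := sin_mvt (n.+1%:R^-1 * Z w); exists y; split.
        by apply: (le_trans yx); rewrite normrM ger0_norm.
      by rewrite sy !mulrA mulVf// mul1r.
    have y0 : y n @[n --> \oo] --> 0.
      apply/norm_cvg0P; apply: (squeeze_cvgr _ (@cvg_cst _ 0 _ _ _) (_ : n.+1%:R^-1 * `|Z w| @[n --> \oo] --> 0)).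
        by apply: nearW => n; rewrite normr_ge0/=; have [] := yP n.
      by rewrite -(mul0r `|Z w|); apply: cvgM; [exact: cvg_harmonic|exact: cvg_cst].
    rewrite (_ : (fun n => _) = fun n => Z w * cos (y n)); last by apply/funext => n; rewrite (yP _).2.
    suff : Z w * cos (y n) @[n --> \oo] --> Z w * cos 0 by rewrite cos0 mulr1.
    apply: cvgM; first exact: cvg_cst.
    by apply: (cvg_comp y cos y0); exact: continuous_cos.
  - by apply: int1_abs; exact: L2_int1.
  - move=> n w; rewrite normrM -[leRHS]mulr1 ler_pM//; last first.
      by rewrite indicE; case: (_ \in _); rewrite ?normr1 ?normr0.
    have [y _ ->] := sin_mvt (n.+1%:R^-1 * Z w).
    by rewrite !mulrA mulVf// mul1r normrM -[leRHS]mulr1 ler_pM// bcos.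
apply: (cvg_unique _ lim); first exact: Rhausdorff.
rewrite /= (_ : (fun n => _) = fun=> 0); first exact: cvg_cst.
apply/funext => n; rewrite -[RHS](mulr0 (n.+1%:R^-1^-1)) -(sinZ n.+1%:R^-1) -ExZ.
  by apply: eq_Rintegral => w _; rewrite mulrA.
apply: (@int1_bdd _ _ _ _ (1 * 1)).
  by apply: measurable_funM; [apply: msinf; exact: measurable_funM|exact: measurable_indic].
move=> w; rewrite normrM ler_pM ?bsin//.
by rewrite indicE; case: (_ \in _); rewrite ?normr1 ?normr0.
Qed.

Let SV := \bigcup_(i in S) preimage_set_system setT (V i) measurable.

Lemma lc_sigma s : inS S s -> measurable_fun setT (lc V s : g_sigma_algebraType SV -> R).
Proof.
elim: s => [|x s IH] sS.
  by rewrite /lc; under eq_fun do rewrite big_nil; exact: measurable_cst.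
rewrite /lc; under eq_fun do rewrite big_cons; apply: measurable_funD.
  apply: measurable_funM => // _ B mB; rewrite setTI; apply: sub_sigma_algebra.
  exists x.2; first by apply: sS; rewrite inE eqxx.
  by exists B => //; rewrite setTI.
by apply: IH => y ys; apply: sS; rewrite inE ys orbT.
Qed.

Lemma ospan_lim (Z_ : nat -> Om -> R) Z : (forall n, ospan P U SU (Z_ n)) -> L2 P Z ->
  ip P (fun w => Z_ n w - Z w) (fun w => Z_ n w - Z w) @[n --> \oo] --> 0 -> ospan P U SU Z.
Proof.
move=> oZ LZ H; split => // h Lh hU.
have := L2_cauchy_cvg (fun n => (oZ n).1) LZ Lh H.
rewrite (_ : (fun n => _) = fun=> 0); last by apply/funext => n; rewrite ipC (oZ n).2.
by move=> h'; rewrite ipC; apply: cvg_unique h' (@cvg_cst _ 0 _ _ _).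
Qed.

Let span_le Z p (s : nat -> seq (R * I)) : ospan P U SU Z -> ospan P U SU p ->
  (forall n, inS S (s n)) -> {ae P, forall w, lc V (s n) w @[n --> \oo] --> p w} ->
  (forall i, S i -> ip P (fun w => Z w - p w) (V i) = 0) ->
  (forall B : set R, measurable B -> completed P <<s SV >> (Z @^-1` B)) ->
  {ae P, forall w, Z w <= p w}.
Proof.
move=> oZ op sS aes pV cZ.
(* A version of [p] that is measurable for the sigma-algebra generated by [V], without
   completion. *)
pose p' w := flim (fun n => lc V (s n) w).
have mp' : measurable_fun setT (p' : g_sigma_algebraType SV -> R).
  by apply: measurable_flim => // n; exact: lc_sigma.
have pp' : {ae P, forall w, p' w = p w} by apply: filterS aes => w /flimE.
have mV i : S i -> measurable_fun setT (V i \o (@id Om)) by move=> /VU [[]].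
have key (r : rat) : {ae P, forall w, ~ (p' w < ratr r < Z w)}.
  have [F sF nF] := cZ `]ratr r, +oo[%classic (measurable_itv _).
  (* Up to a null set [A] is the event [p < r < Z]. There [Z - p] is positive while its integral
     over [A] is zero, so [A] is null. *)
  pose A := F `&` p' @^-1` `]-oo, ratr r[%classic.
  have sA : <<s SV >> A.
    have mA : SV.-sigma.-measurable A.
      apply: measurableI; first exact: sF.
      by rewrite -[X in measurable X]setTI; exact: mp'.
    exact: mA.
  have mA := sigma_preimage_measurable mV sA.
  have := orth_weight (ospanB oZ op) pV sA.
  set g := fun w => _; move=> Eg.
  have aeF : {ae P, forall w, F w <-> ratr r < Z w}.
    have : P.-negligible ((Z @^-1` `]ratr r, +oo[%classic) `+` F) := nF.
    apply: negligibleS => w /= nw; apply: contrapT => h; apply: nw.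
    split => [Fw|Zr]; apply: contrapT => h'; apply: h.
      by right; split => //; rewrite /= in_itv/= andbT.
    by left; split => //; rewrite /= in_itv/= andbT.
  have Lg : int1 P g.
    have := L2_mul (ospanB oZ op).1 (L2_bdd P (measurable_indic mA) (M := 1) _).
    by apply=> w; rewrite indicE; case: (_ \in _); rewrite ?normr1 ?normr0.
  have absg : Ex P (fun w => `|g w|) = 0.
    rewrite -Eg; apply: Ex_ae.
    - exact: int1_meas (int1_abs Lg).
    - exact: int1_meas Lg.
    apply: filterS2 aeF pp' => w [Fr _] pw; rewrite /g indicE.
    case: (boolP (w \in A)) => [/set_mem[/Fr Zr]|_]; last by rewrite mulr0 normr0.
    by rewrite /= in_itv/= mulr1 pw => pr; rewrite ger0_norm// subr_ge0 ltW// (lt_trans pr).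
  have := Ex_eq0 (int1_abs Lg) (fun w => normr_ge0 _) absg.
  apply: filterS3 aeF pp' => w [_ rF] pw /eqP; rewrite normr_eq0 /g => g0 /andP[pr rZ].
  move: g0; rewrite indicE mem_set; last by split; [exact: rF|rewrite /= in_itv].
  by rewrite mulr1 subr_eq0 -pw => /eqP Zp; move: pr; rewrite -Zp ltNge (ltW rZ).
(* The rationals are enumerated by their codes, so that countably many null sets can be united. *)
have : {ae P, forall w, forall n, if unpickle n is Some r then ~ (p' w < ratr r < Z w) else True}.
  apply: ae_foralln => n; case: (unpickle n) => [r|]; last exact: aeW.
  exact: key.
apply: filterS2 pp' => w pw H; rewrite leNgt -pw; apply/negP => pZ.
have [r] := rat_in_itvoo pZ; rewrite in_itv/= => rr.
by have := H (pickle r); rewrite pickleK; apply.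
Qed.

(* Let [p] be the projection of [Z] on the span of [V]: [Z - p] is orthogonal to the events of the completed sigma-algebra of [V],
   among which [r < Z] and [p < r] for rational [r], so [Z <= p] almost surely, and symmetrically. *)
Theorem span_lemma Z : ospan P U SU Z ->
  (forall B : set R, measurable B -> completed P <<s SV >> (Z @^-1` B)) -> ospan P V S Z.
Proof.
move=> oZ cZ.
have LV i : S i -> L2 P (V i) by move=> /VU [].
have LZ := oZ.1.
have [p [Lp [s sS [aes sn]] pV]] := ospan_projection LV LZ.
have cvs : ip P (fun w => lc V (s n) w - p w) (fun w => lc V (s n) w - p w) @[n --> \oo] --> 0.
  apply: (squeeze_cvgr _ (@cvg_cst _ 0 _ _ _) (geo4_cvg0 4)).
  by apply: nearW => n; rewrite ip_ge0/=.
have op : ospan P U SU p.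
  by apply: (@ospan_lim (fun n => lc V (s n))) => // n; exact: ospan_lc.
have h1 := span_le oZ op sS aes pV cZ.
have neg (f : Om -> R) : (fun w => - f w) = (fun w => -1 * f w) by apply/funext => w; rewrite mulN1r.
pose s' n := [seq (- x.1, x.2) | x <- s n].
have s'E n w : lc V (s' n) w = - lc V (s n) w.
  by rewrite /lc big_map -sumrN; apply: eq_bigr => x _; rewrite mulNr.
have h2 : {ae P, forall w, - Z w <= - p w}.
  apply: (@span_le (fun w => - Z w) (fun w => - p w) s').
  - by rewrite neg; exact: ospanZ.
  - by rewrite neg; exact: ospanZ.
  - by move=> n x /mapP[y ys ->]; exact: (sS n y).
  - by apply: filterS aes => w cw; under eq_fun do rewrite s'E; exact: cvgN.
  - move=> i Si; rewrite (_ : (fun w => _) = fun w => -1 * (Z w - p w)).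
      by rewrite ipZl ?pV ?mulr0//; [exact: L2B|exact: LV].
    by apply/funext => w; ring.
  - move=> B mB; have mN : measurable_fun setT (-%R : R -> R).
      by apply: continuous_measurable_fun; exact: opp_continuous.
    have mB' : measurable (-%R @^-1` B) by rewrite -[X in measurable X]setTI; exact: mN.
    exact: cZ _ mB'.
split => // h Lh hV.
have [mZ _] := LZ; have [mp _] := Lp; have [mh _] := Lh.
rewrite (@ip_ae _ _ _ P h h Z p)//.
- have := L2_cauchy_cvg (fun n => L2_lc LV (sS n)) Lp Lh cvs.
  rewrite (_ : (fun n => _) = fun=> 0).
    by move=> h'; rewrite ipC; apply: cvg_unique h' (@cvg_cst _ 0 _ _ _).
  by apply/funext => n; rewrite ipC; exact: (ip_lc_eq0 LV (sS n)).
- exact: aeW.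
- apply: filterS2 h1 h2 => w a b; apply/eqP; rewrite eq_le a/=.
  by rewrite -lerN2.
Qed.

End gaussian_space.

Section clt.
Context {d} {Om : measurableType d} {R : realType} (P : probability Om R).

(* Iterating the hypothesis, the characteristic function at [x] is the power [2 ^ k] of that at [x / sqrt 2 ^ k], as in the central limit theorem. *)
Lemma clt_gaussian Z : L2 P Z ->
  (forall x, Ex P (fun w => cos (x * Z w)) = Ex P (fun w => cos (x / Num.sqrt 2 * Z w)) ^+ 2) ->
  (forall x, Ex P (fun w => sin (x * Z w)) = 0) -> isG P (ip P Z Z) Z.
Proof.
move=> LZ hc hs; have [mZ _] := LZ; split=> // x; split=> //.
pose xk k : R := x / Num.sqrt 2 ^+ k.
have s2 : (Num.sqrt 2 : R) != 0 by rewrite gt_eqF// sqrtr_gt0.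
have s22 k : (Num.sqrt 2 ^+ k) ^+ 2 = 2 ^+ k :> R by rewrite exprAC sqr_sqrtr.
pose chi y := Ex P (fun w => cos (y * Z w)).
have chiE k : chi x = chi (xk k) ^+ (2 ^ k).
  elim: k => [|k ->]; first by rewrite /xk expr0 divr1 expn0 expr1.
  rewrite {1}/chi hc -exprM -expnS; congr (_ ^+ _); rewrite /chi; congr (Ex P _).
  by apply/funext => w; rewrite /xk exprSr invfM mulrA.
(* With this [q], [chi x = (1 - q k / 2^k)^(2^k)], and [q k] tends to [x^2 v / 2]. Elementary bounds
   squeeze the power between [exp(- q k / (1 - q k / 2^k))] and [exp(- q k)]. *)
pose v := ip P Z Z; pose q k := 2 ^+ k * (1 - chi (xk k)).
have m k : measurable_fun setT (fun w => cos (xk k * Z w)) by apply: mcosf; exact: measurable_funM.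
have i1 k : int1 P (fun w => cos (xk k * Z w)) by apply: (@int1_bdd _ _ _ _ 1) => // w; exact: bcos.
have qY w k : exists2 y, `|y| <= `|xk k / 2 * Z w| & 2 ^+ k * (1 - cos (xk k * Z w)) = x ^+ 2 / 2 * (Z w * cos y) ^+ 2.
  have [y yx sy] := sin_mvt (xk k / 2 * Z w); exists y => //.
  have -> : cos (xk k * Z w) = cos (xk k / 2 * Z w + xk k / 2 * Z w) by congr cos; field.
  have h := cos2Dsin2 (xk k / 2 * Z w); rewrite cosD.
  have -> : 1 - (cos (xk k / 2 * Z w) * cos (xk k / 2 * Z w) - sin (xk k / 2 * Z w) * sin (xk k / 2 * Z w)) =
     2 * sin (xk k / 2 * Z w) ^+ 2 by rewrite !expr2 in h *; lra.
  rewrite sy.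
  rewrite /xk !exprMn !exprVn s22; field.
  by rewrite expf_neq0.
have qE k : q k = Ex P (fun w => 2 ^+ k * (1 - cos (xk k * Z w))).
  by rewrite /q ExZ ?ExB ?Ex_cst//; [exact: int1_cst|apply: int1B => //; exact: int1_cst].
have cc : (2^-1 : R) ^+ k @[k --> \oo] --> 0.
  by apply: cvg_expr; rewrite ger0_norm// invf_lt1 ?ltr1n.
have xk2 k : xk k ^+ 2 = x ^+ 2 * 2^-1 ^+ k by rewrite /xk expr_div_n s22 exprVn.
have cq : q k @[k --> \oo] --> x ^+ 2 / 2 * v.
  rewrite (_ : q = fun k => Ex P (fun w => 2 ^+ k * (1 - cos (xk k * Z w)))); last exact/funext.
  rewrite /v ip_sqr -ExZ; last exact: LZ.2.
  apply: (@Ex_dct _ _ _ P _ _ (fun w => x ^+ 2 / 2 * Z w ^+ 2)).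
  - by move=> k; apply: measurable_funM => //; exact: measurable_funB.
  - by apply: measurable_funM => //; exact: measurable_funX.
  - apply: aeW => w.
    have /choice[y yP] : forall k, exists y, `|y| <= `|xk k / 2 * Z w| /\
        2 ^+ k * (1 - cos (xk k * Z w)) = x ^+ 2 / 2 * (Z w * cos y) ^+ 2.
      by move=> k; have [y] := qY w k; exists y.
    have y20 : y k ^+ 2 @[k --> \oo] --> 0.
      have h : (x ^+ 2 / 4 * Z w ^+ 2) * 2^-1 ^+ k @[k --> \oo] --> 0.
        by rewrite -(mulr0 (x ^+ 2 / 4 * Z w ^+ 2)); apply: cvgM => //; exact: cvg_cst.
      apply: (squeeze_cvgr _ (@cvg_cst _ 0 _ _ _) h); apply: nearW => k; rewrite sqr_ge0/=.
      rewrite -(real_normK (num_real (y k))).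
      apply: (@le_trans _ _ (`|xk k / 2 * Z w| ^+ 2)).
        by rewrite lerXn2r ?nnegrE//; have [] := yP k.
      rewrite (real_normK (num_real _)).
        have -> : (xk k / 2 * Z w) ^+ 2 = xk k ^+ 2 * (Z w ^+ 2 / 4) by field.
        by rewrite xk2 le_eqVlt; apply/orP; left; apply/eqP; field.
    have y0 : y k @[k --> \oo] --> 0.
      have := cvg_comp _ _ y20 (@sqrt_continuous R 0); rewrite sqrtr0.
      rewrite (_ : _ \o _ = fun k => `|y k|); last by apply/funext => k; rewrite /= sqrtr_sqr.
      by move/norm_cvg0P.
    rewrite (_ : (fun k => _) = fun k => x ^+ 2 / 2 * (Z w * cos (y k)) ^+ 2); last by apply/funext => k; rewrite (yP _).2.
    suff : x ^+ 2 / 2 * (Z w * cos (y k)) ^+ 2 @[k --> \oo] --> x ^+ 2 / 2 * (Z w * cos 0) ^+ 2.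
      by rewrite cos0 mulr1.
    apply: cvgM; first exact: cvg_cst.
    have h : Z w * cos (y k) @[k --> \oo] --> Z w * cos 0.
      apply: cvgM; first exact: cvg_cst.
      by apply: (cvg_comp y cos y0); exact: continuous_cos.
    by under eq_fun do rewrite expr2; rewrite expr2; exact: cvgM.
  - by apply: int1Z; exact: LZ.2.
  - move=> k w; have [y _ ->] := qY w k.
    rewrite normrM !normrX ger0_norm ?divr_ge0 ?sqr_ge0// ler_wpM2l ?divr_ge0 ?sqr_ge0//.
    by rewrite -(real_normK (num_real (Z w))) lerXn2r ?nnegrE// normrM -[leRHS]mulr1 ler_pM// bcos.
have q0 k : 0 <= q k.
  by rewrite qE; apply: Ex_ge0 => w; rewrite mulr_ge0 ?exprn_ge0// subr_ge0 cos_le1.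
have cqk : q k * 2^-1 ^+ k @[k --> \oo] --> 0.
  by rewrite -(mulr0 (x ^+ 2 / 2 * v)); exact: cvgM.
have chiq k : chi (xk k) = 1 - q k * 2^-1 ^+ k.
  rewrite /q mulrAC exprVn mulfV ?expf_neq0// mul1r; ring.
have e2 k (y : R) : expR y ^+ (2 ^ k) = expR (2 ^+ k * y).
  by rewrite -expRM_natl natrX.
have up : \forall k \near \oo, chi x <= expR (- q k).
  near=> k.
  have y1 : q k * 2^-1 ^+ k <= 1 by near: k; exact: (cvgr_le _ cqk).
  rewrite (chiE k) chiq.
  have -> : - q k = 2 ^+ k * (- (q k * 2^-1 ^+ k)) by rewrite exprVn; field; rewrite expf_neq0.
  by rewrite -e2 lerXn2r ?nnegrE ?expR_ge0 ?subr_ge0//; exact: expR_ge1Dx.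
have lo : \forall k \near \oo, expR (- q k / (1 - q k * 2^-1 ^+ k)) <= chi x.
  near=> k.
  have y1 : q k * 2^-1 ^+ k < 1 by near: k; exact: (cvgr_lt _ cqk).
  rewrite (chiE k) chiq; set y := q k * _ in y1 *.
  have -> : - q k / (1 - y) = 2 ^+ k * (- y / (1 - y)).
    rewrite mulrA mulrN; congr (- _ / _).
    by rewrite /y mulrCA -exprMn divff// expr1n mulr1.
  rewrite -e2 lerXn2r ?nnegrE ?expR_ge0 ?subr_ge0//; first exact: ltW.
  have h := expR_ge1Dx (y / (1 - y)).
  have e1 : 1 + y / (1 - y) = (1 - y)^-1 by field; rewrite gt_eqF ?subr_gt0.
  rewrite mulNr expRN -[leRHS]invrK lef_pV2 ?posrE ?expR_gt0 ?invr_gt0 ?subr_gt0//.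
  by rewrite e1 in h.
have c1 : expR (- q k) @[k --> \oo] --> expR (- (x ^+ 2 / 2 * v)).
  have h : - q k @[k --> \oo] --> - (x ^+ 2 / 2 * v) by exact: cvgN.
  by apply: (cvg_comp (fun k => - q k) expR h); exact: continuous_expR.
have c2 : expR (- q k / (1 - q k * 2^-1 ^+ k)) @[k --> \oo] --> expR (- (x ^+ 2 / 2 * v) / (1 - 0)).
  have h : - q k / (1 - q k * 2^-1 ^+ k) @[k --> \oo] --> - (x ^+ 2 / 2 * v) / (1 - 0).
    apply: cvgM; first exact: cvgN.
    apply: cvgV; first by rewrite subr0 oner_eq0.
    by apply: cvgB => //; exact: cvg_cst.
  by apply: (cvg_comp (fun k => - q k / (1 - q k * 2^-1 ^+ k)) expR h); exact: continuous_expR.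
have -> : x ^+ 2 * ip P Z Z / 2 = x ^+ 2 / 2 * v by rewrite /v; ring.
apply/eqP; rewrite eq_le; apply/andP; split.
  by apply: (cvgr_to_ge c1).
rewrite -[X in expR X]divr1 -[X in _ / X](subr0 1).
by apply: (cvgr_to_le c2).
Unshelve. all: by end_near. Qed.
End clt.

(** * The Borel structure of the path space *)

Section path_space_borel.
Context {R : realType} (T : R) (T0 : 0 < T).
Implicit Types f g : path_space T.

Lemma pathB f g (x : R) : (f - g) x = f x - g x. Proof. by []. Qed.
Lemma pathZ (c : R) f (x : R) : (c *: f) x = c * f x. Proof. by []. Qed.

Lemma path_cvg f (x : R) : x \in `[0, T] ->
  forall e : R, 0 < e -> exists2 dl : R, 0 < dl & forall y : R, y \in `[0, T] -> `|x - y| < dl -> `|f x - f y| < e.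
Proof.
move=> xT e e0; have /asboolP[cf _] := path_funP f.
move/subspace_continuousP : cf => /(_ x xT)/cvgr_dist_lt/(_ _ e0).
move=> [dl /= dl0 H]; exists dl => // y yT xy.
exact: H.
Qed.

Lemma path_unif f (e : R) : 0 < e -> exists2 dl : R, 0 < dl &
  forall x y : R, x \in `[0, T] -> y \in `[0, T] -> `|x - y| < dl -> `|f x - f y| < e.
Proof.
move=> e0; apply: contrapT => H.
have /choice[xy xyP] : forall n : nat, exists xy : R * R, [/\ xy.1 \in `[0, T], xy.2 \in `[0, T],
    `|xy.1 - xy.2| < n.+1%:R^-1 & e <= `|f xy.1 - f xy.2|].
  move=> n; apply: contrapT => h; apply: H; exists n.+1%:R^-1 => // x y xT yT xye.
  by rewrite ltNge; apply/negP => he; apply: h; exists (x, y).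
have := @segment_compact R 0 T ((fun n => (xy n).1) @ \oo) _.
case.
  by exists 0%N => // n _ /=; have [+ _ _ _] := xyP n.
move=> c [/= cT cl]; have e2 : 0 < e / 2 by rewrite divr_gt0.
have [dl dl0 fc] := path_cvg f cT e2.
have dl2 : 0 < dl / 2 by rewrite divr_gt0.
have h1 : ((fun n => (xy n).1) @ \oo) [set x | exists2 n, n.+1%:R^-1 < dl / 2 & x = (xy n).1].
  have : \forall n \near \oo, (n.+1%:R^-1 : R) < dl / 2.
    by have := @cvg_harmonic R => /cvgr_lt; apply.
  by apply: filterS => n h; exists n.
have [_ [[n nd ->] /= cx]] := cl _ _ h1 (nbhsx_ballx c _ dl2).
have [x1 x2 x12 ex] := xyP n.
move: ex; rewrite leNgt => /negP; apply.
rewrite (_ : _ - _ = (f c - f (xy n).2) - (f c - f (xy n).1)); last by ring.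
apply: (le_lt_trans (ler_normB _ _)).
rewrite [ltRHS](splitr e) ltrD//; apply: fc => //; last first.
  by apply: (lt_le_trans cx) => /=; move: dl0; lra.
rewrite (_ : _ - _ = (c - (xy n).1) + ((xy n).1 - (xy n).2)); last by ring.
apply: (le_lt_trans (ler_normD _ _)); rewrite [ltRHS](splitr dl) ltrD//.
exact: lt_trans x12 _.
Qed.

Lemma rat_near (x dl : R) : x \in `[0, T] -> 0 < dl -> exists2 q : rat, ratr q \in `[0, T] & `|x - ratr q| < dl.
Proof.
rewrite in_itv/= => /andP[x0 xT] dl0.
have : Num.max 0 (x - dl) < Num.min T (x + dl).
  rewrite lt_min !gt_max; apply/andP; split; apply/andP; split => //; move: T0; lra.
move=> /rat_in_itvoo[q]; rewrite in_itv/= lt_min !gt_max => /andP[/andP[q0 qx] /andP[qT qx']].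
exists q; first by rewrite in_itv/= !ltW.
by rewrite ltr_norml; apply/andP; split; lra.
Qed.

(* Countably many closed sets separating paths uniformly: closeness at rational times to a rational step function. *)
Definition step_nbhd (nqr : nat * seq rat * rat) : set (path_space T) :=
  [set f | forall x : rat, ratr x \in `[0, T] ->
    `|f (ratr x) - ratr (nth 0 nqr.1.2 (Num.truncn ((ratr x : R) * nqr.1.1.+1%:R)))| <= ratr nqr.2].

(** The term [e] pays, by uniform continuity of both paths, for passing from rational times to all
    times. *)
Lemma step_nbhd_ball f g nqr : step_nbhd nqr f -> step_nbhd nqr g ->
  forall e : R, 0 < e -> `|f - g| <= 2 * ratr nqr.2 + e.
Proof.
move=> sf sg e e0; have e2 : 0 < e / 2 by rewrite divr_gt0.
have [d1 d10 uf] := path_unif f e2; have [d2 d20 ug] := path_unif g e2.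
apply: sup_norm_le => [|x xT].
  have h : 0 <= ratr nqr.2 :> R.
    have TT : T \in `[0, T] by rewrite in_itv/= lexx ltW.
    have [q qT _] := rat_near TT ltr01.
    exact: le_trans (normr_ge0 _) (sf q qT).
  by apply: addr_ge0; [exact: mulr_ge0|exact: ltW].
have d0 : 0 < Num.min d1 d2 by rewrite lt_min d10.
have [q qT] := rat_near xT d0; rewrite lt_min => /andP[q1 q2].
have {uf}h1 := uf x _ xT qT q1; have {ug}h2 := ug x _ xT qT q2.
have h3 := sf q qT; have h4 := sg q qT.
set y := ratr (nth _ _ _) in h3 h4.
rewrite (_ : _ x = (f x - f (ratr q)) - (g x - g (ratr q)) + ((f (ratr q) - y) - (g (ratr q) - y))); last first.
  by rewrite pathB; ring.
apply: (le_trans (ler_normD _ _)); rewrite addrC lerD//.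
  by apply: (le_trans (ler_normB _ _)); rewrite mulr_natl mulr2n lerD.
by apply: (le_trans (ler_normB _ _)); rewrite [leRHS](splitr e) lerD// ltW.
Qed.

Lemma step_nbhd_ex f (e : R) : 0 < e -> exists nqr, step_nbhd nqr f /\ ratr nqr.2 < e.
Proof.
move=> e0; have [r] := rat_in_itvoo e0; rewrite in_itv/= => /andP[r0 re].
have r2 : 0 < (ratr r : R) / 2 by rewrite divr_gt0.
have [dl dl0 uf] := path_unif f r2.
have [n nd] : exists n : nat, (n.+1%:R^-1 : R) < dl.
  have : \forall n \near \oo, (n.+1%:R^-1 : R) < dl.
    by have := @cvg_harmonic R => /cvgr_lt; apply.
  by move=> [n _ H]; exists n; apply: H => /=.
have /choice[q qP] : forall k : nat, exists q : rat, `|f (k%:R / n.+1%:R) - ratr q| < ratr r / 2.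
  move=> k; have : f (k%:R / n.+1%:R) - ratr r / 2 < f (k%:R / n.+1%:R) + ratr r / 2 by lra.
  move=> /rat_in_itvoo[q]; rewrite in_itv/= => /andP[h1 h2]; exists q.
  by rewrite ltr_norml; apply/andP; split; lra.
exists (n, mkseq q (Num.truncn (T * n.+1%:R)).+1, r); split=> //= x xT.
move: (xT); rewrite in_itv/= => /andP[x0 xT'].
set k := Num.truncn (ratr x * _).
have xn0 : 0 <= (ratr x : R) * n.+1%:R by rewrite mulr_ge0.
have /andP[k1 k2] := truncn_itv xn0.
rewrite -/k in k1 k2.
have kT : (k < (Num.truncn (T * n.+1%:R)).+1)%N.
  by rewrite ltnS /k le_truncn// ler_wpM2r.
rewrite nth_mkseq//.
have kx : k%:R / n.+1%:R <= ratr x :> R by rewrite ler_pdivrMr.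
have kx' : ratr x - k%:R / n.+1%:R < n.+1%:R^-1 :> R.
  rewrite ltrBlDr -[X in X + _]mul1r -mulrDl ltr_pdivlMr//.
  have ek : k.+1%:R = 1 + k%:R :> R by rewrite -natr1 addrC.
  by rewrite -ek.
have := qP k; have := uf (ratr x) (k%:R / n.+1%:R) xT _ _.
rewrite in_itv/= divr_ge0//= (le_trans kx)// => /(_ isT).
rewrite ger0_norm ?subr_ge0// (lt_trans kx')// => /(_ isT) h1 h2.
rewrite (_ : _ - _ = (f (ratr x) - f (k%:R / n.+1%:R)) + (f (k%:R / n.+1%:R) - ratr (q k))); last by ring.
by apply: (le_trans (ler_normD _ _)); rewrite [leRHS](splitr (ratr r)) lerD// ltW.
Qed.

(** An open set is the union of the step sets it contains. There are countably many of these, and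
    each is a countable intersection of conditions on values at rational times. *)
Lemma open_past (U : set (path_space T)) : open U -> <<s past (@idfun (path_space T)) T >> U.
Proof.
move=> oU.
pose D := [set nqr | step_nbhd nqr `<=` U].
have -> : U = \bigcup_(nqr in D) step_nbhd nqr.
  apply/seteqP; split=> [f Uf|f [nqr + sf]]; last exact.
  have /nbhs_ballP[e /= e0 eU] : nbhs f U by exact: open_nbhs_nbhs.
  (* Paths in a common step set of radius below [e/4] have distance at most [2 (e/4) + e/4 < e]. *)
  have e4 : 0 < e / 4 by rewrite divr_gt0.
  have [nqr [sf r4]] := step_nbhd_ex f e4.
  exists nqr => //= g sg; apply: eU; rewrite -ball_normE/=.
  have := step_nbhd_ball sf sg e4; move/le_lt_trans; apply; lra.
have mpt (x : rat) : (ratr x : R) \in `[0, T] ->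
    measurable_fun setT (fun f : g_sigma_algebraType (past (@idfun (path_space T)) T) => (f : path_space T) (ratr x)).
  move=> xT _ B mB; rewrite setTI; apply: sub_sigma_algebra.
  by exists (ratr x) => //; exists B => //; rewrite setTI.
suff : (past (@idfun (path_space T)) T).-sigma.-measurable (\bigcup_(nqr in D) step_nbhd nqr) by [].
rewrite bigcup_mkcond; apply: countable_bigcupT_measurable; first exact: countableP.
move=> nqr.
case: ifP => // _.
rewrite (_ : step_nbhd nqr = \bigcap_(x in [set x : rat | (ratr x : R) \in `[0, T]])
   [set f | `|f (ratr x) - ratr (nth 0 nqr.1.2 (Num.truncn ((ratr x : R) * nqr.1.1.+1%:R)))| <= ratr nqr.2]).
  rewrite -[X in measurable X]setCK setC_bigcap bigcup_mkcond; apply: measurableC.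
  apply: countable_bigcupT_measurable; first exact: countableP.
  move=> x; case: ifP => // /set_mem/= xT; apply: measurableC.
  rewrite -[X in measurable X]setTI.
  have mf : measurable_fun setT (fun f : g_sigma_algebraType (past (@idfun (path_space T)) T) =>
     `|(f : path_space T) (ratr x) - ratr (nth 0 nqr.1.2 (Num.truncn ((ratr x : R) * nqr.1.1.+1%:R)))|).
    by apply: measurableT_comp => //; apply: measurable_funB => //; exact: mpt.
  have := mf measurableT `]-oo, (ratr nqr.2 : R)]%classic (measurable_itv _).
  set A := (X in _ X -> _) => mA; rewrite (_ : _ `&` _ = A)//.
by apply/seteqP; split=> f /= sf x; apply: sf.
Qed.

Lemma borel_past (B : set (path_space T)) : measurable B -> <<s past (@idfun (path_space T)) T >> B.
Proof. by apply: smallest_sub; [exact: smallest_sigma_algebra|exact: open_past]. Qed.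

Lemma measurable_path {d} {Om : measurableType d} (F : Om -> path_space T) :
  (forall r, r \in `[0, T] -> measurable_fun setT (fun w => F w r)) -> measurable_fun setT F.
Proof.
move=> mF _ B mB; rewrite setTI.
apply: (@sigma_preimage_measurable _ _ _ (fun r f => f r) `[0, T]%classic _ _ F); first exact: mF.
exact: borel_past.
Qed.

Lemma continuous_borel (b : path_space T -> R) : continuous b -> measurable_fun setT b.
Proof.
move=> cb; apply: (measurability _ (RGenOpens.measurableE R)).
move=> _ [_ [x [y ->] <-]]; rewrite setTI; apply: sub_sigma_algebra.
by move/continuousP : cb; apply; exact: interval_open.
Qed.

Lemma eval_continuous (r : R) : continuous (fun f => f r).
Proof.
move=> f; have FF : Filter (nbhs f) by exact: nbhs_filter.
apply/cvgrPdist_lt => e e0; move: (nbhsx_ballx (f : path_space T) e e0); apply: filterS => g.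
rewrite -ball_normE/= => fg; rewrite -pathB; apply: le_lt_trans fg.
have [rT|rT] := boolP (r \in `[0, T]); first exact: sup_norm_ub.
by rewrite path_out// normr0.
Qed.

Lemma eval_measurable (r : R) : measurable_fun setT (fun f => f r).
Proof. exact: continuous_borel (@eval_continuous r). Qed.
End path_space_borel.

(** * Measurability of time integrals, of the drift and of the noise *)

Section rint_measurable.
Context {d} {Om : measurableType d} {R : realType}.
Local Notation lam := (@lebesgue_measure R).

Lemma measurable_int_section (G : Om * R -> \bar R) (D : set R) : measurable D ->
  measurable_fun setT G -> (forall p, (0 <= G p)%E) ->
  measurable_fun setT (fun w => (\int[lam]_(x in D) G (w, x))%E).
Proof.
move=> mD mG G0.
pose g (p : Om * R) := (G p * (\1_D p.2)%:E)%E.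
have mg : measurable_fun setT g.
  apply: emeasurable_funM => //; apply/measurable_EFinP.
  by apply: measurableT_comp => //; exact: measurable_indic.
have g0 p : (0 <= g p)%E by rewrite mule_ge0// lee_fin.
have := @measurable_fun_fubini_tonelli_F _ _ Om (measurableTypeR R) R lam g mg g0.
apply: eq_measurable_fun => w _; rewrite /fubini_F/= [RHS]integral_mkcond.
apply: eq_integral => x _; rewrite /g patchE indicE/=.
by case: ifP; rewrite ?mule1 ?mule0.
Qed.

Lemma measurable_Rint_section (G : Om * R -> R) (D : set R) : measurable D ->
  measurable_fun setT G ->
  measurable_fun setT (fun w => \int[lam]_(x in D) G (w, x)).
Proof.
move=> mD mG; have mE : measurable_fun setT (EFin \o G) by exact/measurable_EFinP.
rewrite /Rintegral; apply: (measurableT_comp (fine_measurable measurableT)).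
under eq_fun do rewrite integralE.
apply: emeasurable_funB.
  have h := measurable_int_section mD (measurable_funepos mE) (fun p => funepos_ge0 _ p).
  apply: eq_measurable_fun h => w _ /=; apply: eq_integral => x _; by rewrite ?funeposE ?funenegE.
have h := measurable_int_section mD (measurable_funeneg mE) (fun p => funeneg_ge0 _ p).
  apply: eq_measurable_fun h => w _ /=; apply: eq_integral => x _; by rewrite ?funeposE ?funenegE.
Qed.
End rint_measurable.

Section drift.
Context {R : realType} {T : R}.
Local Notation C := (path_space T).
Local Notation lam := (@lebesgue_measure R).
Implicit Types (delta : R -> C -> R).

Lemma past_measurable {d} {Om : measurableType d} (F : Om -> C) (s : R) :
  (forall r, r \in `[0, s] -> measurable_fun setT (fun w => F w r)) ->
  measurable_fun setT (F : Om -> g_sigma_algebraType (past (@idfun C) s)).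
Proof.
move=> mF _ B mB; rewrite setTI.
exact: (@sigma_preimage_measurable R R C (fun r f => f r) `[0, s]%classic _ _ F B mF mB).
Qed.

Lemma past_eval (s r : R) : r \in `[0, s] ->
  measurable_fun setT (fun f : g_sigma_algebraType (past (@idfun C) s) => (f : C) r).
Proof.
move=> rs _ B mB; rewrite setTI; apply: sub_sigma_algebra.
by exists r => //; exists B => //; rewrite setTI.
Qed.

Section joint.
Context (delta : R -> C -> R) (prog : progressively_measurable delta).
Context {d} {Om : measurableType d} (F : Om -> C) (s : R) (sT : 0 <= s <= T).
Hypothesis mF : forall r, r \in `[0, s] -> measurable_fun setT (fun w => F w r).

(** The indicator extends the functional by zero after time [s], which makes it measurable on the
    whole product with the line; inside integrals up to [t <= s] it is removed by [Rint_indic]. *)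
Lemma prog_joint : measurable_fun setT (fun p : Om * R => \1_(`[0, s]%classic) p.2 * delta p.2 (F p.1)).
Proof.
have mp : measurable_fun setT (fun p : Om * R => (p.2, F p.1) : R * g_sigma_algebraType (past (@idfun C) s)).
  apply/measurable_fun_pairP; split => /=; first exact: measurable_snd.
  by apply: (measurableT_comp (past_measurable mF)); exact: measurable_fst.
pose D : set (Om * R) := [set p | p.2 \in `[0, s]].
have mD : measurable D.
  rewrite (_ : D = setT `&` snd @^-1` `[0, s]%classic); last by rewrite setTI.
  by apply: measurable_snd => //; exact: measurable_itv.
have h : measurable_fun D (fun p : Om * R => delta p.2 (F p.1)).
  apply: (measurable_comp (F := `[0, s]%classic `*` setT) (f := fun p : R * g_sigma_algebraType (past (@idfun C) s) => delta p.1 p.2)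
    (g := fun p : Om * R => (p.2, F p.1) : R * g_sigma_algebraType (past (@idfun C) s))).
  - by apply: measurableX => //; exact: measurable_itv.
  - by move=> _ [p Dp <-].
  - exact: prog.
  - exact: measurable_funTS.
have := (measurable_restrict (fun p : Om * R => delta p.2 (F p.1)) mD measurableT).1.
rewrite setTI => /(_ h); apply: eq_measurable_fun => p _.
rewrite patchE indicE /D; case: (boolP (p.2 \in `[0, s])) => ps.
  by rewrite !mem_set// mul1r.
by rewrite !memNset ?mul0r//; apply/negP.
Qed.
End joint.

Definition noise (alpha : R) delta (t : R) (f : C) : R :=
  (f t - \int[lam]_(x in `[0, t]) delta x f) / alpha.

Lemma Rint_indic (h : R -> R) (s t : R) : t <= s ->
  \int[lam]_(x in `[0, t]) (\1_(`[0, s]%classic) x * h x) = \int[lam]_(x in `[0, t]) h x.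
Proof.
move=> ts; apply: eq_Rintegral => x; rewrite inE/= in_itv/= => /andP[x0 xt].
by rewrite indicE mem_set ?mul1r//= in_itv/= x0 (le_trans xt).
Qed.

Lemma noise_past alpha delta (t : R) : progressively_measurable delta -> 0 <= t <= T ->
  measurable_fun setT (noise alpha delta t : g_sigma_algebraType (past (@idfun C) t) -> R).
Proof.
move=> pd tT; apply: measurable_funM => //; apply: measurable_funB.
  by apply: past_eval; rewrite in_itv/= lexx; case/andP : tT => ->.
have := @measurable_Rint_section _ (g_sigma_algebraType (past (@idfun C) t)) R _ `[0, t]%classic (measurable_itv _)
  (@prog_joint _ pd _ (g_sigma_algebraType (past (@idfun C) t)) idfun t tT (@past_eval t)).
by apply: eq_measurable_fun => f _ /=; rewrite Rint_indic.
Qed.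

Lemma noise_measurable alpha delta (t : R) {d} {Om : measurableType d} (F : Om -> C) :
  progressively_measurable delta -> 0 <= t <= T ->
  (forall r, r \in `[0, t] -> measurable_fun setT (fun w => F w r)) ->
  measurable_fun setT (fun w => noise alpha delta t (F w)).
Proof. by move=> pd tT mF; apply: (measurableT_comp (noise_past alpha pd tT)); exact: past_measurable. Qed.

Lemma drift_section delta (s : R) (f : C) : progressively_measurable delta -> 0 <= s <= T ->
  measurable_fun `[0, s] (delta^~ f).
Proof.
move=> pd sT; have mf := @prog_joint _ pd _ (g_sigma_algebraType (past (@idfun C) s)) idfun s sT (@past_eval s).
have : measurable_fun setT (fun x : R => \1_(`[0, s]%classic) x * delta x f).
  have h : measurable_fun setT (fun x : R => (f, x) : g_sigma_algebraType (past (@idfun C) s) * R).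
    by apply/measurable_fun_pairP; split => /=; [exact: measurable_cst|exact: measurable_id].
  exact: (measurableT_comp mf h).
move=> /(measurable_funTS (D := `[0, s]%classic)); apply: eq_measurable_fun => x xs.
by rewrite indicE xs mul1r.
Qed.

Lemma lint_past delta (t : R) : progressively_measurable delta -> 0 <= t <= T ->
  measurable_fun setT ((fun f => \int[lam]_(x in `[0%R, t]) `|delta x f|%:E)%E : g_sigma_algebraType (past (@idfun C) t) -> \bar R).
Proof.
move=> pd tT.
have := @measurable_int_section _ (g_sigma_algebraType (past (@idfun C) t)) R
   (fun p => (`|\1_(`[0, t]%classic) p.2 * delta p.2 p.1|%:E)%E) `[0, t]%classic (measurable_itv _).
move=> /(_ _ (fun p => _)) h.
have := h _ _; move=> {}h.
apply: eq_measurable_fun (h _ _) => [f _ /=||].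
- by apply: eq_integral => x xt; rewrite indicE xt mul1r.
- apply/measurable_EFinP; apply: measurableT_comp => //.
  exact: (@prog_joint _ pd _ (g_sigma_algebraType (past (@idfun C) t)) idfun t tT (@past_eval t)).
- by move=> p; rewrite lee_fin.
Qed.
End drift.

(** * Independence and Brownian motion *)

Lemma mk_mfun {d d'} {Om : measurableType d} {E : measurableType d'} (f : Om -> E) :
  measurable_fun setT f -> exists g : {mfun Om >-> E}, forall w, g w = f w.
Proof.
move=> mf; pose h := isMeasurableFun.Build _ _ _ _ f mf.
by pose g : {mfun Om >-> E} := HB.pack f h; exists g.
Qed.

Lemma indic_big_setI {T : Type} {R : realType} n (F : nat -> set T) (w : T) :
  \1_(\big[setI/setT]_(i < n) F i) w = \prod_(i < n) \1_(F i) w :> R.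
Proof.
elim: n => [|n IH]; first by rewrite !big_ord0 indicE in_setT.
by rewrite !big_ord_recr/= indicI/= IH.
Qed.

Section independent.
Context {d} {Om : measurableType d} {R : realType} (P : probability Om R).
Context (X : nat -> Om -> R) (n : nat).
Hypothesis mX : forall i, (i < n)%N -> measurable_fun setT (X i).
Hypothesis indep : forall B : nat -> set R, (forall i, measurable (B i)) ->
  P (\big[setI/setT]_(i < n) (X i @^-1` B i)) = (\prod_(i < n) P (X i @^-1` B i))%E.

Let bi (B : set R) (x : R) : `|\1_B x : R| <= 1.
Proof. by rewrite indicE; case: (x \in B); rewrite ?normr1 ?normr0. Qed.

Let prod_le1 (I : eqType) (s : seq I) (F : I -> R) : (forall i, `|F i| <= 1) -> `|\prod_(i <- s) F i| <= 1.
Proof.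
move=> F1; elim: s => [|i s IH]; first by rewrite big_nil normr1.
by rewrite big_cons normrM -[leRHS]mulr1 ler_pM.
Qed.

Let prod_meas (I : eqType) (s : seq I) (x : I -> nat) (f : nat -> R -> R) : (forall i, i \in s -> (x i < n)%N) ->
  (forall i, measurable_fun setT (f i)) -> measurable_fun setT (fun w => \prod_(i <- s) f (x i) (X (x i) w)).
Proof.
move=> sn mf; apply: measurable_prod => i /sn xn.
by apply: (measurableT_comp (mf (x i))); exact: mX.
Qed.

Lemma indep_prod (f : nat -> R -> R) : (forall i, measurable_fun setT (f i)) ->
  (forall i x, `|f i x| <= 1) ->
  Ex P (fun w => \prod_(i < n) f i (X i w)) = \prod_(i < n) Ex P (fun w => f i (X i w)).
Proof.
move=> mf f1.
(* Indicators are replaced by the functions [f i] one index at a time. At each stage the other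
   factors form a bounded weight, and [agree_bdd] compares it with the constant weight that
   independence predicts. *)
suff H k : (k <= n)%N -> forall B : nat -> set R, (forall i, measurable (B i)) ->
    let h i := if (i < k)%N then f i else \1_(B i) in
    Ex P (fun w => \prod_(i < n) h i (X i w)) = \prod_(i < n) Ex P (fun w => h i (X i w)).
  have := H n (leqnn n) (fun=> setT) (fun=> measurableT) => /= e.
  transitivity (Ex P (fun w => \prod_(i < n) (if (i < n)%N then f i else \1_setT) (X i w))).
    by congr (Ex P _); apply/funext => w; apply: eq_bigr => i _; rewrite ltn_ord.
  by rewrite e; apply: eq_bigr => i _; rewrite ltn_ord.
elim: k => [_ B mB /=|k IH kn B mB].
  have mXB i : (i < n)%N -> measurable (X i @^-1` B i).
    by move=> ik; rewrite -[X in measurable X]setTI; exact: mX.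
  have e i (w : Om) : \1_(B i) (X i w) = \1_(X i @^-1` B i) w :> R by [].
  have := indep mB; rewrite -Ex_indic; last first.
    apply: big_ind => //; first by move=> ? ?; exact: measurableI.
    by move=> i _; exact: mXB.
  have -> : (\prod_(i < n) P (X i @^-1` B i))%E = (\prod_(i < n) Ex P (\1_(X i @^-1` B i)))%:E.
    rewrite (big_morph EFin (@EFinM R) (erefl _)); apply: eq_bigr => i _.
    by rewrite Ex_indic//; exact: mXB.
  move=> -[h]; rewrite -h; congr (Ex P _); apply/funext => w.
  by rewrite (@indic_big_setI _ R n (fun i => X i @^-1` B i) w).
pose K := Ordinal kn.
pose hk (g : R -> R) (i : nat) := if (i < k)%N then f i else if i == k then g else \1_(B i).
pose V w := \prod_(i < n) hk (fun=> 1) i (X i w).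
pose c := \prod_(i < n) Ex P (fun w => hk (fun=> 1) i (X i w)).
have nK (i : 'I_n) : i != K -> (i : nat) != k by apply: contra => /eqP e; apply/eqP/val_inj.
have D (G : 'I_n -> R) : \prod_(i < n) G i = G K * \prod_(i < n | i != K) G i by rewrite (bigD1 K).
have prE g w : \prod_(i < n) hk g i (X i w) = V w * g (X k w).
  rewrite /V (D (fun i => hk g i (X i w))) (D (fun i => hk (fun=> 1) i (X i w))) /= {1 3}/hk ltnn eqxx mul1r mulrC; congr (_ * _).
  by apply: eq_bigr => i /nK iK; rewrite /hk (negbTE iK).
have exE g : \prod_(i < n) Ex P (fun w => hk g i (X i w)) = c * Ex P (fun w => g (X k w)).
  rewrite /c (D (fun i => Ex P (fun w => hk g i (X i w)))) (D (fun i => Ex P (fun w => hk (fun=> 1) i (X i w)))) /= {1 3}/hk ltnn eqxx Ex_cst mul1r mulrC; congr (_ * _).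
  by apply: eq_bigr => i /nK iK; rewrite /hk (negbTE iK).
have mh i : measurable_fun setT (hk (fun=> 1) i).
  by rewrite /hk; case: ifP => // _; case: ifP => // _; exact: measurable_indic.
have h1 i x : `|hk (fun=> 1) i x| <= 1 by rewrite /hk; case: ifP => // _; case: ifP => // _; rewrite normr1.
have mV : measurable_fun setT V by apply: prod_meas => // i _.
have V1 w : `|V w| <= 1 by apply: prod_le1.
have i1h (i : 'I_n) : int1 P (fun w => hk (fun=> 1) i (X i w)).
  by apply: (@int1_bdd _ _ _ _ 1) => //; apply: (measurableT_comp (mh i)); exact: mX.
have c1 : `|c| <= 1.
  apply: prod_le1 => i; apply: le_trans (Ex_abs _) _ => //.
  rewrite -[leRHS](Ex_cst P); apply: Ex_le => //; last exact: int1_cst.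
  exact: int1_abs.
have AG := @agree_bdd _ _ _ _ _ P P V (X k) (fun=> c) (X k) 1 mV (@measurable_cst _ _ _ _ _ c) (mX kn) (mX kn) V1 (fun=> c1) _ (f k) 1 (mf k) (f1 k).
suff : Ex P (fun w => V w * f k (X k w)) = Ex P (fun w => c * f k (X k w)).
  rewrite ExZ; last by apply: (@int1_bdd _ _ _ _ 1) => //; apply: (measurableT_comp (mf k)); exact: mX.
  rewrite -exE.
  have <- : (fun w => \prod_(i < n) hk (f k) i (X i w)) = fun w => V w * f k (X k w) by apply/funext.
  have -> // : hk (f k) = (fun i => if (i < k.+1)%N then f i else \1_(B i)).
  by apply/funext => i; rewrite /hk ltnS; case: (ltngtP i k) => // ->.
apply: AG.
  move=> A mA.
  pose B' i := if i == k then A else B i.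
  have mB' i : measurable (B' i) by rewrite /B'; case: ifP.
  have := IH (ltnW kn) B' mB'; set h := (fun i => if _ then _ else _) => /=.
  have -> : h = hk \1_A by apply/funext => i; rewrite /h /hk /B'; case: ifP => // _; case: ifP.
  have -> : (fun w => \prod_(i < n) hk \1_A i (X i w)) = fun w => V w * \1_A (X k w) by apply/funext.
  by rewrite exE /agree => ->; rewrite ExZ//; apply: (@int1_bdd _ _ _ _ 1) => //; apply: (measurableT_comp (measurable_indic mA)); exact: mX.
Qed.

Section gaussian.
Context (v c : nat -> R).
Hypothesis GX : forall i, (i < n)%N -> isG P (v i) (X i).

(** The product over the remaining indices is carried along so that, after the addition formulas,
    the cosine or sine of the [k]-th term can be handed to the induction hypothesis as one more
    factor. *)
Lemma indep_cos_sin k : (k <= n)%N -> forall f : nat -> R -> R, (forall i, measurable_fun setT (f i)) ->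
  (forall i x, `|f i x| <= 1) ->
  Ex P (fun w => cos (\sum_(i < k) c i * X i w) * \prod_(k <= i < n) f i (X i w)) =
   expR (- (\sum_(i < k) c i ^+ 2 * v i / 2)) * \prod_(k <= i < n) Ex P (fun w => f i (X i w)) /\
  Ex P (fun w => sin (\sum_(i < k) c i * X i w) * \prod_(k <= i < n) f i (X i w)) = 0.
Proof.
elim: k => [_ f mf f1|k IH kn f mf f1].
  rewrite big_ord0 oppr0 expR0 mul1r; split.
    rewrite big_mkord -indep_prod//; congr (Ex P _); apply/funext => w.
    by rewrite big_ord0 cos0 mul1r big_mkord.
  rewrite -[RHS](Ex_cst P); congr (Ex P _); apply/funext => w.
  by rewrite big_ord0 sin0 mul0r.
pose fg (g : R -> R) i := if i == k then g else f i.
have mX' i : (k < i < n)%N -> measurable_fun setT (X i) by move=> /andP[_]; exact: mX.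
have fgE g w : \prod_(k <= i < n) fg g i (X i w) = g (X k w) * \prod_(k.+1 <= i < n) f i (X i w).
  rewrite big_ltn// /fg eqxx; congr (_ * _); apply: eq_big_nat => i /andP[ki _].
  by rewrite gtn_eqF.
have efgE g : \prod_(k <= i < n) Ex P (fun w => fg g i (X i w)) =
    Ex P (fun w => g (X k w)) * \prod_(k.+1 <= i < n) Ex P (fun w => f i (X i w)).
  rewrite big_ltn// /fg eqxx; congr (_ * _); apply: eq_big_nat => i /andP[ki _].
  by rewrite gtn_eqF.
pose C x := cos (c k * x); pose S x := sin (c k * x).
have mC : measurable_fun setT C by apply: mcosf; exact: measurable_funM.
have mS : measurable_fun setT S by apply: msinf; exact: measurable_funM.
have mfg g : measurable_fun setT g -> forall i, measurable_fun setT (fg g i).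
  by move=> mg i; rewrite /fg; case: ifP.
have fg1 g : (forall x, `|g x| <= 1) -> forall i x, `|fg g i x| <= 1.
  by move=> mg i; rewrite /fg; case: ifP.
have [Cc Cs] := IH (ltnW kn) (fg C) (mfg C mC) (fg1 C (fun x => bcos _)).
have [Sc Ss] := IH (ltnW kn) (fg S) (mfg S mS) (fg1 S (fun x => bsin _)).
pose L w := \sum_(i < k) c i * X i w; pose V w := \prod_(k.+1 <= i < n) f i (X i w).
have [_ /(_ (c k))[EC ES]] := GX kn.
have mL : measurable_fun setT L.
  by apply: measurable_sum => i; apply: measurable_funM => //; apply: mX; rewrite (ltn_trans (ltn_ord i)).
have i1 (u g : R -> R) : measurable_fun setT u -> (forall x : R, `|u x| <= 1) -> measurable_fun setT g -> (forall x, `|g x| <= 1) ->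
    int1 P (fun w => u (L w) * \prod_(k <= i < n) fg g i (X i w)).
  move=> mu u1 mg g1; apply: (@int1_bdd _ _ _ _ (1 * 1)) => [|w].
    apply: measurable_funM; first exact: measurableT_comp.
    by apply: prod_meas => [i|]; [rewrite mem_index_iota => /andP[]|exact: mfg].
  by rewrite normrM ler_pM//; apply: prod_le1 => i; exact: fg1.
have mc := continuous_measurable_fun (@continuous_cos R).
have ms := continuous_measurable_fun (@continuous_sin R).
split.
  have -> : (fun w => cos (\sum_(i < k.+1) c i * X i w) * \prod_(k.+1 <= i < n) f i (X i w)) =
      fun w => cos (L w) * \prod_(k <= i < n) fg C i (X i w) - sin (L w) * \prod_(k <= i < n) fg S i (X i w).
    by apply/funext => w; rewrite big_ord_recr/= cosD !fgE /C /S /L; ring.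
  rewrite ExB; [|exact: (i1 cos _ mc bcos mC (fun x => bcos _))|exact: (i1 sin _ ms bsin mS (fun x => bsin _))].
  rewrite Cc Ss subr0 efgE EC big_ord_recr/= opprD expRD mulrA//.
have -> : (fun w => sin (\sum_(i < k.+1) c i * X i w) * \prod_(k.+1 <= i < n) f i (X i w)) =
      fun w => sin (L w) * \prod_(k <= i < n) fg C i (X i w) + cos (L w) * \prod_(k <= i < n) fg S i (X i w).
  by apply/funext => w; rewrite big_ord_recr/= sinD !fgE /C /S /L; ring.
rewrite ExD; [|exact: (i1 sin _ ms bsin mC (fun x => bcos _))|exact: (i1 cos _ mc bcos mS (fun x => bsin _))].
by rewrite Cs Sc efgE ES mul0r mulr0 addr0.
Qed.
End gaussian.

Lemma indep_isG (v c : nat -> R) : (forall i, (i < n)%N -> isG P (v i) (X i)) ->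
  isG P (\sum_(i < n) c i ^+ 2 * v i) (fun w => \sum_(i < n) c i * X i w).
Proof.
move=> GX; split.
  by apply: measurable_sum => i; apply: measurable_funM => //; exact: mX.
move=> t; have [] := @indep_cos_sin v (fun i => t * c i) GX n (leqnn n) (fun i x => 1) (fun=> measurable_cst _) (fun _ _ => _).
  by rewrite normr1.
have e w : \sum_(i < n) t * c i * X i w = t * \sum_(i < n) c i * X i w.
  by rewrite mulr_sumr; apply: eq_bigr => i _; rewrite mulrA.
move=> h1 h2; split.
  transitivity (Ex P (fun w => cos (\sum_(i < n) t * c i * X i w) * \prod_(n <= i < n) 1)).
    by congr (Ex P _); apply/funext => w; rewrite e big_geq// mulr1.
  rewrite h1 big_geq// mulr1; congr expR; congr (- _).
  by rewrite mulr_sumr mulr_suml; apply: eq_bigr => i _; ring.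
rewrite -[RHS]h2; congr (Ex P _); apply/funext => w.
by rewrite e big_geq// mulr1.
Qed.
End independent.

Lemma isG_law {d1 d2} {O1 : measurableType d1} {O2 : measurableType d2} {R : realType}
    (P1 : probability O1 R) (P2 : probability O2 R) v Z1 Z2 :
  measurable_fun setT Z2 -> (forall A, measurable A -> P1 (Z1 @^-1` A) = P2 (Z2 @^-1` A)) ->
  isG P1 v Z1 -> isG P2 v Z2.
Proof.
move=> mZ2 law [mZ1 G1]; split=> // c; have [h1 h2] := G1 c.
have key (f : R -> R) : measurable_fun setT f -> (forall x, `|f x| <= 1) ->
    Ex P2 (fun w => f (Z2 w)) = Ex P1 (fun w => f (Z1 w)).
  move=> mf f1.
  have e (O : Type) (Y : O -> R) (g : R -> R) : (fun w => 1 * g (Y w)) = (fun w => g (Y w)).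
    by apply/funext => w; rewrite mul1r.
  have n1 (O : Type) : O -> `|1 : R| <= 1 by rewrite normr1.
  have := @agree_bdd _ _ _ _ R P1 P2 (fun=> 1) Z1 (fun=> 1) Z2 1
    (measurable_cst _) (measurable_cst _) mZ1 mZ2 (n1 _) (n1 _) _ f 1 mf f1.
  rewrite /agree/= !e => -> // A mA; rewrite !e.
  have mp d (O : measurableType d) (Z : O -> R) : measurable_fun setT Z -> measurable (Z @^-1` A).
    by move=> mZ; rewrite -[X in measurable X]setTI; exact: mZ.
  by apply: EFin_inj; rewrite (Ex_indic P1 (mp _ _ _ mZ1)) (Ex_indic P2 (mp _ _ _ mZ2)) law.
split.
  rewrite -h1; apply: (key (fun x => cos (c * x))); last by move=> x; exact: bcos.
  by apply: mcosf; exact: measurable_funM.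
rewrite -[RHS]h2; apply: (key (fun x => sin (c * x))); last by move=> x; exact: bsin.
by apply: msinf; exact: measurable_funM.
Qed.

Lemma normal_isG {d} {Om : measurableType d} {R : realType} (P : probability Om R) (s : R) Z :
  s != 0 -> measurable_fun setT Z -> has_normal_law P 0 s Z -> isG P (s ^+ 2) Z.
Proof.
move=> s0 mZ nZ; apply: (isG_law mZ _ (isG_normal_prob s0)) => A mA.
by rewrite (nZ _ mA) (negbTE s0).
Qed.

Lemma isG0 {d} {Om : measurableType d} {R : realType} (P : probability Om R) : isG P 0 (fun=> 0).
Proof.
split=> // c; split.
  rewrite (_ : _ / 2 = 0); last by rewrite mulr0 mul0r.
  by rewrite oppr0 expR0 -[RHS](Ex_cst P); congr (Ex P _); apply/funext => w; rewrite mulr0 cos0.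
by rewrite -[RHS](Ex_cst P); congr (Ex P _); apply/funext => w; rewrite mulr0 sin0.
Qed.

Lemma isG_same_law {d1 d2} {O1 : measurableType d1} {O2 : measurableType d2} {R : realType}
    (P1 : probability O1 R) (P2 : probability O2 R) v Z1 Z2 : isG P1 v Z1 -> isG P2 v Z2 ->
  forall A, measurable A -> P1 (Z1 @^-1` A) = P2 (Z2 @^-1` A).
Proof.
move=> G1 G2 B mB; have [m1 _] := G1; have [m2 _] := G2.
have := @gaussian_law_eq R unit R (fun _ x => x) setT _ _ _ _ P1 P2 Z1 Z2.
apply; [by move=> _ _; exact: m1|by move=> _ _; exact: m2| |]; last first.
  by apply: sub_sigma_algebra; exists tt => //; exists B => //; rewrite setTI.
move=> t _.
have e (O : Type) (Y : O -> R) : lc (fun _ w => Y w) t = fun w => (\sum_(x <- t) x.1) * Y w.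
  by apply/funext => w; rewrite /lc mulr_suml.
by exists ((\sum_(x <- t) x.1) ^+ 2 * v); rewrite e; exact: isG_scale.
Qed.

Lemma isG_normal {d} {Om : measurableType d} {R : realType} (P : probability Om R) (s : R) Z :
  s != 0 -> isG P (s ^+ 2) Z -> has_normal_law P 0 s Z.
Proof.
move=> s0 GZ B mB; rewrite (negbTE s0).
exact: (isG_same_law GZ (isG_normal_prob s0) mB).
Qed.

Section brownian.
Context {R : realType} {T : R} (T0 : 0 < T) {d} {Om : measurableType d} (P : probability Om R).
Context (W : Om -> path_space T) (mW : forall r, r \in `[0, T] -> measurable_fun setT (fun w => W w r)).
Hypothesis BW : brownian_motion P W.

Lemma bm_incr (s t : R) : 0 <= s -> s <= t -> t <= T -> isG P (t - s) (fun w => W w t - W w s).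
Proof.
move=> s0; rewrite le_eqVlt => /predU1P[->|st] tT.
  by rewrite subrr; under eq_fun do rewrite subrr; exact: isG0.
have [_ /(_ s t s0 st tT) nl _] := BW.
have ts : 0 < t - s by rewrite subr_gt0.
rewrite -[X in isG _ X](@sqr_sqrtr R) ?ltW//; apply: normal_isG => //.
  by rewrite gt_eqF// sqrtr_gt0.
apply: measurable_funB; apply: mW; rewrite in_itv/= ?tT ?s0 ?(le_trans s0 (ltW st))//.
exact: le_trans (ltW st) tT.
Qed.

Lemma bm_indep n (t : nat -> R) : 0 <= t 0%N -> t n <= T ->
  (forall i, (i < n)%N -> t i <= t i.+1) -> forall B : nat -> set R, (forall i, measurable (B i)) ->
  P (\big[setI/setT]_(i < n) ((fun w => W w (t i.+1) - W w (t i)) @^-1` B i)) =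
  (\prod_(i < n) P ((fun w => (W w (t i.+1) - W w (t i))%R) @^-1` B i))%E.
Proof.
move=> t0 tn tm B mB; have [_ _ /(_ n t t0 tn tm)] := BW.
move=> /(_ (enum 'I_n) (enum_uniq _) (fun i => B i) (fun i => mB i)).
rewrite big_enum/= => <-; congr (P _).
rewrite -(@bigcap_mkord _ n (fun i => (fun w => W w (t i.+1) - W w (t i)) @^-1` B i)); apply/seteqP; split=> w h i.
  by move=> _; apply: h; exact: ltn_ord.
by move=> /= ni; apply: (h (Ordinal ni)); rewrite /= mem_enum.
Qed.

Lemma bm_isG r : 0 <= r <= T -> isG P r (fun w => W w r).
Proof.
move=> /andP[r0 rT]; have G := bm_incr (lexx 0) r0 rT.
rewrite subr0 in G; apply: isG_ae G.
  by apply: mW; rewrite in_itv/= r0.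
by have [W0 _ _] := BW; apply: filterS W0 => w ->; rewrite subr0.
Qed.

Lemma bm_gfam : gfam P (fun r w => W w r) (fun r => r \in `[0, T]).
Proof.
have LW r : r \in `[0, T] -> L2 P (fun w => W w r) by rewrite in_itv/= => /bm_isG/isG_L2[].
split=> [//|s sT].
suff [v Gv] : exists v, isG P v (lc (fun r w => W w r) s).
  by have [_ ->] := isG_L2 Gv.
(* The times are sorted and preceded by 0, so that the combination can be rewritten in independent
   increments. *)
pose l := sort <=%R [seq x.2 | x <- s].
pose t i := nth 0 (0 :: l) i; pose n := size l.
have lT y : y \in l -> 0 <= y <= T.
  by rewrite mem_sort => /mapP[x xs ->]; have := sT x xs; rewrite in_itv.
have tm i : (i < n)%N -> t i <= t i.+1.
  have : path <=%R 0 l.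
    rewrite path_min_sorted; first exact: (sort_sorted (@le_total _ R)).
    by apply/allP => y /lT/andP[].
  by move/(pathP 0) => H ni; exact: H.
have tn : t n <= T.
  rewrite /t /n; case: (l) lT => [|y l'] lT; first exact: ltW.
  by have /andP[] := lT _ (@mem_nth _ 0 (y :: l') (size l') (ltnSn _)).
pose X i w := W w (t i.+1) - W w (t i).
have tT i : (i <= n)%N -> 0 <= t i <= T.
  case: i => [|i] ni; first by rewrite /t /= lexx ltW.
  by apply: lT; exact: mem_nth.
have GX i : (i < n)%N -> isG P (t i.+1 - t i) (X i).
  move=> ni; apply: bm_incr; last by have /andP[] := tT _ ni.
    by have /andP[] := tT _ (ltnW ni).
  exact: tm.
have mX i : (i < n)%N -> measurable_fun setT (X i) by move=> /GX[].
have ind := bm_indep (lexx (t 0%N)) tn tm.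
(* A value of [W] at the time in position [j] of [l] is the sum of the increments [0, ..., j]; thus
   increment [i] is counted by the terms whose position is at least [i]. *)
pose c i := \sum_(x <- s) x.1 * (i <= index x.2 l)%N%:R.
exists (\sum_(i < n) c i ^+ 2 * (t i.+1 - t i)).
apply: (isG_ae _ _ (indep_isG mX ind c GX)); first by have [] := L2_lc LW sT.
have [W0 _ _] := BW; apply: filterS W0 => w W0.
have Wt j : W w (t j) = \sum_(0 <= i < j) X i w.
  by rewrite telescope_sumr// /t /= W0 subr0.
rewrite /lc.
transitivity (\sum_(x <- s) \sum_(i < n) x.1 * (i <= index x.2 l)%N%:R * X i w); last first.
  by rewrite exchange_big/=; apply: eq_bigr => i _; rewrite /c mulr_suml.
apply: eq_big_seq => x xs; have xl : x.2 \in l by rewrite mem_sort map_f.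
have jn : (index x.2 l < n)%N by rewrite /n index_mem.
have {1}-> : x.2 = t (index x.2 l).+1 by rewrite /t /= nth_index.
rewrite Wt (big_nat_widen _ _ n)// big_mkord mulr_sumr big_mkcond/=; apply: eq_bigr => i _.
by rewrite ltnS; case: ifP => _; rewrite ?mulr1// mulr0 mul0r.
Qed.

Lemma bm_cov (s t : R) : 0 <= s <= t -> t <= T -> ip P (fun w => W w s) (fun w => W w t) = s.
Proof.
move=> /andP[s0 st] tT.
have sT : 0 <= s <= T by rewrite s0 (le_trans st).
have tT' : 0 <= t <= T by rewrite tT (le_trans s0).
have [Ls es] := isG_L2 (bm_isG sT); have [Lt et] := isG_L2 (bm_isG tT').
have [_] := isG_L2 (bm_incr s0 st tT).
by rewrite ip_sqrB// es et ipC mulr2n; lra.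
Qed.
End brownian.

(** * The Hilbert space generating the process *)

Section dot_product.
Context {R : realType} {H : completeNormedModType R} (hp : {dot H for idfun}).
Hypothesis norm_hp : forall h, `|h| ^+ 2 = hp h h.

Lemma hpC x y : hp x y = hp y x.
Proof. by rewrite hermC expr0 mul1r. Qed.

Lemma hpDl x y z : hp (x + y) z = hp x z + hp y z. Proof. exact: linearDl. Qed.
Lemma hpZl a x z : hp (a *: x) z = a * hp x z. Proof. by rewrite linearZl_LR. Qed.
Lemma hpDr x y z : hp z (x + y) = hp z x + hp z y. Proof. by rewrite hpC hpDl !(hpC z). Qed.
Lemma hpZr a x z : hp z (a *: x) = a * hp z x. Proof. by rewrite hpC hpZl (hpC z). Qed.
Lemma hpBl x y z : hp (x - y) z = hp x z - hp y z.
Proof. by rewrite hpDl -scaleN1r hpZl mulN1r. Qed.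
Lemma hpBr x y z : hp z (x - y) = hp z x - hp z y. Proof. by rewrite hpC hpBl !(hpC z). Qed.
Lemma hp0l z : hp 0 z = 0. Proof. by rewrite -(scale0r 0) hpZl mul0r. Qed.
Lemma hp0r z : hp z 0 = 0. Proof. by rewrite hpC hp0l. Qed.
Lemma hp_suml I (s : seq I) (F : I -> H) z : hp (\sum_(i <- s) F i) z = \sum_(i <- s) hp (F i) z.
Proof.
elim: s => [|i s IH]; first by rewrite !big_nil hp0l.
by rewrite !big_cons hpDl IH.
Qed.

Lemma hp_CS x y : `|hp x y| <= `|x| * `|y|.
Proof.
have h : hp x y ^+ 2 <= hp x x * hp y y.
  apply: quad_ge0 => [|t]; first by rewrite -norm_hp sqr_ge0.
  suff <- : `|x + t *: y| ^+ 2 = hp x x + t * hp x y *+ 2 + t ^+ 2 * hp y y by rewrite sqr_ge0.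
  by rewrite norm_hp !hpDl !hpDr !hpZl !hpZr (hpC y x); ring.
rewrite -(@ler_pXn2r _ 2) ?nnegrE ?mulr_ge0// real_normK ?num_real//.
by rewrite exprMn !norm_hp.
Qed.

Lemma hp_cvg (x : nat -> H) (l y : H) : x n @[n --> \oo] --> l -> hp (x n) y @[n --> \oo] --> hp l y.
Proof.
move=> xl; apply/cvgrPdist_le => e e0.
have y0 : 0 < `|y| + 1 by rewrite ltr_wpDl.
have ey : 0 < e / (`|y| + 1) by rewrite divr_gt0.
move/cvgrPdist_le : xl => /(_ _ ey); apply: filterS => n xn.
rewrite -hpBl (le_trans (hp_CS _ _))//.
rewrite ler_pdivlMr// in xn; apply: le_trans xn.
by rewrite ler_wpM2l// lerDl.
Qed.

Section basis_exists.
Context (dn : nat -> H) (dn_dense : forall (x : H) (e : R), 0 < e -> exists m, `|x - dn m| < e).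

Definition resid (s : seq H) (x : H) := x - \sum_(y <- s) hp x y *: y.

(** Gram-Schmidt along a dense sequence that jumps to the first element not yet spanned. Normalising
    the residuals one by one would leave zero vectors in the middle, whereas [orthonormal_basis]
    admits them only at the tail. *)
Definition gs_next (s : seq H) : H :=
  if pselect (exists m, resid s (dn m) != 0) is left ex
  then let r := resid s (dn (ex_minn ex)) in `|r|^-1 *: r else 0.

Fixpoint gs n : seq H := if n is m.+1 then rcons (gs m) (gs_next (gs m)) else [::].

Let h n := gs_next (gs n).

Let gsE n : gs n = [seq h i | i <- iota 0 n].
Proof. by elim: n => [|n IH] //; rewrite -addn1 iotaD map_cat -IH /= cats1 addn1. Qed.

Let resid_next n x : resid (gs n.+1) x = resid (gs n) x - hp x (h n) *: h n.
Proof. by rewrite /resid /= -cats1 big_cat big_seq1/= -/(h n) opprD addrA. Qed.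

Let h_neq0 n : h n != 0 -> hp (h n) (h n) = 1.
Proof.
rewrite /h /gs_next; case: pselect => [ex _|]; last by rewrite eqxx.
case: ex_minnP => m r0 _ /=; rewrite -norm_hp normrZ normfV normr_id mulVf ?expr1n//.
by rewrite normr_eq0.
Qed.

Let h_orth n : forall i, (i < n)%N -> hp (h n) (h i) = 0.
Proof.
have [m nm] := ubnP n; elim: m => // m IH in n nm * => i ni.
have res x : hp (resid (gs n) x) (h i) = 0.
  rewrite /resid hpBl hp_suml gsE big_map -{1}(subn0 n) -/(index_iota 0 n) (bigD1_seq i)/= ?mem_index_iota ?iota_uniq//.
  rewrite hpZl big_seq_cond big1 ?addr0 => [|j /andP[]]; last first.
    rewrite mem_index_iota => /andP[_ jn] ji; rewrite hpZl.
    case: (ltngtP i j) ji => // ij _.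
      by rewrite IH ?mulr0// (leq_trans jn).
    by rewrite hpC IH ?mulr0// (leq_trans ni).
  have [->|/h_neq0 ->] := eqVneq (h i) 0; first by rewrite !hp0r mul0r subrr.
  by rewrite mulr1 subrr.
rewrite {1}/h /gs_next; case: pselect => [ex|_]; last by rewrite hp0l.
by rewrite hpZl res mulr0.
Qed.

Let next_eq0 s : gs_next s = 0 -> forall m, resid s (dn m) = 0.
Proof.
rewrite /gs_next; case: pselect => [ex|nex _ m]; last first.
  by apply/eqP; apply: contra_notT nex => r0; exists m.
case: ex_minnP => m r0 _ /= /eqP; rewrite scaler_eq0 invr_eq0 normr_eq0.
by rewrite (negbTE r0).
Qed.

Let eq0_next s : (forall m, resid s (dn m) = 0) -> gs_next s = 0.
Proof.
move=> r0; rewrite /gs_next; case: pselect => // ex.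
by have [m] := ex; rewrite r0 eqxx.
Qed.

(** The elements of index below [n] are already spanned at stage [n]. If [dn n] is not, it is the
    first such element, so [h n] is its normalised residual and the next stage spans it. *)
Let resid_dn n : forall m, (m < n)%N -> resid (gs n) (dn m) = 0.
Proof.
elim: n => // n IH m; rewrite ltnS => mn.
have orth0 x : resid (gs n) x = 0 -> resid (gs n.+1) x = 0.
  move=> x0; rewrite resid_next x0 sub0r.
  have -> : hp x (h n) = 0; last by rewrite scale0r oppr0.
  move/eqP : x0; rewrite subr_eq0 => /eqP ->; rewrite hp_suml gsE big_map big_seq big1// => j.
  by rewrite mem_iota => /= jn; rewrite hpZl hpC h_orth// mulr0.
have [//|r0] := eqVneq (resid (gs n) (dn m)) 0; first exact: orth0.
have nm : m = n.
  by move: mn r0; rewrite leq_eqVlt => /predU1P[//|/IH ->]; rewrite eqxx.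
move: r0; rewrite {}nm => r0.
have hE : h n = `|resid (gs n) (dn n)|^-1 *: resid (gs n) (dn n).
  rewrite /h /gs_next; case: pselect => [ex|]; last by case; exists n.
  case: ex_minnP => k k0 kmin /=; suff -> : k = n by [].
  apply/eqP; rewrite eqn_leq kmin//= leqNgt; apply/negP => /IH k1.
  by rewrite k1 eqxx in k0.
set r := resid _ _ in r0 hE.
have rh : hp (dn n) (h n) = `|r|.
  have -> : dn n = r + \sum_(y <- gs n) hp (dn n) y *: y by rewrite /r /resid subrK.
  rewrite hpDl hp_suml [X in _ + X](_ : _ = 0) ?addr0; last first.
    rewrite gsE big_map big_seq big1// => j.
    by rewrite mem_iota => /= jn; rewrite hpZl (hpC (h j)) h_orth// mulr0.
  by rewrite hE hpZr -norm_hp expr2 mulKf// normr_eq0.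
by rewrite resid_next -/r rh hE scalerA divff ?scale1r ?subrr// normr_eq0.
Qed.

Lemma basis_exists : exists h, orthonormal_basis hp setT h.
Proof.
exists h; split => //.
- by move=> i j; case: (ltngtP i j) => // ij _; [rewrite hpC|]; exact: h_orth.
- by move=> i h0; apply: eq0_next => m; rewrite resid_next h0 scaler0 subr0 next_eq0.
- move=> x _ B /nbhs_ballP[e /= e0 xB]; have [m xm] := dn_dense x e0.
  exists (dn m); split; last by apply: xB; rewrite -ball_normE.
  exists m.+1, (fun i => hp (dn m) (h i)).
  have /eqP := resid_dn (ltnSn m); rewrite subr_eq0 => /eqP {1}->.
  by rewrite gsE big_map -{1}(subn0 m.+1) -/(index_iota 0 m.+1) big_mkord.
Qed.
End basis_exists.

Lemma separable_basis : (exists2 D : set H, countable D & dense D) -> exists h, orthonormal_basis hp setT h.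
Proof.
move=> [D /countable_injP[f finj] dD].
pose dn n := xget 0 [set x | D x /\ f x = n].
apply: (@basis_exists dn) => x e e0.
have /dD : ball x e !=set0 by exists x; exact: ballxx.
move=> /(_ (ball_open _ _))[y [xy Dy]]; exists (f y).
have [Dz fz] : [set x | D x /\ f x = f y] (dn (f y)) by apply: (xgetPex 0); exists y.
by rewrite (finj _ _ _ _ fz) ?inE//; move: xy; rewrite -ball_normE.
Qed.

(** The representing vector is the sum of the [phi (h i) *: h i], which converges because the bound
    on [phi] bounds the sums of squares (Bessel). These sums are part of the conclusion because they
    are the variances of the partial sums of the series generating the process. *)
Lemma riesz_onb (h : nat -> H) (phi : {scalar H}) K : orthonormal_basis hp setT h ->
  (forall x, `|phi x| <= K * `|x|) ->
  exists k, (forall v, hp k v = phi v) /\ \sum_(i < n) phi (h i) ^+ 2 @[n --> \oo] --> hp k k.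
Proof.
move=> [_ horth h1 h0 hdense] phiK.
(* This covers the padding zero vectors as well, where both sides vanish. *)
have phih i : phi (h i) * hp (h i) (h i) = phi (h i).
  by have [->|/h1 ->] := eqVneq (h i) 0; rewrite ?linear0 ?mul0r ?mulr1.
pose x := series (fun i => phi (h i) *: h i); pose q := series (fun i => phi (h i) ^+ 2).
have xhE m n j : hp (\sum_(m <= i < n) phi (h i) *: h i) (h j) = (m <= j < n)%:R * phi (h j).
  rewrite hp_suml; case: (boolP (m <= j < n)%N) => jmn.
    rewrite (bigD1_seq j) ?mem_index_iota ?iota_uniq//= hpZl phih mul1r big1 ?addr0// => i ij.
    by rewrite hpZl horth// mulr0.
  rewrite mul0r big_nat_cond big1// => i; rewrite andbT => imn; rewrite hpZl horth ?mulr0//.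
  by apply: contraNneq jmn => <-.
have nE m n : `|\sum_(m <= i < n) phi (h i) *: h i| ^+ 2 = \sum_(m <= i < n) phi (h i) ^+ 2.
  rewrite norm_hp {1}(hp_suml _ (fun i => phi (h i) *: h i)).
  by apply: eq_big_nat => i imn; rewrite hpZl hpC xhE imn mul1r expr2.
(* A negative bound [K] forces [phi] to be zero. *)
have K0 : 0 <= K \/ forall v, phi v = 0.
  case: (leP 0 K) => K0; [by left|right => v].
  apply/eqP; rewrite -normr_eq0 eq_le normr_ge0 andbT (le_trans (phiK v))// nmulr_rle0//.
have qK n : q n <= K ^+ 2.
  case: K0 => [K0|p0]; last by rewrite /q seriesEord/= big1 ?sqr_ge0// => i _; rewrite p0 expr0n.
  have := phiK (x n); rewrite /x {1}seriesEnat/= linear_sum/=.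
  have -> : \sum_(0 <= i < n) phi (phi (h i) *: h i) = q n.
    by rewrite /q seriesEnat/=; apply: eq_bigr => i _; rewrite linearZ/= expr2.
  have q0 : 0 <= q n by rewrite /q seriesEord/=; apply: sumr_ge0 => i _; exact: sqr_ge0.
  rewrite ger0_norm// => qx.
  have nx : `|x n| ^+ 2 = q n by rewrite /x /q !seriesEnat/= nE.
  have : q n ^+ 2 <= (K * `|x n|) ^+ 2 by rewrite lerXn2r ?nnegrE ?mulr_ge0.
  rewrite exprMn nx.
  have [-> _|qn0] := eqVneq (q n) 0; first exact: sqr_ge0.
  by rewrite expr2 ler_pM2r// lt_def qn0.
have cq : cvgn q.
  apply: nondecreasing_is_cvgn.
    by apply: nondecreasing_series => i _ _; exact: sqr_ge0.
  by exists (K ^+ 2) => _ [n _ <-].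
have cx : cvgn x.
  apply: cauchy_cvg; apply/cauchy_seriesP => e e0.
  have e20 : 0 < e ^+ 2 by rewrite exprn_gt0.
  have cq' : cauchy (q @ \oo) by apply: cvg_cauchy; exact: cq.
  have := (@cauchy_seriesP R R^o (fun i => phi (h i) ^+ 2)).1 cq' _ e20; apply: filterS => n.
  rewrite ger0_norm; last by apply: sumr_ge0 => i _; exact: sqr_ge0.
  by rewrite -nE ltr_pXn2r ?nnegrE// ltW.
pose k := limn x; exists k.
have cxk : x n @[n --> \oo] --> k by exact: cx.
have kh j : hp k (h j) = phi (h j).
  have c1 := @hp_cvg x k (h j) cxk.
  apply: (cvg_unique _ c1); first exact: Rhausdorff.
  apply: cvg_near_cst; exists j.+1 => // n /= jn.
  by rewrite /x seriesEnat/= xhE jn mul1r.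
have kphi v : hp k v = phi v.
  apply/eqP; rewrite -subr_eq0 -normr_le0; apply/ler_addgt0Pl => e e0; rewrite addr0.
  have L0 : 0 < `|k| + `|K| + 1 by rewrite ltr_wpDl// addr_ge0.
  have eL : 0 < e / (`|k| + `|K| + 1) by rewrite divr_gt0.
  have [_ [[n [c ->]]]] := hdense v I _ (nbhsx_ballx v _ eL).
  rewrite -ball_normE/= => vw; set w := \sum_(i < n) _ in vw.
  have kw : hp k w = phi w.
    rewrite hpC /w hp_suml linear_sum; apply: eq_bigr => i _.
    by rewrite hpZl linearZ/= hpC kh.
  rewrite (_ : _ - _ = hp k (v - w) - phi (v - w)); last by rewrite hpBr linearB kw; ring.
  apply: (le_trans (ler_normB _ _)).
  apply: (@le_trans _ _ ((`|k| + `|K| + 1) * `|v - w|)).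
    rewrite -addrA mulrDl lerD ?hp_CS//; apply: (le_trans (phiK _)).
    by rewrite ler_wpM2r// (le_trans (ler_norm _))// lerDl.
  by rewrite mulrC -ler_pdivlMr// ltW.
split=> //.
have c2 : hp (x n) k @[n --> \oo] --> hp k k by exact: hp_cvg.
have -> // : (fun n => \sum_(i < n) phi (h i) ^+ 2) = (fun n => hp (x n) k).
apply/funext => n; rewrite hpC kphi /x seriesEord/= linear_sum; apply: eq_bigr => i _.
by rewrite linearZ/= expr2.
Qed.

End dot_product.

Section iid_normals.
Context {R : realType} {T : R} (T0 : 0 < T) {d} {Om : measurableType d} (P : probability Om R).
Context (W : Om -> path_space T) (mW : forall r, r \in `[0, T] -> measurable_fun setT (fun w => W w r)).
Hypothesis BW : brownian_motion P W.

(** [generated_by] is a statement about any given sequence of independent normal variables, so one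
    has to be exhibited: the increments of [W] over consecutive intervals accumulating at [T],
    rescaled to variance 1. *)
Lemma iid_normals : exists g : nat -> {RV P >-> R},
  (forall i, has_normal_law P 0 1 (g i)) /\ mutually_independent P g.
Proof.
pose t i := T * (1 - 2^-1 ^+ i).
have t0T i : 0 <= t i <= T.
  have h1 : 0 <= (2^-1 : R) ^+ i by rewrite exprn_ge0.
  have h2 : (2^-1 : R) ^+ i <= 1 by rewrite exprn_ile1// invf_le1// ler1n.
  by rewrite /t mulr_ge0 ?subr_ge0 ?(ltW T0)//= ler_piMr ?(ltW T0)// gerBl.
have tm i : t i < t i.+1.
  rewrite /t ltr_pM2l// ltrD2l ltrN2 exprSr gtr_pMr ?exprn_gt0//.
  by rewrite invf_lt1// ltr1n.
pose D i w := W w (t i.+1) - W w (t i).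
pose s i := Num.sqrt (t i.+1 - t i).
have s0 i : s i != 0 by rewrite gt_eqF// sqrtr_gt0 subr_gt0.
have mD i : measurable_fun setT (D i) by apply: measurable_funB; apply: mW; rewrite in_itv/= t0T.
have GD i : isG P (t i.+1 - t i) (D i).
  have /andP[h1 _] := t0T i; have /andP[_ h2] := t0T i.+1.
  exact: (bm_incr mW BW h1 (ltW (tm i)) h2).
have /choice[g gE] : forall i, exists g : {RV P >-> R}, forall w, g w = (s i)^-1 * D i w.
  by move=> i; apply: mk_mfun; exact: measurable_funM.
have gE' i : (g i : Om -> R) = fun w => (s i)^-1 * D i w by apply/funext => w; rewrite gE.
exists g; split=> [i|q uq B mB].
  apply: isG_normal; first exact: oner_neq0.
  rewrite gE'; have := isG_scale (s i)^-1 (GD i).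
  rewrite -[X in _ * X](@sqr_sqrtr R); last by rewrite subr_ge0 ltW.
  by rewrite -exprMn mulVf// expr1n.
pose n := (\max_(i <- q) i).+1.
have qn i : i \in q -> (i < n)%N by move=> iq; rewrite ltnS; exact: leq_bigmax_seq.
have [_ _ ind] := BW.
have := ind n t _ _ (fun i _ => ltW (tm i)).
have /andP[-> _] := t0T 0%N; have /andP[_ ->] := t0T n => /(_ isT isT).
pose q' : seq 'I_n := [seq inord i | i <- q].
have iq i : i \in q -> (@inord n.-1 i : nat) = i by move=> /qn ni; rewrite inordK.
have uq' : uniq q'.
  rewrite map_inj_in_uniq// => i j /iq ei /iq ej e.
  by rewrite -ei -ej e.
pose B' (i : 'I_n) : set R := (fun x => (s i)^-1 * x) @^-1` B i.
have mB' i : measurable (B' i).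
  rewrite /B' -[X in measurable X]setTI; by apply: (@measurable_funM _ _ _ _ (fun=> (s i)^-1) id) => //; exact: mB.
move=> /(_ q' uq' B' mB').
rewrite /q' big_map => H.
transitivity (P (\bigcap_(i in [set` [seq inord i | i <- q]]) ((fun w => W w (t (i : 'I_n).+1) - W w (t i)) @^-1` B' i))).
  congr (P _); apply/seteqP; split=> w h i /=.
    move=> /mapP[j jq ->]; rewrite /B' /= iq//.
    by have := h j jq; rewrite /= gE.
  move=> iq'; have := h (inord i) (map_f _ iq').
  by rewrite /B' /= iq// gE.
rewrite H; apply: eq_big_seq => i iq'; congr (P _).
by apply/seteqP; split=> w; rewrite /B' /= iq// gE.
Qed.
End iid_normals.

(** * Continuous linear functionals of the process and hypothesis (i) *)

Section functionals.
Context {R : realType} {T : R}.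
Local Notation C := (path_space T).

(** A predicate on plain functions, so that functionals can be combined as lambda terms and serve as
    indices of a Gaussian family. *)
Definition clf (b : C -> R) := scalar b /\ continuous b.

Lemma clfD b c : clf b -> clf c -> clf (fun f => b f + c f).
Proof.
move=> [lb cb] [lc cc]; split=> [x f g|f]; first by rewrite lb lc; ring.
have FF : Filter (nbhs f) by exact: nbhs_filter.
exact: (@cvgD R R^o C (nbhs f) _ b c _ _ (cb f) (cc f)).
Qed.

Lemma clfZ x b : clf b -> clf (fun f => x * b f).
Proof.
move=> [lb cb]; split=> [y f g|f]; first by rewrite lb; ring.
have FF : Filter (nbhs f) by exact: nbhs_filter.
exact: (@cvgM R C (nbhs f) _ (fun=> x) b _ _ (@cvg_cst _ x _ _ _) (cb f)).
Qed.

Lemma clf0 : clf (fun=> 0).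
Proof.
split=> [y f g|f]; first by rewrite mulr0 addr0.
have FF : Filter (nbhs f) by exact: nbhs_filter.
exact: cvg_cst.
Qed.

Lemma clf_ev r : clf (fun f => f r).
Proof. by split=> //; exact: eval_continuous. Qed.

Lemma clf_sum I (s : seq I) (b : I -> C -> R) : (forall i, clf (b i)) -> clf (fun f => \sum_(i <- s) b i f).
Proof.
move=> cb; elim: s => [|i s IH].
  by under eq_fun do rewrite big_nil; exact: clf0.
by under eq_fun do rewrite big_cons; exact: clfD.
Qed.

Lemma clf_lc (I : eqType) (b : I -> C -> R) (S : I -> Prop) s : (forall i, S i -> clf (b i)) ->
  inS S s -> clf (lc b s).
Proof.
move=> cb; elim: s => [|x s IH] sS.
  by rewrite /lc; under eq_fun do rewrite big_nil; exact: clf0.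
rewrite /lc; under eq_fun do rewrite big_cons; apply: clfD.
  by apply/clfZ/cb/sS; rewrite inE eqxx.
by apply: IH => y ys; apply: sS; rewrite inE ys orbT.
Qed.

Lemma clf_bound b : clf b -> exists K, forall f, `|b f| <= K * `|f|.
Proof.
move=> [lb cb]; have bZ x f : b (x *: f) = x * b f.
  have := lb x f 0; rewrite addr0 => ->; have := lb 0 f 0; rewrite scale0r mul0r add0r.
  by have := lb 1 0 0; rewrite scaler0 addr0 mul1r; lra.
have b0 : b 0 = 0 by rewrite -(scale0r 0) bZ mul0r.
have : b f @[f --> (0 : C)] --> b 0 := cb 0.
have FF : Filter (nbhs (0 : C)) by exact: nbhs_filter.
move=> /cvgrPdist_lt/(_ 1 ltr01); rewrite b0 => /nbhs_ballP[e /= e0 be].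
exists (2 / e) => f; have [->|f0] := eqVneq f 0; first by rewrite b0 !normr0 mulr0.
have nf : 0 < `|f| by rewrite normr_gt0.
pose c := e / 2 / `|f|; have c0 : 0 < c by rewrite !divr_gt0.
have /be : ball 0 e (c *: f).
  rewrite -ball_normE/= sub0r normrN normrZ gtr0_norm// /c divfK ?gt_eqF//.
  by rewrite ltr_pdivrMr// ltr_pMr// ltr1n.
rewrite /= sub0r normrN bZ normrM gtr0_norm// => /ltW h.
have -> : 2 / e * `|f| = c^-1 by rewrite /c; field; rewrite !gt_eqF.
by rewrite -[leRHS]mul1r ler_pdivlMr// mulrC.
Qed.
End functionals.

Section gaussian_functionals.
Context {R : realType} {T : R} (T0 : 0 < T) {H : completeNormedModType R} (hp : {dot H for idfun}).
Hypothesis norm_hp : forall h, `|h| ^+ 2 = hp h h.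
Hypothesis H_separable : exists2 D : set H, countable D & dense D.
Context (u : {linear H -> path_space T}) (u_bounded : bounded_near u (nbhs 0)).
Context {d} {Om : measurableType d} (P : probability Om R) (X : {RV P >-> path_space T}).
Hypothesis X_generated : generated_by P hp u X.
Context (W : {RV P >-> path_space T}) (BW : brownian_motion P W).

(** [X] has the law of a series [S] of independent normals, and [b(S)] is the series of the
    [b(u h_i)] times these normals. Its variance is the sum of the [b(u h_i)^2], which is the
    squared norm of the vector [k] representing [b] composed with [u]. *)
Lemma functional_riesz b : clf b -> exists k,
  (forall v, hp k v = b (u v)) /\ isG P (hp k k) (fun w => b (X w)).
Proof.
move=> cb; have [K bK] := clf_bound cb.
have [h onb] := separable_basis norm_hp H_separable.
have [L uL] : exists L, forall x, `|u x| <= L * `|x|.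
  by move/linear_boundedP : u_bounded => [L [_ HL]]; exists (L + 1) => x; apply: HL; rewrite ltrDl.
have [lb ctb] := cb.
have lphi : scalar (b \o u) by move=> x f g /=; rewrite linearP lb.
pose phi : {scalar H} := HB.pack (b \o u) (GRing.isLinear.Build _ _ _ _ (b \o u) lphi).
pose bl : {scalar path_space T} := HB.pack b (GRing.isLinear.Build _ _ _ _ b lb).
have phiK : forall x, `|phi x| <= (`|K| * L) * `|x|.
  move=> x /=; apply: (le_trans (bK _)); apply: (@le_trans _ _ (`|K| * `|u x|)).
    by rewrite ler_wpM2r// ler_norm.
  by rewrite -mulrA ler_wpM2l.
have [k [kv kk]] := @riesz_onb _ _ hp norm_hp h phi (`|K| * L) onb phiK.
exists k; split=> //.
have mev (Y : {RV P >-> path_space T}) r : measurable_fun setT (fun w => Y w r).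
  apply: (measurableT_comp (f := fun f : path_space T => f r)) => //.
  exact: eval_measurable.
have [g [gn gi]] := iid_normals T0 (fun r _ => mev W r) BW.
have [S [SS Slaw]] := X_generated onb gn gi.
have mb := continuous_borel ctb.
have mbX (Y : {RV P >-> path_space T}) : measurable_fun setT (fun w => b (Y w)).
  by apply: (measurableT_comp mb).
apply: (@isG_law _ _ _ _ _ P P _ (fun w => b (S w))) => //.
  move=> A mA; have := Slaw (b @^-1` A) _; apply.
  by rewrite -[X in measurable X]setTI; exact: mb.
have ind n : forall B : nat -> set R, (forall i, measurable (B i)) ->
  P (\big[setI/setT]_(i < n) (g i @^-1` B i)) = (\prod_(i < n) P (g i @^-1` B i))%E.
  move=> B mB; have := gi (iota 0 n) (iota_uniq _ _) B mB.
  rewrite -{2}(subn0 n) -/(index_iota 0 n) big_mkord => <-.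
  rewrite -(@bigcap_mkord _ n (fun i => g i @^-1` B i)); congr (P _); apply: eq_bigcapl.
  by split=> i /=; rewrite mem_iota.
have gG i : isG P 1 (g i).
  by rewrite -(expr1n _ 2); apply: normal_isG => //; exact: oner_neq0.
apply: (@isG_lim _ _ _ P (fun n w => \sum_(i < n) b (u (h i)) * g i w)
    (fun n => \sum_(i < n) b (u (h i)) ^+ 2 * 1)) => //.
- move=> n; apply: (indep_isG (X := fun i => (g i : Om -> R)) _ (ind n) (fun i => b (u (h i))) (v := fun=> 1)) => //.
- by rewrite (_ : (fun n => _) = fun n => \sum_(i < n) phi (h i) ^+ 2)//; apply/funext => n; apply: eq_bigr => i _; rewrite mulr1.
apply: filterS SS => w Sw.
have := cvg_comp _ _ Sw (ctb (S w)).
rewrite (_ : b \o _ = fun n => \sum_(i < n) b (u (h i)) * g i w)//.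
apply/funext => n; rewrite /= seriesEord/= -[LHS]/(bl _) linear_sum; apply: eq_bigr => i _.
by rewrite linearZ/= mulrC.
Qed.

(** Here [k] is the vector [u^* b]. The vector of [b + b'] is the sum of those of [b] and [b'], so
    comparing variances gives the covariance by polarisation. *)
Lemma functional_cov b b' : clf b -> clf b' -> exists k,
  [/\ forall v, hp k v = b (u v), ip P (fun w => b (X w)) (fun w => b (X w)) = hp k k &
  ip P (fun w => b (X w)) (fun w => b' (X w)) = b' (u k)].
Proof.
move=> cb cb'; have [k [kv Gk]] := functional_riesz cb.
have [k' [kv' Gk']] := functional_riesz cb'.
have [l [lv Gl]] := functional_riesz (clfD cb cb').
have le : l = k + k'.
  apply/eqP; rewrite -subr_eq0 -normr_eq0 -sqrf_eq0 norm_hp.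
  by set x := l - _; rewrite /x (hpBl hp) (hpDl hp) lv kv kv' subrr.
have [Lb eb] := isG_L2 Gk; have [Lb' eb'] := isG_L2 Gk'.
exists k; split=> //.
have [_] := isG_L2 Gl.
have -> : (fun w => b (X w) + b' (X w)) = fun w => b (X w) + 1 * b' (X w).
  by apply/funext => w; rewrite mul1r.
rewrite ip_quad// eb eb' le !(hpDl hp) !(hpDr hp) (hpC hp k k') -kv' mulr2n; lra.
Qed.

Lemma functional_gfam : gfam P (fun b w => b (X w)) clf.
Proof.
split=> [b cb|s sS].
  by have [k [_ /isG_L2[]]] := functional_riesz cb.
have cb : clf (lc (fun b : path_space T -> R => b) s) by apply: (clf_lc _ sS).
have [k [_ Gk]] := functional_riesz cb.
by have [_ ->] := isG_L2 Gk.
Qed.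

Context {N : nat} (a : 'I_N -> {scalar path_space T}) (a_continuous : forall i, continuous (a i)).
Context (e : N.-tuple H) (e_basis : orthonormal_basis hp (detached_space hp u a) (nth 0 e)).

(** The residual of the expansion is detached, so it is approximated by combinations of the basis;
    being orthogonal to all of these, it is zero. Padding zero vectors contribute nothing. *)
Lemma detached_expansion k : detached_space hp u a k ->
  k = \sum_(j < N) hp k (tnth e j) *: tnth e j.
Proof.
move=> dk; have [de eorth e1 _ ecl] := e_basis.
pose r := k - \sum_(j < N) hp k (tnth e j) *: tnth e j.
have er j : hp r (nth 0 e j) = 0.
  have [jN|jN] := ltnP j N; last by rewrite nth_default ?size_tuple// hp0r.
  rewrite /r hpBl hp_suml (bigD1 (Ordinal jN))//= big1 => [|i ij].
    rewrite addr0 hpZl (tnth_nth 0)/=.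
    have [->|/e1 ->] := eqVneq (nth 0 e j) 0; first by rewrite !hp0r mul0r subrr.
    by rewrite mulr1 subrr.
  by rewrite hpZl (tnth_nth 0 e i) eorth ?mulr0.
have rd : detached_space hp u a r.
  move=> h hr; rewrite /r hpBl dk// hp_suml big1 ?subr0// => j _.
  by rewrite hpZl (tnth_nth 0) de// mulr0.
apply/eqP; rewrite -subr_eq0 -/r -normr_le0; apply/negPn/negP; rewrite -ltNge => r0.
have [_ [[n [c ->]]]] := ecl r rd _ (nbhsx_ballx r _ r0).
rewrite -ball_normE/= => rw; set w := \sum_(i < n) _ in rw.
have rw0 : hp r w = 0.
  by rewrite hpC /w hp_suml big1// => i _; rewrite hpZl hpC er mulr0.
have : `|r| ^+ 2 <= `|r| * `|r - w|.
  apply: le_trans (hp_CS norm_hp _ _).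
  by rewrite hpBr rw0 subr0 -norm_hp ger0_norm// sqr_ge0.
by rewrite expr2 ler_pM2l// leNgt rw.
Qed.

Definition acomb (c : 'I_N -> R) (f : path_space T) := \sum_(i < N) c i * a i f.

Let A := [set s | 0 <= s <= T /\
  exists e' : 'I_N -> H, forall i, reduced_space u a (e' i) /\
    forall x, 0 <= x <= s -> u (e' i) x = u (tnth e i) x].

(* Replacing the [e_i] by the [e_i'] of condition (i) turns the vector of a condition [acomb c] into a reduced one with the same path on [[0,s]]. *)
Lemma nondegenerate s : sup A = T -> s < T -> exists2 C, 0 < C & forall (c : 'I_N -> R) (l : seq (R * R)),
  inS (fun r => 0 <= r <= s) l ->
  ip P (fun w => acomb c (X w)) (fun w => acomb c (X w)) <=
  C * ip P (fun w => acomb c (X w) - lc (fun r w => X w r) l w)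
           (fun w => acomb c (X w) - lc (fun r w => X w r) l w).
Proof.
move=> cond_i sT.
have [s' [s'T [e' e'P]] ss'] : exists2 s', A s' & s < s'.
  have hA : has_sup A.
    split; last by exists T => x [/andP[]].
    by apply/set0P/eqP => A0; move: cond_i T0; rewrite A0 sup0 => ->; rewrite ltxx.
  have TS : 0 < T - s by rewrite subr_gt0.
  have [s' As' h] := sup_adherent TS hA; exists s' => //.
  by move: h; rewrite cond_i opprB addrC subrK.
(* [K] bounds the map from [k] to [k - k'] below: each coefficient of [k] in the detached basis is
   at most the norm of [k]. *)
pose K := 1 + \sum_(j < N) `|e' j|.
have K0 : 0 < K by rewrite ltr_pwDl// sumr_ge0.
exists (K ^+ 2); first by rewrite exprn_gt0.
move=> c l lS; pose b := acomb c.
have ca i : clf (a i) by split; [move=> x f g; rewrite linearP|exact: a_continuous].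
have cb : clf b by apply: clf_sum => i; exact: clfZ.
have cl : clf (lc (fun r (f : path_space T) => f r) l).
  by apply: (clf_lc _ lS) => r _; exact: clf_ev.
have cbl : clf (fun f => b f + (-1) * lc (fun r (f : path_space T) => f r) l f) by apply/clfD/clfZ.
have [k [kv eb _]] := functional_cov cb cb.
have [k1 [k1v ebl _]] := functional_cov cbl cbl.
have -> : (fun w => acomb c (X w) - lc (fun r w => X w r) l w) =
    fun w => b (X w) + (-1) * lc (fun r (f : path_space T) => f r) l (X w).
  by apply/funext => w; rewrite mulN1r.
rewrite ebl -/b eb.
have kd : detached_space hp u a k.
  by move=> v rv; rewrite kv /b /acomb big1// => i _; rewrite rv mulr0.
pose k' := \sum_(j < N) hp k (tnth e j) *: e' j.
have uk' x : 0 <= x <= s -> u k' x = u k x.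
  move=> /andP[x0 xs].
  have sE (F : 'I_N -> H) : u (\sum_(j < N) hp k (tnth e j) *: F j) x = \sum_(j < N) hp k (tnth e j) * u (F j) x.
    rewrite linear_sum; elim/big_ind2 : _ => [//|f1 y1 f2 y2 <- <- //|j _].
    by rewrite linearZ.
  have -> : u k x = u (\sum_(j < N) hp k (tnth e j) *: tnth e j) x by rewrite -detached_expansion.
  rewrite !sE; apply: eq_bigr => j _.
  by have [_ ->//] := e'P j; rewrite x0 (le_trans xs)// ltW.
have lk : lc (fun r (f : path_space T) => f r) l (u (k - k')) = 0.
  rewrite /lc big_seq big1// => x xl.
  have -> : u (k - k') x.2 = u k x.2 - u k' x.2 by rewrite linearB.
  by rewrite uk' ?subrr ?mulr0//; exact: lS.
have kk' : hp k k' = 0.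
  rewrite hpC /k' hp_suml big1// => j _; rewrite hpZl (hpC hp (e' j)) (kd (e' j)) ?mulr0//.
  by have [] := e'P j.
(* [k'] is reduced, hence orthogonal to [k]; and the path of [k - k'] vanishes on [[0,s]], so [l]
   does not see it. Cauchy-Schwarz on the right then compares the norm of [k] with that of [k1], the
   vector of the difference. *)
have e1 : hp k k = hp k1 (k - k').
  by rewrite k1v lk mulr0 addr0 -kv hpBr kk' subr0.
have tn j : `|tnth e j| <= 1.
  rewrite -(@ler_pXn2r _ 2) ?nnegrE// expr1n norm_hp (tnth_nth 0).
  have [_ _ e1' _ _] := e_basis.
  by have [->|/e1' ->//] := eqVneq (nth 0 e j) 0; rewrite hp0l.
have nk : `|k - k'| <= K * `|k|.
  apply: (le_trans (ler_normB _ _)); rewrite /K mulrDl mul1r lerD2l.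
  rewrite /k' (le_trans (ler_norm_sum _ _ _))// mulr_suml ler_sum// => j _.
  rewrite normrZ mulrC ler_wpM2l// (le_trans (hp_CS norm_hp _ _))//.
  by rewrite ler_piMr.
have h1 : `|k| ^+ 2 <= `|k1| * (K * `|k|).
  rewrite norm_hp e1; apply: (le_trans (ler_norm _)); apply: (le_trans (hp_CS norm_hp _ _)).
  by rewrite ler_wpM2l.
rewrite -!norm_hp -exprMn lerXn2r ?nnegrE ?mulr_ge0 ?(ltW K0)//.
have [k0|k0] := eqVneq `|k| 0; first by rewrite k0 mulr_ge0// ltW.
have nk0 : 0 < `|k| by rewrite lt_def k0/=.
by rewrite -(ler_pM2r nk0) -expr2 (le_trans h1)//; rewrite mulrA [`|k1| * K]mulrC.
Qed.
End gaussian_functionals.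

(** * The noise belongs to the Gaussian space *)

Section law_transfer.
Context {d1 d2 d'} {O1 : measurableType d1} {O2 : measurableType d2} {E : measurableType d'} {R : realType}
  (P1 : probability O1 R) (P2 : probability O2 R) (X1 : O1 -> E) (X2 : O2 -> E).
Hypotheses (mX1 : measurable_fun setT X1) (mX2 : measurable_fun setT X2).
Hypothesis law : forall A, measurable A -> P1 (X1 @^-1` A) = P2 (X2 @^-1` A).

Lemma law_integral (f : E -> \bar R) : measurable_fun setT f -> (forall x, (0 <= f x)%E) ->
  (\int[P1]_w f (X1 w) = \int[P2]_w f (X2 w))%E.
Proof.
move=> mf f0.
have h1 := @ge0_integral_pushforward _ _ _ _ R X1 mX1 P1 setT f measurableT mf (fun x _ => f0 x).
have h2 := @ge0_integral_pushforward _ _ _ _ R X2 mX2 P2 setT f measurableT mf (fun x _ => f0 x).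
rewrite !preimage_setT in h1 h2; rewrite -h1 -h2.
by apply: eq_measure_integral => A mA _ /=; rewrite /pushforward law.
Qed.

Lemma law_Ex (f : E -> R) : measurable_fun setT f -> Ex P1 (fun w => f (X1 w)) = Ex P2 (fun w => f (X2 w)).
Proof.
move=> mf; rewrite /Ex /Rintegral; congr fine.
have mE : measurable_fun setT (EFin \o f) by exact/measurable_EFinP.
have ep (O : Type) (X : O -> E) : (fun w => (f (X w))%:E)^\+%E = (fun w => (EFin \o f)^\+%E (X w)).
  by apply/funext => w; rewrite !funeposE.
have en (O : Type) (X : O -> E) : (fun w => (f (X w))%:E)^\-%E = (fun w => (EFin \o f)^\-%E (X w)).
  by apply/funext => w; rewrite !funenegE.
rewrite [LHS]integralE [RHS]integralE !ep !en.
rewrite (law_integral (measurable_funepos mE) (fun x => funepos_ge0 _ x)).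
by rewrite (law_integral (measurable_funeneg mE) (fun x => funeneg_ge0 _ x)).
Qed.
End law_transfer.

Section expectation_lemmas.
Context {d} {Om : measurableType d} {R : realType} (P : probability Om R).

Lemma orth_bdd (Z h : Om -> R) (M : R) : int1 P Z -> measurable_fun setT h -> (forall w, `|h w| <= M) ->
  (forall B, measurable B -> Ex P (fun w => Z w * \1_(h @^-1` B) w) = 0) ->
  Ex P (fun w => Z w * h w) = 0.
Proof.
move=> iZ mh hM H.
have mZ := int1_meas iZ.
have M0 : 0 <= M by apply: le_trans (normr_ge0 _) (hM point).
pose m := (Num.truncn M).+1.
have Mm : M < m%:R by rewrite truncnS_gt.
have step n : exists hn : Om -> R, [/\ measurable_fun setT hn, forall w, `|h w - hn w| <= n.+1%:R^-1 &
    Ex P (fun w => Z w * hn w) = 0].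
  (* The values [lo k] form a grid of mesh [1/(n+1)] from [-m] to [m], where [m > M]; rounding [h]
     down to it costs at most one mesh. *)
  pose N := (2 * m * n.+1)%N.
  pose lo k : R := - m%:R + k%:R / n.+1%:R.
  pose B k := `[lo k, lo k.+1[%classic.
  have mB k : measurable (h @^-1` B k).
    by rewrite -[X in measurable X]setTI; apply: mh => //; exact: measurable_itv.
  exists (fun w => \sum_(k < N) lo k * \1_(h @^-1` B k) w); split.
  - by apply: measurable_sum => k; apply: measurable_funM => //; exact: measurable_indic.
  - move=> w.
    have h0 : 0 <= (h w + m%:R) * n.+1%:R.
      rewrite mulr_ge0//; have := hM w; rewrite ler_norml => /andP[h1 _].
      by rewrite -lerBlDr sub0r (le_trans _ h1)// lerN2 ltW.
    pose k := Num.truncn ((h w + m%:R) * n.+1%:R).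
    have /andP[k1 k2] := truncn_itv h0; rewrite -/k in k1 k2.
    have kN : (k < N)%N.
      rewrite -(ltr_nat R); apply: (le_lt_trans k1); rewrite /N natrM ltr_pM2r// natrM.
      have := hM w; rewrite ler_norml => /andP[_ h2]; lra.
    have lok : lo k <= h w < lo k.+1.
      rewrite /lo; apply/andP; split.
        by rewrite addrC lerBlDr ler_pdivrMr.
      by rewrite addrC ltrBrDr ltr_pdivlMr.
    rewrite (bigD1 (Ordinal kN))//= big1 ?addr0.
      rewrite indicE mem_set/= ?mulr1; last by rewrite /B/= in_itv/=.
      case/andP : lok => l1 l2; rewrite ger0_norm ?subr_ge0// lerBlDl (le_trans (ltW l2))//.
      by rewrite /lo -natr1 mulrDl mul1r addrA.
    move=> j jk; rewrite indicE memNset ?mulr0//= /B/= in_itv/= => /andP[j1 j2].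
    have jk' : (j : nat) != k by apply: contra jk => /eqP e; apply/eqP/val_inj.
    case/andP : lok => l1 l2.
    have lo_lt a b : lo a < lo b -> (a < b)%N.
      by rewrite /lo ltrD2l ltr_pM2r ?invr_gt0// ltr_nat.
    have a1 := lo_lt _ _ (le_lt_trans j1 l2); have a2 := lo_lt _ _ (le_lt_trans l1 j2).
    by move: jk'; rewrite neq_ltn; rewrite !ltnS in a1 a2; rewrite !ltnNge a1 a2.
  - have i1 (k : 'I_N) : int1 P (fun w => lo k * (Z w * \1_(h @^-1` B k) w)).
      apply: int1Z; apply: (int1_le (Y := fun w => `|Z w|)); last exact: int1_abs.
        by apply: measurable_funM => //; exact: measurable_indic.
      move=> w; rewrite normrM ler_piMr// indicE; case: (_ \in _); rewrite ?normr1 ?normr0//.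
    transitivity (Ex P (fun w => \sum_(k < N) lo k * (Z w * \1_(h @^-1` B k) w))).
      by congr (Ex P _); apply/funext => w; rewrite mulr_sumr; apply: eq_bigr => k _; ring.
    rewrite Ex_sum// big1// => k _; rewrite ExZ ?H ?mulr0//.
      exact: measurable_itv.
    apply: (int1_le (Y := fun w => `|Z w|)); last exact: int1_abs.
      by apply: measurable_funM => //; exact: measurable_indic.
    by move=> w; rewrite normrM ler_piMr// indicE; case: (_ \in _); rewrite ?normr1 ?normr0.
have iZh (g : Om -> R) K : measurable_fun setT g -> (forall w, `|g w| <= K) -> int1 P (fun w => Z w * g w).
  move=> mg gK; apply: (int1_le (Y := fun w => K * `|Z w|)); last by apply: int1Z; exact: int1_abs.
    exact: measurable_funM.
  by move=> w; rewrite normrM mulrC ler_wpM2r.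
have bound n : `|Ex P (fun w => Z w * h w)| <= n.+1%:R^-1 * Ex P (fun w => `|Z w|).
  have [hn [mhn hhn Ehn]] := step n.
  have i2 : int1 P (fun w => Z w * (h w - hn w)).
    by apply: (iZh _ n.+1%:R^-1) => //; exact: measurable_funB.
  have -> : Ex P (fun w => Z w * h w) = Ex P (fun w => Z w * (h w - hn w)).
    rewrite -[RHS]addr0 -Ehn -ExD//; last first.
      apply: (iZh _ (M + n.+1%:R^-1)) => // w.
      rewrite (_ : hn w = h w - (h w - hn w)); last by ring.
      by apply: (le_trans (ler_normB _ _)); rewrite lerD.
    by congr (Ex P _); apply/funext => w; ring.
  apply: (le_trans (Ex_abs i2)); rewrite -ExZ; last exact: int1_abs.
  apply: Ex_le; [exact: int1_abs|by apply: int1Z; exact: int1_abs|].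
  by move=> w; rewrite normrM mulrC ler_wpM2r.
apply/eqP; rewrite -normr_eq0 eq_le normr_ge0 andbT.
have c0 : n.+1%:R^-1 * Ex P (fun w => `|Z w|) @[n --> \oo] --> 0.
  by rewrite -(mul0r (Ex P (fun w => `|Z w|))); apply: cvgM; [exact: cvg_harmonic|exact: cvg_cst].
by apply: (cvgr_to_ge c0); exact: nearW.
Qed.

(* The squared norm of [M t] is the expected sum of squared increments.  The part of the squares exceeding [K / n] is negligible by the
   third hypothesis; the rest is at most [sqrt (K / n)] times the variation, hence tends to [0]. *)
Lemma fv_martingale (M : R -> Om -> R) (B : Om -> R) (t : R) : 0 <= t ->
  (forall s, 0 <= s <= t -> L2 P (M s)) -> (forall w, M 0 w = 0) -> L2 P B ->
  (forall s s', 0 <= s -> s <= s' -> s' <= t -> ip P (M s) (fun w => M s' w - M s w) = 0) ->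
  (forall (K : R) n k, 0 <= K -> (k < n)%N ->
    Ex P (fun w => Num.max 0 ((M (t * k.+1%:R / n%:R) w - M (t * k%:R / n%:R) w) ^+ 2 - K / n%:R)) <=
      n%:R^-1 * Ex P (fun w => Num.max 0 (B w ^+ 2 - K))) ->
  {ae P, forall w, exists V, forall n,
     \sum_(k < n) `|M (t * k.+1%:R / n%:R) w - M (t * k%:R / n%:R) w| <= V} ->
  ip P (M t) (M t) = 0.
Proof.
move=> t0 LM M0 LB orth trunc fv.
pose D n k w := M (t * k.+1%:R / n%:R) w - M (t * k%:R / n%:R) w.
have tk (n k : nat) : (k <= n)%N -> (0 < n)%N -> 0 <= t * k%:R / n%:R <= t.
  move=> kn n0; rewrite divr_ge0 ?mulr_ge0//= ler_pdivrMr ?ltr0n// ler_wpM2l// ler_nat//.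
have LD n k : (k < n)%N -> L2 P (D n k).
  move=> kn; have n0 : (0 < n)%N by case: n kn.
  by apply: L2B; apply: LM; apply: tk => //; exact: ltnW.
have quad n : (0 < n)%N -> ip P (M t) (M t) = \sum_(k < n) ip P (D n k) (D n k).
  move=> n0.
  suff H k : (k <= n)%N -> ip P (M (t * k%:R / n%:R)) (M (t * k%:R / n%:R)) = \sum_(i < k) ip P (D n i) (D n i).
    by rewrite -(H n (leqnn n)) mulfK// pnatr_eq0 -lt0n.
  elim: k => [_|k IH kn].
    rewrite big_ord0 mulr0 mul0r /ip -[RHS](Ex_cst P); congr (Ex P _); apply/funext => w.
    by rewrite M0 mulr0.
  rewrite big_ord_recr/= -IH ?(ltnW kn)//.
  have -> : M (t * k.+1%:R / n%:R) = fun w => M (t * k%:R / n%:R) w + 1 * D n k w.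
    by apply/funext => w; rewrite /D; ring.
  have /andP[k0 kt] := tk n k (ltnW kn) n0; have /andP[k0' kt'] := tk n k.+1 kn n0.
  rewrite ip_quad//; [|by apply: LM; rewrite k0|exact: LD].
  have -> : ip P (M (t * k%:R / n%:R)) (D n k) = 0.
    apply: orth => //; rewrite ler_pM2r ?invr_gt0 ?ltr0n// ler_wpM2l// ler_nat//.
  by rewrite mulr0 mul0rn addr0 expr1n mul1r.
pose S K n w := \sum_(k < n) Num.min (D n k w ^+ 2) (K / n%:R).
have bound (K : R) n : 0 <= K -> (0 < n)%N -> ip P (M t) (M t) <= Ex P (S K n) + Ex P (fun w => Num.max 0 (B w ^+ 2 - K)).
  move=> K0 n0; rewrite (quad n n0).
  have mD k : (k < n)%N -> measurable_fun setT (fun w => D n k w ^+ 2) by move=> /LD[_ /int1_meas].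
  have imin (k : 'I_n) : int1 P (fun w => Num.min (D n k w ^+ 2) (K / n%:R)).
    have Kn : 0 <= K / n%:R by rewrite divr_ge0.
    apply: (@int1_bdd _ _ _ _ (K / n%:R)) => [|w].
      by apply: measurable_minr => //; exact: mD.
    by rewrite ger0_norm ?ge_min ?lexx ?orbT// le_min sqr_ge0.
  have imax (k : 'I_n) : int1 P (fun w => Num.max 0 (D n k w ^+ 2 - K / n%:R)).
    apply: (int1_le (Y := fun w => D n k w ^+ 2)); last by have [] := LD n k (ltn_ord k).
      by apply: measurable_maxr => //; apply: measurable_funB => //; exact: mD.
    move=> w; rewrite ger0_norm ?le_max ?lexx// ge_max sqr_ge0/=.
    by rewrite gerBl divr_ge0.
  rewrite /S Ex_sum//.
  apply: (@le_trans _ _ (\sum_(k < n) (Ex P (fun w => Num.min (D n k w ^+ 2) (K / n%:R)) +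
      Ex P (fun w => Num.max 0 (D n k w ^+ 2 - K / n%:R))))).
    apply: ler_sum => k _; rewrite -ExD// ip_sqr; apply: Ex_le.
    - by have [] := LD n k (ltn_ord k).
    - exact: int1D.
    - move=> w; rewrite /Num.min /Num.max; case: ltP => h; case: ltP; lra.
  rewrite big_split/= lerD2l.
  apply: (@le_trans _ _ (\sum_(k < n) n%:R^-1 * Ex P (fun w => Num.max 0 (B w ^+ 2 - K)))).
    by apply: ler_sum => k _; exact: trunc.
  by rewrite sumr_const card_ord -[leLHS]mulr_natl mulrA mulfV ?mul1r// pnatr_eq0 -lt0n.
have S0 K : 0 <= K -> Ex P (S K n.+1) @[n --> \oo] --> 0.
  move=> K0; rewrite -[X in _ --> X](Ex_cst P 0).
  apply: (@Ex_dct _ _ _ P _ _ (fun=> K)).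
  - move=> n; apply: measurable_sum => k; apply: measurable_minr => //.
    by have [_ /int1_meas] := LD n.+1 k (ltn_ord k).
  - exact: measurable_cst.
  - apply: filterS fv => w [V HV].
    have h : Num.sqrt (K / n.+1%:R) * V @[n --> \oo] --> 0.
      rewrite -(mul0r V); apply: cvgM; last exact: cvg_cst.
      have h : K / n.+1%:R @[n --> \oo] --> 0.
        by rewrite -(mulr0 K); apply: cvgM; [exact: cvg_cst|exact: cvg_harmonic].
      by rewrite -[X in _ --> X]sqrtr0; apply: (cvg_comp (fun n => K / n.+1%:R) Num.sqrt h); exact: sqrt_continuous.
    apply: (squeeze_cvgr _ (@cvg_cst _ 0 _ _ _) h); apply: nearW => n.
    have Kn : 0 <= K / n.+1%:R by rewrite divr_ge0.
    apply/andP; split.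
      by apply: sumr_ge0 => k _; rewrite le_min sqr_ge0.
    apply: (@le_trans _ _ (Num.sqrt (K / n.+1%:R) * \sum_(k < n.+1) `|D n.+1 k w|)); last first.
      by rewrite ler_wpM2l ?sqrtr_ge0//; exact: HV.
    rewrite mulr_sumr; apply: ler_sum => k _.
    set x := D _ _ _; rewrite -(real_normK (num_real x)) -{1}(sqr_sqrtr Kn).
    set q := Num.sqrt _; have q0 : 0 <= q by exact: sqrtr_ge0.
    have x0 := normr_ge0 x; rewrite ge_min; case: (leP `|x| q) => xq; apply/orP; [left|right].
      by rewrite expr2 ler_wpM2r.
    by rewrite expr2 ler_wpM2l// ltW.
  - exact: int1_cst.
  - move=> n w; have Kn : 0 <= K / n.+1%:R by rewrite divr_ge0.
    rewrite ger0_norm; last by apply: sumr_ge0 => k _; rewrite le_min sqr_ge0.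
    apply: (@le_trans _ _ (\sum_(k < n.+1) K / n.+1%:R)).
      by apply: ler_sum => k _; rewrite ge_min lexx orbT.
    by rewrite sumr_const card_ord -[leLHS]mulr_natr mulfVK.
have b2 (K : R) : 0 <= K -> ip P (M t) (M t) <= Ex P (fun w => Num.max 0 (B w ^+ 2 - K)).
  move=> K0; rewrite -[leRHS]add0r.
  have h : Ex P (S K n.+1) + Ex P (fun w => Num.max 0 (B w ^+ 2 - K)) @[n --> \oo] --> 0 + Ex P (fun w => Num.max 0 (B w ^+ 2 - K)).
    by apply: cvgD; [exact: S0|exact: cvg_cst].
  by apply: (cvgr_to_ge h); apply: nearW => n; exact: bound.
have cB : Ex P (fun w => Num.max 0 (B w ^+ 2 - n%:R)) @[n --> \oo] --> 0.
  have mB : measurable_fun setT (fun w => B w ^+ 2) by have [_ /int1_meas] := LB.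
  rewrite -[X in _ --> X](Ex_cst P 0); apply: (@Ex_dct _ _ _ P _ _ (fun w => B w ^+ 2)).
  - by move=> n; apply: measurable_maxr => //; exact: measurable_funB.
  - exact: measurable_cst.
  - apply: aeW => w; apply: cvg_near_cst; exists (Num.truncn (B w ^+ 2)).+1 => // n /= nB.
    apply/max_idPl; rewrite subr_le0 ltW// (lt_le_trans (truncnS_gt _))// ler_nat//.
  - by have [] := LB.
  - move=> n w; rewrite ger0_norm ?le_max ?lexx// ge_max sqr_ge0/=.
    by rewrite gerBl.
apply/eqP; rewrite eq_le ip_ge0 andbT.
by apply: (cvgr_to_ge cB); apply: nearW => n; exact: b2.
Qed.
End expectation_lemmas.

Lemma law_ae {d1 d2 d'} {O1 : measurableType d1} {O2 : measurableType d2} {E : measurableType d'} {R : realType}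
    (P1 : probability O1 R) (P2 : probability O2 R) (X1 : O1 -> E) (X2 : O2 -> E) (A : set E) :
  measurable_fun setT X2 ->
  (forall A, measurable A -> P1 (X1 @^-1` A) = P2 (X2 @^-1` A)) -> measurable_fun setT X1 -> measurable A ->
  {ae P1, forall w, A (X1 w)} -> {ae P2, forall w, A (X2 w)}.
Proof.
move=> mX2 law mX1 mA.
have m1 : measurable (X1 @^-1` (~` A)) by rewrite -[X in measurable X]setTI; apply: mX1 => //; exact: measurableC.
have m2 : measurable (X2 @^-1` (~` A)) by rewrite -[X in measurable X]setTI; apply: mX2 => //; exact: measurableC.
move=> h1; have h : P1.-negligible (X1 @^-1` (~` A)) by exact: h1.
have h0 : P1 (X1 @^-1` (~` A)) = 0%E by apply/negligibleP.
suff : P2.-negligible (X2 @^-1` (~` A)) by [].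
by apply/negligibleP; [exact: m2|rewrite -[LHS](law _ (measurableC mA))].
Qed.

(** * Two independent copies and their rotations *)

Section product_expectation.
Context {d1 d2} {O1 : measurableType d1} {O2 : measurableType d2} {R : realType}
  (P1 : probability O1 R) (P2 : probability O2 R).
Local Notation Q := (P1 \x P2)%E.

Lemma fst_law A : measurable A -> Q (fst @^-1` A) = P1 A.
Proof.
move=> mA; rewrite (_ : fst @^-1` A = A `*` setT); last by apply/seteqP; split=> p //= -[].
by rewrite product_measure1E// -[RHS]mule1; congr (_ * _)%E; exact: probability_setT.
Qed.

Lemma snd_law A : measurable A -> Q (snd @^-1` A) = P2 A.
Proof.
move=> mA; rewrite (_ : snd @^-1` A = setT `*` A); last by apply/seteqP; split=> p //= -[].
by rewrite product_measure1E// -[RHS]mul1e; congr (_ * _)%E; exact: probability_setT.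
Qed.

Lemma prod_Ex2 (F : O1 * O2 -> R) (g : O2 -> R) : int1 Q F -> int1 P2 g ->
  (forall w2, int1 P1 (fun w1 => F (w1, w2))) ->
  (forall w2, Ex P1 (fun w1 => F (w1, w2)) = g w2) -> Ex Q F = Ex P2 g.
Proof.
move=> iF ig iF2 Fg; apply: EFin_inj; rewrite !EFin_Ex//.
rewrite -(@integral21_prod_meas1 _ _ _ _ R P1 P2 (EFin \o F))//; apply: eq_integral => w2 _.
by rewrite /fubini_G /= -Fg EFin_Ex.
Qed.

Lemma prod_Ex1 (F : O1 * O2 -> R) (g : O1 -> R) : int1 Q F -> int1 P1 g ->
  (forall w1, int1 P2 (fun w2 => F (w1, w2))) ->
  (forall w1, Ex P2 (fun w2 => F (w1, w2)) = g w1) -> Ex Q F = Ex P1 g.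
Proof.
move=> iF ig iF2 Fg; apply: EFin_inj; rewrite !EFin_Ex//.
rewrite -(@integral12_prod_meas1 _ _ _ _ R P1 P2 (EFin \o F))//; apply: eq_integral => w2 _.
by rewrite /fubini_F /= -Fg EFin_Ex.
Qed.

Lemma prod_ExM (f : O1 -> R) (g : O2 -> R) K : measurable_fun setT f -> measurable_fun setT g ->
  (forall w, `|f w| <= K) -> (forall w, `|g w| <= K) ->
  Ex Q (fun p => f p.1 * g p.2) = Ex P1 f * Ex P2 g.
Proof.
move=> mf mg fK gK.
have if_ : int1 P1 f by exact: (@int1_bdd _ _ _ _ K).
have ig : int1 P2 g by exact: (@int1_bdd _ _ _ _ K).
rewrite -ExZ//; apply: prod_Ex2.
- apply: (@int1_bdd _ _ _ _ (K * K)) => [|p]; last by rewrite normrM ler_pM.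
  by apply: measurable_funM; apply: measurableT_comp.
- exact: int1Z.
- by move=> w2; rewrite /=; under eq_fun do rewrite mulrC; exact: int1Z.
- by move=> w2; rewrite /= mulrC -ExZ//; congr (Ex P1 _); apply/funext => w; rewrite mulrC.
Qed.

Lemma prod_isG (v1 v2 : R) (f : O1 -> R) (g : O2 -> R) : isG P1 v1 f -> isG P2 v2 g ->
  isG Q (v1 + v2) (fun p => f p.1 + g p.2).
Proof.
move=> [mf Gf] [mg Gg]; split.
  by apply: measurable_funD; apply: measurableT_comp.
move=> c; have [cf sf] := Gf c; have [cg sg] := Gg c.
have mcf : measurable_fun setT (fun w => c * f w) by exact: measurable_funM.
have mcg : measurable_fun setT (fun w => c * g w) by exact: measurable_funM.
have b (h1 h2 : R -> R) : measurable_fun setT h1 -> measurable_fun setT h2 ->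
    (forall x, `|h1 x| <= 1) -> (forall x, `|h2 x| <= 1) ->
    int1 Q (fun p => h1 (c * f p.1) * h2 (c * g p.2)) /\
    Ex Q (fun p => h1 (c * f p.1) * h2 (c * g p.2)) = Ex P1 (fun w => h1 (c * f w)) * Ex P2 (fun w => h2 (c * g w)).
  move=> mh1 mh2 b1 b2.
  have m1 : measurable_fun setT (fun w => h1 (c * f w)) by exact: measurableT_comp.
  have m2 : measurable_fun setT (fun w => h2 (c * g w)) by exact: measurableT_comp.
  split; last exact: (prod_ExM m1 m2 (fun=> b1 _) (fun=> b2 _)).
  apply: (@int1_bdd _ _ _ _ (1 * 1)) => [|p]; last by rewrite normrM ler_pM.
  apply: measurable_funM.
    exact: (measurableT_comp m1 measurable_fst).
  exact: (measurableT_comp m2 measurable_snd).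
have mc := continuous_measurable_fun (@continuous_cos R).
have ms := continuous_measurable_fun (@continuous_sin R).
have [i1 e1] := b _ _ mc mc (@bcos _) (@bcos _).
have [i2 e2] := b _ _ ms ms (@bsin _) (@bsin _).
have [i3 e3] := b _ _ ms mc (@bsin _) (@bcos _).
have [i4 e4] := b _ _ mc ms (@bcos _) (@bsin _).
split.
  have -> : (fun p => cos (c * (f p.1 + g p.2))) =
      fun p => cos (c * f p.1) * cos (c * g p.2) - sin (c * f p.1) * sin (c * g p.2).
    by apply/funext => p; rewrite mulrDr cosD.
  rewrite ExB// e1 e2 sf mul0r subr0 cf cg -expRD; congr expR; ring.
have -> : (fun p => sin (c * (f p.1 + g p.2))) =
    fun p => sin (c * f p.1) * cos (c * g p.2) + cos (c * f p.1) * sin (c * g p.2).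
  by apply/funext => p; rewrite mulrDr sinD.
by rewrite ExD// e3 e4 sf sg mul0r mulr0 addr0.
Qed.
End product_expectation.

Section rotation.
Context {R : realType} {T : R} (T0 : 0 < T) {d} {Om : measurableType d} (P : probability Om R).
Local Notation C := (path_space T).
Local Notation Q := (P \x P)%E.
Local Notation lam := (@lebesgue_measure R).
Context (X : {RV P >-> C}) (GX : gfam P (fun b w => b (X w)) clf).
Context (c s : R) (cs1 : c ^+ 2 + s ^+ 2 = 1).

Let mev (F : Om * Om -> C) r : measurable_fun setT F -> measurable_fun setT (fun p => F p r).
Proof. by move=> mF; apply: (measurableT_comp (@eval_measurable R T r)). Qed.

Definition Xrot (p : Om * Om) : C := c *: X p.1 + s *: X p.2.
Definition Xort (p : Om * Om) : C := - s *: X p.1 + c *: X p.2.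

Let clin a b : measurable_fun setT (fun p : Om * Om => a *: X p.1 + b *: X p.2 : C).
Proof.
apply: (measurable_path T0) => r _.
have -> : (fun p : Om * Om => (a *: X p.1 + b *: X p.2 : C) r) = fun p => a * X p.1 r + b * X p.2 r by [].
have mX r' : measurable_fun setT (fun w => X w r').
  by apply: (measurableT_comp (eval_measurable r')).
apply: measurable_funD; apply: measurable_funM => //.
  exact: (measurableT_comp (mX r) measurable_fst).
exact: (measurableT_comp (mX r) measurable_snd).
Qed.

Lemma Xrot_meas : measurable_fun setT Xrot. Proof. exact: clin. Qed.
Lemma Xort_meas : measurable_fun setT Xort. Proof. exact: clin. Qed.

Let pr (i : bool * R) (q : C * C) : R := if i.1 then q.1 i.2 else q.2 i.2.
Let S : set (bool * R) := [set i | i.2 \in `[0, T]].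
Let gen := \bigcup_(i in S) preimage_set_system setT (pr i) measurable.

Let gen_pr i : S i -> measurable_fun setT (pr i : g_sigma_algebraType gen -> R).
Proof.
move=> Si _ B mB; rewrite setTI; apply: sub_sigma_algebra.
by exists i => //; exists B => //; rewrite setTI.
Qed.

Let pair_gen (A : set (C * C)) : measurable A -> <<s gen >> A.
Proof.
move=> mA; suff : measurable_fun setT (id : g_sigma_algebraType gen -> C * C).
  by move/(_ measurableT A mA); rewrite setTI.
apply/measurable_fun_pairP; split; apply: (measurable_path T0) => r rT.
  exact: (@gen_pr (true, r)).
exact: (@gen_pr (false, r)).
Qed.

Let lc_pair (l : seq (R * (bool * R))) : exists b1 b2, [/\ clf b1, clf b2 & forall q : C * C, lc pr l q = b1 q.1 + b2 q.2].
Proof.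
elim: l => [|[x [i r]] l [b1 [b2 [cb1 cb2 bE]]]].
  exists (fun=> 0), (fun=> 0); split; try exact: clf0.
  by move=> q; rewrite /lc big_nil addr0.
case: i.
  exists (fun f : C => x * f r + b1 f), b2; split=> //.
    by apply: clfD => //; apply: clfZ; exact: clf_ev.
  by move=> q; rewrite /lc big_cons -/(lc _ _ q) bE /= addrA.
exists b1, (fun f : C => x * f r + b2 f); split=> //.
  by apply: clfD => //; apply: clfZ; exact: clf_ev.
by move=> q; rewrite /lc big_cons -/(lc _ _ q) bE /pr /=; ring.
Qed.

Let Gb b : clf b -> isG P (ip P (fun w => b (X w)) (fun w => b (X w))) (fun w => b (X w)).
Proof. by move=> cb; apply: (gfam_ospan GX); apply: ospan_gen => //; exact: GX.1. Qed.

(** A rotation preserves the variance of [b1(X) + b2(X')], since [c^2 + s^2 = 1]. The law of the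
    whole pair is needed, and not only that of [Xrot], because martingales will be considered with
    respect to the past of both copies. *)
Lemma rot_law (A : set (C * C)) : measurable A ->
  Q ((fun p => (Xrot p, Xort p)) @^-1` A) = Q ((fun p => (X p.1, X p.2)) @^-1` A).
Proof.
move=> /pair_gen.
apply: (@gaussian_law_eq R _ (C * C)%type pr S _ _ _ _ Q Q).
- move=> [[] r] _; rewrite /pr /=; apply: mev; [exact: Xrot_meas|exact: Xort_meas].
- move=> [[] r] _; rewrite /pr /=.
    by apply: (@mev (fun p => X p.1)); exact: measurableT_comp.
  by apply: (@mev (fun p => X p.2)); exact: measurableT_comp.
move=> l _; have [b1 [b2 [cb1 cb2 bE]]] := lc_pair l.
pose K b := ip P (fun w => b (X w)) (fun w => b (X w)) : R.
exists (K b1 + K b2); last first.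
  have -> : lc (fun i p => pr i (X p.1, X p.2)) l = fun p => b1 (X p.1) + b2 (X p.2).
    by apply/funext => p; rewrite -(bE (X p.1, X p.2)).
  exact: (prod_isG (Gb cb1) (Gb cb2)).
pose d1 f := c * b1 f + (- s) * b2 f; pose d2 f := s * b1 f + c * b2 f.
have cd1 : clf d1 by apply: clfD; exact: clfZ.
have cd2 : clf d2 by apply: clfD; exact: clfZ.
have -> : lc (fun i p => pr i (Xrot p, Xort p)) l = fun p => d1 (X p.1) + d2 (X p.2).
  apply/funext => p; rewrite [LHS](bE (Xrot p, Xort p))/= /Xrot /Xort /d1 /d2.
  have [lb1 _] := cb1; have [lb2 _] := cb2.
  have e (b : C -> R) (x y : R) (f g : C) : scalar b -> b (x *: f + y *: g) = x * b f + y * b g.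
    move=> lb; rewrite lb; congr (_ + _); have := lb y g 0; have := lb 0 g 0.
    by have := lb 1 0 0; rewrite scaler0 scale0r !addr0 => h1 h2 ->; lra.
  by rewrite (e _ _ _ _ _ lb1) (e _ _ _ _ _ lb2); ring.
suff -> : K b1 + K b2 = K d1 + K d2 by exact: (prod_isG (Gb cd1) (Gb cd2)).
rewrite /K /d1 /d2.
have L1 : L2 P (fun w => b1 (X w)) by exact: GX.1.
have L2' : L2 P (fun w => b2 (X w)) by exact: GX.1.
rewrite !ipDl ?ipDr ?ipZl ?ipZr//; try (by do ? [apply: L2D|apply: L2Z]).
rewrite (ipC P (fun w => b2 (X w)) (fun w => b1 (X w))).
rewrite -[LHS]mul1r -cs1; ring.
Qed.

Lemma Xrot_law (A : set C) : measurable A -> Q (Xrot @^-1` A) = P (X @^-1` A).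
Proof.
move=> mA; have mA' : measurable (A `*` [set: C]) by exact: measurableX.
transitivity (Q ((fun p => (Xrot p, Xort p)) @^-1` (A `*` setT))).
  by congr (Q _); apply/seteqP; split=> p /=; [|case].
rewrite rot_law// -(fst_law P P); last by rewrite -[X in measurable X]setTI; exact: measurable_funPT.
by congr (Q _); apply/seteqP; split=> p /=; [case|].
Qed.

Lemma Xrot_inv p : c *: Xrot p - s *: Xort p = X p.1 /\ s *: Xrot p + c *: Xort p = X p.2.
Proof.
split; apply/val_inj/funext => r /=.
  rewrite -[LHS]/(c * (c * X p.1 r + s * X p.2 r) - s * (- s * X p.1 r + c * X p.2 r)).
  by rewrite -[RHS]mul1r -cs1; ring.
rewrite -[LHS]/(s * (c * X p.1 r + s * X p.2 r) + c * (- s * X p.1 r + c * X p.2 r)).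
by rewrite -[RHS]mul1r -cs1; ring.
Qed.

End rotation.

Lemma clamp_le {R : realType} (N x : R) : 0 <= N -> `|Num.max (- N) (Num.min N x)| <= N.
Proof.
by move=> N0; rewrite ler_norml le_max lexx/= ge_max ge_min lexx/= andbT; lra.
Qed.

Lemma clamp_id {R : realType} (N x : R) : `|x| <= N -> Num.max (- N) (Num.min N x) = x.
Proof.
by rewrite ler_norml => /andP[h1 h2]; rewrite (min_idPr h2) (max_idPr h1).
Qed.

Lemma clamp_abs {R : realType} (N x : R) : 0 <= N -> `|Num.max (- N) (Num.min N x)| <= `|x|.
Proof.
move=> N0; rewrite /Num.max /Num.min; case: (ltP N x) => h1; case: ltP => h2.
- by rewrite !ger0_norm ?(le_trans N0)// ltW.
- by rewrite normrN !ger0_norm ?(le_trans N0)// ltW.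
- by [].
- by rewrite normrN ger0_norm// ler0_norm; lra.
Qed.

Lemma ip_clamp_lim {d} {Om : measurableType d} {R : realType} (P : probability Om R) (Z h : Om -> R) :
  L2 P Z -> L2 P h -> (forall n : nat, Ex P (fun w => Z w * Num.max (- n%:R) (Num.min n%:R (h w))) = 0) ->
  Ex P (fun w => Z w * h w) = 0.
Proof.
move=> LZ Lh H.
have lim : Ex P (fun w => Z w * Num.max (- n%:R) (Num.min n%:R (h w))) @[n --> \oo] --> Ex P (fun w => Z w * h w).
  apply: (@Ex_dct _ _ _ P _ _ (fun w => `|Z w * h w|)).
  - move=> n; apply: measurable_funM; first by have [] := LZ.
    by apply: measurable_maxr => //; apply: measurable_minr => //; have [] := Lh.
  - by apply: measurable_funM; [have [] := LZ|have [] := Lh].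
  - apply: aeW => w; apply: cvg_near_cst; exists (Num.truncn `|h w|).+1 => // n /= nh.
    by rewrite clamp_id// ltW// (lt_le_trans (truncnS_gt _))// ler_nat.
  - by apply: int1_abs; exact: L2_mul.
  - by move=> n w; rewrite !normrM ler_wpM2l// clamp_abs.
apply: (cvg_unique _ lim); first exact: Rhausdorff.
by rewrite (_ : (fun n => _) = fun=> 0); [exact: cvg_cst|apply/funext].
Qed.

Lemma Rint_incr {R : realType} (h : R -> R) (a b : R) : a <= b -> 0 <= a ->
  (@lebesgue_measure R).-integrable `[0, b] (EFin \o h) ->
  `|\int[@lebesgue_measure R]_(x in `[0, b]) h x - \int[@lebesgue_measure R]_(x in `[0, a]) h x| <=
  \int[@lebesgue_measure R]_(x in `[0, b]) `|h x| - \int[@lebesgue_measure R]_(x in `[0, a]) `|h x|.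
Proof.
move=> ab a0 ih.
have iab : (@lebesgue_measure R).-integrable `[0, b] (EFin \o (fun x => `|h x|)).
  by have := integrable_norm ih.
rewrite !Rintegral_itvB//.
apply: le_normr_Rintegral => //.
by apply: integrableS ih => //; apply: subset_itvr; rewrite bnd_simp.
Qed.

(** Since [c^2] and [s^2] are at most 1, the square is at most [3 (x^2 + y^2 + z^2)]; the threshold
    [k] is then shared equally among the three terms. *)
Lemma ge0_sqr3 {R : realType} (x y z c s k : R) : c ^+ 2 + s ^+ 2 = 1 ->
  Num.max 0 ((x - c * y - s * z) ^+ 2 - k) <= Num.max 0 (3 * x ^+ 2 - k / 3) +
    Num.max 0 (3 * y ^+ 2 - k / 3) + Num.max 0 (3 * z ^+ 2 - k / 3).
Proof.
move=> cs.
have h : (x - c * y - s * z) ^+ 2 <= 3 * x ^+ 2 + 3 * y ^+ 2 + 3 * z ^+ 2.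
  have e : 3 * x ^+ 2 + 3 * y ^+ 2 + 3 * z ^+ 2 - (x - c * y - s * z) ^+ 2 =
     (x + c * y) ^+ 2 + (x + s * z) ^+ 2 + (c * y - s * z) ^+ 2 + 3 * (1 - c ^+ 2) * y ^+ 2 + 3 * (1 - s ^+ 2) * z ^+ 2 by ring.
  have c1 : 0 <= 1 - c ^+ 2 by have := sqr_ge0 s; lra.
  have s1 : 0 <= 1 - s ^+ 2 by have := sqr_ge0 c; lra.
  rewrite -subr_ge0 e.
  have y1 : 0 <= (1 - c ^+ 2) * y ^+ 2 by rewrite mulr_ge0// sqr_ge0.
  have z1 : 0 <= (1 - s ^+ 2) * z ^+ 2 by rewrite mulr_ge0// sqr_ge0.
  have := sqr_ge0 (x + c * y); have := sqr_ge0 (x + s * z); have := sqr_ge0 (c * y - s * z).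
  lra.
have m (a : R) : a <= Num.max 0 a by rewrite le_max lexx orbT.
have m0 (a : R) : 0 <= Num.max 0 a by rewrite le_max lexx.
rewrite ge_max !addr_ge0//=.
have := m (3 * x ^+ 2 - k / 3); have := m (3 * y ^+ 2 - k / 3); have := m (3 * z ^+ 2 - k / 3).
lra.
Qed.

Section rotation_drift.
Context {R : realType} {T : R} (T0 : 0 < T) {d} {Om : measurableType d} (P : probability Om R).
Local Notation C := (path_space T).
Local Notation Q := (P \x P)%E.
Local Notation lam := (@lebesgue_measure R).
Context (X : {RV P >-> C}) (GX : gfam P (fun b w => b (X w)) clf).
Context (alpha : R) (alpha0 : alpha != 0) (delta : R -> C -> R)
  (pd : progressively_measurable delta) (li : locally_integrable_drift P delta X).
Local Notation wf := (noise alpha delta).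
Local Notation gs a := (g_sigma_algebraType (past (@idfun C) a)).

Hypothesis incr : forall a b, 0 <= a -> a <= b -> b < T -> isG P (b - a) (fun w => wf b (X w) - wf a (X w)).
Hypothesis mart : forall a b, 0 <= a -> a <= b -> b < T -> forall (h : C -> R) K,
  measurable_fun setT (h : gs a -> R) -> (forall f, `|h f| <= K) ->
  Ex P (fun w => (wf b (X w) - wf a (X w)) * h (X w)) = 0.

Context (c s : R) (cs1 : c ^+ 2 + s ^+ 2 = 1).
Local Notation Xr := (Xrot X c s).
Local Notation Xo := (Xort X c s).

Let Dw a b (f : C) := wf b f - wf a f.

Let mwf a : 0 <= a < T -> measurable_fun setT (wf a).
Proof.
move=> /andP[a0 aT]; apply: (@noise_measurable _ _ alpha delta a _ C id) => //.
  by rewrite a0 ltW.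
by move=> r _; exact: eval_measurable.
Qed.

Let mDw a b : 0 <= a -> a <= b -> b < T -> measurable_fun setT (Dw a b).
Proof.
move=> a0 ab bT; apply: measurable_funB; apply: mwf.
  by rewrite (le_trans a0 ab).
by rewrite a0 (le_lt_trans ab).
Qed.

Let mXr : measurable_fun setT Xr. Proof. exact: Xrot_meas. Qed.
Let mX1 : measurable_fun setT (fun p : Om * Om => X p.1). Proof. exact: measurableT_comp. Qed.
Let mX2 : measurable_fun setT (fun p : Om * Om => X p.2). Proof. exact: measurableT_comp. Qed.

Let mXinv (A : set C) : measurable A -> measurable (X @^-1` A).
Proof. by move=> mA; rewrite -[Y in measurable Y]setTI; exact: measurable_funPT. Qed.

Let law1 (A : set C) : measurable A -> P (X @^-1` A) = Q ((fun p => X p.1) @^-1` A).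
Proof. by move=> mA; rewrite -(fst_law P P (mXinv mA)). Qed.
Let law2 (A : set C) : measurable A -> P (X @^-1` A) = Q ((fun p => X p.2) @^-1` A).
Proof. by move=> mA; rewrite -(snd_law P P (mXinv mA)). Qed.
Let law3 (A : set C) : measurable A -> P (X @^-1` A) = Q (Xr @^-1` A).
Proof. by move=> mA; rewrite (Xrot_law T0 GX cs1). Qed.

Let three (Y : Om * Om -> C) : measurable_fun setT Y ->
  (forall A, measurable A -> P (X @^-1` A) = Q (Y @^-1` A)) ->
  forall a b, 0 <= a -> a <= b -> b < T -> isG Q (b - a) (fun p => Dw a b (Y p)).
Proof.
move=> mY lY a b a0 ab bT; apply: (@isG_law _ _ _ _ _ P Q (b - a) (fun w => Dw a b (X w))).
- by apply: (measurableT_comp (mDw a0 ab bT)).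
- move=> A mA; apply: (lY (Dw a b @^-1` A)).
  by rewrite -[Y in measurable Y]setTI; exact: mDw.
- exact: incr.
Qed.

(** The failure of the noise to be linear, normalised to start at 0. The values of the paths cancel
    in its increments, leaving drift integrals and hence bounded variation; on the other hand each
    of its three terms is a martingale. *)
Let M b p := Dw 0 b (Xr p) - c * Dw 0 b (X p.1) - s * Dw 0 b (X p.2).

Let ME a b p : M b p - M a p = Dw a b (Xr p) - c * Dw a b (X p.1) - s * Dw a b (X p.2).
Proof. by rewrite /M /Dw; ring. Qed.

Let LDw (Y : Om * Om -> C) a b : measurable_fun setT Y ->
  (forall A, measurable A -> P (X @^-1` A) = Q (Y @^-1` A)) ->
  0 <= a -> a <= b -> b < T -> L2 Q (fun p => Dw a b (Y p)).
Proof. by move=> mY lY a0 ab bT; have [] := isG_L2 (three mY lY a0 ab bT). Qed.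

Let LM b : 0 <= b -> b < T -> L2 Q (M b).
Proof.
move=> b0 bT; apply: L2B; last by apply: L2Z; exact: (LDw mX2 law2).
by apply: L2B; [exact: (LDw mXr law3)|apply: L2Z; exact: (LDw mX1 law1)].
Qed.

Section orthogonality.
Context (a b : R) (a0 : 0 <= a) (ab : a <= b) (bT : b < T).

Let int1M (Y : Om * Om -> C) (g : Om * Om -> R) K : measurable_fun setT Y ->
  (forall A, measurable A -> P (X @^-1` A) = Q (Y @^-1` A)) ->
  measurable_fun setT g -> (forall p, `|g p| <= K) -> int1 Q (fun p => Dw a b (Y p) * g p).
Proof. by move=> mY lY mg gK; apply: L2_mul; [exact: LDw|exact: (@L2_bdd _ _ _ _ K)]. Qed.

Let to_gs {d'} {O : measurableType d'} (F G : O -> C) : (forall r, measurable_fun setT (fun w => F w r)) ->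
  (forall r, measurable_fun setT (fun w => G w r)) ->
  measurable_fun setT (fun p => (F p, G p) : gs a * gs a).
Proof. by move=> mF mG; apply/measurable_fun_pairP; split; apply: past_measurable. Qed.

Let ev_meas {d'} {O : measurableType d'} (F : O -> C) : measurable_fun setT F ->
  forall r, measurable_fun setT (fun w => F w r).
Proof. by move=> mF r; apply: (measurableT_comp (@eval_measurable R T r)). Qed.

Let gs_sec (g : gs a * gs a -> R) y : measurable_fun setT g -> measurable_fun setT (fun x : gs a => g (x, y)).
Proof.
move=> mg; apply: (measurableT_comp mg); apply/measurable_fun_pairP; split => /=.
  exact: measurable_id.
exact: measurable_cst.
Qed.

Let gs_sec2 (g : gs a * gs a -> R) y : measurable_fun setT g -> measurable_fun setT (fun x : gs a => g (y, x)).
Proof.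
move=> mg; apply: (measurableT_comp mg); apply/measurable_fun_pairP; split => /=.
  exact: measurable_cst.
exact: measurable_id.
Qed.

Let mart1 (g : gs a * gs a -> R) K : measurable_fun setT g -> (forall q, `|g q| <= K) ->
  Ex Q (fun p => Dw a b (X p.1) * g (X p.1, X p.2)) = 0.
Proof.
move=> mg gK; rewrite -[RHS](Ex_cst P).
have mgp : measurable_fun setT (fun p : Om * Om => g (X p.1, X p.2)).
  by apply: (measurableT_comp mg); apply: to_gs; exact: ev_meas.
apply: prod_Ex2.
- exact: (int1M mX1 law1 mgp).
- exact: int1_cst.
- move=> w2; apply: L2_mul; first by have [] := isG_L2 (incr a0 ab bT).
  apply: (@L2_bdd _ _ _ _ K) => //=.
  apply: (measurableT_comp (gs_sec (X w2) mg)).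
  by apply: past_measurable => r _; exact: ev_meas.
- by move=> w2 /=; exact: (@mart a b a0 ab bT (fun x => g (x, X w2)) K (gs_sec (X w2) mg)).
Qed.

Let mart2 (g : gs a * gs a -> R) K : measurable_fun setT g -> (forall q, `|g q| <= K) ->
  Ex Q (fun p => Dw a b (X p.2) * g (X p.1, X p.2)) = 0.
Proof.
move=> mg gK; rewrite -[RHS](Ex_cst P).
have mgp : measurable_fun setT (fun p : Om * Om => g (X p.1, X p.2)).
  by apply: (measurableT_comp mg); apply: to_gs; exact: ev_meas.
apply: prod_Ex1.
- exact: (int1M mX2 law2 mgp).
- exact: int1_cst.
- move=> w2; apply: L2_mul; first by have [] := isG_L2 (incr a0 ab bT).
  apply: (@L2_bdd _ _ _ _ K) => //=.
  apply: (measurableT_comp (gs_sec2 (X w2) mg)).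
  by apply: past_measurable => r _; exact: ev_meas.
- by move=> w2 /=; exact: (@mart a b a0 ab bT (fun x => g (X w2, x)) K (gs_sec2 (X w2) mg)).
Qed.

(** A function of the past of the two copies is also one of the past of the rotated pair, through
    the inverse rotation [rg]. As both pairs have the same law, the claim becomes [mart1]. *)
Let mart3 (g : gs a * gs a -> R) K : measurable_fun setT g -> (forall q, `|g q| <= K) ->
  Ex Q (fun p => Dw a b (Xr p) * g (X p.1, X p.2)) = 0.
Proof.
move=> mg gK.
pose rg (q : gs a * gs a) : gs a * gs a :=
  (c *: (q.1 : C) - s *: (q.2 : C), s *: (q.1 : C) + c *: (q.2 : C)).
have mrg d' (O : measurableType d') (F G : O -> C) : (forall r, r \in `[0, a] -> measurable_fun setT (fun w => F w r)) ->
  (forall r, r \in `[0, a] -> measurable_fun setT (fun w => G w r)) ->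
  measurable_fun setT (fun p => rg (F p, G p)).
  move=> mF mG; apply/measurable_fun_pairP; split; apply: past_measurable => r ra.
    have -> : (fun w => (c *: F w - s *: G w : C) r) = fun w => c * F w r - s * G w r by [].
    by apply: measurable_funB; apply: measurable_funM => //; [exact: mF|exact: mG].
  have -> : (fun w => (s *: F w + c *: G w : C) r) = fun w => s * F w r + c * G w r by [].
  by apply: measurable_funD; apply: measurable_funM => //; [exact: mF|exact: mG].
have mid : measurable_fun setT (fun q : C * C => (rg q)).
  have := mrg _ (C * C)%type fst snd; rewrite (_ : (fun p => rg (p.1, p.2)) = rg); last by apply/funext => -[].
  by apply=> r _; apply: (measurableT_comp (@eval_measurable R T r)).
have mgr : measurable_fun setT (g \o rg : gs a * gs a -> R).
  apply: (measurableT_comp mg).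
  have := mrg _ (gs a * gs a)%type fst snd; rewrite (_ : (fun p => rg (p.1, p.2)) = rg); last by apply/funext => -[].
  by apply=> r ra; apply: (measurableT_comp (past_eval ra)).
transitivity (Ex Q (fun p => Dw a b (X p.1) * (g \o rg) (X p.1, X p.2))); last exact: (mart1 mgr (fun q => gK (rg q))).
pose Phi (q : C * C) := Dw a b q.1 * g (rg q).
have mPhi : measurable_fun setT Phi.
  apply: measurable_funM; first by apply: (measurableT_comp (mDw a0 ab bT)).
  exact: (measurableT_comp mg mid).
have mp : measurable_fun setT (fun p => (Xr p, Xo p)).
  by apply/measurable_fun_pairP; split => /=; [exact: Xrot_meas|exact: Xort_meas].
have mp' : measurable_fun setT (fun p : Om * Om => (X p.1, X p.2)).
  by apply/measurable_fun_pairP; split.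
have := law_Ex mp mp' (fun A mA => rot_law T0 GX cs1 mA) mPhi.
rewrite /Phi /= => <-; congr (Ex Q _); apply/funext => p.
by have [h1 h2] := Xrot_inv X cs1 p; rewrite /rg /= h1 h2.
Qed.

Lemma rot_orth : ip Q (M a) (fun p => M b p - M a p) = 0.
Proof.
have aT : a < T by exact: le_lt_trans ab bT.
have b0 : 0 <= b by exact: le_trans a0 ab.
(* The martingale property is available against bounded functions of the past, so [M a] is first
   truncated at level [n]. *)
rewrite ipC; apply: ip_clamp_lim; [by apply: L2B; exact: LM|exact: LM|move=> n].
pose g (q : gs a * gs a) : R := Dw 0 a (c *: (q.1 : C) + s *: (q.2 : C)) - c * Dw 0 a q.1 - s * Dw 0 a q.2.
have mDa (F : gs a * gs a -> C) : (forall r, r \in `[0, a] -> measurable_fun setT (fun w => F w r)) ->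
    measurable_fun setT (fun q => Dw 0 a (F q)).
  move=> mF; apply: measurable_funB; apply: noise_measurable => //.
  - by rewrite a0 ltW.
  - by rewrite lexx ltW.
  - by move=> r; rewrite in_itv/= => /andP[r0 r0']; apply: mF; rewrite in_itv/= r0 (le_trans r0').
have m1 r : r \in `[0, a] -> measurable_fun setT (fun q : gs a * gs a => (q.1 : C) r).
  by move=> ra; apply: (measurableT_comp (past_eval ra)).
have m2 r : r \in `[0, a] -> measurable_fun setT (fun q : gs a * gs a => (q.2 : C) r).
  by move=> ra; apply: (measurableT_comp (past_eval ra)).
have mg : measurable_fun setT g.
  apply: measurable_funB; last by apply: measurable_funM => //; exact: mDa.
  apply: measurable_funB; last by apply: measurable_funM => //; exact: mDa.
  apply: mDa => r ra.
  have -> : (fun q : gs a * gs a => (c *: (q.1 : C) + s *: (q.2 : C) : C) r) =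
     fun q => c * (q.1 : C) r + s * (q.2 : C) r by [].
  by apply: measurable_funD; apply: measurable_funM => //; [exact: m1|exact: m2].
pose gn q := Num.max (- n%:R) (Num.min n%:R (g q)).
have mgn : measurable_fun setT gn by apply: measurable_maxr => //; exact: measurable_minr.
have gn1 q : `|gn q| <= n%:R by exact: clamp_le.
have mgp : measurable_fun setT (fun p : Om * Om => gn (X p.1, X p.2)).
  by apply: (measurableT_comp mgn); apply: to_gs; exact: ev_meas.
have i1 := int1M mX1 law1 mgp (fun p => gn1 (X p.1, X p.2)).
have i2 := int1M mX2 law2 mgp (fun p => gn1 (X p.1, X p.2)).
have i3 := int1M mXr law3 mgp (fun p => gn1 (X p.1, X p.2)).
transitivity (Ex Q (fun p => Dw a b (Xr p) * gn (X p.1, X p.2) - c * (Dw a b (X p.1) * gn (X p.1, X p.2))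
     - s * (Dw a b (X p.2) * gn (X p.1, X p.2)))).
  by congr (Ex Q _); apply/funext => p; rewrite ME -[Num.max _ _]/(gn (X p.1, X p.2)); ring.
rewrite ExB; [|by apply: int1B => //; exact: int1Z|exact: int1Z].
rewrite ExB//; last exact: int1Z.
by rewrite !ExZ// (mart1 mgn gn1) (mart2 mgn gn1) (mart3 mgn gn1) !mulr0 !subr0.
Qed.
End orthogonality.

(** Brownian scaling: an increment over a time [t/n] has the law of the increment over [[0,t]]
    divided by the square root of [n]. The factor 3 in the dominating variable absorbs the splitting
    into three terms by [ge0_sqr3]. *)
Let trunc (t K : R) n k : 0 <= t -> t < T -> 0 <= K -> (k < n)%N ->
  Ex Q (fun p => Num.max 0 ((M (t * k.+1%:R / n%:R) p - M (t * k%:R / n%:R) p) ^+ 2 - K / n%:R)) <=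
  n%:R^-1 * Ex Q (fun p => Num.max 0 ((3 * Dw 0 t (X p.1)) ^+ 2 - K)).
Proof.
move=> t0 tT K0 kn; have n0 : (0 < n)%N by case: n kn.
have nR : 0 < n%:R :> R by rewrite ltr0n.
set b := t * k.+1%:R / n%:R; set a := t * k%:R / n%:R.
have a0 : 0 <= a by rewrite divr_ge0// mulr_ge0.
have ab : a <= b by rewrite ler_pM2r ?invr_gt0// ler_wpM2l// ler_nat.
have bT : b < T.
  apply: le_lt_trans tT; rewrite /b ler_pdivrMr// ler_wpM2l// ler_nat//.
have ba : b - a = t / n%:R by rewrite /a /b -natr1; field; rewrite gt_eqF.
pose q := K / n%:R / 3.
have q0 : 0 <= q by rewrite !divr_ge0.
pose f (x : R) := Num.max 0 (3 * x ^+ 2 - q).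
have mf : measurable_fun setT f.
  by apply: measurable_maxr => //; apply: measurable_funB => //; apply: measurable_funM => //; exact: measurable_funX.
have f0 x : 0 <= f x <= 3 * x ^+ 2.
  by rewrite /f le_max lexx/= ge_max mulr_ge0 ?sqr_ge0//= gerBl.
have i1 (Y : Om * Om -> R) : L2 Q Y -> int1 Q (fun p => f (Y p)).
  move=> [mY iY]; apply: (int1_le (Y := fun p => 3 * Y p ^+ 2)); last exact: int1Z.
    exact: measurableT_comp.
  by move=> p; have /andP[h1 h2] := f0 (Y p); rewrite ger0_norm.
have GY : isG Q (b - a) (fun p => (Num.sqrt n%:R)^-1 * Dw 0 t (X p.1)).
  have := isG_scale (Num.sqrt n%:R)^-1 (three mX1 law1 (lexx 0) t0 tT).
  by rewrite subr0 exprVn sqr_sqrtr ?ltW// ba mulrC.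
have same (Y : Om * Om -> C) : measurable_fun setT Y ->
    (forall A, measurable A -> P (X @^-1` A) = Q (Y @^-1` A)) ->
    Ex Q (fun p => f (Dw a b (Y p))) = n%:R^-1 / 3 * Ex Q (fun p => Num.max 0 ((3 * Dw 0 t (X p.1)) ^+ 2 - K)).
  move=> mY lY; have G1 := three mY lY a0 ab bT; have [mG1 _] := G1; have [mGY _] := GY.
  rewrite (law_Ex mG1 mGY (isG_same_law G1 GY) mf) -ExZ; last first.
    have [mX' iX'] := L2Z 3 (LDw mX1 law1 (lexx 0) t0 tT).
    apply: int1_le iX'; first by apply: measurable_maxr => //; apply: measurable_funB => //; exact: measurable_funX.
    by move=> p; rewrite ger0_norm ?le_max ?lexx// ge_max sqr_ge0/= gerBl.
  congr (Ex Q _); apply/funext => p; rewrite /f exprMn exprVn sqr_sqrtr ?ltW//.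
  have n3 : 0 <= n%:R^-1 / 3 :> R by rewrite divr_ge0// invr_ge0 ltW.
  rewrite maxr_pMr// mulr0; congr Num.max; rewrite /q; field.
  by rewrite gt_eqF.
have := LDw mX1 law1 a0 ab bT; have := LDw mX2 law2 a0 ab bT; have := LDw mXr law3 a0 ab bT.
move=> L3 L2' L1.
have mL (Z : Om * Om -> R) : L2 Q Z -> measurable_fun setT Z by case.
apply: (@le_trans _ _ (Ex Q (fun p => f (Dw a b (Xr p)) + f (Dw a b (X p.1)) + f (Dw a b (X p.2))))).
  have iS : int1 Q (fun p => f (Dw a b (Xr p)) + f (Dw a b (X p.1)) + f (Dw a b (X p.2))).
    by apply: int1D; [apply: int1D|]; exact: i1.
  have bd p : Num.max 0 ((M b p - M a p) ^+ 2 - K / n%:R) <= f (Dw a b (Xr p)) + f (Dw a b (X p.1)) + f (Dw a b (X p.2)).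
    by rewrite ME; exact: ge0_sqr3.
  apply: Ex_le => //; apply: (int1_le _ _ iS) => [|p]; last first.
    by rewrite ger0_norm ?le_max ?lexx.
  apply: measurable_maxr => //; apply: measurable_funB => //; apply: measurable_funX.
  have e : (fun p => M b p - M a p) = fun p => Dw a b (Xr p) - c * Dw a b (X p.1) - s * Dw a b (X p.2).
    by apply/funext => p; exact: ME.
  by rewrite e; apply: mL; apply: L2B; [apply: L2B => //|]; exact: L2Z.
rewrite ExD; [|by apply: int1D; exact: i1|exact: i1].
rewrite ExD; [|exact: i1|exact: i1].
rewrite !same//; set E := Ex _ _; rewrite le_eqVlt; apply/orP; left; apply/eqP; field.
by rewrite gt_eqF.
Qed.

Let good t : set C := [set f | (\int[lam]_(x in `[0%R, t]) `|delta x f|%:E < +oo)%E].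

Let mgood t : 0 <= t < T -> measurable (good t).
Proof.
move=> /andP[t0 tT]; have tT' : 0 <= t <= T by rewrite t0 ltW.
have m : measurable_fun setT (fun f : C => (\int[lam]_(x in `[0%R, t]) `|delta x f|%:E)%E).
  have mid : measurable_fun setT (id : C -> gs t).
    by apply: past_measurable => r _; exact: eval_measurable.
  exact: (measurableT_comp (lint_past pd tT') mid).
by rewrite -[X in measurable X]setTI; apply: emeasurable_fun_infty_o.
Qed.

(** Increments of [M] are dominated by those of the function [J], which combines the integrals of
    the absolute drifts along the three paths; the sums of these bounds telescope. *)
Let fv (t : R) : 0 <= t -> t < T -> {ae Q, forall p, exists V, forall n,
  \sum_(k < n) `|M (t * k.+1%:R / n%:R) p - M (t * k%:R / n%:R) p| <= V}.
Proof.
move=> t0 tT.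
have t0T : 0 <= t < T by rewrite t0.
have gX : {ae P, forall w, good t (X w)} by apply: filterS li => w; apply.
have mXP : measurable_fun setT X by [].
have g1 := law_ae mX1 law1 mXP (mgood t0T) gX.
have g2 := law_ae mX2 law2 mXP (mgood t0T) gX.
have g3 := law_ae mXr law3 mXP (mgood t0T) gX.
apply: filterS3 g1 g2 g3 => p g1 g2 g3.
pose I (f : C) b := \int[lam]_(x in `[0, b]) `|delta x f|.
have int_f (f : C) b : good t f -> 0 <= b -> b <= t -> lam.-integrable `[0, b] (EFin \o delta^~ f).
  move=> gf b0 bt.
  have : lam.-integrable `[0, t] (EFin \o delta^~ f).
    apply/integrableP; split=> //; apply/measurable_EFinP.
    by apply: drift_section => //; rewrite t0 ltW.
  by apply: integrableS => //; apply: subset_itvl; rewrite bnd_simp.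
pose J b := `|alpha|^-1 * (I (Xr p) b + `|c| * I (X p.1) b + `|s| * I (X p.2) b).
have Jincr a b : 0 <= a -> a <= b -> b <= t -> `|M b p - M a p| <= J b - J a.
  move=> a0 ab bt.
  have b0 := le_trans a0 ab.
  pose D (f : C) := \int[lam]_(x in `[0, b]) delta x f - \int[lam]_(x in `[0, a]) delta x f.
  have DI (f : C) : good t f -> `|D f| <= I f b - I f a by move=> gf; apply: Rint_incr => //; exact: int_f.
  have -> : M b p - M a p = alpha^-1 * (c * D (X p.1) + s * D (X p.2) - D (Xr p)).
    rewrite ME /Dw /noise /D.
    have e r : (Xr p) r = c * X p.1 r + s * X p.2 r by [].
    by rewrite !e; ring.
  rewrite normrM normfV /J -mulrBr ler_wpM2l ?invr_ge0//.
  apply: (le_trans (ler_normB _ _)); rewrite addrC.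
  have h1 : `|c * D (X p.1)| <= `|c| * (I (X p.1) b - I (X p.1) a) by rewrite normrM ler_wpM2l// DI.
  have h2 : `|s * D (X p.2)| <= `|s| * (I (X p.2) b - I (X p.2) a) by rewrite normrM ler_wpM2l// DI.
  have h3 := DI _ g3; have h4 := ler_normD (c * D (X p.1)) (s * D (X p.2)).
  lra.
exists (J t - J 0) => n; case: n => [|n].
  by rewrite big_ord0; apply: le_trans (Jincr 0 t (lexx 0) t0 (lexx t)).
pose j k := J (t * k%:R / n.+1%:R).
have tk (k : nat) : (k <= n.+1)%N -> 0 <= t * k%:R / n.+1%:R <= t.
  by move=> kn; rewrite divr_ge0 ?mulr_ge0//= ler_pdivrMr// ler_wpM2l// ler_nat.
apply: (@le_trans _ _ (\sum_(k < n.+1) (j k.+1 - j k))).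
  apply: ler_sum => k _; apply: Jincr.
  - by have /andP[] := tk k (ltnW (ltn_ord k)).
  - by rewrite ler_pM2r ?invr_gt0// ler_wpM2l// ler_nat.
  - by have /andP[] := tk k.+1 (ltn_ord k).
rewrite -(big_mkord xpredT (fun k => j k.+1 - j k)) telescope_sumr// /j mulr0 mul0r mulfK//.
Qed.

Lemma rotation_noise t : 0 <= t < T ->
  {ae Q, forall p, wf t (Xr p) = c * wf t (X p.1) + s * wf t (X p.2)}.
Proof.
move=> /andP[t0 tT].
have h : ip Q (M t) (M t) = 0.
  apply: (@fv_martingale _ _ _ Q M (fun p => 3 * Dw 0 t (X p.1)) t t0).
  - by move=> r /andP[r0 rt]; apply: LM => //; exact: le_lt_trans rt tT.
  - by move=> p; rewrite /M /Dw; ring.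
  - by apply: L2Z; exact: (LDw mX1 law1).
  - by move=> a b a0 ab bt; apply: rot_orth => //; exact: le_lt_trans bt tT.
  - by move=> K n k K0 kn; exact: trunc.
  - exact: fv.
have := ip0_ae (LM t0 tT) h; apply: filterS => p; rewrite /M /Dw.
(* The normalisation at time 0 is undone: the noise at 0 is a multiple of the initial value, which
   is linear in the path. *)
have w0 (f : C) : wf 0 f = f 0 / alpha by rewrite /noise set_itv1 Rintegral_set1 subr0.
have e : (Xr p) 0 = c * X p.1 0 + s * X p.2 0 by [].
rewrite !w0 e => /eqP; rewrite subr_eq0 => /eqP h'.
have -> : wf t (Xr p) = (wf t (Xr p) - (c * X p.1 0 + s * X p.2 0) / alpha - c * (wf t (X p.1) - X p.1 0 / alpha))
   + c * wf t (X p.1) + s * X p.2 0 / alpha by ring.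
by rewrite h'; ring.
Qed.
End rotation_drift.

Section completed_sigma.
Context {d} {Om : measurableType d} {R : realType} (P : probability Om R) (G : set (set Om)).

Lemma negligible_setYC (E F : set Om) : P.-negligible (E `+` F) -> P.-negligible (~` E `+` ~` F).
Proof.
apply: negligibleS => w /= [[h1 h2]|[h1 h2]]; [right|left]; split=> //; exact: contrapT.
Qed.

Lemma completed_sigma_algebra : sigma_algebra setT (completed P <<s G>>).
Proof.
split=> [|A [F GF nF]|A_ cA].
- exists set0; first exact: sigma_algebra0.
  by rewrite setYK; exact: negligible_set0.
- exists (setT `\` F); first exact: sigma_algebraCD.
  by rewrite !setTD; exact: negligible_setYC.
- have /choice[F FP] : forall i, exists F, <<s G>> F /\ P.-negligible (A_ i `+` F).
    by move=> i; have [F h1 h2] := cA i; exists F.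
  exists (\bigcup_i F i); first by apply: sigma_algebra_bigcup => i; have [] := FP i.
  have h : P.-negligible (\bigcup_i (A_ i `+` F i)) by apply: negligible_bigcup => i; have [] := FP i.
  apply: negligibleS h => w /= [[[i _ Ai] nF]|[[i _ Fi] nA]]; exists i => //=.
    by left; split=> // Fi; apply: nF; exists i.
  by right; split=> // Ai; apply: nA; exists i.
Qed.
End completed_sigma.

Section good_definition.
Context {R : realType} {T : R} {d} {Om : measurableType d} (P : probability Om R).
Local Notation C := (path_space T).

(* The linear form of being a solution with drift [delta]: the noise has Brownian covariance and generates
   the same closed spans as [Y]. *)
Definition good (alpha : R) (delta : R -> C -> R) (Y : Om -> C) := [/\
  progressively_measurable delta,
  locally_integrable_drift P delta Y,
  forall s t, 0 <= s -> s <= t -> t < T ->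
    ip P (fun w => noise alpha delta s (Y w)) (fun w => noise alpha delta t (Y w)) = s,
  forall t, 0 <= t -> t < T ->
    ospan P (fun r w => Y w r) `[0, t]%classic (fun w => noise alpha delta t (Y w)) &
  forall t, 0 <= t -> t < T ->
    ospan P (fun r w => noise alpha delta r (Y w)) `[0, t]%classic (fun w => Y w t)].
End good_definition.

Section initial.
Context {R : realType} {T : R} (T0 : 0 < T) {d} {Om : measurableType d} (P : probability Om R).
Local Notation C := (path_space T).
Local Notation Q := (P \x P)%E.
Local Notation lam := (@lebesgue_measure R).
Context (X : {RV P >-> C}) (GX : gfam P (fun b w => b (X w)) clf).
Context (W : {RV P >-> C}) (BW : brownian_motion P W).
Context (alpha : R) (alpha0 : alpha != 0) (delta : R -> C -> R)
  (pd : progressively_measurable delta) (li : locally_integrable_drift P delta X).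
Hypothesis sol : strong_solution P W alpha delta X.
Local Notation wf := (noise alpha delta).
Local Notation gs a := (g_sigma_algebraType (past (@idfun C) a)).

Let mW r : measurable_fun setT (fun w => W w r).
Proof. by apply: (measurableT_comp (@eval_measurable R T r)). Qed.
Let mX r : measurable_fun setT (fun w => X w r).
Proof. by apply: (measurableT_comp (@eval_measurable R T r)). Qed.
Let mW' r : r \in `[0, T] -> measurable_fun setT (fun w => W w r). Proof. by []. Qed.

Let GW := bm_gfam T0 mW' BW.

Let mwf t : 0 <= t -> t < T -> measurable_fun setT (fun w => wf t (X w)).
Proof. by move=> t0 tT; apply: noise_measurable => //; rewrite t0 ltW. Qed.

Let wfW t : 0 <= t -> t < T -> {ae P, forall w, wf t (X w) = W w t}.
Proof.
move=> t0 tT; have [_ h _] := sol; apply: filterS h => w /(_ t).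
rewrite t0 tT /noise => /(_ isT) ->.
by rewrite addrK mulrAC mulfV// mul1r.
Qed.

Let incr a b : 0 <= a -> a <= b -> b < T -> isG P (b - a) (fun w => wf b (X w) - wf a (X w)).
Proof.
move=> a0 ab bT; have b0 := le_trans a0 ab; have aT := le_lt_trans ab bT.
apply: isG_ae (bm_incr mW' BW a0 ab (ltW bT)).
  by apply: measurable_funB; exact: mwf.
by apply: filterS2 (wfW b0 bT) (wfW a0 aT) => w -> ->.
Qed.

Let X_completed a (A : set C) : 0 <= a -> a < T -> <<s past (@idfun C) a>> A ->
  completed P <<s past W a>> (X @^-1` A).
Proof.
move=> a0 aT; suff : <<s past (@idfun C) a>> `<=` [set A | completed P <<s past W a>> (X @^-1` A)] by apply.
apply: smallest_sub.
  have [c0 cC cU] := completed_sigma_algebra P (past W a).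
  split=> [|B /cC|F cF]; first by rewrite /= preimage_set0.
    by rewrite /= !setTD preimage_setC.
  by rewrite /= preimage_bigcup; exact: cU.
move=> _ [r /= ra [B mB <-]]; rewrite setTI.
have [_ _ /(_ r)] := sol.
move: ra; rewrite in_itv/= => /andP[r0 ra]; rewrite r0 (le_lt_trans ra aT) => /(_ isT B mB)[F sF nF].
exists F => //; apply: sub_sigma_algebra2 sF => E [q /= qr hE]; exists q => //=.
by move: qr; rewrite /= !in_itv/= => /andP[-> qr]; exact: le_trans qr ra.
Qed.

(** This is where adaptedness enters: an event in the past of [X] agrees up to a null set with an
    event in the past of [W], and the increment of [W], being uncorrelated with that past, is
    orthogonal to it. *)
Let mart a b : 0 <= a -> a <= b -> b < T -> forall (h : C -> R) K,
  measurable_fun setT (h : gs a -> R) -> (forall f, `|h f| <= K) ->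
  Ex P (fun w => (wf b (X w) - wf a (X w)) * h (X w)) = 0.
Proof.
move=> a0 ab bT h K mh hK.
have b0 := le_trans a0 ab; have aT := le_lt_trans ab bT.
have [LZ _] := isG_L2 (bm_incr mW' BW a0 ab (ltW bT)); have [mZ _] := LZ.
have mhX : measurable_fun setT (fun w => h (X w)).
  by apply: (measurableT_comp mh); apply: past_measurable.
transitivity (Ex P (fun w => (W w b - W w a) * h (X w))).
  apply: Ex_ae.
  - by apply: measurable_funM => //; apply: measurable_funB; exact: mwf.
  - exact: measurable_funM.
  - by apply: filterS2 (wfW b0 bT) (wfW a0 aT) => w -> ->.
apply: (@orth_bdd _ _ _ P _ _ K) => //; first exact: L2_int1.
move=> B mB.
have sA : <<s past (@idfun C) a>> (h @^-1` B) by have := mh measurableT B mB; rewrite setTI.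
have [F sF nF] := X_completed a0 aT sA.
have SW : <<s \bigcup_(r in `[0, a]%classic) preimage_set_system setT (fun w => W w r) measurable>> F by [].
have WW r : r \in `[0, T] -> ospan P (fun r w => W w r) (fun r => r \in `[0, T]) (fun w => W w r).
  by move=> rT; apply: ospan_gen => //; exact: GW.1.
have mF : measurable F.
  by apply: (sigma_preimage_measurable (X := id) _ SW) => r _; exact: mW.
have aI : a \in `[0, T] by rewrite in_itv/= a0 ltW.
have bI : b \in `[0, T] by rewrite in_itv/= b0 ltW.
have orthW := @orth_weight _ _ _ P _ _ _ GW _ (fun r w => W w r) `[0, a]%classic _ (fun w => W w b - W w a) (ospanB (WW b bI) (WW a aI)) _ F SW.
rewrite -[RHS]orthW; last 2 first.
- by move=> r /=; rewrite in_itv/= => /andP[r0 ra]; apply: WW; rewrite in_itv/= r0 (le_trans ra)// ltW.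
- move=> r /=; rewrite in_itv/= => /andP[r0 ra].
  have Lw q : q \in `[0, T] -> L2 P (fun w => W w q) by exact: GW.1.
  have rI : r \in `[0, T] by rewrite in_itv/= r0 (le_trans ra)// ltW.
  have ra0 : 0 <= r <= a by rewrite r0.
  have rb0 : 0 <= r <= b by rewrite r0 (le_trans ra).
  have e1 := bm_cov mW' BW ra0 (ltW aT); have e2 := bm_cov mW' BW rb0 (ltW bT).
  rewrite ipBl; [|exact: Lw..].
  by rewrite (ipC P (fun w => W w b)) (ipC P (fun w => W w a)) e1 e2 subrr.
have mE : measurable ((fun w => h (X w)) @^-1` B).
  by rewrite -[Y in measurable Y]setTI; exact: mhX.
apply: Ex_ae.
- by apply: measurable_funM => //; exact: measurable_indic.
- by apply: measurable_funM => //; exact: measurable_indic.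
have : P.-negligible (X @^-1` (h @^-1` B) `+` F) := nF.
apply: negligibleS => w /= nw; apply: contrapT => hw; apply: nw; congr (_ * _).
rewrite !indicE; congr (_%:R); congr nat_of_bool; apply/idP/idP => /set_mem h1; apply/mem_set.
  by apply: contrapT => h2; apply: hw; left.
by apply: contrapT => h2; apply: hw; right.
Qed.

Section fixed_time.
Context (t : R) (t0 : 0 <= t) (tT : t < T).

(** Functionals of the path together with multiples of the noise at one fixed time. Finite
    combinations have the same form, and almost surely these maps commute with rotations; both facts
    are used to show that the family is Gaussian. *)
Let F (i : (C -> R) * R) (f : C) := i.1 f + i.2 * wf t f.
Let SF (i : (C -> R) * R) := clf i.1.

Let mwfC : measurable_fun setT (wf t).
Proof.
apply: (@noise_measurable _ _ alpha delta t _ C id) => //; first by rewrite t0 ltW.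
by move=> r _; exact: eval_measurable.
Qed.

Let mF i : SF i -> measurable_fun setT (F i).
Proof.
move=> [_ cb]; apply: measurable_funD; last exact: measurable_funM.
exact: continuous_borel.
Qed.

Let F_rot c s i : SF i -> c ^+ 2 + s ^+ 2 = 1 ->
  {ae Q, forall p, F i (Xrot X c s p) = c * F i (X p.1) + s * F i (X p.2)}.
Proof.
move=> [lb _] cs.
have t0T : 0 <= t < T by rewrite t0.
have := rotation_noise T0 GX pd li incr mart cs t0T.
apply: filterS => p h; rewrite /F h /Xrot.
have e x y (f g : C) : i.1 (x *: f + y *: g) = x * i.1 f + y * i.1 g.
  rewrite lb; congr (_ + _); have := lb y g 0; have := lb 0 g 0.
  by have := lb 1 0 0; rewrite scaler0 scale0r !addr0 => h1 h2 ->; lra.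
by rewrite e; ring.
Qed.

Let F_law c s i (phi : R -> R) : SF i -> c ^+ 2 + s ^+ 2 = 1 -> measurable_fun setT phi ->
  Ex P (fun w => phi (F i (X w))) = Ex Q (fun p => phi (F i (Xrot X c s p))).
Proof.
move=> Si cs mphi.
have mXr := Xrot_meas T0 X c s.
have mX' : measurable_fun setT X by [].
apply: (@law_Ex _ _ _ _ _ _ R P Q X (Xrot X c s) mX' mXr _ (phi \o F i)).
  by move=> A mA; exact/esym/Xrot_law.
by apply: (measurableT_comp mphi); exact: (mF Si).
Qed.

Let mFX i : SF i -> measurable_fun setT (fun w => F i (X w)).
Proof. by move=> Si; apply: (measurableT_comp (mF Si)). Qed.

Let LF i : SF i -> L2 P (fun w => F i (X w)).
Proof.
move=> Si; apply: L2D; first by exact: (GX.1 i.1 Si).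
have t0T : 0 <= t <= T by rewrite t0 ltW.
apply: L2Z; have [LW _] := isG_L2 (bm_isG mW' BW t0T).
exact: (L2_ae (mwf t0 tT) (wfW t0 tT) LW).
Qed.

Let Q_ae (phi : R -> R) c s i (psi : Om * Om -> R) : SF i -> c ^+ 2 + s ^+ 2 = 1 ->
  measurable_fun setT phi -> measurable_fun setT psi ->
  (forall p, phi (c * F i (X p.1) + s * F i (X p.2)) = psi p) ->
  Ex Q (fun p => phi (F i (Xrot X c s p))) = Ex Q psi.
Proof.
move=> Si cs mphi mpsi H; apply: Ex_ae => //.
  by apply: (measurableT_comp mphi); apply: (measurableT_comp (mF Si)); exact: Xrot_meas.
by apply: filterS (F_rot Si cs) => p ->; exact: H.
Qed.

Let F_sin i x : SF i -> Ex P (fun w => sin (x * F i (X w))) = 0.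
Proof.
(* The rotation with [c = -1] and [s = 0] shows that the law of [F i (X)] is symmetric. *)
move=> Si; have cs : (-1) ^+ 2 + 0 ^+ 2 = 1 :> R by rewrite sqrrN expr1n expr0n addr0.
have ms : measurable_fun setT (fun y : R => sin (x * y)) by apply: msinf; exact: measurable_funM.
have mX1 : measurable_fun setT (fun p : Om * Om => F i (X p.1)) by apply: (measurableT_comp (mFX Si)).
have := F_law Si cs ms; rewrite (Q_ae (psi := fun p => -1 * sin (x * F i (X p.1))) Si cs ms); last 2 first.
- by apply: measurable_funM => //; apply: msinf; exact: measurable_funM.
- by move=> p; rewrite mul0r addr0 !mulN1r mulrN sinN.
rewrite ExZ; last first.
  by apply: (@int1_bdd _ _ _ _ 1) => [|p]; [apply: msinf; exact: measurable_funM|exact: bsin].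
have <- : Ex P (fun w => sin (x * F i (X w))) = Ex Q (fun p => sin (x * F i (X p.1))).
  apply: (@law_Ex _ _ _ _ _ _ R P Q id fst _ _ _ (fun w => sin (x * F i (X w)))) => //.
  - by move=> A mA; exact/esym/fst_law.
  - by apply: msinf; apply: measurable_funM => //; exact: mFX.
by lra.
Qed.

Let F_isG i : SF i -> isG P (ip P (fun w => F i (X w)) (fun w => F i (X w))) (fun w => F i (X w)).
Proof.
move=> Si; apply: clt_gaussian; [exact: LF| |by move=> x; exact: F_sin].
(* For [c = s = 1/sqrt 2], the variable has the law of the sum of two independent copies divided by
   [sqrt 2], which is the hypothesis of [clt_gaussian]; the product of the sines has mean zero by
   symmetry. *)
move=> x; pose r : R := (Num.sqrt 2)^-1.
have r2 : r ^+ 2 = 2^-1 by rewrite exprVn sqr_sqrtr.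
have cs : r ^+ 2 + r ^+ 2 = 1 by rewrite r2; field.
have mc : measurable_fun setT (fun y : R => cos (x * y)) by apply: mcosf; exact: measurable_funM.
have m1 : measurable_fun setT (fun w => cos (x * r * F i (X w))) by apply: mcosf; apply: measurable_funM => //; exact: mFX.
have m2 : measurable_fun setT (fun w => sin (x * r * F i (X w))) by apply: msinf; apply: measurable_funM => //; exact: mFX.
have m1a : measurable_fun setT (fun p : Om * Om => cos (x * r * F i (X p.1))) by apply: (measurableT_comp m1).
have m1b : measurable_fun setT (fun p : Om * Om => cos (x * r * F i (X p.2))) by apply: (measurableT_comp m1).
have m2a : measurable_fun setT (fun p : Om * Om => sin (x * r * F i (X p.1))) by apply: (measurableT_comp m2).
have m2b : measurable_fun setT (fun p : Om * Om => sin (x * r * F i (X p.2))) by apply: (measurableT_comp m2).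
rewrite (F_law Si cs mc).
rewrite (Q_ae (psi := fun p => cos (x * r * F i (X p.1)) * cos (x * r * F i (X p.2)) -
     sin (x * r * F i (X p.1)) * sin (x * r * F i (X p.2))) Si cs mc); last 2 first.
- by apply: measurable_funB; exact: measurable_funM.
- by move=> p; rewrite mulrDr !mulrA cosD.
rewrite ExB; last 2 first.
- by apply: (@int1_bdd _ _ _ _ (1 * 1)) => [|p]; [exact: measurable_funM|rewrite normrM ler_pM ?bcos].
- by apply: (@int1_bdd _ _ _ _ (1 * 1)) => [|p]; [exact: measurable_funM|rewrite normrM ler_pM ?bsin].
rewrite (prod_ExM P P m1 m1 (fun=> bcos _) (fun=> bcos _)) (prod_ExM P P m2 m2 (fun=> bsin _) (fun=> bsin _)).
by rewrite F_sin// mul0r subr0 expr2.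
Qed.

Let F_gfam : gfam P (fun i w => F i (X w)) SF.
Proof.
split=> [i|l lS]; first exact: LF.
have [j Sj jE] : exists2 j, SF j & forall f, lc F l f = F j f.
  elim: l lS => [|[x i] l IH] lS.
    exists ((fun=> 0), 0); first exact: clf0.
    by move=> f; rewrite /lc big_nil /F /= add0r mul0r.
  have [|j Sj jE] := IH; first by move=> y yl; apply: lS; rewrite inE yl orbT.
  exists ((fun f => x * i.1 f + j.1 f), x * i.2 + j.2).
    by apply: clfD => //; apply: clfZ; apply: (lS (x, i)); rewrite inE eqxx.
  by move=> f; rewrite /lc big_cons -/(lc F l f) jE /F /=; ring.
have -> : lc (fun i w => F i (X w)) l = fun w => F j (X w) by apply/funext => w; exact: jE.
exact: F_isG.
Qed.

Lemma noise_ospan : ospan P (fun r w => X w r) `[0, t]%classic (fun w => wf t (X w)).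
Proof.
apply: (span_lemma F_gfam).
- move=> r _.
  have Si : SF ((fun f : C => f r), 0) by exact: clf_ev.
  have := ospan_gen (F_gfam.1 _ Si) Si; congr (ospan _ _ _ _).
  by apply/funext => w; rewrite /F /= mul0r addr0.
- have Si : SF ((fun=> 0), 1) by exact: clf0.
  have := ospan_gen (F_gfam.1 _ Si) Si; congr (ospan _ _ _ _).
  by apply/funext => w; rewrite /F /= mul1r add0r.
move=> B mB; exists ((fun w => wf t (X w)) @^-1` B); last by rewrite setYK; exact: negligible_set0.
have m1 : measurable_fun setT (X : g_sigma_algebraType (past X t) -> gs t).
  apply: past_measurable => r rt _ E mE; rewrite setTI; apply: sub_sigma_algebra.
  by exists r => //; exists E => //; rewrite setTI.
have t0T : 0 <= t <= T by rewrite t0 ltW.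
have := measurableT_comp (noise_past alpha pd t0T) m1.
by move=> /(_ measurableT B mB); rewrite setTI.
Qed.

End fixed_time.

Lemma noise_amb t : 0 <= t -> t < T -> ospan P (fun b w => b (X w)) clf (fun w => wf t (X w)).
Proof.
move=> t0 tT; apply: ospan_trans (noise_ospan t0 tT) => r _.
have Si : clf (fun f : C => f r) by exact: clf_ev.
exact: (ospan_gen (GX.1 _ Si) Si).
Qed.

(** [W] agrees almost surely with the noise, so it lies in the Gaussian space of [X]. There,
    measurability of [X_t] for the completed past of [W] becomes membership in its closed span. *)
Lemma X_ospan t : 0 <= t -> t < T -> ospan P (fun r w => wf r (X w)) `[0, t]%classic (fun w => X w t).
Proof.
move=> t0 tT.
have Wamb r : `[0, t]%classic r -> ospan P (fun b w => b (X w)) clf (fun w => W w r).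
  rewrite /= in_itv/= => /andP[r0 rt]; have rT := le_lt_trans rt tT.
  apply: ospan_ae (noise_amb r0 rT) => //.
  by apply: filterS (wfW r0 rT) => w ->.
have Si : clf (fun f : C => f t) by exact: clf_ev.
have XW : ospan P (fun r w => W w r) `[0, t]%classic (fun w => X w t).
  apply: (span_lemma GX Wamb (ospan_gen (GX.1 _ Si) Si)) => B mB.
  have [_ _ /(_ t)] := sol; rewrite t0 tT => /(_ isT B mB); exact.
apply: ospan_trans XW => r /=; rewrite in_itv/= => /andP[r0 rt]; have rT := le_lt_trans rt tT.
apply: (@ospan_ae _ _ _ _ _ _ _ (fun w => wf r (X w))) => //.
  by apply: filterS (wfW r0 rT) => w ->.
apply: ospan_gen; first exact: (noise_amb r0 rT).1.
by rewrite /= in_itv/= r0.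
Qed.

Theorem initial_good : good P alpha delta X.
Proof.
split=> //; [|exact: noise_ospan|exact: X_ospan].
move=> s t s0 st tT; have sT := le_lt_trans st tT; have t0 := le_trans s0 st.
have st' : 0 <= s <= t by rewrite s0.
rewrite -[RHS](bm_cov mW' BW st' (ltW tT)); apply: ip_ae.
- exact: mwf.
- exact: mW.
- exact: mwf.
- exact: mW.
- exact: wfW.
- exact: wfW.
Qed.
End initial.

(** * Absolute continuity under conditioning *)

Lemma normal_null {R : realType} (s1 s2 : R) (N : set R) : s2 != 0 -> measurable N ->
  normal_prob 0 s2 N = 0%E -> normal_prob 0 s1 N = 0%E.
Proof.
move=> s20 mN; have dom := @normal_prob_dominates R 0 s1.
move=> H; suff l0 : (@lebesgue_measure R) N = 0%E.
  by move/null_content_dominatesP : dom; apply.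
have mpdf : measurable_fun N (EFin \o normal_pdf 0 s2).
  by apply/measurable_EFinP; apply: measurable_funTS; exact: measurable_normal_pdf.
have : (\int[@lebesgue_measure R]_(x in N) `|(EFin \o normal_pdf 0 s2) x| = 0)%E.
  by rewrite -[RHS]H; apply: eq_integral => x _; rewrite /= ger0_norm// normal_pdf_ge0.
move=> /((ae_eq_integral_abs (@lebesgue_measure R) mN mpdf).1) h.
have : (@lebesgue_measure R).-negligible N.
  apply: negligibleS h => x Nx /= H0.
  have := H0 Nx; rewrite normal_pdfE// => -[] /eqP.
  by rewrite mulf_eq0 !gt_eqF// ?expR_gt0// normal_peak_gt0.
by move/negligibleP => /(_ mN).
Qed.

Section path_law.
Context {R : realType} {T : R}.
Local Notation C := (path_space T).

Lemma past_local (s : R) (A : set C) : <<s past (@idfun C) s>> A ->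
  forall f g : C, (forall r, r \in `[0, s] -> f r = g r) -> A f -> A g.
Proof.
move=> sA; suff H : <<s past (@idfun C) s>> `<=`
    [set A | forall f g : C, (forall r, r \in `[0, s] -> f r = g r) -> (A f <-> A g)].
  by move=> f g fg; have [] := H A sA f g fg.
apply: smallest_sub.
  split=> [f g _//|B HB f g fg|F HF f g fg].
    by have [h1 h2] := HB f g fg; split=> -[_ h]; split=> //= h'; apply: h; [exact: h2|exact: h1].
  by split=> -[n _ Fn]; exists n => //; have [h1 h2] := HF n f g fg; [exact: h1|exact: h2].
move=> _ [r /= rs [B mB <-]] f g fg.
by split=> -[_ h]; split=> //; move: h; rewrite /= fg.
Qed.

Context (T0 : 0 < T) {d} {Om : measurableType d} (P : probability Om R).
Context (X : {RV P >-> C}) (GX : gfam P (fun b w => b (X w)) clf).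
Local Notation amb := (ospan P (fun b w => b (X w)) clf).

Lemma split_law (Zc : Om -> C) (S : Om -> R) (v : C) (s q : R) : q != 0 -> q ^+ 2 = ip P S S ->
  (forall r, amb (fun w => Zc w r)) -> amb S ->
  (forall r, r \in `[0, s] -> ip P (fun w => Zc w r) S = 0) ->
  forall A, <<s past (@idfun C) s>> A ->
  P ((fun w => Zc w + S w *: v : C) @^-1` A) =
  (P \x normal_prob 0 q)%E ((fun p => Zc p.1 + p.2 *: v : C) @^-1` A).
Proof.
move=> q0 qS ZA SA ZS A sA.
have LZ r : L2 P (fun w => Zc w r) by have [] := ZA r.
have LS : L2 P S by have [] := SA.
apply: (@gaussian_law_eq R R C (fun r f => f r) `[0, s]%classic _ _ _ _ P (P \x normal_prob 0 q)%E) => //.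
- move=> r _; have -> : (fun f : C => f r) \o (fun w => Zc w + S w *: v) = fun w => Zc w r + S w * v r by [].
  by apply: measurable_funD; [have [] := LZ r|apply: measurable_funM => //; have [] := LS].
- move=> r _; have -> : (fun f : C => f r) \o (fun p : Om * R => Zc p.1 + p.2 *: v) = fun p => Zc p.1 r + p.2 * v r by [].
  apply: measurable_funD; last by apply: measurable_funM => //.
  by have [mZ _] := LZ r; apply: (measurableT_comp mZ).
move=> l lS; pose c := lc (fun r (f : C) => f r) l v; pose z w := lc (fun r w => Zc w r) l w.
have e x w : lc (fun r (w : Om) => (Zc w + x *: v : C) r) l w = z w + x * c.
  rewrite /z /c /lc mulr_sumr -big_split/=; apply: eq_bigr => i _.
  by rewrite -[(_ + _) _]/(Zc w i.2 + x * v i.2); ring.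
have zA : amb z by apply: (ospan_lc (V := fun r w => Zc w r) _ lS) => r _; exact: ZA.
have Gz := gfam_ospan GX zA.
have zS : ip P z S = 0.
  by rewrite ipC; apply: (ip_lc_eq0 (S := fun r => r \in `[0, s])) => // r rs; rewrite ipC ZS.
have [Lz _] := zA.
exists (ip P z z + c ^+ 2 * ip P S S).
  have -> : lc (fun r w => (Zc w + S w *: v : C) r) l = fun w => z w + c * S w.
    by apply/funext => w; rewrite mulrC -(e (S w) w).
  have := gfam_ospan GX (ospanD zA (ospanZ c SA)); congr (isG _ _ _).
  by rewrite ip_quad// zS mulr0 mul0rn addr0.
have -> : lc (fun r (p : Om * R) => (Zc p.1 + p.2 *: v : C) r) l = fun p => z p.1 + c * p.2.
  by apply/funext => p; rewrite mulrC -(e p.2 p.1).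
apply: prod_isG => //; rewrite -qS; apply: isG_scale; exact: isG_normal_prob.
Qed.

(* Two nondegenerate centred normal laws have the same null sets, and [S1], [S2] are both independent of [Zc] on [[0,s]]. *)
Lemma split_abs_cont (Zc : Om -> C) (S1 S2 : Om -> R) (v : C) (s : R) :
  0 < ip P S1 S1 -> 0 < ip P S2 S2 ->
  (forall r, amb (fun w => Zc w r)) -> amb S1 -> amb S2 ->
  (forall r, r \in `[0, s] -> ip P (fun w => Zc w r) S1 = 0) ->
  (forall r, r \in `[0, s] -> ip P (fun w => Zc w r) S2 = 0) ->
  forall A, <<s past (@idfun C) s>> A ->
  {ae P, forall w, A (Zc w + S2 w *: v)} -> {ae P, forall w, A (Zc w + S1 w *: v)}.
Proof.
move=> p1 p2 ZA S1A S2A ZS1 ZS2 A sA h2.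
pose q1 := Num.sqrt (ip P S1 S1); pose q2 := Num.sqrt (ip P S2 S2).
have q10 : q1 != 0 by rewrite gt_eqF// sqrtr_gt0.
have q20 : q2 != 0 by rewrite gt_eqF// sqrtr_gt0.
have sq1 : q1 ^+ 2 = ip P S1 S1 by rewrite sqr_sqrtr// ltW.
have sq2 : q2 ^+ 2 = ip P S2 S2 by rewrite sqr_sqrtr// ltW.
have sAC : <<s past (@idfun C) s>> (~` A) by rewrite -setTD; exact: sigma_algebraCD.
have mZ r : measurable_fun setT (fun w => Zc w r) by have [[]] := ZA r.
have mC (S : Om -> R) : measurable_fun setT S -> measurable ((fun w => Zc w + S w *: v : C) @^-1` (~` A)).
  move=> mS; apply: (@sigma_preimage_measurable R R C (fun r f => f r) `[0, s]%classic _ _ _ (~` A)) => // r _.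
  have -> : (fun f : C => f r) \o (fun w => Zc w + S w *: v) = fun w => Zc w r + S w * v r by [].
  by apply: measurable_funD => //; apply: measurable_funM.
have mB : measurable ((fun p : Om * R => Zc p.1 + p.2 *: v : C) @^-1` (~` A)).
  apply: (@sigma_preimage_measurable R R C (fun r f => f r) `[0, s]%classic _ _ _ (~` A)) => // r _.
  have -> : (fun f : C => f r) \o (fun p : Om * R => Zc p.1 + p.2 *: v) = fun p => Zc p.1 r + p.2 * v r by [].
  by apply: measurable_funD; [apply: (measurableT_comp (mZ r))|apply: measurable_funM].
set B := _ @^-1` _ in mB.
have mS1 : measurable_fun setT S1 by have [[]] := S1A.
have mS2 : measurable_fun setT S2 by have [[]] := S2A.
have z2 : (P \x normal_prob 0 q2)%E B = 0%E.
  rewrite /B -(split_law v q20 sq2 ZA S2A ZS2 sAC).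
  have : P.-negligible ((fun w => Zc w + S2 w *: v : C) @^-1` (~` A)) by exact: h2.
  by move/negligibleP => /(_ (mC _ mS2)).
suff z1 : (P \x normal_prob 0 q1)%E B = 0%E.
  have : P.-negligible ((fun w => Zc w + S1 w *: v : C) @^-1` (~` A)).
    apply/negligibleP; first exact: mC.
    exact: (etrans (split_law v q10 sq1 ZA S1A ZS1 sAC) z1).
  by [].
rewrite /product_measure1/= in z2 *.
have msec q : measurable_fun setT (fun w => normal_prob 0 q (xsection B w)).
  exact: measurable_fun_xsection.
have ae0 : {ae P, forall w, normal_prob 0 q2 (xsection B w) = 0%E}.
  have : (\int[P]_w `|normal_prob 0 q2 (xsection B w)| = 0)%E.
    by rewrite -[RHS]z2; apply: eq_integral => w _; rewrite gee0_abs.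
  move/(ae_eq_integral_abs _ measurableT (msec q2)).
  by apply: filterS => w /(_ I).
rewrite (ae_eq_integral (cst 0%E))//; first by rewrite integral0.
apply: filterS ae0 => w h _; rewrite /= (@normal_null _ q1 q2)//.
exact: measurable_xsection.
Qed.
End path_law.

Lemma lim_ge {R : realType} (f : nat -> R) (l a : R) : f n @[n --> \oo] --> l ->
  (forall n, a <= f n) -> a <= l.
Proof.
move=> fl h; rewrite -[leRHS](cvg_lim _ fl)//; apply: limr_ge; last exact: nearW.
by apply/cvg_ex; exists l.
Qed.

Section conditioning_step.
Context {R : realType} {T : R} (T0 : 0 < T) {d} {Om : measurableType d} (P : probability Om R).
Local Notation C := (path_space T).
Context (X : {RV P >-> C}) (GX : gfam P (fun b w => b (X w)) clf).
Local Notation amb := (ospan P (fun b w => b (X w)) clf).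
Context (Y : Om -> C) (YA : forall b, clf b -> amb (fun w => b (Y w))).
Context (eta : Om -> R) (etaA : amb eta) (eta1 : ip P eta eta = 1).
Context (v : C) (vE : forall b, clf b -> ip P eta (fun w => b (Y w)) = b v).

Lemma amb_ev r : amb (fun w => Y w r).
Proof. by apply: (@YA (fun f => f r)); exact: clf_ev. Qed.

Lemma ip_ev r : ip P eta (fun w => Y w r) = v r.
Proof. by apply: (@vE (fun f => f r)); exact: clf_ev. Qed.

(** On [[0,s]] the processes [Y] and [Y - eta v] are written as [Zc + S2 v] and [Zc + S1 v], with
    one [Zc] uncorrelated with both factors, so that [split_abs_cont] applies. The randomness in the
    direction [v] that is lost with [eta] is resupplied by [S1], which can be chosen because the
    past up to [s] does not determine [eta]. *)
Lemma hat_abs_cont (s : R) (A : set C) :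
  (exists2 K : R, 0 < K & forall l, inS (fun r : R => 0 <= r <= s) l ->
     1 <= K * ip P (fun w => eta w - lc (fun r w => Y w r) l w) (fun w => eta w - lc (fun r w => Y w r) l w)) ->
  <<s past (@idfun C) s>> A ->
  {ae P, forall w, A (Y w)} -> {ae P, forall w, A (Y w - eta w *: v)}.
Proof.
move=> [K K0 nd] sA hA.
have [Le _] := etaA.
have LY r : L2 P (fun w => Y w r) by have [] := amb_ev r.
have LYs r : 0 <= r <= s -> L2 P (fun w => Y w r) by [].
have [p [Lp [l lS [_ lp]] orth]] := ospan_projection LYs Le.
have Llc n : L2 P (lc (fun r w => Y w r) (l n)) by apply: L2_lc (lS n) => r; exact: LYs.
have cv0 : ip P (fun w => lc (fun r w => Y w r) (l n) w - p w) (fun w => lc (fun r w => Y w r) (l n) w - p w) @[n --> \oo] --> 0.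
  apply: (@squeeze_cvgr _ _ _ _ (fun=> 0) (fun n => 4 * 4^-1 ^+ n)); [|exact: cvg_cst|exact: geo4_cvg0].
  by apply: nearW => n; rewrite ip_ge0 lp.
have pA : amb p.
  by apply: ospan_lim cv0 => // n; apply: (ospan_lc _ (lS n)) => r _; exact: amb_ev.
have ps : ospan P (fun r w => Y w r) (fun r : R => 0 <= r <= s) p.
  by apply: ospan_lim cv0 => // n; apply: (ospan_lc _ (lS n)) => r rs; apply: ospan_gen.
pose z w := eta w - p w.
have zA : amb z by exact: ospanB.
have [Lz _] := zA.
have zY r : 0 <= r <= s -> ip P z (fun w => Y w r) = 0 by move=> rs; exact: orth.
have zp : ip P z p = 0 by apply: ps.2.
have z0 : 0 < ip P z z.
  have h : ip P (fun w => eta w - lc (fun r w => Y w r) (l n) w) (fun w => eta w - lc (fun r w => Y w r) (l n) w)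
     @[n --> \oo] --> ip P z z.
    apply: ip_limr => //; first by move=> n; exact: L2B.
    apply: cvg_trans cv0; apply: near_eq_cvg; apply: nearW => n.
    by apply: eq_Rintegral => w _; rewrite /z; ring.
  have : 1 <= K * ip P z z.
    apply: (@lim_ge R (fun n => K * ip P (fun w => eta w - lc (fun r w => Y w r) (l n) w)
      (fun w => eta w - lc (fun r w => Y w r) (l n) w))); last by move=> n; exact: nd.
    by apply: cvgM h; exact: cvg_cst.
  by move=> h1; have := lt_le_trans ltr01 h1; rewrite pmulr_rgt0.
have ze : ip P z eta = ip P z z.
  have -> : ip P z z = ip P z eta - ip P z p by rewrite -ipBr.
  by rewrite zp subr0.
pose s2 := ip P z z.
(* [th] has the same covariances with the past up to [s] as [eta], but is orthogonal to [eta]; this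
   divides by the variance of the unpredictable part [z]. *)
pose th w := eta w - s2^-1 * z w.
have thA : amb th by apply: ospanB => //; exact: ospanZ.
have [Lth _] := thA.
have Lsz : L2 P (fun w => s2^-1 * z w) by exact: L2Z.
have thY r : 0 <= r <= s -> ip P th (fun w => Y w r) = v r.
  by move=> rs; rewrite ipBl// ipZl// zY// mulr0 subr0 ip_ev.
have the : ip P th eta = 0.
  by rewrite ipBl// ipZl// ze eta1 mulVf ?subrr// gt_eqF.
(* If [th] vanishes, so does [v] on [[0,s]], and the two processes have the same path there. *)
have [t0|t0] := eqVneq (ip P th th) 0.
  have v0 r : r \in `[0, s] -> v r = 0.
    rewrite in_itv/= => rs; have := ip_CS Lth (LY r).
    by rewrite thY// t0 mul0r => h; apply/eqP; rewrite -sqrf_eq0 eq_le h sqr_ge0.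
  apply: filterS hA => w; apply: (past_local sA) => r rs.
  by rewrite pathB pathZ v0// mulr0 subr0.
have tp : 0 < ip P th th by rewrite lt_neqAle eq_sym t0 ip_ge0.
pose k := (ip P th th)^-1.
(* The factors satisfy [E(S1 Y_r) = v(r) E(S1 S2)] and [E(S2 Y_r) = v(r) E(S2^2)], which says that
   both are uncorrelated with [Zc] on [[0,s]]. *)
pose S1 w := k * th w.
pose S2 w := S1 w + eta w.
pose Zc w : C := Y w - (S2 w) *: v.
have S1A : amb S1 by exact: ospanZ.
have S2A : amb S2 by exact: ospanD.
have [LS1 _] := S1A; have [LS2 _] := S2A.
have S11 : ip P S1 S1 = k by rewrite ipZl// ipZr// /k mulrA mulfVK.
have S1e : ip P S1 eta = 0 by rewrite ipZl// the mulr0.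
have S12 : ip P S1 S2 = k by rewrite ipDr// S11 S1e addr0.
have S2e : ip P S2 eta = 1 by rewrite ipDl// S1e eta1 add0r.
have S22 : ip P S2 S2 = k + 1 by rewrite {2}/S2 ipDr// S2e ipC S12.
have k0 : 0 < k by rewrite invr_gt0.
have ZA r : amb (fun w => Zc w r).
  have -> : (fun w => Zc w r) = fun w => Y w r - v r * S2 w.
    by apply/funext => w; rewrite /Zc pathB pathZ mulrC.
  by apply: ospanB; [exact: amb_ev|exact: ospanZ].
have ZE r S : L2 P S -> ip P (fun w => Zc w r) S = ip P S (fun w => Y w r) - v r * ip P S2 S.
  move=> LS; have -> : (fun w => Zc w r) = fun w => Y w r - v r * S2 w.
    by apply/funext => w; rewrite /Zc pathB pathZ mulrC.
  by rewrite ipBl// ?ipZl//; [rewrite ipC|exact: L2Z].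
have Z1 r : r \in `[0, s] -> ip P (fun w => Zc w r) S1 = 0.
  by rewrite in_itv/= => rs; rewrite ZE// (ipC _ S2) S12 ipZl// thY//; ring.
have Z2 r : r \in `[0, s] -> ip P (fun w => Zc w r) S2 = 0.
  rewrite in_itv/= => rs; rewrite ZE// S22 ipDl// ip_ev ipZl// thY//; ring.
have p1 : 0 < ip P S1 S1 by rewrite S11.
have p2 : 0 < ip P S2 S2 by rewrite S22 ltr_wpDr.
suff h : {ae P, forall w, A (Zc w + S1 w *: v)}.
  apply: filterS h => w; congr A.
  by rewrite /Zc /S2 scalerDl opprD addrA addrAC subrK.
apply: (split_abs_cont GX (v := v) p1 p2 ZA S1A S2A Z1 Z2 sA).
by apply: filterS hA => w; rewrite /Zc subrK.
Qed.
End conditioning_step.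

(** * Wiener integrals and the innovation *)

Section interval_integrals.
Context {R : realType}.
Local Notation lam := (@lebesgue_measure R).

Lemma measurable_Rint_upto {d} {Om : measurableType d} (g : Om * R -> R) (tau : Om -> R) :
  measurable_fun setT g -> measurable_fun setT tau ->
  measurable_fun setT (fun w => \int[lam]_(x in `[0, tau w]) g (w, x)).
Proof.
move=> mg mtau.
have mG : measurable_fun setT (fun p : Om * R => if (0 <= p.2) && (p.2 <= tau p.1) then g p else 0).
  apply: measurable_fun_ifT => //; apply: measurable_and; apply: measurable_fun_ler => //.
  exact: measurableT_comp.
have := measurable_Rint_section measurableT mG.
congr (measurable_fun _ _); apply/funext => w; rewrite [RHS]Rintegral_mkcond.
apply: eq_Rintegral => x _; rewrite patchE /=; case: ifPn; case: ifPn => //.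
  by rewrite notin_setE/= in_itv/= => h1 h2; exfalso; apply: h1.
by rewrite inE/= in_itv/= => -> .
Qed.

Lemma lam_intZ (a b c : R) (f : R -> R) : lam.-integrable `[a, b] (EFin \o f) ->
  lam.-integrable `[a, b] (EFin \o (fun x => c * f x)).
Proof.
move=> h; apply: (@integrableZl _ _ _ lam `[a, b]%classic (measurable_itv _) c (EFin \o f) h).
Qed.

Lemma lam_intD (a b : R) (f g : R -> R) : lam.-integrable `[a, b] (EFin \o f) ->
  lam.-integrable `[a, b] (EFin \o g) ->
  lam.-integrable `[a, b] (EFin \o (fun x => f x + g x)).
Proof.
move=> h h'; apply: (@integrableD _ _ _ lam `[a, b]%classic (measurable_itv _) (EFin \o f) (EFin \o g) h h').
Qed.

Lemma lam_integrable_sqr (k : R -> R) (t : R) : measurable_fun `[0, t] k ->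
  lam.-integrable `[0, t] (fun x => (k x ^+ 2)%:E) -> lam.-integrable `[0, t] (EFin \o k).
Proof.
move=> mk ik.
have i1 : lam.-integrable `[0, t] (EFin \o (fun=> 1)).
  by apply: (@lam_integrable_bdd _ _ _ _ 1) => // x; rewrite normr1.
apply: le_integrable (integrableD _ i1 ik) => //.
- exact/measurable_EFinP.
move=> x _; rewrite /= lee_fin [leRHS]ger0_norm; last by rewrite addr_ge0// sqr_ge0.
rewrite -real_normK ?num_real//.
have := sqr_ge0 (`|k x| - 2^-1); set y := `|k x|; lra.
Qed.

Lemma Rint_CS (f g : R -> R) (t : R) : measurable_fun `[0, t] f -> measurable_fun `[0, t] g ->
  lam.-integrable `[0, t] (fun x => (f x ^+ 2)%:E) -> lam.-integrable `[0, t] (fun x => (g x ^+ 2)%:E) ->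
  lam.-integrable `[0, t] (fun x => (f x * g x)%:E) /\
  (\int[lam]_(x in `[0, t]) (f x * g x)) ^+ 2 <=
    (\int[lam]_(x in `[0, t]) (f x ^+ 2)) * (\int[lam]_(x in `[0, t]) (g x ^+ 2)).
Proof.
move=> mf mg f2 g2.
have fg : lam.-integrable `[0, t] (fun x => (f x * g x)%:E).
  apply: le_integrable (integrableD _ f2 g2) => //.
    by apply/measurable_EFinP; exact: measurable_funM.
  move=> x _; rewrite /= lee_fin [leRHS]ger0_norm ?addr_ge0 ?sqr_ge0//.
  rewrite normrM -(real_normK (num_real (f x))) -(real_normK (num_real (g x))).
  have := sqr_ge0 (`|f x| - `|g x|); have := sqr_ge0 `|f x|; have := sqr_ge0 `|g x|.
  by set y := `|f x|; set z := `|g x|; lra.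
split=> //; apply: quad_ge0 => [|c].
  by apply: Rintegral_ge0 => x _; rewrite sqr_ge0.
have -> : \int[lam]_(x in `[0, t]) (f x ^+ 2) + c * \int[lam]_(x in `[0, t]) (f x * g x) *+ 2 +
    c ^+ 2 * \int[lam]_(x in `[0, t]) (g x ^+ 2) =
   \int[lam]_(x in `[0, t]) ((f x + c * g x) ^+ 2).
  have e x : (f x + c * g x) ^+ 2 = f x ^+ 2 + (c *+ 2) * (f x * g x) + c ^+ 2 * (g x ^+ 2) by ring.
  under [RHS]eq_Rintegral do rewrite e.
  have h1 : lam.-integrable `[0, t] (EFin \o (fun x => (c *+ 2) * (f x * g x))) .
    exact: lam_intZ.
  have h2 : lam.-integrable `[0, t] (EFin \o (fun x => c ^+ 2 * g x ^+ 2)) .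
    exact: lam_intZ.
  have h3 : lam.-integrable `[0, t] (EFin \o (fun x => f x ^+ 2 + (c *+ 2) * (f x * g x))) .
    exact: lam_intD.
  by rewrite RintegralD// RintegralD// !RintegralZl//; ring.
by apply: Rintegral_ge0 => x _; rewrite sqr_ge0.
Qed.

(** The boolean selects the strict or the weak inequality; the two iterated integrals in
    [Rint_triangle] produce one of each. *)
Lemma Rint_indicl (h : R -> R) (t b : R) (o : bool) : 0 <= b -> b <= t ->
  lam.-integrable `[0, t] (EFin \o h) ->
  \int[lam]_x (h x * \1_(`[0, t]%classic) x * (if o then x < b else x <= b)%R%:R) =
  \int[lam]_(x in `[0, b]) h x.
Proof.
move=> b0 bt ih; transitivity (\int[lam]_(x in [set` Interval (BLeft 0) (BSide o b)]) h x).
  rewrite [RHS]Rintegral_mkcond; apply: eq_Rintegral => x _.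
  rewrite patchE indicE !mem_setE !in_itv/=.
  have [x0|x0] := boolP (0 <= x); last by rewrite mulr0 mul0r.
  case: o => /=.
    have [xb|xb] := boolP (x < b); last by rewrite mulr0.
    by rewrite (ltW (lt_le_trans xb bt)) !mulr1.
  have [xb|xb] := boolP (x <= b); last by rewrite mulr0.
  by rewrite (le_trans xb bt) !mulr1.
case: o => //; apply: Rintegral_itv_bndo_bndc; apply: integrableS ih => //.
by move=> x /=; rewrite !in_itv/= => /andP[-> xb]; exact: (ltW (lt_le_trans xb bt)).
Qed.

Lemma integrable_indicl (k : R -> R) (t : R) : lam.-integrable `[0, t] (EFin \o k) ->
  lam.-integrable setT (EFin \o (fun x => k x * \1_(`[0, t]%classic) x)).
Proof.
move=> ik; have := (@integrable_mkcond _ _ _ lam `[0, t]%classic (EFin \o k) (measurable_itv _)).1 ik; congr (_.-integrable _ _).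
apply/funext => x; rewrite patchE /= indicE.
by case: (x \in _); rewrite ?mulr1 ?mulr0.
Qed.

(** Fubini for [k1(x) k2(y)] on the triangle [y < x] in the square over [[0,t]]. *)
Lemma Rint_triangle (k1 k2 : R -> R) (t : R) : 
  measurable_fun setT k1 -> measurable_fun setT k2 ->
  lam.-integrable `[0, t] (EFin \o k1) -> lam.-integrable `[0, t] (EFin \o k2) ->
  \int[lam]_(x in `[0, t]) (k1 x * \int[lam]_(y in `[0, x]) k2 y) =
  \int[lam]_(y in `[0, t]) (k2 y * (\int[lam]_(x in `[0, t]) k1 x - \int[lam]_(x in `[0, y]) k1 x)).
Proof.
move=> mk1 mk2 i1 i2.
pose K1 x := k1 x * \1_(`[0, t]%classic) x; pose K2 x := k2 x * \1_(`[0, t]%classic) x.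
have mK (k : R -> R) : measurable_fun setT k -> measurable_fun setT (fun x => k x * \1_(`[0, t]%classic) x).
  by move=> mk; apply: measurable_funM => //; exact: measurable_indic.
have j1 := integrable_indicl i1; have j2 := integrable_indicl i2.
pose f (p : R * R) := K1 p.1 * K2 p.2 * (p.2 < p.1)%R%:R.
have mlt : measurable_fun setT (fun p : R * R => (p.2 < p.1)%R%:R : R).
  have := @measurable_fun_ifT _ _ (R * R)%type R (fun=> 1) (fun=> 0) (fun p => p.2 < p.1).
  have -> : (fun p : R * R => if p.2 < p.1 then 1 else 0 : R) = fun p => (p.2 < p.1)%R%:R.
    by apply/funext => p; case: ifP.
  by apply => //; apply: measurable_fun_ltr.
have mf : measurable_fun setT f.
  apply: measurable_funM => //; apply: measurable_funM.
    by apply: (measurableT_comp (mK _ mk1)).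
  by apply: (measurableT_comp (mK _ mk2)).
have mf' : measurable_fun setT (EFin \o f) by exact/measurable_EFinP.
have sec (K : R -> R) (B : R -> bool) : lam.-integrable setT (EFin \o K) -> measurable_fun setT (fun x => (B x)%:R : R) ->
    lam.-integrable setT (EFin \o (fun x => K x * (B x)%:R)) .
  move=> iK mB; apply: (le_integrable _ _ _ iK) => //.
    apply/measurable_EFinP; apply: measurable_funM => //.
    by apply/measurable_EFinP; have /integrableP[] := iK.
  by move=> x _; rewrite /= lee_fin normrM; case: (B x); rewrite ?normr1 ?normr0 ?mulr1 ?mulr0.
have ilf : (lam \x lam)%E.-integrable setT (EFin \o f).
  apply/integrable12ltyP => //.
  have /integrableP[_ I2f] := j2.
  have /integrableP[_ I1f] := j1.
  pose I2 := (\int[lam]_y `|K2 y|%:E)%E.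
  have I20 : (0 <= I2)%E by apply: integral_ge0.
  have I2fin : I2 \is a fin_num by rewrite ge0_fin_numE.
  have mK1 := mK _ mk1; have mK2 := mK _ mk2.
  have nK1 : measurable_fun setT (fun x => `|K1 x|) by apply: measurableT_comp.
  have nK2 : measurable_fun setT (fun x => `|K2 x|) by apply: measurableT_comp.
  apply: (@le_lt_trans _ _ (\int[lam]_x (`|K1 x|%:E * I2))%E).
    apply: ge0_le_integral => //=.
    - by move=> x _; apply: integral_ge0.
    - apply: (@measurable_fun_fubini_tonelli_F _ _ _ _ _ lam (fun p => `|(f p)%:E|%E)) => //.
      exact: measurableT_comp.
    - by apply: emeasurable_funM => //; apply/measurable_EFinP.
    - move=> x _; rewrite -ge0_integralZl//; last exact/measurable_EFinP.
      apply: ge0_le_integral => //=.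
      + apply/measurable_EFinP/measurableT_comp => //.
        by apply: (measurableT_comp mf); apply: measurable_fun_pair.
      + by apply/measurable_EFinP; apply: measurable_funM.
      + move=> y _; rewrite -EFinM lee_fin /f !normrM ler_piMr ?mulr_ge0//.
        by case: (y < x); rewrite ?normr1 ?normr0.
  rewrite ge0_integralZr//; last exact/measurable_EFinP.
  by apply: lte_mul_pinfty => //; [apply: integral_ge0|rewrite ge0_fin_numE//; apply: integral_ge0].
have Fub := Fubini ilf.
have mltx (x : R) : measurable_fun setT (fun y : R => (y < x)%R%:R : R).
  by have := @measurableT_comp _ _ _ _ _ _ _ _ (fun y : R => (x, y)) mlt; apply; apply: measurable_fun_pair.
have mltx' (x : R) : measurable_fun setT (fun y : R => (x < y)%R%:R : R).
  by have := @measurableT_comp _ _ _ _ _ _ _ _ (fun y : R => (y, x)) mlt; apply; apply: measurable_fun_pair.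
have ZL (h : R -> R) (r : R) : lam.-integrable setT (EFin \o h) ->
    (\int[lam]_y (r * h y)%:E)%E = (r * \int[lam]_y h y)%:E.
  move=> ih; rewrite EFinM /Rintegral fineK; last exact: integrable_fin_num ih.
  exact: (integralZl measurableT ih r).
have in1 x : (\int[lam]_y (f (x, y))%:E)%E = (K1 x * \int[lam]_y (K2 y * (y < x)%R%:R))%:E.
  apply: etrans (ZL _ _ (sec _ _ j2 (mltx x))).
  by apply: eq_integral => y _; rewrite /f; cbn [fst snd]; rewrite -mulrA.
have in2 y : (\int[lam]_x (f (x, y))%:E)%E = (K2 y * (\int[lam]_x K1 x - \int[lam]_x (K1 x * (x <= y)%R%:R)))%:E.
  have mle : measurable_fun setT (fun x : R => (x <= y)%R%:R : R).
    have -> : (fun x : R => (x <= y)%R%:R : R) = fun x => 1 - (y < x)%R%:R.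
      by apply/funext => x; rewrite leNgt; case: (y < x); rewrite ?subrr ?subr0.
    exact: measurable_funB.
  have <- : \int[lam]_x (K1 x * (y < x)%R%:R) = \int[lam]_x K1 x - \int[lam]_x (K1 x * (x <= y)%R%:R).
    apply: etrans (RintegralB measurableT j1 (sec _ _ j1 mle)).
    by apply: eq_Rintegral => x _; rewrite /K1 leNgt; case: (y < x) => /=; ring.
  apply: etrans (ZL _ _ (sec _ _ j1 (mltx' y))).
  apply: eq_integral => x _; rewrite /f; cbn [fst snd].
  by rewrite /K1 /K2; congr (_%:E); ring.
transitivity (fine (\int[lam]_x \int[lam]_y (f (x, y))%:E)%E).
  rewrite Rintegral_mkcond; congr fine; apply: eq_integral => x _.
  rewrite in1 patchE; case: ifPn => xt; last by rewrite /K1 indicE (negbTE xt) mulr0 mul0r.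
  rewrite /K1 indicE xt mulr1.
  move: xt; rewrite inE/= in_itv/= => /andP[x0 xt].
  by rewrite /K2 (Rint_indicl true x0 xt i2).
rewrite Fub [RHS]Rintegral_mkcond; congr fine; apply: eq_integral => y _.
rewrite in2 patchE; case: ifPn => yt; last by rewrite /K2 indicE (negbTE yt) mulr0 mul0r.
rewrite /K2 indicE yt mulr1.
move: yt; rewrite inE/= in_itv/= => /andP[y0 yt].
rewrite /K1 (Rint_indicl false y0 yt i1); congr (_ * (_ - _))%:E.
rewrite [RHS]Rintegral_mkcond; apply: eq_Rintegral => x _; rewrite patchE indicE.
by case: (x \in _); rewrite ?mulr1 ?mulr0.
Qed.
End interval_integrals.

Section volterra.
Context {d} {Om : measurableType d} {R : realType} (P : probability Om R).
Local Notation lam := (@lebesgue_measure R).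

Lemma ip_abs_le Z Y : L2 P Z -> L2 P Y ->
  Ex P (fun w => `|Z w * Y w|) <= (ip P Z Z + ip P Y Y) / 2.
Proof.
move=> LZ LY; have iZ : int1 P (fun w => Z w ^+ 2) by case: LZ.
have iY : int1 P (fun w => Y w ^+ 2) by case: LY.
apply: (@le_trans _ _ (Ex P (fun w => 2^-1 * (Z w ^+ 2 + Y w ^+ 2)))).
  apply: Ex_le; [exact/int1_abs/L2_mul|by apply: int1Z; exact: int1D|move=> w].
  rewrite normrM -(real_normK (num_real (Z w))) -(real_normK (num_real (Y w))).
  by have := sqr_ge0 (`|Z w| - `|Y w|); set y := `|Z w|; set z := `|Y w|; lra.
by rewrite ExZ; [rewrite ExD// !ip_sqr mulrC|exact: int1D].
Qed.

Lemma lint_const_lty (k : R -> R) (t M : R) (g : R -> \bar R) :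
  measurable_fun `[0, t] k -> lam.-integrable `[0, t] (EFin \o k) ->
  measurable_fun `[0, t] g ->
  (forall x, 0 <= x <= t -> (0 <= g x <= (`|k x| * M)%:E)%E) -> 0 <= M ->
  (\int[lam]_(x in `[0%R, t]) g x < +oo)%E.
Proof.
move=> mk /integrableP[_ ik] mg gM M0.
apply: (@le_lt_trans _ _ (\int[lam]_(x in `[0%R, t]) (`|(k x)%:E| * M%:E))%E).
  apply: ge0_le_integral => //=.
  - by move=> x; rewrite /= in_itv/= => /gM/andP[].
  - by apply/measurable_EFinP; apply: measurable_funM => //; exact: measurableT_comp.
  - by move=> x; rewrite /= in_itv/= => /gM/andP[].
rewrite ge0_integralZr//; last by apply/measurable_EFinP; apply: measurableT_comp.
by apply: lte_mul_pinfty => //; [apply: integral_ge0|rewrite ge0_fin_numE//; apply: integral_ge0|exact: ltry].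
Qed.

Context (k : R -> R) (m : Om * R -> R) (t : R) (t0 : 0 <= t).
Hypotheses (mk : measurable_fun setT k) (mm : measurable_fun setT m).
Hypothesis ik2 : lam.-integrable `[0, t] (fun x => (k x ^+ 2)%:E).
Hypothesis Lm : forall x, 0 <= x <= t -> L2 P (fun w => m (w, x)) /\
  ip P (fun w => m (w, x)) (fun w => m (w, x)) <= 1.

Let mk' : measurable_fun `[0, t] k. Proof. exact: measurable_funTS. Qed.
Let ik : lam.-integrable `[0, t] (EFin \o k). Proof. exact: lam_integrable_sqr. Qed.

Let absint (G : Om * R -> R) (M : R) (k' : R -> R) : measurable_fun setT G -> 
  measurable_fun `[0, t] k' -> lam.-integrable `[0, t] (EFin \o k') ->
  (forall x, 0 <= x <= t -> int1 P (fun w => G (w, x)) /\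
     Ex P (fun w => `|G (w, x)|) <= `|k' x| * M) -> 0 <= M ->
  (\int[lam]_(x in `[0%R, t]) \int[P]_w `|G (w, x)|%:E < +oo)%E.
Proof.
move=> mG mk1 ik1 h M0; apply: (@lint_const_lty k' _ M) => //.
  apply: measurable_funTS.
  apply: (@measurable_fun_fubini_tonelli_G _ _ _ _ _ P (fun p => `|G p|%:E)) => //.
  by apply/measurable_EFinP; exact: measurableT_comp.
move=> x /h[iG hG]; rewrite integral_ge0//=.
by rewrite -EFin_Ex ?lee_fin//; exact: int1_abs.
Qed.

Let mkm : measurable_fun setT (fun p : Om * R => k p.2 * m p).
Proof. by apply: measurable_funM => //; exact: measurableT_comp. Qed.

Lemma volterra_ae : {ae P, forall w, lam.-integrable `[0, t] (fun x => (k x * m (w, x))%:E)}.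
Proof.
have [] := @Ex_fubini _ _ _ P `[0, t]%classic (fun p => k p.2 * m p) (measurable_itv _) mkm.
  apply: (absint (M := 1) mkm mk' ik) => // x xt; have [Lx l1] := Lm xt; rewrite /=.
  split; first by apply: int1Z; exact: L2_int1.
  under [X in Ex P X]eq_fun do rewrite normrM.
  rewrite ExZ; last by apply: int1_abs; exact: L2_int1.
  apply: ler_wpM2l => //.
  have := ip_abs_le Lx (L2_cst P 1).
  have -> : (fun w => `|m (w, x) * 1|) = fun w => `|m (w, x)| by apply/funext => w; rewrite mulr1.
  move=> h; apply: (le_trans h).
  rewrite [X in _ + X](_ : _ = 1); last by rewrite /ip mul1r Ex_cst.
  by lra.
by [].
Qed.

Lemma volterra_L2 : L2 P (fun w => \int[lam]_(x in `[0, t]) (k x * m (w, x))).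
Proof.
have mI := measurable_Rint_section (measurable_itv `[0, t]) mkm.
have mm2 : measurable_fun setT (fun p => m p ^+ 2) by exact: measurable_funX.
have [ae1 _ i1 _] := @Ex_fubini _ _ _ P `[0, t]%classic (fun p => m p ^+ 2) (measurable_itv _) mm2
  ltac:(apply: (absint (M := 1) (k' := fun=> 1) mm2); [by []|
    by apply: (@lam_integrable_bdd _ _ _ _ 1) => // x; rewrite normr1|
    move=> x /Lm[[mx i2] l1]; split => //; under [X in Ex P X]eq_fun do rewrite ger0_norm ?sqr_ge0//;
    by rewrite normr1 mul1r -ip_sqr|by []]).
have mZ := measurable_Rint_section (measurable_itv `[0, t]) mm2.
pose K := \int[lam]_(x in `[0, t]) (k x ^+ 2).
pose Z w := \int[lam]_(x in `[0, t]) (m (w, x) ^+ 2).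
have iZ : int1 P Z by apply: i1 => //; exact: aeW.
split=> //.
pose I w := \int[lam]_(x in `[0, t]) (k x * m (w, x)).
have mI2 : measurable_fun setT (fun w => I w ^+ 2) by exact: measurable_funX.
have K0 : 0 <= K by apply: Rintegral_ge0 => x _; rewrite sqr_ge0.
have Z0 w : 0 <= Z w by apply: Rintegral_ge0 => x _; rewrite sqr_ge0.
(* The pathwise Cauchy-Schwarz bound holds almost surely; replacing the square by a minimum gives a
   version dominated everywhere. *)
have IZ : {ae P, forall w, I w ^+ 2 = Num.min (I w ^+ 2) (K * Z w)}.
  apply: filterS ae1 => w h; apply/esym/min_idPl.
  apply: (Rint_CS mk' _ ik2 h).2.
  apply: measurable_funTS.
  by apply: (@measurableT_comp _ _ _ _ _ _ m _ (fun x => (w, x))) => //; exact: measurable_fun_pair.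
apply: int1_ae IZ _ => //.
apply: (@int1_le _ _ _ P _ (fun w => K * Z w)); last exact: int1Z.
  by apply: measurable_minr => //; exact: measurable_funM.
move=> w; rewrite ger0_norm ?ge_min ?lexx ?orbT//.
by rewrite le_min sqr_ge0 mulr_ge0.
Qed.

Lemma volterra_ip h : L2 P h ->
  lam.-integrable `[0, t] (fun x => (k x * ip P h (fun w => m (w, x)))%:E) /\
  ip P h (fun w => \int[lam]_(x in `[0, t]) (k x * m (w, x))) =
    \int[lam]_(x in `[0, t]) (k x * ip P h (fun w => m (w, x))).
Proof.
move=> Lh; have [mh _] := Lh.
pose G (p : Om * R) := h p.1 * (k p.2 * m p).
have mG : measurable_fun setT G by apply: measurable_funM => //; exact: measurableT_comp.
have e x : 0 <= x <= t -> Ex P (fun w => G (w, x)) = k x * ip P h (fun w => m (w, x)).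
  move=> /Lm[Lx _]; rewrite /ip -ExZ; last exact: L2_mul.
  by congr (Ex P _); apply/funext => w; rewrite /G /= mulrCA.
have fin : (\int[lam]_(x in `[0%R, t]) \int[P]_w `|G (w, x)|%:E < +oo)%E.
  apply: (absint (M := (ip P h h + 1) / 2) mG mk' ik); last first.
    by rewrite divr_ge0 ?addr_ge0 ?ip_ge0.
  move=> x /Lm[Lx l1]; have E : (fun w => G (w, x)) = fun w => k x * (h w * m (w, x)).
    by apply/funext => w; rewrite /G /= mulrCA.
  split; first by rewrite E; apply: int1Z; exact: L2_mul.
  have -> : (fun w => `|G (w, x)|) = fun w => `|k x| * `|h w * m (w, x)|.
    by apply/funext => w; rewrite -normrM /G /= mulrCA.
  rewrite ExZ; last exact/int1_abs/L2_mul.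
  apply: ler_wpM2l => //; apply: (le_trans (ip_abs_le Lh Lx)).
  by rewrite ler_pM2r ?invr_gt0// lerD2l.
have [_ i2 _ E] := Ex_fubini (measurable_itv `[0, t]) mG fin.
split.
  apply: eq_integrable i2 => // x; rewrite inE/= in_itv/= => xt.
  by rewrite e.
transitivity (\int[lam]_(x in `[0, t]) Ex P (fun w => G (w, x))); last first.
  apply: eq_Rintegral.
  by move=> x; rewrite inE/= in_itv/= => /e.
rewrite -E; apply: Ex_ae.
- by apply: measurable_funM => //; have [] := volterra_L2.
- exact: (measurable_Rint_section (measurable_itv `[0, t]) mG).
- by apply: filterS volterra_ae => w iw; rewrite /G /= RintegralZl.
Qed.
End volterra.

Section uniform.
Context {R : realType} (T : R) (T0 : 0 < T).
Local Notation lam := (@lebesgue_measure R).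
(** Lebesgue measure on [[0,T]] is normalised to a probability, so that the theory of [L2] and of
    closed spans applies to functions of time. *)
Definition unif : probability (measurableTypeR R) R := uniform_prob T0.

Lemma unif_lint (f : R -> \bar R) : measurable_fun setT f -> (forall x, (0 <= f x)%E) ->
  (\int[unif]_x f x = T^-1%:E * \int[lam]_(x in `[0%R, T]) f x)%E.
Proof. by move=> mf f0; rewrite integral_uniform// subr0. Qed.

Lemma unif_int1 (f : R -> R) : measurable_fun setT f ->
  int1 unif f <-> lam.-integrable `[0, T] (EFin \o f).
Proof.
move=> mf.
have mf' : measurable_fun `[0, T] f by exact: measurable_funTS.
have E : (\int[unif]_x `|(EFin \o f) x| = T^-1%:E * \int[lam]_(x in `[0%R, T]) `|(EFin \o f) x|)%E.
  by apply: unif_lint => // x; apply: measurableT_comp => //; exact/measurable_EFinP.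
split=> /integrableP[m1 h]; apply/integrableP; split; try exact/measurable_EFinP.
  move: h; rewrite E; rewrite !ltey; apply: contra => /eqP ->.
  by rewrite gt0_muley// lte_fin invr_gt0.
rewrite E; apply: lte_mul_pinfty => //; last by rewrite lee_fin invr_ge0 ltW.
Qed.

Lemma unif_Ex (f : R -> R) : int1 unif f -> Ex unif f = T^-1 * \int[lam]_(x in `[0, T]) f x.
Proof.
move=> i1; have mf := int1_meas i1.
have i2 : lam.-integrable `[0, T] (EFin \o f) by apply/unif_int1.
have mF : measurable_fun setT (EFin \o f) by exact/measurable_EFinP.
apply: EFin_inj; rewrite EFinM (EFin_Ex i1) /Rintegral fineK; last exact: integrable_fin_num.
transitivity ((\int[unif]_x (EFin \o f)^\+ x) - (\int[unif]_x (EFin \o f)^\- x))%E.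
  exact: integralE.
rewrite (unif_lint (measurable_funepos mF) (funepos_ge0 _)) (unif_lint (measurable_funeneg mF) (funeneg_ge0 _)).
transitivity (T^-1%:E * ((\int[lam]_(x in `[0%R, T]) (EFin \o f)^\+ x) - (\int[lam]_(x in `[0%R, T]) (EFin \o f)^\- x)))%E; last first.
  by congr (_ * _)%E; apply/esym/integralE.
have /fineK <- := @integrable_pos_fin_num _ _ _ lam `[0, T]%classic (measurable_itv _) _ i2.
have /fineK <- := @integrable_neg_fin_num _ _ _ lam `[0, T]%classic (measurable_itv _) _ i2.
exact: (congr1 EFin (esym (mulrBr _ _ _))).
Qed.
End uniform.

Section isometry.
Context {d1 d2} {O1 : measurableType d1} {O2 : measurableType d2} {R : realType}
  (P1 : probability O1 R) (P2 : probability O2 R).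
Context {I : eqType} (V1 : I -> O1 -> R) (V2 : I -> O2 -> R) (S : I -> Prop).
Hypotheses (L1 : forall i, S i -> L2 P1 (V1 i)) (LV2 : forall i, S i -> L2 P2 (V2 i)).
Hypothesis gram : forall i j, S i -> S j -> ip P1 (V1 i) (V1 j) = ip P2 (V2 i) (V2 j).

Lemma ip_lcl {d} {O : measurableType d} (P : probability O R) (V : I -> O -> R) s Z :
  (forall i, S i -> L2 P (V i)) -> inS S s -> L2 P Z ->
  ip P (lc V s) Z = \sum_(x <- s) x.1 * ip P (V x.2) Z.
Proof.
move=> LV; elim: s => [|[c i] s IH] sS LZ.
  rewrite big_nil /ip; under [X in Ex P X]eq_fun do rewrite /lc big_nil mul0r.
  exact: Ex_cst.
have Si : S i by apply: (sS (c, i)); rewrite inE eqxx.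
have sS' : inS S s by move=> y ys; apply: sS; rewrite inE ys orbT.
rewrite big_cons -IH//.
have -> : lc V ((c, i) :: s) = fun w => c * V i w + lc V s w by apply/funext => w; rewrite /lc big_cons.
have LVi := LV i Si; have Lc := L2_lc LV sS'.
by rewrite ipDl//; [rewrite ipZl|exact: L2Z].
Qed.

Lemma iso_lc s s' : inS S s -> inS S s' -> ip P1 (lc V1 s) (lc V1 s') = ip P2 (lc V2 s) (lc V2 s').
Proof.
move=> sS sS'; have L1' := L2_lc L1 sS'; have L2' := L2_lc LV2 sS'.
rewrite (ip_lcl L1 sS L1') (ip_lcl LV2 sS L2').
apply: eq_big_seq => x xs; congr (_ * _); have Sx := sS x xs.
rewrite (ipC P1) (ipC P2) (ip_lcl L1 sS' (L1 Sx)) (ip_lcl LV2 sS' (LV2 Sx)).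
by apply: eq_big_seq => y ys; congr (_ * _); apply: gram => //; exact: sS'.
Qed.

Lemma iso_lcB s s' : inS S s -> inS S s' ->
  ip P1 (fun w => lc V1 s w - lc V1 s' w) (fun w => lc V1 s w - lc V1 s' w) =
  ip P2 (fun w => lc V2 s w - lc V2 s' w) (fun w => lc V2 s w - lc V2 s' w).
Proof.
move=> sS sS'; rewrite !ip_sqrB; [|exact: (L2_lc LV2)|exact: (L2_lc LV2)|exact: (L2_lc L1)|exact: (L2_lc L1)].
by rewrite !iso_lc.
Qed.

(** Equal Gram matrices define an isometry between combinations. Coefficients approximating [Z2] on
    one side therefore give a Cauchy sequence on the other, and the coefficients are returned for
    use at truncated times. *)
Lemma iso_approx Z2 : ospan P2 V2 S Z2 -> exists Z1 (s : nat -> seq (R * I)),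
  [/\ L2 P1 Z1, forall n, inS S (s n),
   forall n, ip P1 (fun w => lc V1 (s n.+1) w - lc V1 (s n) w) (fun w => lc V1 (s n.+1) w - lc V1 (s n) w) <= 4^-1 ^+ n,
   ip P1 (fun w => lc V1 (s n) w - Z1 w) (fun w => lc V1 (s n) w - Z1 w) @[n --> \oo] --> 0 &
   ip P2 (fun w => lc V2 (s n) w - Z2 w) (fun w => lc V2 (s n) w - Z2 w) @[n --> \oo] --> 0].
Proof.
move=> Z2S; have [LZ _] := Z2S; have [s sS [_ sZ]] := ospan_approx LV2 Z2S.
have Ls n : L2 P2 (lc V2 (s n)) by exact: (L2_lc LV2).
(* Dropping two terms turns the error [4 * 4^-n] into steps of squared norm at most [4^-n]. *)
pose s' n := s n.+2.
have step n : ip P1 (fun w => lc V1 (s' n.+1) w - lc V1 (s' n) w) (fun w => lc V1 (s' n.+1) w - lc V1 (s' n) w) <= 4^-1 ^+ n.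
  rewrite iso_lcB; [|exact: sS..].
  have -> : (fun w => lc V2 (s' n.+1) w - lc V2 (s' n) w) =
     fun w => (lc V2 (s' n.+1) w - Z2 w) + (Z2 w - lc V2 (s' n) w) by apply/funext => w; ring.
  apply: (le_trans (ip_tri (L2B (Ls _) LZ) (L2B LZ (Ls _)))).
  have -> : ip P2 (fun w => Z2 w - lc V2 (s' n) w) (fun w => Z2 w - lc V2 (s' n) w) =
    ip P2 (fun w => lc V2 (s' n) w - Z2 w) (fun w => lc V2 (s' n) w - Z2 w).
    by apply: eq_Rintegral => w _; ring.
  have := sZ n.+3; have := sZ n.+2; rewrite /s' !exprS.
  have : 0 <= 4^-1 ^+ n :> R by rewrite exprn_ge0.
  by set a := 4^-1 ^+ n; set b := ip _ _ _; set c := ip _ _ _; lra.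
have [Z1 [LZ1 _ Z1s]] := L2_complete (fun n => L2_lc L1 (sS n.+2)) step.
exists Z1, s'; split => //; first by move=> n; exact: sS.
  apply: (@squeeze_cvgr _ _ _ _ (fun=> 0) (fun n => 4 * 4^-1 ^+ n)); [|exact: cvg_cst|exact: geo4_cvg0].
  by apply: nearW => n; rewrite ip_ge0 Z1s.
apply: (@squeeze_cvgr _ _ _ _ (fun=> 0) (fun n => 4 * 4^-1 ^+ n)); [|exact: cvg_cst|exact: geo4_cvg0].
apply: nearW => n; rewrite ip_ge0/=; apply: (le_trans (sZ n.+2)).
rewrite ler_pM2l// !exprS.
have : 0 <= 4^-1 ^+ n :> R by rewrite exprn_ge0.
by set a := 4^-1 ^+ n; lra.
Qed.
End isometry.

(** For a process with covariance [min(s,t)], stopping the times at [x] projects a combination of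
    its values on the closed span of the values up to [x]. *)
Definition trunc_times {R : realType} (x : R) (s : seq (R * R)) := [seq (c.1, Num.min c.2 x) | c <- s].

Lemma trunc_timesS {R : realType} (S : R -> Prop) (x : R) s : inS S s -> S x -> inS S (trunc_times x s).
Proof.
move=> sS Sx _ /mapP[c cs ->] /=; rewrite minEle; case: ifP => // _; exact: sS.
Qed.

Lemma lc_trunc {R : realType} {T : Type} (V : R -> T -> R) (x : R) s w :
  lc V (trunc_times x s) w = \sum_(c <- s) c.1 * V (Num.min c.2 x) w.
Proof. by rewrite /lc big_map. Qed.

Section kernel.
Context {R : realType} (T : R) (T0 : 0 < T) {d} {Om : measurableType d} (P : probability Om R).
Local Notation lam := (@lebesgue_measure R).
Local Notation S := (fun t : R => 0 <= t < T).
Local Notation U := (unif T0).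
Local Notation q := (Num.sqrt T).

(** The factor [q = sqrt T] undoes the normalisation of the uniform law: the inner product of [V s]
    and [V t] is [min(s,t)]. *)
Let V (t y : R) := q * \1_(`[0, t]%classic) y.

Let q2 : q * q = T. Proof. by rewrite -expr2 sqr_sqrtr// ltW. Qed.

Lemma Rint_mul_indic (h : R -> R) (t : R) : t <= T ->
  \int[lam]_(y in `[0, T]) (h y * \1_(`[0, t]%classic) y) = \int[lam]_(y in `[0, t]) h y.
Proof.
move=> tT; rewrite Rintegral_mkcond [RHS]Rintegral_mkcond; apply: eq_Rintegral => y _.
rewrite !patchE indicE !mem_setE !in_itv/=.
have [y0|] := boolP (0 <= y) => //=; have [yt|yt] := boolP (y <= t).
  by rewrite (le_trans yt tT) mulr1.
by rewrite mulr0; case: ifP.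
Qed.

Lemma unif_indic (h : R -> R) (t : R) : t <= T -> measurable_fun setT h ->
  lam.-integrable `[0, t] (EFin \o h) ->
  int1 U (fun y => h y * \1_(`[0, t]%classic) y) /\
  Ex U (fun y => h y * \1_(`[0, t]%classic) y) = T^-1 * \int[lam]_(y in `[0, t]) h y.
Proof.
move=> tT mh ih.
have i1 : int1 U (fun y => h y * \1_(`[0, t]%classic) y).
  apply/unif_int1; first by apply: measurable_funM => //; exact: measurable_indic.
  by have := integrable_indicl ih; apply: integrableS.
by split=> //; rewrite unif_Ex// Rint_mul_indic.
Qed.

Let LV t : L2 U (V t).
Proof.
apply: (@L2_bdd _ _ _ _ (`|q|)) => [|y].
  by apply: measurable_funM => //; exact: measurable_indic.
by rewrite /V normrM ler_piMr// indicE; case: (_ \in _); rewrite ?normr1 ?normr0.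
Qed.

Let Vmin t x y : V (Num.min t x) y = V t y * \1_(`[0, x]%classic) y.
Proof.
rewrite /V !indicE !mem_setE !in_itv/= le_min.
by case: (0 <= y); case: (y <= t); case: (y <= x); rewrite /= ?mulr1 ?mulr0.
Qed.

Let ipV (h : R -> R) t : t <= T -> measurable_fun setT h -> lam.-integrable `[0, t] (EFin \o h) ->
  ip U (V t) (fun y => q * h y) = \int[lam]_(y in `[0, t]) h y.
Proof.
move=> tT mh ih.
have ih' : lam.-integrable `[0, t] (EFin \o (fun y => T * h y)) by exact: lam_intZ.
have mh' : measurable_fun setT (fun y => T * h y) by exact: measurable_funM.
have [_ E] := unif_indic tT mh' ih'.
rewrite /ip (_ : (fun w => _) = fun y => T * h y * \1_(`[0, t]%classic) y); last first.
  by apply/funext => y; rewrite /V -[in X in _ = X * _ * _]q2; ring.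
by rewrite E RintegralZl// mulrA mulVf ?gt_eqF// mul1r.
Qed.

Let i_cst (t : R) : lam.-integrable `[0, t] (EFin \o (fun=> 1)).
Proof. by apply: (@lam_integrable_bdd _ _ _ _ 1) => // x; rewrite normr1. Qed.

Let gramV s t : 0 <= s <= t -> t < T -> ip U (V s) (V t) = s.
Proof.
move=> /andP[s0 st] tT.
have -> : ip U (V s) (V t) = ip U (V s) (fun y => q * 1).
  rewrite /ip; congr (Ex _ _); apply/funext => y.
  have -> : V s y = V s y * \1_(`[0, t]%classic) y by rewrite -Vmin; congr (V _ y); apply/esym/min_idPl.
  by rewrite /V !indicE; case: (y \in `[0, t]%classic); rewrite /= ?mulr0 ?mul0r ?mulr1.
rewrite ipV//; last exact: (le_trans st (ltW tT)).
rewrite Rintegral_cst//= lebesgue_measure_itv/= mul1r; case: ifP => //=; first by rewrite oppr0 addr0.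
by move/negbT; rewrite lte_fin -leNgt => s0'; apply/esym/le_anti; rewrite s0' s0.
Qed.

Context (W : R -> Om -> R) (LW : forall t, S t -> L2 P (W t)).
Hypothesis gramW : forall s t, 0 <= s -> s <= t -> t < T -> ip P (W s) (W t) = s.
Context (eta : Om -> R) (etaS : ospan P W S eta).

(* The isometry [W t |-> 1_[0,t]] into [L^2(0,T)], realised with the uniform law, sends [eta] to [phi]. *)
Theorem wiener_kernel : exists (phi : R -> R) (s : nat -> seq (R * R)),
  [/\ measurable_fun setT phi /\ lam.-integrable `[0, T] (fun x => (phi x ^+ 2)%:E),
    forall n, inS S (s n),
    forall x, S x -> forall g : R -> R, measurable_fun setT g -> lam.-integrable `[0, x] (fun y => (g y ^+ 2)%:E) ->
      \sum_(c <- s n) c.1 * \int[lam]_(y in `[0, Num.min c.2 x]) g y @[n --> \oo] -->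
      \int[lam]_(y in `[0, x]) (phi y * g y),
    forall x, S x -> forall n, ip P (fun w => lc W (trunc_times x (s n.+1)) w - lc W (trunc_times x (s n)) w)
      (fun w => lc W (trunc_times x (s n.+1)) w - lc W (trunc_times x (s n)) w) <= 4^-1 ^+ n &
    ip P (fun w => lc W (s n) w - eta w) (fun w => lc W (s n) w - eta w) @[n --> \oo] --> 0].
Proof.
have gram s t : S s -> S t -> ip U (V s) (V t) = ip P (W s) (W t).
  move=> /andP[s0 sT] /andP[t0 tT]; have [st|ts] := leP s t.
    by rewrite gramV ?gramW ?s0.
  by rewrite ipC [RHS]ipC gramV ?gramW ?t0 ?ltW.
have LVS t : S t -> L2 U (V t) by [].
have [Phi [s [LPhi sS step PhiE etaE]]] := iso_approx LVS LW gram etaS.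
have [mPhi _] := LPhi.
(* Every [V t] carries the factor [q], which is divided out to obtain the density with respect to
   Lebesgue measure. *)
exists (fun y => q^-1 * Phi y), s.
have q0 : q != 0 by rewrite gt_eqF// sqrtr_gt0.
split => //.
- split; first exact: measurable_funM.
  have /unif_int1 : int1 U (fun y => Phi y ^+ 2) by case: LPhi.
  move=> h; have {}h := h (measurable_funX _ mPhi).
  have := lam_intZ (q^-1 ^+ 2) h; congr (_.-integrable _ _).
  by apply/funext => y; rewrite /= exprMn.
- move=> x /andP[x0 xT] g mg ig2.
  have ig : lam.-integrable `[0, x] (EFin \o g).
    by apply: lam_integrable_sqr => //; exact: measurable_funTS.
  pose g' y := g y * \1_(`[0, x]%classic) y.
  have mg' : measurable_fun setT g' by apply: measurable_funM => //; exact: measurable_indic.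
  have Lg : L2 U g'.
    split=> //; have [] := unif_indic (ltW xT) (measurable_funX 2 mg) ig2.
    move=> + _; congr (int1 _ _); apply/funext => y; rewrite /g' exprMn indicE.
    by case: (_ \in _); rewrite ?expr1n ?expr0n.
  have Lqg : L2 U (fun y => q * g' y) by exact: L2Z.
  have := L2_cauchy_cvg (fun n => L2_lc LVS (sS n)) LPhi Lqg PhiE.
  have -> : ip U Phi (fun y => q * g' y) = \int[lam]_(y in `[0, x]) (q^-1 * Phi y * g y).
    have iPg := L2_mul LPhi Lqg.
    rewrite /ip unif_Ex//.
    transitivity (T^-1 * \int[lam]_(y in `[0, T]) (T * (q^-1 * Phi y * g y) * \1_(`[0, x]%classic) y)).
      congr (_ * _); apply: eq_Rintegral => y _; rewrite /g' -{2}q2.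
      by rewrite mulrA !mulrA; congr (_ * _); field.
    rewrite Rint_mul_indic ?(ltW xT)// RintegralZl//.
      by rewrite mulrA mulVf ?gt_eqF// mul1r.
    have /unif_int1 h := L2_mul LPhi Lg.
    have {}h := h (measurable_funM mPhi mg').
    have : lam.-integrable `[0, x] (EFin \o (fun y => Phi y * g' y)).
      apply: integrableS h => // y /=; rewrite !in_itv/= => /andP[-> yx].
      exact: (le_trans yx (ltW xT)).
    move=> /(lam_intZ q^-1) {}h; apply: eq_integrable h => // y; rewrite inE/= => yx.
    by rewrite /g' indicE mem_set// mulr1 mulrA.
  apply: cvg_trans; apply: near_eq_cvg; apply: nearW => n.
  rewrite (ip_lcl LVS (sS n) Lqg); apply: eq_big_seq => c cs.
  have /andP[c0 cT] := sS n c cs; congr (_ * _).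
  have mT : Num.min c.2 x <= T by rewrite ge_min (ltW cT).
  have -> : ip U (V c.2) (fun y => q * g' y) = ip U (V (Num.min c.2 x)) (fun y => q * g y).
    rewrite /ip; congr (Ex _ _); apply/funext => y; rewrite Vmin /g'; ring.
  rewrite ipV//.
  apply: integrableS ig => // y /=; rewrite !in_itv/= => /andP[-> yx].
  by apply: (le_trans yx); rewrite ge_min lexx orbT.
- move=> x Sx n.
  have tS k : inS S (trunc_times x (s k)) by exact: trunc_timesS.
  rewrite -(iso_lcB LVS LW gram (tS n.+1) (tS n)); apply: le_trans (step n).
  have tE k y : lc V (trunc_times x (s k)) y = lc V (s k) y * \1_(`[0, x]%classic) y.
    rewrite lc_trunc /lc mulr_suml; apply: eq_bigr => c _; rewrite Vmin; ring.
  have LL := L2B (L2_lc LVS (sS n.+1)) (L2_lc LVS (sS n)).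
  have LL' := L2B (L2_lc LVS (tS n.+1)) (L2_lc LVS (tS n)).
  rewrite !ip_sqr; apply: Ex_le; [by case: LL'|by case: LL|move=> y].
  rewrite !tE indicE; case: (_ \in _); first by rewrite !mulr1.
  by rewrite !mulr0 subrr expr0n sqr_ge0.
Qed.
End kernel.

Section random_time.
Context {R : realType} {T : R}.
Local Notation C := (path_space T).
Local Notation lam := (@lebesgue_measure R).
Context {d} {Om : measurableType d} (F : Om -> C) (tau : Om -> R) (s : R).
Hypothesis sT : 0 <= s <= T.
Hypothesis mF : forall r, r \in `[0, s] -> measurable_fun setT (fun w => F w r).
Hypotheses (mtau : measurable_fun setT tau) (taus : forall w, 0 <= tau w <= s).

Lemma path_at_measurable : measurable_fun setT (fun w => F w (tau w)).
Proof.
have [s0 sleT] := andP sT.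
pose idx n w := Num.truncn (tau w * n.+1%:R).
(* The path is read at the grid point just below [tau w]; exactly one summand is selected. The
   minimum with [s] keeps the times of the other summands in the range where evaluation is
   measurable. *)
pose g n w : R := \sum_(k < (Num.truncn (s * n.+1%:R)).+1)
  (if (k%:R <= tau w * n.+1%:R) && (tau w * n.+1%:R < k.+1%:R) then 1 else 0) * F w (Num.min (k%:R / n.+1%:R) s).
have gE n w : g n w = F w ((idx n w)%:R / n.+1%:R).
  have /andP[t0 ts] := taus w.
  have tn0 : 0 <= tau w * n.+1%:R by rewrite mulr_ge0.
  have [k1 _] := andP (truncn_itv tn0).
  have kK : (idx n w < (Num.truncn (s * n.+1%:R)).+1)%N by rewrite ltnS /idx le_truncn// ler_wpM2r.
  rewrite /g (bigD1 (Ordinal kK))//= -truncn_eq// eqxx mul1r big1 ?addr0.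
    congr (F w _); apply/min_idPl; rewrite ler_pdivrMr ?ltr0n//.
    by apply: (le_trans k1); rewrite ler_wpM2r.
  move=> k kn; rewrite -truncn_eq// -/(idx n w); case: eqP => [e|]; last by rewrite mul0r.
  by move: kn; rewrite -val_eqE /= e eqxx.
have mg n : measurable_fun setT (g n).
  apply: measurable_sum => k; apply: measurable_funM.
    apply: measurable_fun_ifT => //; apply: measurable_and; first by apply: measurable_fun_ler => //; exact: measurable_funM.
    by apply: measurable_fun_ltr => //; exact: measurable_funM.
  apply: mF; rewrite in_itv/= le_min s0 andbT ge_min lexx orbT andbT.
  by rewrite divr_ge0.
apply: (measurable_fun_cvg mg) => w _.
have /andP[t0 ts] := taus w.
have tT : tau w \in `[0, T] by rewrite in_itv/= t0 (le_trans ts).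
apply/cvgrPdist_lt => e e0; have [dl dl0 H] := path_cvg (F w) tT e0.
near=> n; rewrite gE; have tn0 : 0 <= tau w * n.+1%:R by rewrite mulr_ge0.
have /andP[k1 k2] := truncn_itv tn0.
have n0 : 0 < n.+1%:R :> R by rewrite ltr0n.
have le1 : (idx n w)%:R / n.+1%:R <= tau w by rewrite ler_pdivrMr.
apply: H; first by rewrite in_itv/= divr_ge0//= (le_trans le1) ?(le_trans ts).
rewrite ger0_norm ?subr_ge0// ltrBlDr.
have h : n.+1%:R^-1 < dl by near: n; apply: (near_infty_natSinv_lt (PosNum dl0)).
apply: (@lt_trans _ _ (n.+1%:R^-1 + (idx n w)%:R / n.+1%:R)); last by rewrite ltrD2r.
by rewrite -[X in _ < X + _]mul1r -mulrDl ltr_pdivlMr// addrC natr1.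
Unshelve. all: by end_near.
Qed.

(** When progressive measurability of the new drift is checked, time is itself a coordinate; this is
    why the noise is taken at a measurable time. *)
Lemma noise_at_measurable alpha (delta : R -> C -> R) : progressively_measurable delta ->
  measurable_fun setT (fun w => noise alpha delta (tau w) (F w)).
Proof.
move=> pd; apply: measurable_funM => //; apply: measurable_funB; first exact: path_at_measurable.
have := measurable_Rint_upto (prog_joint pd sT mF) mtau.
congr (measurable_fun _ _); apply/funext => w.
by apply: Rint_indic; have /andP[] := taus w.
Qed.
End random_time.

(** One null set serves for all [S < T], since integrability at countably many times increasing to
    [T] implies the rest. *)
Lemma locally_integrable_ae {R : realType} {T : R} (T0 : 0 < T) {d} {Om : measurableType d} (P : probability Om R)
  (delta : R -> path_space T -> R) (Y : Om -> path_space T) : progressively_measurable delta ->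
  (forall t, 0 <= t < T -> {ae P, forall w, (\int[@lebesgue_measure R]_(x in `[0%R, t]) `|delta x (Y w)|%:E < +oo)%E}) ->
  locally_integrable_drift P delta Y.
Proof.
move=> pd H.
pose S k := T * (1 - k.+1%:R^-1) : R.
have ST k : 0 <= S k < T.
  have k1 : 0 < k.+1%:R^-1 :> R by rewrite invr_gt0.
  have k2 : k.+1%:R^-1 <= 1 :> R by rewrite invf_le1 ?ltr0n// ler1n.
  rewrite /S mulr_ge0 ?subr_ge0// ?(ltW T0)//= mulrBr mulr1 ltrBlDr ltrDl.
  exact: mulr_gt0.
have := ae_foralln (fun k => H (S k) (ST k)); apply: filterS => w hw s /andP[s0 sT].
have [k sk] : exists k, s <= S k.
  have e0 : 0 < 1 - s / T by rewrite subr_gt0 ltr_pdivrMr// mul1r.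
  have [k _ hk] := near_infty_natSinv_lt (PosNum e0).
  exists k; rewrite /S -ler_pdivrMl// mulrC.
  by have : k.+1%:R^-1 < 1 - s / T := hk k (leqnn _); set a := k.+1%:R^-1; set b := s / T; lra.
apply: le_lt_trans (hw k); apply: ge0_subset_integral => //.
- have sT' : 0 <= S k <= T by have /andP[-> /ltW] := ST k.
  apply/measurable_EFinP/measurableT_comp => //.
  exact: drift_section.
- by move=> x /=; rewrite !in_itv/= => /andP[-> xs]; exact: (le_trans xs sk).
Qed.

Section hat_functional.
Context {R : realType} {T : R} (T0 : 0 < T) {d} {Om : measurableType d} (P : probability Om R).
Local Notation C := (path_space T).
Local Notation lam := (@lebesgue_measure R).
Context (X : {RV P >-> C}) (GX : gfam P (fun b w => b (X w)) clf).
Local Notation amb := (ospan P (fun b w => b (X w)) clf).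
Context (Y : Om -> C) (YA : forall b, clf b -> amb (fun w => b (Y w))).
Context (eta : Om -> R) (etaA : amb eta) (eta1 : ip P eta eta = 1).
Context (v : C) (vE : forall b, clf b -> ip P eta (fun w => b (Y w)) = b v).
Hypothesis nd : forall s, 0 <= s < T -> exists2 K : R, 0 < K & forall l, inS (fun r : R => 0 <= r <= s) l ->
  1 <= K * ip P (fun w => eta w - lc (fun r w => Y w r) l w) (fun w => eta w - lc (fun r w => Y w r) l w).
Context (alpha : R) (delta : R -> C -> R) (gd : good P alpha delta Y).
Local Notation wf := (noise alpha delta).
Local Notation gs a := (g_sigma_algebraType (past (@idfun C) a)).
Local Notation Yh := (fun w => Y w - eta w *: v : C).

Let pd : progressively_measurable delta. Proof. by case: gd. Qed.

Lemma lc_past_measurable (t : R) (l : seq (R * R)) : inS (fun r => r \in `[0, t]) l ->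
  measurable_fun setT (lc (fun r (f : C) => f r) l : gs t -> R).
Proof.
elim: l => [|[c r] l IH] lS.
  rewrite (_ : lc _ _ = fun=> 0); last by apply/funext => f; rewrite /lc big_nil.
  exact: measurable_cst.
rewrite (_ : lc _ _ = fun f : C => c * f r + lc (fun r (f : C) => f r) l f); last first.
  by apply/funext => f; rewrite /lc big_cons.
apply: measurable_funD; last by apply: IH => x xl; apply: lS; rewrite inE xl orbT.
by apply: measurable_funM => //; apply: past_eval; apply: (lS (c, r)); rewrite inE eqxx.
Qed.

(** [wf t (Y)] is almost surely a limit of combinations of values of [Y] up to [t]. That identity is
    an event of the past of [t], so by absolute continuity it also holds along [Y - eta v], where
    the combinations can be computed because they are linear in the path. *)
Lemma hat_noise t : 0 <= t < T ->
  {ae P, forall w, wf t (Yh w) = wf t (Y w) - ip P eta (fun w => wf t (Y w)) * eta w}.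
Proof.
move=> tT; have /andP[t0 tlT] := tT.
have tT' : 0 <= t <= T by rewrite t0 ltW.
have [_ _ _ /(_ t t0 tlT) Ws _] := gd.
have LY r : `[0, t]%classic r -> L2 P (fun w => Y w r) by move=> _; have [] := amb_ev YA r.
have [s sS [aes cs]] := ospan_approx LY Ws.
have sS' n : inS (fun r => r \in `[0, t]) (s n) by exact: sS.
have LW : L2 P (fun w => wf t (Y w)) by have [] := Ws.
have [Le _] := etaA.
pose ev := fun (r : R) (f : C) => f r.
pose h f := flim (fun n => lc ev (s n) f).
have mh : measurable_fun setT (h : gs t -> R).
  by apply: (@measurable_flim _ (gs t) R setT (fun n f => lc ev (s n) f)) => // n; exact: lc_past_measurable.
pose A : set C := [set f | h f - wf t f = 0].
have sA : <<s past (@idfun C) t>> A.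
  have m1 : measurable_fun setT ((fun f => h f - wf t f) : gs t -> R).
    by apply: measurable_funB => //; exact: noise_past.
  have := m1 measurableT [set 0] (measurable_set1 _); rewrite setTI.
  exact.
have aeA : {ae P, forall w, A (Y w)}.
  by apply: filterS aes => w cw; rewrite /A /= /h (flimE cw) subrr.
have aeAh := hat_abs_cont GX YA etaA eta1 vE (nd tT) sA aeA.
apply: filterS2 aes aeAh => w cw; rewrite /A /= => /eqP; rewrite subr_eq0 => /eqP <-.
apply: flimE.
have e n : lc ev (s n) (Yh w) = lc (fun r w => Y w r) (s n) w - ip P eta (lc (fun r w => Y w r) (s n)) * eta w.
  have -> : ip P eta (lc (fun r w => Y w r) (s n)) = lc ev (s n) v.
    rewrite ipC (ip_lcl (S := `[0, t]%classic)) //; first by apply: eq_bigr => c _; rewrite ipC (ip_ev vE).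
  rewrite /lc mulr_suml -sumrB; apply: eq_bigr => c _.
  by rewrite /ev pathB pathZ; ring.
under eq_fun do rewrite e.
apply: cvgB => //; apply: cvgMl.
have Ln n : L2 P (lc (fun r w => Y w r) (s n)) by exact: (L2_lc LY).
rewrite ipC; under eq_fun do rewrite ipC.
apply: (L2_cauchy_cvg Ln LW Le).
apply: (@squeeze_cvgr _ _ _ _ (fun=> 0) (fun n => 4 * 4^-1 ^+ n)); [|exact: cvg_cst|exact: geo4_cvg0].
by apply: nearW => n; rewrite ip_ge0 cs.
Qed.

Lemma hat_drift : locally_integrable_drift P delta Yh.
Proof.
have [_ li _ _ _] := gd.
apply: (locally_integrable_ae T0 pd) => t tT.
have tT' : 0 <= t <= T by have /andP[-> /ltW] := tT.
pose A : set C := [set f | (\int[lam]_(x in `[0%R, t]) `|delta x f|%:E < +oo)%E].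
have sA : <<s past (@idfun C) t>> A.
  have := lint_past pd tT' measurableT; move=> /(_ [set x | (x < +oo)%E]); rewrite setTI; apply.
  by rewrite -set_itvNyo; exact: emeasurable_itv.
apply: (hat_abs_cont GX YA etaA eta1 vE (nd tT) sA).
by apply: filterS li => w /(_ t tT).
Qed.
End hat_functional.

Lemma cvgR_unique {R : realType} (f : nat -> R) (l l' : R) :
  f n @[n --> \oo] --> l -> f n @[n --> \oo] --> l' -> l = l'.
Proof. by move=> h h'; rewrite -(cvg_lim _ h)// -(cvg_lim _ h'). Qed.

Lemma Rint1 {R : realType} (a : R) : 0 <= a -> \int[@lebesgue_measure R]_(x in `[0, a]) 1 = a.
Proof.
move=> a0; rewrite Rintegral_cst//= lebesgue_measure_itv/= mul1r; case: ifP => //=.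
  by rewrite oppr0 addr0.
by move/negbT; rewrite lte_fin -leNgt => h; apply/esym/le_anti; rewrite h a0.
Qed.

Lemma lam_int_sub {R : realType} (f : R -> \bar R) (a b : R) : b <= a ->
  (@lebesgue_measure R).-integrable `[0, a] f -> (@lebesgue_measure R).-integrable `[0, b] f.
Proof.
move=> ba; apply: integrableS => // x /=; rewrite !in_itv/= => /andP[-> xb].
exact: (le_trans xb ba).
Qed.

Lemma measurable_inv {R : realType} : measurable_fun setT (fun x : R => x^-1).
Proof.
rewrite (_ : (fun x => _) = fun x : R => x * (x ^+ 2) `^ (-1)); last first.
  apply/funext => x; rewrite powR_inv1 ?sqr_ge0//.
  by have [->|x0] := eqVneq x 0; [rewrite invr0 mul0r|field].
apply: measurable_funM => //; apply: (measurableT_comp (measurable_powR _)).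
exact: measurable_funX.
Qed.

Section filtering.
Context {R : realType} (T : R) (T0 : 0 < T) {d} {Om : measurableType d} (P : probability Om R).
Local Notation lam := (@lebesgue_measure R).
Local Notation S := (fun t : R => 0 <= t < T).
Context (W : R -> Om -> R) (LW : forall t, S t -> L2 P (W t)).
Hypothesis gramW : forall s t, 0 <= s -> s <= t -> t < T -> ip P (W s) (W t) = s.
Context (eta : Om -> R) (etaS : ospan P W S eta).

(** [M x] is the projection of [eta] on the noise up to [x], obtained from the stopped combinations;
    the coefficients [s n] are kept because the same limit defines the new drift as a functional of
    paths. The fourth clause evaluates [M x] against any [Z] whose covariances with the noise have a
    square integrable density. *)
Theorem kernel_filter : exists (phi : R -> R) (s : nat -> seq (R * R)) (M : R -> Om -> R),
  [/\ measurable_fun setT phi /\ lam.-integrable `[0, T] (fun x => (phi x ^+ 2)%:E),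
    forall n, inS S (s n),
    forall x, S x -> [/\ L2 P (M x), {ae P, forall w, lc W (trunc_times x (s n)) w @[n --> \oo] --> M x w} &
      ip P (fun w => lc W (trunc_times x (s n)) w - M x w) (fun w => lc W (trunc_times x (s n)) w - M x w) @[n --> \oo] --> 0],
    forall x y, S x -> S y -> forall (g : R -> R) Z, measurable_fun setT g -> lam.-integrable `[0, y] (fun y => (g y ^+ 2)%:E) ->
      L2 P Z -> (forall r, 0 <= r -> r <= x -> ip P (W r) Z = \int[lam]_(u in `[0, Num.min r y]) g u) ->
      ip P (M x) Z = \int[lam]_(u in `[0, Num.min x y]) (phi u * g u) &
    forall t, S t -> ip P eta (W t) = \int[lam]_(u in `[0, t]) phi u].
Proof.
have [phi [s [[mphi iphi] sS kr step etaE]]] := wiener_kernel T0 LW gramW etaS.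
have tS x n : S x -> inS S (trunc_times x (s n)) by move=> Sx; exact: trunc_timesS.
have /choice[M ME] : forall x, exists Mx, S x -> [/\ L2 P Mx, {ae P, forall w, lc W (trunc_times x (s n)) w @[n --> \oo] --> Mx w} &
      ip P (fun w => lc W (trunc_times x (s n)) w - Mx w) (fun w => lc W (trunc_times x (s n)) w - Mx w) @[n --> \oo] --> 0].
  move=> x; have [Sx|nSx] := pselect (S x); last by exists (fun=> 0).
  have [Mx [LM aeM cM]] := L2_complete (fun n => L2_lc LW (tS x n Sx)) (step x Sx).
  exists Mx => _; split=> //.
  apply: (@squeeze_cvgr _ _ _ _ (fun=> 0) (fun n => 4 * 4^-1 ^+ n)); [|exact: cvg_cst|exact: geo4_cvg0].
  by apply: nearW => n; rewrite ip_ge0 cM.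
exists phi, s, M; split=> //.
- move=> x y Sx Sy g Z mg ig LZ H; have [LM _ cM] := ME x Sx.
  have Sm : S (Num.min x y) by rewrite minEle; case: ifP.
  have c1 := L2_cauchy_cvg (fun n => L2_lc LW (tS x n Sx)) LM LZ cM.
  have ig' : lam.-integrable `[0, Num.min x y] (fun y => (g y ^+ 2)%:E).
    by apply: lam_int_sub ig; rewrite ge_min lexx orbT.
  apply: cvgR_unique c1 _; apply: cvg_trans (kr _ Sm g mg ig'); apply: near_eq_cvg; apply: nearW => n.
  rewrite (ip_lcl LW (tS x n Sx) LZ) big_map; apply: eq_big_seq => c cs; congr (_ * _).
  have /andP[c0 cT] := sS n c cs; have /andP[x0 xT] := Sx.
  rewrite H/=; first by rewrite minA.
    by rewrite le_min c0.
  by rewrite ge_min lexx orbT.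
- move=> t St; have /andP[t0 tT] := St.
  have [Le _] := etaS.
  have c1 := L2_cauchy_cvg (fun n => L2_lc LW (sS n)) Le (LW St) etaE.
  have i1 : lam.-integrable `[0, t] (fun y : R => ((fun=> 1 : R) y ^+ 2)%:E).
    by apply: (@lam_integrable_bdd _ (fun y => 1 ^+ 2) _ _ 1) => // x; rewrite expr1n normr1.
  have -> : \int[lam]_(u in `[0, t]) phi u = \int[lam]_(u in `[0, t]) (phi u * 1).
    by apply: eq_Rintegral => u _; rewrite mulr1.
  apply: cvgR_unique c1 _; apply: cvg_trans (kr t St (fun=> 1) (measurable_cst _) i1); apply: near_eq_cvg; apply: nearW => n.
  rewrite (ip_lcl LW (sS n) (LW St)); apply: eq_big_seq => c cs; congr (_ * _).
  have /andP[c0 cT] := sS n c cs; rewrite Rint1; last by rewrite le_min c0.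
  have [ct|/ltW tc] := leP c.2 t; first by rewrite gramW.
  by rewrite ipC gramW.
Qed.

Context (eta1 : ip P eta eta = 1).
Context (phi : R -> R) (s : nat -> seq (R * R)) (M : R -> Om -> R).
Hypotheses (mphi : measurable_fun setT phi) (iphi : lam.-integrable `[0, T] (fun x => (phi x ^+ 2)%:E)).
Hypothesis LM : forall x, S x -> L2 P (M x).
Hypothesis ip_M : forall x y, S x -> S y -> forall (g : R -> R) Z, measurable_fun setT g -> lam.-integrable `[0, y] (fun y => (g y ^+ 2)%:E) ->
      L2 P Z -> (forall r, 0 <= r -> r <= x -> ip P (W r) Z = \int[lam]_(u in `[0, Num.min r y]) g u) ->
      ip P (M x) Z = \int[lam]_(u in `[0, Num.min x y]) (phi u * g u).
Hypothesis ip_etaW : forall t, S t -> ip P eta (W t) = \int[lam]_(u in `[0, t]) phi u.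

(* [resvar] and [gain] are the [gamma] and [phi/gamma] of the header; [residual x] is the part of [eta] unpredictable at time [x]. *)
Definition resvar t := 1 - \int[lam]_(u in `[0, t]) (phi u ^+ 2).
Definition gain t := phi t / resvar t.
Definition residual x (w : Om) := eta w - M x w.

Let Le : L2 P eta. Proof. by case: etaS. Qed.
Let i1 t : lam.-integrable `[0, t] (fun y : R => ((fun=> 1 : R) y ^+ 2)%:E).
Proof. by apply: (@lam_integrable_bdd _ (fun y => 1 ^+ 2) _ _ 1) => // x; rewrite expr1n normr1. Qed.
Let ip2 t : S t -> lam.-integrable `[0, t] (fun x => (phi x ^+ 2)%:E).
Proof. by move=> /andP[_ /ltW tT]; exact: lam_int_sub iphi. Qed.
Let ip1 t : S t -> lam.-integrable `[0, t] (EFin \o phi).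
Proof. by move=> St; apply: lam_integrable_sqr (ip2 St); exact: measurable_funTS. Qed.
Lemma ip_MW x t : S x -> S t -> ip P (M x) (W t) = \int[lam]_(u in `[0, Num.min x t]) phi u.
Proof.
move=> Sx St; rewrite (ip_M Sx St (measurable_cst _) (i1 t) (LW St)).
  by apply: eq_Rintegral => u _; rewrite mulr1.
have /andP[x0 xT] := Sx; have /andP[t0 tT] := St.
move=> r r0 rx; rewrite Rint1; last by rewrite le_min r0.
have [rt|/ltW tr] := leP r t; first by rewrite gramW.
by rewrite ipC gramW// (le_lt_trans rx).
Qed.

Lemma ip_MM x y : S x -> S y -> ip P (M x) (M y) = 1 - resvar (Num.min x y).
Proof.
move=> Sx Sy; rewrite (ip_M Sx Sy mphi (ip2 Sy) (LM Sy)).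
  by rewrite /resvar opprB addrC subrK; apply: eq_Rintegral => u _; rewrite expr2.
move=> r r0 rx; rewrite ipC ip_MW// 1?minC//.
by rewrite r0; apply: (le_lt_trans rx); have /andP[] := Sx.
Qed.

Lemma ip_Meta x : S x -> ip P (M x) eta = 1 - resvar x.
Proof.
move=> Sx; rewrite (ip_M Sx Sx mphi (ip2 Sx) Le).
  by rewrite minxx /resvar opprB addrC subrK; apply: eq_Rintegral => u _; rewrite expr2.
move=> r r0 rx; rewrite ipC ip_etaW; first by move/min_idPl: rx => ->.
by rewrite r0; apply: (le_lt_trans rx); have /andP[] := Sx.
Qed.

Lemma residual_L2 x : S x -> L2 P (residual x).
Proof. by move=> Sx; apply: L2B => //; exact: LM. Qed.

Lemma ip_residual x y : S x -> S y -> x <= y -> ip P (residual x) (residual y) = resvar y.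
Proof.
move=> Sx Sy xy; have Lx := LM Sx; have Ly := LM Sy.
rewrite /residual ipBl//; last exact: residual_L2.
rewrite !ipBr// eta1 ip_Meta// ip_MM// ipC ip_Meta//.
by move/min_idPl: xy => ->; ring.
Qed.

Lemma ip_W_residual t x : S t -> S x -> ip P (W t) (residual x) =
  \int[lam]_(u in `[0, t]) phi u - \int[lam]_(u in `[0, Num.min t x]) phi u.
Proof.
move=> St Sx; have Lx := LM Sx; have Lt := LW St.
by rewrite ipBr// (ipC P _ eta) ip_etaW// (ipC P _ (M x)) ip_MW// minC.
Qed.

Lemma resvar_le x y : S y -> 0 <= x -> x <= y -> resvar y <= resvar x.
Proof.
move=> Sy x0 xy; rewrite /resvar lerB//.
rewrite /Rintegral fine_le//.
- by apply: integrable_fin_num => //; apply: lam_int_sub (ip2 Sy).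
- exact: integrable_fin_num (ip2 Sy).
apply: ge0_subset_integral => //.
- apply/measurable_EFinP; apply: measurable_funTS; exact: measurable_funX.
- by move=> u _; rewrite lee_fin sqr_ge0.
by move=> u /=; rewrite !in_itv/= => /andP[-> ux]; exact: (le_trans ux xy).
Qed.

Lemma resvar_measurable : measurable_fun setT resvar.
Proof.
apply: measurable_funB => //.
apply: (@measurable_Rint_upto _ _ R (fun p : R * R => phi p.2 ^+ 2) id) => //.
by apply: measurable_funX; exact: measurableT_comp.
Qed.

Lemma gain_measurable : measurable_fun setT gain.
Proof. by apply: measurable_funM => //; apply: (measurableT_comp measurable_inv resvar_measurable). Qed.

Hypothesis gam0 : forall t, S t -> 0 < resvar t.

Lemma gain_resvar t : S t -> gain t * resvar t = phi t.
Proof. by move=> /gam0 h; rewrite /gain mulfVK// gt_eqF. Qed.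

Lemma gain_sqr_integrable t : S t -> lam.-integrable `[0, t] (fun x => (gain x ^+ 2)%:E).
Proof.
move=> St; have := lam_intZ (resvar t ^- 2) (ip2 St).
apply: le_integrable => //.
  by apply/measurable_EFinP; apply: measurable_funX; apply: measurable_funTS; exact: gain_measurable.
move=> x; rewrite /= in_itv/= => /andP[x0 xt]; rewrite lee_fin.
have /andP[t0 tT] := St; have Sx : S x by rewrite x0 (le_lt_trans xt).
have gx := gam0 Sx; have gt := gam0 St.
rewrite ger0_norm ?sqr_ge0//; apply: le_trans (ler_norm _).
rewrite /gain exprMn mulrC ler_wpM2r ?sqr_ge0// exprVn lef_pV2 ?posrE ?exprn_gt0// ler_sqr ?nnegrE ?(ltW gx) ?(ltW gt)//.
exact: resvar_le.
Qed.

Let ik t : S t -> lam.-integrable `[0, t] (EFin \o gain).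
Proof. by move=> St; apply: lam_integrable_sqr (gain_sqr_integrable St); apply: measurable_funTS; exact: gain_measurable. Qed.

Let splitS x t : S x -> S t -> x <= t -> \int[lam]_(u in `[0, t]) phi u - \int[lam]_(u in `[0, x]) phi u = \int[lam]_(u in `]x, t]) phi u.
Proof.
move=> /andP[x0 xT] St xt; apply: Rintegral_itvB; first exact: ip1 St.
  by rewrite bnd_simp.
by rewrite bnd_simp.
Qed.

Section covariance.
Context (Wp : R -> Om -> R) (LWp : forall t, S t -> L2 P (Wp t)).
Hypothesis WpE : forall t, S t -> forall h, L2 P h ->
  lam.-integrable `[0, t] (EFin \o (fun x => gain x * ip P h (residual x))) /\
  ip P h (Wp t) = ip P h (W t) - \int[lam]_(x in `[0, t]) (gain x * ip P h (residual x)).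

(** For [x] beyond [y] the two residuals have covariance [resvar x], and
    [gain x * resvar x = phi x]; this part of the integral cancels the covariance of [residual y]
    with [W t], leaving only the integral up to [y]. *)
Let ip_WpN y t : S y -> S t -> y <= t -> ip P (residual y) (Wp t) = - (resvar y * \int[lam]_(x in `[0, y]) gain x).
Proof.
move=> Sy St yt; have Ly := residual_L2 Sy; have Ly0 := LM Sy.
have /andP[y0 yT] := Sy; have /andP[t0 tT] := St.
have [iN ->] := WpE St Ly.
rewrite (ipC P _ (W t)) ip_W_residual//.
have -> : Num.min t y = y by apply/min_idPr.
rewrite splitS//.
have e := Rintegral_itvB iN (a := BLeft 0) (b := BRight t) (x := y); rewrite !bnd_simp in e.
have e1 : \int[lam]_(x in `]y, t]) (gain x * ip P (residual y) (residual x)) = \int[lam]_(x in `]y, t]) phi x.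
  apply: eq_Rintegral => x; rewrite inE/= in_itv/= => /andP[yx xt].
  have Sx : S x by rewrite (le_trans y0 (ltW yx)) (le_lt_trans xt).
  by rewrite ip_residual ?(ltW yx)// gain_resvar.
have e2 : \int[lam]_(x in `[0, y]) (gain x * ip P (residual y) (residual x)) = resvar y * \int[lam]_(x in `[0, y]) gain x.
  rewrite -RintegralZl//; last exact: ik Sy.
  apply: eq_Rintegral => x; rewrite inE/= in_itv/= => /andP[x0 xy].
  have Sx : S x by rewrite x0 (le_lt_trans xy).
  by rewrite ipC ip_residual// mulrC.
have {e} := e y0 yt; rewrite e1 e2.
by set c := \int[lam]_(x in `[0, t]) _; set b := \int[lam]_(x in `]y, t]) _; lra.
Qed.

(** Expanding both factors leaves [a] and two double integrals of [phi] and [gain] over a triangle,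
    taken in opposite orders; they cancel by [Rint_triangle]. *)
Lemma innovation_cov a t : 0 <= a -> a <= t -> t < T -> ip P (Wp a) (Wp t) = a.
Proof.
move=> a0 at_ tT; have Sa : S a by rewrite a0 (le_lt_trans at_).
have St : S t by rewrite tT (le_trans a0).
have [_ E1] := WpE Sa (LWp St); have [iN E2] := WpE St (LW Sa).
transitivity (ip P (Wp t) (Wp a)); first exact: ipC.
apply: (etrans E1).
have -> : ip P (Wp t) (W a) = a - \int[lam]_(x in `[0, t]) (gain x * ip P (W a) (residual x)).
  by apply: (etrans (ipC _ _ _)); apply: (etrans E2); rewrite gramW.
have e1 : \int[lam]_(x in `[0, a]) (gain x * ip P (Wp t) (residual x)) =
    \int[lam]_(y in `[0, a]) (-1 * (phi y * \int[lam]_(x in `[0, y]) gain x)).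
  apply: eq_Rintegral => y; rewrite inE/= in_itv/= => /andP[y0 ya].
  have Sy : S y by rewrite y0 (le_lt_trans ya)// (le_lt_trans at_).
  by rewrite ipC ip_WpN// ?(le_trans ya)// mulrN mulrA gain_resvar// mulN1r.
have e2 : \int[lam]_(x in `]a, t]) (gain x * ip P (W a) (residual x)) = 0.
  transitivity (\int[lam]_(x in `]a, t]) (0 : R)).
    apply: eq_Rintegral => x; rewrite inE/= in_itv/= => /andP[ax xt].
    have Sx : S x by rewrite (le_trans a0 (ltW ax)) (le_lt_trans xt).
    rewrite ip_W_residual//; have -> : Num.min a x = a by apply/min_idPl/ltW.
    by rewrite subrr mulr0.
  by rewrite (@Rintegral_cst _ _ R lam _ (measurable_itv _) 0) mul0r.
have e3 : \int[lam]_(x in `[0, a]) (gain x * ip P (W a) (residual x)) =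
   \int[lam]_(x in `[0, a]) (gain x * (\int[lam]_(u in `[0, a]) phi u - \int[lam]_(u in `[0, x]) phi u)).
  apply: eq_Rintegral => x; rewrite inE/= in_itv/= => /andP[x0 xa].
  have Sx : S x by rewrite x0 (le_lt_trans xa)// (le_lt_trans at_).
  by rewrite ip_W_residual//; have -> : Num.min a x = x by apply/min_idPr.
have tri := Rint_triangle mphi gain_measurable (ip1 Sa) (ik Sa).
have e := Rintegral_itvB iN (a := BLeft 0) (b := BRight t) (x := a); rewrite !bnd_simp in e.
have {e} := e a0 at_; rewrite e2 e1 e3 -tri => /eqP; rewrite subr_eq0 => /eqP ->.
rewrite RintegralZl//; first by rewrite mulN1r; ring.
have iN' : lam.-integrable `[0, a] (EFin \o (fun x => gain x * ip P (Wp t) (residual x))).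
  by have [h _] := WpE Sa (LWp St).
have := lam_intZ (-1) iN'; apply: eq_integrable => // y; rewrite inE/= in_itv/= => /andP[y0 ya].
have Sy : S y by rewrite y0 (le_lt_trans ya)// (le_lt_trans at_).
by rewrite ipC ip_WpN// ?(le_trans ya)// mulrN mulrA gain_resvar// mulN1r opprK.
Qed.
End covariance.

(* Let [G x = E(h M_x)] and [g = - gain G].  Then [G' = phi g], so [(G^2)' = - 2 resvar g^2 <= 0] with [G 0 = 0], which forces [g = 0]. *)
Lemma energy h t : S t -> L2 P h ->
  lam.-integrable `[0, t] (fun x => (gain x * ip P h (M x))%:E) ->
  (forall r, 0 <= r -> r <= t -> ip P h (W r) = - \int[lam]_(x in `[0, r]) (gain x * ip P h (M x))) ->
  forall r, 0 <= r -> r <= t -> ip P h (W r) = 0.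
Proof.
move=> St Lh ig0 H.
have /andP[t0 tT] := St.
have Sr r : 0 <= r -> r <= t -> S r by move=> r0 rt; rewrite r0 (le_lt_trans rt).
pose g x := (- (gain x * ip P h (M x))) * \1_(`[0, t]%classic) x.
have gE x : 0 <= x -> x <= t -> g x = - (gain x * ip P h (M x)).
  by move=> x0 xt; rewrite /g indicE mem_set ?mulr1//= in_itv/= x0.
have mg : measurable_fun setT g.
  have := integrable_indicl (lam_intZ (-1) ig0).
  move=> /integrableP[/measurable_EFinP + _]; congr (measurable_fun _ _).
  by apply/funext => x; rewrite /g mulN1r.
have mg' : measurable_fun `[0, t] g by exact: measurable_funTS.
pose K := ip P h h.
have K0 : 0 <= K := ip_ge0 _ _.
have GK x : 0 <= x -> x <= t -> ip P h (M x) ^+ 2 <= K.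
  move=> x0 xt; have Sx := Sr x x0 xt; apply: le_trans (ip_CS Lh (LM Sx)) _.
  rewrite ler_piMr// ip_MM// minxx; have := gam0 Sx; lra.
have ig2 : lam.-integrable `[0, t] (fun x => (g x ^+ 2)%:E).
  have := lam_intZ K (gain_sqr_integrable St); apply: le_integrable => //.
    by apply/measurable_EFinP; exact: measurable_funX.
  move=> x; rewrite /= in_itv/= => /andP[x0 xt]; rewrite lee_fin.
  rewrite ger0_norm ?sqr_ge0//; apply: le_trans (ler_norm _).
  rewrite gE// sqrrN exprMn mulrC ler_wpM2r ?sqr_ge0//.
  exact: GK.
have hW r : 0 <= r -> r <= t -> ip P (W r) h = \int[lam]_(u in `[0, r]) g u.
  move=> r0 rt; rewrite ipC H// -mulN1r -RintegralZl//; last by apply: lam_int_sub ig0.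
  apply: eq_Rintegral => x; rewrite inE/= in_itv/= => /andP[x0 xr].
  by rewrite gE ?(le_trans xr)// mulN1r.
have hM x : 0 <= x -> x <= t -> ip P h (M x) = \int[lam]_(u in `[0, x]) (phi u * g u).
  move=> x0 xt; have Sx := Sr x x0 xt.
  have ig2' : lam.-integrable `[0, x] (fun x => (g x ^+ 2)%:E) by exact: lam_int_sub ig2.
  rewrite ipC (ip_M Sx Sx mg ig2' Lh) ?minxx// => r r0 rx.
  by rewrite hW ?(le_trans rx)//; move/min_idPl: rx => ->.
have mphi' : measurable_fun `[0, t] phi by exact: measurable_funTS.
have [ipg _] := Rint_CS mphi' mg' (ip2 St) ig2.
pose psi x := phi x * g x.
have mpsi : measurable_fun setT psi by exact: measurable_funM.
(* With both kernels equal to [psi = phi g = G'], this is the integrated form of [(G^2)' = 2 G G'],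
   where [I = G(t)]. *)
have tri := Rint_triangle mpsi mpsi ipg ipg.
set I := \int[lam]_(x in `[0, t]) psi x in tri.
have gg0 : 0 <= \int[lam]_(x in `[0, t]) (g x ^+ 2) by apply: Rintegral_ge0 => x _; rewrite sqr_ge0.
have gt0 := gam0 St.
have pe x : 0 <= x -> x <= t -> psi x * \int[lam]_(y in `[0, x]) psi y = - (resvar x * g x ^+ 2).
  move=> x0 xt; rewrite -hM// /psi -(gain_resvar (Sr x x0 xt)) gE//; ring.
have iL : lam.-integrable `[0, t] (EFin \o (fun x => resvar x * g x ^+ 2)).
  have := ig2; apply: le_integrable => //.
    by apply/measurable_EFinP; apply: measurable_funTS; apply: measurable_funM; [exact: resvar_measurable|exact: measurable_funX].
  move=> x; rewrite /= in_itv/= => /andP[x0 xt]; rewrite lee_fin normrM ler_piMl//.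
  have gx := gam0 (Sr x x0 xt); rewrite gtr0_norm// /resvar lerBlDr lerDl.
  by apply: Rintegral_ge0 => u _; rewrite sqr_ge0.
have E1 : \int[lam]_(x in `[0, t]) (psi x * \int[lam]_(y in `[0, x]) psi y) = - \int[lam]_(x in `[0, t]) (resvar x * g x ^+ 2).
  rewrite -mulN1r -RintegralZl//; apply: eq_Rintegral => x; rewrite inE/= in_itv/= => /andP[x0 xt].
  by rewrite pe// mulN1r.
have E2 : \int[lam]_(y in `[0, t]) (psi y * (I - \int[lam]_(x in `[0, y]) psi x)) = I * I + \int[lam]_(x in `[0, t]) (resvar x * g x ^+ 2).
  have h1 := lam_intZ I ipg.
  transitivity (\int[lam]_(y in `[0, t]) (I * psi y + resvar y * g y ^+ 2)).
    apply: eq_Rintegral => x; rewrite inE/= in_itv/= => /andP[x0 xt].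
    by rewrite mulrBr pe// opprK mulrC.
  by rewrite RintegralD// RintegralZl.
have E3 : resvar t * \int[lam]_(x in `[0, t]) (g x ^+ 2) <= \int[lam]_(x in `[0, t]) (resvar x * g x ^+ 2).
  have h1 : lam.-integrable `[0, t] (EFin \o (fun x => resvar t * g x ^+ 2)) by exact: lam_intZ.
  have <- : \int[lam]_(x in `[0, t]) (resvar t * g x ^+ 2) = resvar t * \int[lam]_(x in `[0, t]) (g x ^+ 2).
    by rewrite RintegralZl.
  apply: (le_Rintegral _ h1 iL) => //.
  move=> x; rewrite /= in_itv/= => /andP[x0 xt]; rewrite ler_wpM2r ?sqr_ge0//.
  exact: resvar_le.
have Z : \int[lam]_(x in `[0, t]) (g x ^+ 2) = 0.
  apply/eqP; rewrite eq_le gg0 andbT -(pmulr_rle0 _ gt0).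
  apply: le_trans E3 _; move: tri; rewrite E1 E2; have := sqr_ge0 I; rewrite expr2.
  by set a := I * I; set b := \int[lam]_(x in _) _; lra.
move=> r r0 rt; rewrite ipC hW//.
have mg1 : measurable_fun `[0, r] g by exact: measurable_funTS.
have ig2' : lam.-integrable `[0, r] (fun x => (g x ^+ 2)%:E) by exact: lam_int_sub ig2.
have m1 : measurable_fun `[0, r] (fun=> 1 : R) by [].
have [_] := Rint_CS mg1 m1 ig2' (i1 r).
rewrite (_ : \int[lam]_(x in `[0, r]) (g x ^+ 2) = 0); last first.
  apply/eqP; rewrite eq_le; apply/andP; split; last by apply: Rintegral_ge0 => x _; rewrite sqr_ge0.
  apply: (@le_trans _ _ (\int[lam]_(x in `[0, t]) (g x ^+ 2))); last by rewrite Z.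
  rewrite /Rintegral fine_le//.
  - exact: integrable_fin_num ig2'.
  - exact: integrable_fin_num ig2.
  apply: ge0_subset_integral => //.
  - by apply/measurable_EFinP; exact: measurable_funX.
  - by move=> u _; rewrite lee_fin sqr_ge0.
  by move=> u /=; rewrite !in_itv/= => /andP[-> ux]; exact: (le_trans ux rt).
rewrite mul0r => h0; apply/eqP; rewrite -sqrf_eq0 eq_le sqr_ge0 andbT.
by move: h0; under eq_Rintegral do rewrite mulr1.
Qed.
End filtering.

Lemma ae_seq {d} {Om : measurableType d} {R : realType} (P : probability Om R) (I : eqType)
  (l : seq I) (B : I -> Om -> Prop) : (forall i, i \in l -> {ae P, forall w, B i w}) ->
  {ae P, forall w, forall i, i \in l -> B i w}.
Proof.
elim: l => [|i l IH] H; first exact: aeW.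
have h1 := H i (mem_head _ _); have h2 : {ae P, forall w, forall i, i \in l -> B i w}.
  by apply: IH => j jl; apply: H; rewrite inE jl orbT.
by apply: filterS2 h1 h2 => w b1 b2 j; rewrite inE => /orP[/eqP ->|/b2].
Qed.

Section conditioned_drift.
Context {R : realType} {T : R}.
Local Notation C := (path_space T).
Context (alpha : R) (delta : R -> C -> R) (pd : progressively_measurable delta).
Local Notation wf := (noise alpha delta).
Local Notation gs a := (g_sigma_algebraType (past (@idfun C) a)).
Context (s : nat -> seq (R * R)) (k : R -> R) (mk : measurable_fun setT k).

(* Only paths for which the limit exists matter; clamping the times keeps [filt x] a function of the path up to [x]. *)
Definition filt (x : R) (f : C) := flim (fun n => \sum_(c <- s n) c.1 * wf (Num.max 0 (Num.min c.2 x)) f).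

Definition cond_drift (x : R) (f : C) := delta x f - alpha * (k x * filt x f).

Lemma filt_measurable {d} {Om : measurableType d} (F : Om -> C) (tau : Om -> R) (t : R) : 0 <= t <= T ->
  (forall r, r \in `[0, t] -> measurable_fun setT (fun w => F w r)) ->
  measurable_fun setT tau -> (forall w, 0 <= tau w <= t) ->
  measurable_fun setT (fun w => filt (tau w) (F w)).
Proof.
move=> tT mF mtau htau; apply: (@measurable_flim _ _ R setT) => // n.
apply: measurable_sum => c; apply: measurable_funM => //.
apply: (noise_at_measurable tT mF) => //.
  apply: measurable_maxr => //; exact: measurable_minr.
move=> w; have /andP[h1 h2] := htau w; rewrite le_max lexx/= ge_max ge_min h2 orbT andbT.
exact: le_trans h1 h2.
Qed.

Lemma cond_drift_prog : progressively_measurable cond_drift.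
Proof.
move=> t tT; have /andP[t0 _] := tT.
apply: measurable_funB; first exact: pd.
apply: measurable_funM => //; apply: measurable_funM.
  by apply: measurable_funTS; apply: measurableT_comp.
have mF (r : R) : r \in `[0, t] -> measurable_fun setT (fun p : R * gs t => (p.2 : C) r).
  by move=> rt; apply: (measurableT_comp (past_eval rt)).
have mtau : measurable_fun setT (fun p : R * gs t => Num.max 0 (Num.min p.1 t)).
  by apply: measurable_maxr => //; apply: measurable_minr.
have := filt_measurable tT mF mtau; move=> /(_ _)/measurable_funTS h.
apply: (eq_measurable_fun (fun p : R * gs t => filt (Num.max 0 (Num.min p.1 t)) p.2)); last first.
  by apply: h => p; rewrite le_max lexx/= ge_max t0 ge_min lexx orbT.
move=> [x f]; rewrite inE /= => -[/=]; rewrite in_itv/= => /andP[x0 xt] _.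
have -> // : Num.max 0 (Num.min x t) = x by rewrite (min_idPl xt); apply/max_idPr.
Qed.
End conditioned_drift.

Section conditioning_step.
Context {R : realType} {T : R} (T0 : 0 < T) {d} {Om : measurableType d} (P : probability Om R).
Local Notation C := (path_space T).
Local Notation lam := (@lebesgue_measure R).
Local Notation S := (fun t : R => 0 <= t < T).
Context (X : {RV P >-> C}) (GX : gfam P (fun b w => b (X w)) clf).
Local Notation amb := (ospan P (fun b w => b (X w)) clf).
Context (Y : Om -> C) (YA : forall b, clf b -> amb (fun w => b (Y w))).
Context (eta : Om -> R) (etaA : amb eta) (eta1 : ip P eta eta = 1).
Context (v : C) (vE : forall b, clf b -> ip P eta (fun w => b (Y w)) = b v).
Hypothesis nd : forall s, 0 <= s < T -> exists2 K : R, 0 < K & forall l, inS (fun r : R => 0 <= r <= s) l ->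
  1 <= K * ip P (fun w => eta w - lc (fun r w => Y w r) l w) (fun w => eta w - lc (fun r w => Y w r) l w).
Context (alpha : R) (alpha0 : alpha != 0) (delta : R -> C -> R) (gd : good P alpha delta Y).
Local Notation wf := (noise alpha delta).
Hypothesis etaW : ospan P (fun t w => wf t (Y w)) S eta.
Local Notation Yh := (fun w => Y w - eta w *: v : C).
Let W t w := wf t (Y w).

Let pd : progressively_measurable delta. Proof. by case: gd. Qed.
Let LW t : S t -> L2 P (W t).
Proof. by move=> /andP[t0 tT]; have [_ _ _ /(_ t t0 tT) [LWt _] _] := gd. Qed.
Let gramW s t : 0 <= s -> s <= t -> t < T -> ip P (W s) (W t) = s.
Proof. by move=> s0 st tT; have [_ _ /(_ s t s0 st tT)] := gd. Qed.
Let Le : L2 P eta. Proof. by case: etaA. Qed.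
Let LY r : L2 P (fun w => Y w r). Proof. by have [] := amb_ev YA r. Qed.

Context (phi : R -> R) (s : nat -> seq (R * R)) (M : R -> Om -> R).
Hypotheses (mphi : measurable_fun setT phi) (iphi : lam.-integrable `[0, T] (fun x => (phi x ^+ 2)%:E)).
Hypothesis sS : forall n, inS S (s n).
Hypothesis ME : forall x, S x -> [/\ L2 P (M x), {ae P, forall w, lc W (trunc_times x (s n)) w @[n --> \oo] --> M x w} &
      ip P (fun w => lc W (trunc_times x (s n)) w - M x w) (fun w => lc W (trunc_times x (s n)) w - M x w) @[n --> \oo] --> 0].
Hypothesis ip_M : forall x y, S x -> S y -> forall (g : R -> R) Z, measurable_fun setT g -> lam.-integrable `[0, y] (fun y => (g y ^+ 2)%:E) ->
      L2 P Z -> (forall r, 0 <= r -> r <= x -> ip P (W r) Z = \int[lam]_(u in `[0, Num.min r y]) g u) ->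
      ip P (M x) Z = \int[lam]_(u in `[0, Num.min x y]) (phi u * g u).
Hypothesis ip_etaW : forall t, S t -> ip P eta (W t) = \int[lam]_(u in `[0, t]) phi u.

Local Notation gam := (resvar phi).
Local Notation ker := (gain phi).
Local Notation resi := (residual eta M).
Let LM x : S x -> L2 P (M x). Proof. by move=> /ME[]. Qed.

Let sub_le (x y r : R) : `[0, x]%classic r -> x <= y -> `[0, y]%classic r.
Proof. by rewrite /= !in_itv/= => /andP[-> rx] xy; exact: le_trans rx xy. Qed.

Let WY r t : 0 <= r -> r <= t -> t < T -> ospan P (fun r w => Y w r) `[0, t]%classic (W r).
Proof.
move=> r0 rt tT; have [_ _ _ /(_ r r0 (le_lt_trans rt tT)) h _] := gd.
apply: ospan_trans h => q qr; apply: ospan_gen => //; exact: sub_le qr rt.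
Qed.

Let trunc_in x n : S x -> inS `[0, x]%classic (trunc_times x (s n)).
Proof.
move=> /andP[x0 xT] _ /mapP[c cs ->]; have /andP[c0 _] := sS cs.
by rewrite /= in_itv/= le_min c0 x0 ge_min lexx orbT.
Qed.

Let MW x : S x -> ospan P W `[0, x]%classic (M x).
Proof.
move=> Sx; have [Lx _ cx] := ME Sx; have /andP[x0 xT] := Sx.
apply: ospan_lim cx => // n.
have LW' r : `[0, x]%classic r -> L2 P (W r).
  by rewrite /= in_itv/= => /andP[r0 rx]; apply: LW; rewrite r0 (le_lt_trans rx).
split=> [|h Lh H]; first exact: (L2_lc LW' (@trunc_in x n Sx)).
exact: (ip_lc_eq0 LW' (@trunc_in x n Sx) Lh H).
Qed.

Let MY x : S x -> ospan P (fun r w => Y w r) `[0, x]%classic (M x).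
Proof.
move=> Sx; apply: ospan_trans (MW Sx) => r; rewrite /= in_itv/= => /andP[r0 rx].
by apply: WY => //; have /andP[] := Sx.
Qed.

(** [resvar t] is the squared distance from [eta] to [M t]. Since [M t] lies in the closed span of
    [Y] up to [t], the lower bound [nd] passes to the limit along the approximating combinations. *)
Let gam0 t : S t -> 0 < gam t.
Proof.
move=> St; have [K K0 ndt] := nd St.
rewrite -(ip_residual LW gramW etaW eta1 mphi iphi LM ip_M ip_etaW St St (lexx t)).
have LYs r : `[0, t]%classic r -> L2 P (fun w => Y w r) by [].
have [l lS [_ cl]] := ospan_approx LYs (MY St).
have Ll n : L2 P (lc (fun r w => Y w r) (l n)) by exact: (L2_lc LYs).
have LMt := LM St.
have cv : ip P (fun w => eta w - lc (fun r w => Y w r) (l n) w) (fun w => eta w - lc (fun r w => Y w r) (l n) w)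
   @[n --> \oo] --> ip P (resi t) (resi t).
  apply: ip_limr; [by move=> n; exact: L2B|exact: L2B|].
  apply: (@squeeze_cvgr _ _ _ _ (fun=> 0) (fun n => 4 * 4^-1 ^+ n)); [|exact: cvg_cst|exact: geo4_cvg0].
  apply: nearW => n; rewrite ip_ge0/=; apply: le_trans (cl n).
  rewrite le_eqVlt; apply/orP; left; apply/eqP; apply: eq_Rintegral => w _; rewrite /residual; ring.
have : 1 <= K * ip P (resi t) (resi t).
  apply: (@lim_ge R (fun n => K * ip P (fun w => eta w - lc (fun r w => Y w r) (l n) w)
      (fun w => eta w - lc (fun r w => Y w r) (l n) w))); first by apply: cvgM cv; exact: cvg_cst.
  move=> n; apply: ndt => c cl'; have := lS n c cl'.
  by rewrite /= in_itv.
by move=> h1; have := lt_le_trans ltr01 h1; rewrite pmulr_rgt0.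
Qed.

Local Opaque filt.
Let m x f := filt alpha delta s x f.
Let dh := cond_drift alpha delta s ker.
Let kap t := \int[lam]_(u in `[0, t]) phi u.

Let Lhat x : S x -> L2 P (fun w => M x w - (1 - gam x) * eta w).
Proof. by move=> Sx; apply: L2B; [exact: LM|exact: L2Z]. Qed.

Let m_hat x : S x -> {ae P, forall w, m x (Yh w) = M x w - (1 - gam x) * eta w}.
Proof.
move=> Sx; have /andP[x0 xT] := Sx.
(* Only countably many times occur in the lists [s n], so one null set serves for all applications
   of [hat_noise]. *)
have h1 : {ae P, forall w, forall n c, c \in s n -> wf (Num.min c.2 x) (Yh w) =
    W (Num.min c.2 x) w - ip P eta (W (Num.min c.2 x)) * eta w}.
  apply: ae_foralln => n; apply: ae_seq => c cs.
  have Sc := sS cs; have Sm : S (Num.min c.2 x) by rewrite minEle; case: ifP.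
  exact: (hat_noise GX YA etaA eta1 vE nd gd Sm).
have [LMx ae1 cx] := ME Sx.
apply: filterS2 h1 ae1 => w hw cw; apply: flimE.
have tS n : inS S (trunc_times x (s n)) by exact: trunc_timesS.
have e n : \sum_(c <- s n) c.1 * wf (Num.max 0 (Num.min c.2 x)) (Yh w) =
   lc W (trunc_times x (s n)) w - ip P (lc W (trunc_times x (s n))) eta * eta w.
  rewrite (ip_lcl LW (tS n) Le) big_map lc_trunc mulr_suml -sumrB; apply: eq_big_seq => c cs.
  have /andP[c0 cT] := sS cs.
  have -> : Num.max 0 (Num.min c.2 x) = Num.min c.2 x by apply/max_idPr; rewrite le_min c0.
  by rewrite (hw n c cs) (ipC P _ eta) /=; ring.
under eq_fun do rewrite e.
apply: cvgB => //; apply: cvgMl.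
have <- := ip_Meta etaW mphi iphi ip_M ip_etaW Sx.
exact: (L2_cauchy_cvg (fun n => L2_lc LW (tS n)) LMx Le cx).
Qed.

Let mYh r : measurable_fun setT (fun w => Yh w r).
Proof.
have [mY _] := LY r; have [me _] := Le.
rewrite (_ : (fun w => _) = fun w => Y w r - eta w * v r) //.
by apply: measurable_funB => //; apply: measurable_funM.
Qed.

Section fixed_time.
Context (t : R) (St : S t).
Let t0 : 0 <= t. Proof. by have /andP[] := St. Qed.
Let tT : t < T. Proof. by have /andP[] := St. Qed.
Let tT' : 0 <= t <= T. Proof. by rewrite t0 ltW. Qed.
Let Sle x : 0 <= x -> x <= t -> S x.
Proof. by move=> x0 xt; apply/andP; split=> //; exact: (le_lt_trans xt tT). Qed.

(** Clamping the time to [[0,t]] makes the filter along the new path jointly measurable on the whole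
    line, as the Volterra lemmas require. *)
Let mm (p : Om * R) := m (Num.max 0 (Num.min p.2 t)) (Yh p.1).

Let mmE w x : 0 <= x -> x <= t -> mm (w, x) = m x (Yh w).
Proof.
move=> x0 xt; rewrite /mm /=.
by have -> : Num.min x t = x by [apply/min_idPl]; have -> : Num.max 0 x = x by apply/max_idPr.
Qed.

Let mmm : measurable_fun setT mm.
Proof.
apply: (@filt_measurable R T alpha delta pd s _ _ (fun p : Om * R => Yh p.1) (fun p => Num.max 0 (Num.min p.2 t)) t tT').
- by move=> r _; apply: (measurableT_comp (mYh r)).
- by apply: measurable_maxr => //; apply: measurable_minr.
by move=> p; rewrite le_max lexx/= ge_max t0 ge_min lexx orbT.
Qed.

Let mmsec x : measurable_fun setT (fun w => mm (w, x)).
Proof. by apply: (measurableT_comp mmm); exact: measurable_fun_pair. Qed.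

Let mm_hat x : 0 <= x -> x <= t -> {ae P, forall w, mm (w, x) = M x w - (1 - gam x) * eta w}.
Proof. by move=> x0 xt; apply: filterS (m_hat (Sle x0 xt)) => w <-; exact: mmE. Qed.

Let Lmm x : 0 <= x <= t -> L2 P (fun w => mm (w, x)) /\ ip P (fun w => mm (w, x)) (fun w => mm (w, x)) <= 1.
Proof.
move=> /andP[x0 xt]; have Sx := Sle x0 xt; have Lx := Lhat Sx; have [mx _] := Lx.
split; first exact: (L2_ae (mmsec x) (mm_hat x0 xt)).
rewrite (ip_ae (mmsec x) mx (mmsec x) mx (mm_hat x0 xt) (mm_hat x0 xt)).
have LMx := LM Sx.
rewrite ip_sqrB//; last exact: L2Z.
rewrite ipZl// 1?ipZr//; last exact: L2Z.
rewrite ipZr// eta1 (ip_Meta etaW mphi iphi ip_M ip_etaW Sx).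
rewrite (ip_MM LW gramW mphi iphi LM ip_M Sx Sx) minxx.
(* The squared norm has become [gam x * (1 - gam x)]. *)
have := gam0 Sx; have : gam x <= 1.
  by rewrite /resvar lerBlDr lerDl; apply: Rintegral_ge0 => u _; rewrite sqr_ge0.
by set a := gam x; nra.
Qed.

Let mk := gain_measurable mphi.
Let ik2 := gain_sqr_integrable mphi iphi gam0 St.

Let I w := \int[lam]_(x in `[0, t]) (ker x * mm (w, x)).
Let LI : L2 P I. Proof. exact: (volterra_L2 mk mmm ik2 Lmm). Qed.

Lemma gain_filt_ae : {ae P, forall w, lam.-integrable `[0, t] (fun x => (ker x * m x (Yh w))%:E)}.
Proof.
have h : {ae P, forall w, lam.-integrable `[0, t] (fun x => (ker x * mm (w, x))%:E)}.
  exact: volterra_ae mk mmm ik2 Lmm.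
apply: filterS h => w; apply: eq_integrable; first exact: measurable_itv.
by move=> x; rewrite inE/= in_itv/= => /andP[x0 xt]; rewrite mmE.
Qed.

Let drift_ae : {ae P, forall w, lam.-integrable `[0, t] (fun x => (delta x (Yh w))%:E)}.
Proof.
apply: filterS (hat_drift T0 GX YA etaA eta1 vE nd gd) => w /(_ t St) h.
apply/integrableP; split=> //; apply/measurable_EFinP; exact: (drift_section _ pd tT').
Qed.

Lemma cond_drift_ae : {ae P, forall w, (\int[lam]_(x in `[0%R, t]) `|dh x (Yh w)|%:E < +oo)%E}.
Proof.
apply: filterS2 gain_filt_ae drift_ae => w i1 i2.
have i3 := lam_intD i2 (lam_intZ (- alpha) i1).
have /integrableP[_] := i3; congr (_ < _)%E; apply: eq_integral => x _.
by rewrite /= /dh /cond_drift mulNr.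
Qed.

Let Wp w := noise alpha dh t (Yh w).

(** The old noise along the new path gives the first two terms, by [hat_noise]; the correction
    [- alpha * (gain * filt)] of the drift, divided by [alpha] and subtracted, adds the integral
    [I]. *)
Let WpE : {ae P, forall w, Wp w = W t w - kap t * eta w + I w}.
Proof.
have hw := hat_noise GX YA etaA eta1 vE nd gd St.
have : {ae P, forall w, lam.-integrable `[0, t] (fun x => (ker x * m x (Yh w))%:E) /\
  lam.-integrable `[0, t] (fun x => (delta x (Yh w))%:E)} by apply: filterS2 gain_filt_ae drift_ae.
apply: filterS2 hw => w h1 [i1 i2].
have -> : kap t = ip P eta (W t) by rewrite ip_etaW.
rewrite -h1 /Wp /noise.
have -> : I w = \int[lam]_(x in `[0, t]) (ker x * m x (Yh w)).
  by apply: eq_Rintegral => x; rewrite inE/= in_itv/= => /andP[x0 xt]; rewrite mmE.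
have -> : \int[lam]_(x in `[0, t]) dh x (Yh w) = \int[lam]_(x in `[0, t]) delta x (Yh w) +
    - alpha * \int[lam]_(x in `[0, t]) (ker x * m x (Yh w)).
  have i3 := lam_intZ (- alpha) i1; rewrite -RintegralZl// -RintegralD//.
  by apply: eq_Rintegral => x _; rewrite /dh /cond_drift mulNr.
by field.
Qed.

Let mWp : measurable_fun setT Wp.
Proof.
apply: noise_measurable => //; exact: (cond_drift_prog alpha pd s mk).
Qed.

Let LD : L2 P (fun w => W t w - kap t * eta w). Proof. by apply: L2B; [exact: LW|exact: L2Z]. Qed.

Lemma innovation_L2 : L2 P Wp.
Proof. exact: (L2_ae mWp WpE (L2D LD LI)). Qed.

Lemma innovation_ip h : L2 P h ->
  lam.-integrable `[0, t] (EFin \o (fun x => ker x * (ip P h (M x) - (1 - gam x) * ip P h eta))) /\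
  ip P h Wp = ip P h (W t) - kap t * ip P h eta +
    \int[lam]_(x in `[0, t]) (ker x * (ip P h (M x) - (1 - gam x) * ip P h eta)).
Proof.
move=> Lh; have [ih E] := volterra_ip mk mmm ik2 Lmm Lh.
have e x : x \in `[0, t]%classic -> ker x * ip P h (fun w => mm (w, x)) = ker x * (ip P h (M x) - (1 - gam x) * ip P h eta).
  rewrite inE/= in_itv/= => /andP[x0 xt]; have Sx := Sle x0 xt; have LMx := LM Sx.
  have [mh _] := Lh; have Lx := Lhat Sx; have [mx _] := Lx.
  rewrite (ip_ae mh mh (mmsec x) mx (aeW _ (fun=> erefl)) (mm_hat x0 xt)).
  by rewrite ipBr// ?ipZr//; exact: L2Z.
split; first by apply: eq_integrable ih => // x xt; rewrite /= e.
have [mh _] := Lh; have [mD _] := L2D LD LI.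
rewrite (ip_ae mh mh mWp mD (aeW _ (fun=> erefl)) WpE).
rewrite ipDr// ipBr//; [|exact: LW|exact: L2Z].
by rewrite ipZr// E; congr (_ + _); apply: eq_Rintegral.
Qed.

(** Because [phi = gain * resvar], the term [kap t * eta] merges with the integral and leaves the
    usual innovation, whose integrand is [gain] times the prediction error [eta - M x]. *)
Lemma innovation_residual h : L2 P h ->
  lam.-integrable `[0, t] (EFin \o (fun x => ker x * ip P h (resi x))) /\
  ip P h Wp = ip P h (W t) - \int[lam]_(x in `[0, t]) (ker x * ip P h (resi x)).
Proof.
move=> Lh; have [i1 ->] := innovation_ip Lh.
have iphi' : lam.-integrable `[0, t] (EFin \o phi).
  apply: lam_integrable_sqr; first exact: measurable_funTS.
  by apply: lam_int_sub iphi; exact: ltW.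
have i2 := lam_intZ (ip P h eta) iphi'; have i3 := lam_intD i2 (lam_intZ (-1) i1).
have e x : x \in `[0, t]%classic -> ker x * ip P h (resi x) =
  ip P h eta * phi x + -1 * (ker x * (ip P h (M x) - (1 - gam x) * ip P h eta)).
  rewrite inE/= in_itv/= => /andP[x0 xt]; have Sx := Sle x0 xt; have LMx := LM Sx.
  by rewrite ipBr// -(gain_resvar gam0 Sx); ring.
split; first by apply: eq_integrable i3 => // x xt; rewrite /= e.
have -> : \int[lam]_(x in `[0, t]) (ker x * ip P h (resi x)) =
  \int[lam]_(x in `[0, t]) (ip P h eta * phi x + -1 * (ker x * (ip P h (M x) - (1 - gam x) * ip P h eta))).
  exact: eq_Rintegral.
rewrite RintegralD//; last exact: lam_intZ.
rewrite RintegralZl// RintegralZl// /kap; ring.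
Qed.

(** Subtracting [eta v] from [Y] is dual to removing from [h] its component along [eta].
    Orthogonality to the new process or noise is thereby restated in terms of [Y], [W] and [M]. *)
Let proj h w := h w - ip P h eta * eta w.
Let Lproj h : L2 P h -> L2 P (proj h). Proof. by move=> Lh; apply: L2B => //; exact: L2Z. Qed.
Let ip_proj h Z : L2 P h -> L2 P Z -> ip P (proj h) Z = ip P h Z - ip P h eta * ip P eta Z.
Proof. by move=> Lh LZ; rewrite ipBl// ?ipZl//; exact: L2Z. Qed.

Let ip_hat h r : L2 P h -> ip P h (fun w => Yh w r) = ip P (proj h) (fun w => Y w r).
Proof.
move=> Lh; rewrite ip_proj// (ip_ev vE).
rewrite (_ : (fun w => Yh w r) = fun w => Y w r - v r * eta w); last first.
  by apply/funext => w; rewrite pathB pathZ mulrC.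
by rewrite ipBr// ?ipZr//; [rewrite mulrC|exact: L2Z].
Qed.

Let proj_M h x : L2 P h -> S x -> ip P (proj h) (M x) = ip P h (M x) - (1 - gam x) * ip P h eta.
Proof.
move=> Lh Sx; rewrite ip_proj//; last exact: LM.
by rewrite (ipC P eta) (ip_Meta etaW mphi iphi ip_M ip_etaW Sx) mulrC.
Qed.

Let proj_W h r : L2 P h -> S r -> ip P (proj h) (W r) = ip P h (W r) - kap r * ip P h eta.
Proof. by move=> Lh Sr; rewrite ip_proj// ?ip_etaW//; [rewrite mulrC|exact: LW]. Qed.

Lemma innovation_span : ospan P (fun r w => Yh w r) `[0, t]%classic Wp.
Proof.
split=> [|h Lh hY]; first exact: innovation_L2.
have Lp := Lproj Lh.
have pY r : `[0, t]%classic r -> ip P (proj h) (fun w => Y w r) = 0 by move=> rt; rewrite -ip_hat// hY.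
have [_ ->] := innovation_ip Lh.
rewrite -proj_W// (_ : ip P (proj h) (W t) = 0); last by have [_] := WY t0 (lexx t) tT; apply.
rewrite add0r (@eq_Rintegral _ _ _ lam `[0, t]%classic (fun=> 0)).
  by rewrite (@Rintegral_cst _ _ R lam _ (measurable_itv _) 0) mul0r.
move=> x; rewrite inE/= in_itv/= => /andP[x0 xt]; have Sx := Sle x0 xt.
rewrite -proj_M// (_ : ip P (proj h) (M x) = 0) ?mulr0//.
have [_] := MY Sx; apply=> // r rx; apply: pY; exact: sub_le rx xt.
Qed.
End fixed_time.

(** If [h] is orthogonal to the innovation up to [t], its component [g] orthogonal to [eta]
    satisfies [E(g W_r) = - int_0^r gain E(g M_x) dx]. By [energy] it is orthogonal to the old
    noise, hence to [Y_t], which the old noise spans. *)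
Lemma innovation_recover t : S t ->
  ospan P (fun r w => noise alpha dh r (Yh w)) `[0, t]%classic (fun w => Yh w t).
Proof.
move=> St; have /andP[t0 tT] := St.
split=> [|h Lh hW].
  rewrite (_ : (fun w => Yh w t) = fun w => Y w t - v t * eta w); last first.
    by apply/funext => w; rewrite pathB pathZ mulrC.
  by apply: L2B => //; exact: L2Z.
pose g w := h w - ip P h eta * eta w.
have Lg : L2 P g by apply: L2B => //; exact: L2Z.
have ip_g Z : L2 P Z -> ip P g Z = ip P h Z - ip P h eta * ip P eta Z.
  by move=> LZ; rewrite ipBl// ?ipZl//; exact: L2Z.
have gM x : S x -> ip P g (M x) = ip P h (M x) - (1 - gam x) * ip P h eta.
  move=> Sx; rewrite ip_g//; last exact: LM.
  by rewrite (ipC P eta) (ip_Meta etaW mphi iphi ip_M ip_etaW Sx) mulrC.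
have gW r : S r -> ip P g (W r) = ip P h (W r) - kap r * ip P h eta.
  by move=> Sr; rewrite ip_g// ?ip_etaW//; [rewrite mulrC|exact: LW].
have Sr r : 0 <= r -> r <= t -> S r by move=> r0 rt; apply/andP; split=> //; exact: le_lt_trans rt tT.
have e r x : 0 <= r -> r <= t -> x \in `[0, r]%classic -> ker x * ip P g (M x) =
    ker x * (ip P h (M x) - (1 - gam x) * ip P h eta).
  move=> r0 rt; rewrite inE/= in_itv/= => /andP[x0 xr].
  by rewrite gM//; apply: Sr => //; exact: le_trans xr rt.
have ig : lam.-integrable `[0, t] (fun x => (ker x * ip P g (M x))%:E).
  have [i1 _] := innovation_ip St Lh.
  by apply: eq_integrable i1 => // x xt; rewrite /= (e t).
have gW0 : forall r, 0 <= r -> r <= t -> ip P g (W r) = 0.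
  apply: (energy LW gramW mphi iphi LM ip_M gam0 St Lg ig) => r r0 rt.
  have St' := Sr r r0 rt; have [_] := innovation_ip St' Lh.
  rewrite (hW r); last by rewrite /= in_itv/= r0.
  have -> : \int[lam]_(x in `[0, r]) (ker x * ip P g (M x)) =
      \int[lam]_(x in `[0, r]) (ker x * (ip P h (M x) - (1 - gam x) * ip P h eta)).
    by apply: eq_Rintegral => x; exact: e.
  by rewrite -gW// => /esym/eqP; rewrite addr_eq0 => /eqP.
rewrite (_ : (fun w => Yh w t) = fun w => Y w t - v t * eta w); last first.
  by apply/funext => w; rewrite pathB pathZ mulrC.
rewrite ipBr// ?ipZr//; last exact: L2Z.
rewrite -(ip_ev vE) mulrC -ip_g//.
have [_ _ _ _ /(_ t t0 tT)[_ spanY]] := gd; apply: (spanY g Lg) => r; rewrite /= in_itv/= => /andP[r0 rt].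
exact: gW0 r r0 rt.
Qed.

Lemma cond_drift_good : good P alpha dh Yh.
Proof.
have mk := gain_measurable mphi; have pdh := cond_drift_prog alpha pd s mk.
split; first exact: pdh.
- by apply: (locally_integrable_ae T0 pdh) => t St; exact: cond_drift_ae.
- move=> a t a0 at_ tT.
  exact: (innovation_cov LW gramW etaW eta1 mphi iphi LM ip_M ip_etaW gam0 innovation_L2 innovation_residual).
- by move=> t t0 tT; apply: innovation_span; rewrite t0.
- by move=> t t0 tT; apply: innovation_recover; rewrite t0.
Qed.
End conditioning_step.

(** * Imposing the conditions *)

Section one_condition.
Context {R : realType} {T : R} (T0 : 0 < T) {d} {Om : measurableType d} (P : probability Om R).
Local Notation C := (path_space T).
Local Notation S := (fun t : R => 0 <= t < T).
Context (X : {RV P >-> C}) (GX : gfam P (fun b w => b (X w)) clf).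
Local Notation amb := (ospan P (fun b w => b (X w)) clf).
Context (Y : Om -> C) (YA : forall b, clf b -> amb (fun w => b (Y w))).

(** By continuity the path at [T] is a limit of its earlier values, so these generate the Borel
    sets; within the Gaussian space measurability gives membership in the closed span. Thus [eta]
    becomes a combination of values before [T], where the noise is available. *)
Lemma functional_span b : clf b -> ospan P (fun r w => Y w r) `[0, T[%classic (fun w => b (Y w)).
Proof.
move=> Sb; have [_ cb] := Sb.
apply: (span_lemma GX); [by move=> r _; exact: amb_ev|exact: YA|move=> B mB].
set SV := \bigcup_(i in _) _.
exists ((fun w => b (Y w)) @^-1` B); last by rewrite setYK; exact: negligible_set0.
have mlt (r : R) : 0 <= r -> r < T -> measurable_fun setT (fun w : g_sigma_algebraType SV => Y w r).
  move=> r0 rT _ E mE; rewrite setTI; apply: sub_sigma_algebra.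
  by exists r => /=; [rewrite in_itv/= r0|exists E => //; rewrite setTI].
have mF (r : R) : r \in `[0, T] -> measurable_fun setT (fun w : g_sigma_algebraType SV => Y w r).
  rewrite in_itv/= => /andP[r0]; rewrite le_eqVlt => /predU1P[->|]; last exact: mlt.
  pose t n : R := T * (1 - n.+1%:R^-1).
  have t01 n : 0 <= t n < T.
    have k1 : 0 < n.+1%:R^-1 :> R by rewrite invr_gt0.
    have k2 : n.+1%:R^-1 <= 1 :> R by rewrite invf_le1 ?ltr0n// ler1n.
    by rewrite /t mulr_ge0 ?subr_ge0// ?(ltW T0)//= mulrBr mulr1 ltrBlDr ltrDl mulr_gt0.
  have mt n : measurable_fun setT (fun w : g_sigma_algebraType SV => Y w (t n)).
    by have /andP[h1 h2] := t01 n; exact: mlt.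
  apply: (measurable_fun_cvg mt) => w _.
  have TT : T \in `[0, T] by rewrite in_itv/= lexx ltW.
  apply/cvgrPdist_lt => e e0; have [dl dl0 H] := path_cvg (Y w) TT e0.
  have dT : 0 < dl / T by rewrite divr_gt0.
  near=> n; have /andP[h1 h2] := t01 n; apply: H; first by rewrite in_itv/= h1 ltW.
  have -> : T - t n = T * n.+1%:R^-1 by rewrite /t; ring.
  rewrite ger0_norm ?mulr_ge0 ?(ltW T0)// -ltr_pdivlMl// mulrC.
  by near: n; apply: (near_infty_natSinv_lt (PosNum dT)).
have mY : measurable_fun setT (Y : g_sigma_algebraType SV -> C) by exact: measurable_path.
have := mY measurableT (b @^-1` B); rewrite setTI; apply.
by rewrite -[X in measurable X]setTI; exact: continuous_borel.
Unshelve. all: by end_near.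
Qed.

Context (alpha : R) (alpha0 : alpha != 0) (delta : R -> C -> R) (gd : good P alpha delta Y).
Context (b0 : C -> R) (Sb0 : clf b0) (eta1 : ip P (fun w => b0 (Y w)) (fun w => b0 (Y w)) = 1).
Local Notation eta := (fun w => b0 (Y w)).
Context (v : C) (vE : forall b, clf b -> ip P eta (fun w => b (Y w)) = b v).
Hypothesis nd : forall s, 0 <= s < T -> exists2 K : R, 0 < K & forall l, inS (fun r : R => 0 <= r <= s) l ->
  1 <= K * ip P (fun w => eta w - lc (fun r w => Y w r) l w) (fun w => eta w - lc (fun r w => Y w r) l w).

Theorem good_step : exists delta', good P alpha delta' (fun w => Y w - eta w *: v : C).
Proof.
have etaW : ospan P (fun t w => noise alpha delta t (Y w)) S eta.
  apply: ospan_trans (functional_span Sb0) => r; rewrite /= in_itv/= => /andP[r0 rT].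
  have [_ _ _ _ /(_ r r0 rT) h] := gd.
  apply: ospan_trans h => q; rewrite /= in_itv/= => /andP[q0 qr].
  have qT := le_lt_trans qr rT.
  apply: ospan_gen; last by rewrite q0.
  by have [_ _ _ /(_ q q0 qT)[] ] := gd.
have LW t : S t -> L2 P (fun w => noise alpha delta t (Y w)).
  by move=> /andP[t0 tT]; have [_ _ _ /(_ t t0 tT)[]] := gd.
have gramW s t : 0 <= s -> s <= t -> t < T -> ip P (fun w => noise alpha delta s (Y w)) (fun w => noise alpha delta t (Y w)) = s.
  by move=> s0 st tT; have [_ _ /(_ s t s0 st tT)] := gd.
have [phi [s [M [[mphi iphi] sS ME ipM ipW]]]] := kernel_filter T0 LW gramW etaW.
eexists; exact: (cond_drift_good T0 GX YA (YA Sb0) eta1 vE nd alpha0 gd etaW mphi iphi sS ME ipM ipW).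
Qed.
End one_condition.

Section reduction.
Context {R : realType} {T : R} (T0 : 0 < T) {H : completeNormedModType R} (hp : {dot H for idfun}).
Hypothesis norm_hp : forall h, `|h| ^+ 2 = hp h h.
Hypothesis H_separable : exists2 D : set H, countable D & dense D.
Local Notation C := (path_space T).
Context (u : {linear H -> C}) (u_bounded : bounded_near u (nbhs 0)).
Context {d} {Om : measurableType d} (P : probability Om R) (X : {RV P >-> C}).
Hypothesis X_generated : generated_by P hp u X.
Context (W : {RV P >-> C}) (BW : brownian_motion P W).
Context {N : nat} (a : 'I_N -> {scalar C}) (a_continuous : forall i, continuous (a i)).
Context (e : N.-tuple H) (e_basis : orthonormal_basis hp (detached_space hp u a) (nth 0 e)).
Hypothesis cond_i : sup [set s | 0 <= s <= T /\
  exists e' : 'I_N -> H, forall i, reduced_space u a (e' i) /\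
    forall x, 0 <= x <= s -> u (e' i) x = u (tnth e i) x] = T.
Context (alpha : R) (alpha0 : alpha != 0) (beta : R -> C -> R) (gX : good P alpha beta X).

Let GX := functional_gfam T0 norm_hp H_separable u_bounded X_generated BW.
Local Notation amb := (ospan P (fun b w => b (X w)) clf).

(** The form kept by every stage: the functions [p i] accumulate the subtractions made so far, and
    the coefficients remain the original functionals [a i]. *)
Definition shift (p : 'I_N -> C) (f : C) : C := f - \sum_(i < N) a i f *: p i.

Let clfa i : clf (a i). Proof. by split=> //; exact: linearP. Qed.

Lemma clf_shift p b : clf b -> (forall f, b (shift p f) = b f - \sum_(i < N) a i f * b (p i)) /\
  clf (fun f => b (shift p f)).
Proof.
move=> Sb; have [lb cb] := Sb.
have bZ x f : b (x *: f) = x * b f.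
  have := lb x f 0; have := lb 1 0 0; rewrite !scale1r !addr0 => h0 ->.
  by move: h0; rewrite mul1r => /esym/eqP; rewrite -subr_eq0 addrK => /eqP ->; rewrite addr0.
have bD f g : b (f + g) = b f + b g by have := lb 1 f g; rewrite scale1r mul1r.
have b0 : b 0 = 0 by rewrite -(scale0r 0) bZ mul0r.
have bS f : b (shift p f) = b f - \sum_(i < N) a i f * b (p i).
  rewrite /shift bD -scaleN1r bZ mulN1r; congr (_ - _).
  by elim/big_ind2: _ => [//|x1 x2 y1 y2 <- <-|i _]; rewrite ?bD ?bZ.
split=> //.
have -> : (fun f => b (shift p f)) = fun f => b f + (-1) * \sum_(i < N) b (p i) * a i f.
  apply/funext => f; rewrite bS mulN1r; congr (_ - _).
  by apply: eq_bigr => i _; rewrite mulrC.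
by apply: clfD => //; apply: clfZ; apply: clf_sum => i; exact: clfZ.
Qed.

Theorem reduction : exists (p : 'I_N -> C) (delta : R -> C -> R),
  good P alpha delta (fun w => shift p (X w)) /\
  forall b i, clf b -> ip P (fun w => b (shift p (X w))) (fun w => a i (X w)) = 0.
Proof.
(* After [n] conditions the functions [p i] of the others must still be zero: this keeps the next
   functional a combination of the conditions up to its own index, with coefficient 1 at that
   index. *)
suff F n : (n <= N)%N -> exists (p : 'I_N -> C) (delta : R -> C -> R),
  [/\ forall i : 'I_N, (n <= i)%N -> p i = 0, good P alpha delta (fun w => shift p (X w)) &
  forall b (i : 'I_N), (i < n)%N -> clf b -> ip P (fun w => b (shift p (X w))) (fun w => a i (X w)) = 0].
  have [p [delta [_ h1 h2]]] := F N (leqnn N).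
  by exists p, delta; split=> // b i; apply: h2.
elim: n => [_|n IH nN].
  exists (fun=> 0), beta; split; [by []| |by []].
  rewrite (_ : (fun w => _) = X)//; apply/funext => w.
  by rewrite /shift big1 ?subr0// => i _; rewrite scaler0.
have [|p [delta [p0 gY orth]]] := IH; first exact: ltnW.
pose k := Ordinal nN.
pose Y w := shift p (X w).
have YA b : clf b -> amb (fun w => b (Y w)).
  by move=> Sb; have [_ h] := clf_shift p Sb; apply: (ospan_gen (GX.1 _ h) h).
have LYb b : clf b -> L2 P (fun w => b (Y w)) by move=> /YA[].
have La i : L2 P (fun w => a i (X w)) by exact: (GX.1 _ (clfa i)).
(* Evaluated on the shifted path, [a k] is the combination of the original conditions with these
   coefficients, which is the form that [nondegenerate] handles. *)
pose ck (i : 'I_N) : R := (i == k)%:R - a k (p i).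
have akE f : a k (shift p f) = acomb a ck f.
  have [-> _] := clf_shift p (clfa k).
  rewrite /acomb /ck; under [RHS]eq_bigr do rewrite mulrBl.
  rewrite sumrB; congr (_ - _); last by apply: eq_bigr => i _; rewrite mulrC.
  rewrite (bigD1 k)//= eqxx mul1r big1 ?addr0// => i /negbTE ->.
  by rewrite mul0r.
have ck0 (i : 'I_N) : (n < i)%N -> ck i = 0.
  move=> ni; rewrite /ck p0 1?ltnW// linear0 subr0.
  by rewrite -val_eqE /= gtn_eqF.
have orthS b (g : 'I_N -> R) : clf b -> (forall i : 'I_N, (n <= i)%N -> g i = 0) ->
    ip P (fun w => b (Y w)) (fun w => \sum_(i < N) g i * a i (X w)) = 0.
  move=> Sb g0; have Lb := LYb b Sb.
  rewrite ipC ip_suml//; last by move=> i; exact: L2Z.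
  rewrite big1// => i _; rewrite ipZl// ipC.
  have [ni|ni] := leqP n i; first by rewrite g0// mul0r.
  by rewrite orth// mulr0.
have orthk b : clf b -> ip P (fun w => b (Y w)) (fun w => a k (X w)) = ip P (fun w => b (Y w)) (fun w => a k (Y w)).
  move=> Sb; have Lb := LYb b Sb.
  have -> : (fun w => a k (X w)) = fun w => a k (Y w) + \sum_(i < N) a k (p i) * a i (X w).
    apply/funext => w; rewrite /Y; have [-> _] := clf_shift p (clfa k).
    by under [X in _ = _ - _ + X]eq_bigr do rewrite mulrC; rewrite subrK.
  rewrite ipDr//; last 2 first.
  - by apply: LYb.
  - by apply: L2_sum => i; exact: L2Z.
  by rewrite orthS ?addr0// => i ni; rewrite p0// linear0.
have Lk : L2 P (fun w => a k (Y w)) by exact: LYb.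
have ik (i : 'I_N) : (i < n.+1)%N -> (i < n)%N \/ i = k.
  by rewrite ltnS leq_eqVlt => /predU1P[h|]; [right; exact: val_inj|left].
(* If the variance is zero, the condition already follows from the earlier ones, and process and
   drift are left unchanged. *)
have [s0|s0] := eqVneq (ip P (fun w => a k (Y w)) (fun w => a k (Y w))) 0.
  exists p, delta; split=> //; first by move=> i /ltnW; exact: p0.
  move=> b i /ik[ni Sb|-> Sb]; first exact: orth.
  rewrite [LHS](orthk b Sb); have := ip_CS (LYb b Sb) Lk; rewrite s0 mulr0 => h.
  by apply/eqP; rewrite -sqrf_eq0 eq_le h sqr_ge0.
set s2 := ip P _ _ in s0.
have s2p : 0 < s2 by rewrite lt_neqAle eq_sym s0 ip_ge0.
pose q := Num.sqrt s2; have q0 : q != 0 by rewrite gt_eqF// sqrtr_gt0.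
have q2 : q * q = s2 by rewrite -expr2 sqr_sqrtr// ltW.
pose b0 f := q^-1 * a k f.
have Sb0 : clf b0 by exact: clfZ.
have Lb0 := LYb b0 Sb0.
have b0k b : clf b -> ip P (fun w => b (Y w)) (fun w => a k (Y w)) = q * ip P (fun w => b0 (Y w)) (fun w => b (Y w)).
  by move=> Sb; have Lb := LYb b Sb; rewrite [in RHS]ipZl// mulrA mulfV// mul1r ipC.
have eta1 : ip P (fun w => b0 (Y w)) (fun w => b0 (Y w)) = 1.
  rewrite ipZl// ipC ipZl// -/s2 -q2; by field.
have [_ Seta] := clf_shift p Sb0.
have [k0 [hk0 _]] := functional_riesz T0 norm_hp H_separable u_bounded X_generated BW Seta.
(* [k0] represents the functional behind [eta], so [u k0] carries its covariances with [X] and the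
   shifted path those with [Y]. *)
pose v := shift p (u k0).
have vE b : clf b -> ip P (fun w => b0 (Y w)) (fun w => b (Y w)) = b v.
  move=> Sb; have [_ Sb'] := clf_shift p Sb.
  have [k1 [hk1 _]] := functional_cov T0 norm_hp H_separable u_bounded X_generated BW Seta Sb'.
  suff -> : k1 = k0 by [].
  apply/eqP; rewrite -subr_eq0 -normr_eq0 -sqrf_eq0 norm_hp hpBl.
  by rewrite hk0 hk1 subrr.
have pE i r : p i r = (fun f : C => f r) (p i) by [].
(* Combinations of values of [X] and of [Y] differ by a combination of earlier conditions. It is
   absorbed into [c'], and because [eta] is orthogonal to those conditions the total still has norm
   at least 1. *)
have nd s : 0 <= s < T -> exists2 K : R, 0 < K & forall l, inS (fun r : R => 0 <= r <= s) l ->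
    1 <= K * ip P (fun w => b0 (Y w) - lc (fun r w => Y w r) l w) (fun w => b0 (Y w) - lc (fun r w => Y w r) l w).
  move=> /andP[_ sT].
  have [K K0 HK] := nondegenerate T0 norm_hp H_separable u_bounded X_generated BW a_continuous e_basis cond_i sT.
  exists K => // l lS.
  pose g (i : 'I_N) := \sum_(x <- l) x.1 * p i x.2.
  pose c' (i : 'I_N) := q^-1 * ck i + g i.
  have aE w : acomb a c' (X w) = b0 (Y w) + \sum_(i < N) g i * a i (X w).
    rewrite /b0 /Y akE /acomb mulr_sumr -big_split/=; apply: eq_bigr => i _.
    by rewrite /c'; ring.
  have lE w : lc (fun r w => X w r) l w = lc (fun r w => Y w r) l w + \sum_(i < N) g i * a i (X w).
    rewrite /lc /g; under [X in _ = _ + X]eq_bigr do rewrite mulr_suml.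
    rewrite exchange_big/= -big_split/=; apply: eq_bigr => x _.
    have [h _] := clf_shift p (clf_ev x.2).
    rewrite [X in x.1 * X + _](h (X w)) mulrBr mulr_sumr -addrA -sumrN -big_split/= big1 ?addr0// => i _; ring.
  have -> : (fun w => b0 (Y w) - lc (fun r w => Y w r) l w) = fun w => acomb a c' (X w) - lc (fun r w => X w r) l w.
    by apply/funext => w; rewrite aE lE; ring.
  apply: le_trans (HK c' l lS).
  have -> : (fun w => acomb a c' (X w)) = fun w => b0 (Y w) + 1 * \sum_(i < N) g i * a i (X w).
    by apply/funext => w; rewrite aE mul1r.
  have LG : L2 P (fun w => \sum_(i < N) g i * a i (X w)) by apply: L2_sum => i; exact: L2Z.
  rewrite ip_quad// eta1 orthS//.
    by rewrite mulr0 mul0rn addr0 expr1n mul1r lerDl ip_ge0.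
  by move=> i ni; rewrite /g big1// => x _; rewrite p0// mulr0.
have [delta' gd'] := good_step T0 GX YA alpha0 gY Sb0 eta1 vE nd.
pose p' i := p i + (q^-1 * ck i) *: v.
have p'E w : shift p' (X w) = Y w - b0 (Y w) *: v.
  rewrite /Y /b0 akE /acomb /shift -addrA -opprD; congr (_ - _).
  rewrite mulr_sumr scaler_suml -big_split/=; apply: eq_bigr => i _.
  by rewrite /p' scalerDr scalerA; congr (_ + _ *: _); ring.
exists p', delta'; split.
- by move=> i ni; rewrite /p' p0 ?(ltnW ni)// ck0// mulr0 scale0r addr0.
- by rewrite (_ : (fun w => _) = fun w => Y w - b0 (Y w) *: v)//; apply/funext => w; exact: p'E.
move=> b i ni Sb; have Lb := LYb b Sb.
have -> : (fun w => b (shift p' (X w))) = fun w => b (Y w) - b v * b0 (Y w).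
  apply/funext => w; rewrite p'E; have [lb _] := Sb.
  rewrite addrC -scaleNr lb mulNr addrC; congr (_ - _); exact: mulrC.
rewrite ipBl//; last exact: L2Z.
rewrite ipZl//; case: (ik i ni) => [{}ni|->].
  by rewrite orth// [X in _ * X]orth// mulr0 subrr.
by rewrite (orthk b Sb) (orthk b0 Sb0) !b0k// eta1 vE//; ring.
Qed.
End reduction.

(** * Transfer to the law on the path space *)

Section rational_extension.
Context {R : realType} (T : R) (T0 : 0 < T).

(* Uniform continuity on the rationals of [0 <= r < T], phrased with countable quantifiers so that it is a measurable event. *)
Definition ratcont (g : R -> R) := forall n, exists m, forall q : rat * rat,
  0 <= (ratr q.1 : R) < T -> 0 <= (ratr q.2 : R) < T -> `|ratr q.1 - ratr q.2| < m.+1%:R^-1 :> R ->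
  `|g (ratr q.1) - g (ratr q.2)| <= n.+1%:R^-1.

Lemma ratcont_measurable {d} {Om : measurableType d} (F : Om -> R -> R) :
  (forall r, 0 <= r < T -> measurable_fun setT (fun w => F w r)) ->
  measurable [set w | ratcont (F w)].
Proof.
move=> mF.
pose A n m (q : rat * rat) := [set w | 0 <= (ratr q.1 : R) < T -> 0 <= (ratr q.2 : R) < T ->
  `|ratr q.1 - ratr q.2| < m.+1%:R^-1 :> R -> `|F w (ratr q.1) - F w (ratr q.2)| <= n.+1%:R^-1].
have -> : [set w | ratcont (F w)] = \bigcap_n \bigcup_m ~` (\bigcup_q ~` A n m q).
  apply/seteqP; split=> w /= h.
    by move=> n _; have [m hm] := h n; exists m => // -[q _]; apply; exact: hm.
  move=> n; have [m _ hm] := h n I; exists m => q; apply: contrapT => hq.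
  by apply: hm; exists q.
apply: bigcap_measurableType => n _; apply: bigcupT_measurable => m; apply: measurableC.
apply: countable_bigcupT_measurable; first exact: countableP.
move=> q; apply: measurableC.
have [h1|h1] := pselect (0 <= (ratr q.1 : R) < T); last first.
  by rewrite (_ : A n m q = setT)//; apply/seteqP; split=> // w _ /= /h1.
have [h2|h2] := pselect (0 <= (ratr q.2 : R) < T); last first.
  by rewrite (_ : A n m q = setT)//; apply/seteqP; split=> // w _ /= _ /h2.
have [h3|h3] := pselect (`|ratr q.1 - ratr q.2| < m.+1%:R^-1 :> R); last first.
  by rewrite (_ : A n m q = setT)//; apply/seteqP; split=> // w _ /= _ _ /h3.
have mf : measurable_fun setT (fun w => `|F w (ratr q.1) - F w (ratr q.2)|).
  by apply: measurableT_comp => //; apply: measurable_funB; exact: mF.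
have := mf measurableT `]-oo, (n.+1%:R^-1 : R)]%classic (measurable_itv _).
rewrite setTI; congr measurable; apply/seteqP; split=> w /=; rewrite in_itv/=.
  by move=> ? _ _ _.
by apply.
Qed.

Let approx_prop (r : R) (qs : nat -> rat) := forall n, 0 <= (ratr (qs n) : R) < T /\ `|r - ratr (qs n)| < n.+1%:R^-1.

Let approx_ex r : 0 <= r <= T -> exists qs, approx_prop r qs.
Proof.
move=> /andP[r0 rT].
suff /choice[qs h] : forall n, exists q : rat, 0 <= (ratr q : R) < T /\ `|r - ratr q| < n.+1%:R^-1 by exists qs.
move=> n; have n0 : 0 < n.+1%:R^-1 :> R by rewrite invr_gt0.
have lt : Num.max 0 (r - n.+1%:R^-1) < Num.min T (r + n.+1%:R^-1).
  move: n0; set x := n.+1%:R^-1 => x0; rewrite gt_max !lt_min T0 /=.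
  by apply/andP; split; [|apply/andP; split]; lra.
have [q] := rat_in_itvoo lt; rewrite in_itv/= gt_max lt_min => /andP[/andP[h1 h2] /andP[h3 h4]].
exists q; rewrite (ltW h1) h3; split=> //.
move: n0 h2 h4; set x := n.+1%:R^-1 => x0 h2 h4.
by rewrite ltr_norml; apply/andP; split; lra.
Qed.

(** The rational times depend on [r] alone and not on the function, so that the extension at [r] is
    a measurable function of the values at rational times. *)
Definition approx (r : R) : nat -> rat :=
  if pselect (exists qs, approx_prop r qs) is left h then projT1 (cid h) else fun=> 0%Q.

Lemma approxP r n : 0 <= r <= T -> 0 <= (ratr (approx r n) : R) < T /\ `|r - ratr (approx r n)| < n.+1%:R^-1.
Proof.
move=> rT; rewrite /approx; case: pselect => [h|/(_ (approx_ex rT))//].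
exact: (projT2 (cid h)).
Qed.

Definition ext (g : R -> R) (r : R) : R :=
  if 0 <= r <= T then flim (fun n => g (ratr (approx r n))) else 0.

Lemma natinv_lt (e : R) : 0 < e -> exists n : nat, forall k, (n <= k)%N -> k.+1%:R^-1 < e.
Proof. by move=> e0; have [n _ h] := near_infty_natSinv_lt (PosNum e0); exists n => k nk; exact: h. Qed.

Lemma ext_cvg g r : ratcont g -> 0 <= r <= T -> g (ratr (approx r n)) @[n --> \oo] --> ext g r.
Proof.
move=> Ug rT; rewrite /ext rT.
set u := fun n => g _.
suff [l ul] : exists l : R, u n @[n --> \oo] --> l by rewrite (flimE ul).
have : cvg (u @ \oo); last by move=> /cvg_ex.
apply: cauchy_cvg; apply: cauchy_exP => eps e0.
have [n hn] := natinv_lt e0; have [m hm] := Ug n.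
have m0 : 0 < m.+1%:R^-1 / 2 :> R by rewrite divr_gt0 ?invr_gt0.
have [k hk] := natinv_lt m0.
exists (u k); exists k => // j /= kj; rewrite -ball_normE /=.
have [k1 k2] := approxP k rT; have [j1 j2] := approxP j rT.
apply: le_lt_trans (hn n (leqnn n)).
apply: (hm (approx r k, approx r j)) => //=.
have b1 := hk k (leqnn k); have b2 := hk j kj.
rewrite -(subrK r (ratr (approx r k))) -addrA; apply: le_lt_trans (ler_normD _ _) _.
rewrite distrC; move: k2 j2 b1 b2; set x := `|_|; set y := `|_|.
set a := k.+1%:R^-1; set b := j.+1%:R^-1; set c := m.+1%:R^-1; lra.
Qed.

Lemma ext_eq g r : ratcont g -> 0 <= r <= T ->
  (forall e : R, 0 < e -> exists2 dl : R, 0 < dl & forall y, 0 <= y < T -> `|r - y| < dl -> `|g r - g y| < e) ->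
  ext g r = g r.
Proof.
move=> Ug rT gr; apply/esym; apply: cvgR_unique (ext_cvg Ug rT).
apply/cvgrPdist_lt => e e0; have [dl dl0 h] := gr e e0.
have [k hk] := natinv_lt dl0; exists k => // n /= kn; have [n1 n2] := approxP n rT.
by apply: h => //; exact: lt_trans n2 (hk n kn).
Qed.

Lemma ext_unif g : ratcont g -> forall n, exists m, forall r r', 0 <= r <= T -> 0 <= r' <= T ->
  `|r - r'| < m.+1%:R^-1 -> `|ext g r - ext g r'| <= n.+1%:R^-1.
Proof.
move=> Ug n; have [m hm] := Ug n; exists m => r r' rT rT' rr.
have c1 : g (ratr (approx r n)) - g (ratr (approx r' n)) @[n --> \oo] --> ext g r - ext g r'.
  by apply: cvgB; exact: ext_cvg.
have c2 : `|g (ratr (approx r n)) - g (ratr (approx r' n))| @[n --> \oo] --> `|ext g r - ext g r'|.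
  exact: cvg_norm c1.
have e0 : 0 < (m.+1%:R^-1 - `|r - r'|) / 2 by rewrite divr_gt0// subr_gt0.
have [k hk] := natinv_lt e0.
rewrite -[leLHS](cvg_lim _ c2)//; apply: limr_le; first by apply/cvg_ex; exists `|ext g r - ext g r'|.
exists k => // j /= kj; have [k1 k2] := approxP j rT; have [j1 j2] := approxP j rT'.
apply: (hm (approx r j, approx r' j)) => //=.
have b := hk j kj.
have -> : ratr (approx r j) - ratr (approx r' j) = - (r - ratr (approx r j)) + (r' - ratr (approx r' j)) + (r - r') :> R by ring.
apply: le_lt_trans (ler_normD _ _) _; apply: le_lt_trans (lerD (ler_normD _ _) (lexx _)) _.
rewrite normrN; move: k2 j2 b; set x := `|_|; set y := `|_|; set z := `|_|.
set b := j.+1%:R^-1; set c := m.+1%:R^-1; lra.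
Qed.

Lemma ext_path g : ratcont g -> exists G : path_space T, forall r, G r = ext g r.
Proof.
(* Clamping to [[0,T]] is a contraction, so composing with it extends the uniform continuity to the
   whole line. *)
move=> Ug; pose cl (r : R) := Num.max 0 (Num.min r T).
have cl0 r : 0 <= cl r <= T by rewrite /cl le_max lexx/= ge_max (ltW T0) ge_min lexx orbT.
have clE r : 0 <= r <= T -> cl r = r.
  by move=> /andP[r0 rT]; rewrite /cl (min_idPl rT); apply/max_idPr.
have cl_lip r r' : `|cl r - cl r'| <= `|r - r'|.
  wlog rr : r r' / r <= r'.
    move=> h; have [|/ltW] := leP r r'; first exact: h.
    by move=> /h; rewrite distrC [leRHS]distrC.
  rewrite (distrC r) (distrC (cl r)) (ger0_norm (_ : 0 <= r' - r)) ?subr_ge0//.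
  have c0 : 0 <= cl r by rewrite /cl le_max lexx.
  have c1 : Num.min r T <= cl r by rewrite /cl le_max lexx orbT.
  have h1 : cl r <= cl r'.
    by rewrite {1}/cl ge_max; apply/andP; split; rewrite /cl le_max ?lexx// le_min !ge_min rr lexx !orbT.
  have h2 : cl r' <= cl r + (r' - r).
    rewrite {1}/cl ge_max; apply/andP; split; first lra.
    have [rT|rT] := leP r T.
      by move: c1; rewrite (min_idPl rT) => c1; rewrite ge_min; apply/orP; left; lra.
    by move: c1; rewrite (min_idPr (ltW rT)) => c1; rewrite ge_min; apply/orP; right; lra.
  by rewrite ger0_norm ?subr_ge0// lerBlDl.
have cG : continuous (fun r => ext g (cl r)).
  move=> r; apply/cvgrPdist_lt => e e0.
  have [n hn] := natinv_lt e0; have [m hm] := ext_unif Ug n.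
  have m0 : 0 < m.+1%:R^-1 :> R by rewrite invr_gt0.
  have := nbhsx_ballx r _ m0; apply: filterS => y; rewrite -ball_normE /= => ry.
  apply: le_lt_trans (hn n (leqnn n)); apply: hm => //.
  exact: le_lt_trans (cl_lip _ _) ry.
have P : ext g \in is_pathb T.
  apply/asboolP; split.
    apply: (@subspace_eq_continuous _ _ _ (fun r => ext g (cl r))); last exact: continuous_subspaceT.
    by move=> r; rewrite inE/= in_itv/= => rT; rewrite /from_subspace /= clE.
  by apply/funext => r; rewrite patchE mem_setE in_itv/= /ext; case: (_ && _).
by exists (PathSpace P).
Qed.

Definition ext_fun (g : R -> R) : path_space T :=
  if pselect (ratcont g) is left h then projT1 (cid (ext_path h)) else 0.

Lemma ext_funE g r : ratcont g -> ext_fun g r = ext g r.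
Proof. by move=> Ug; rewrite /ext_fun; case: pselect => // h; case: (cid _). Qed.

Lemma ext_fun_measurable {d} {Om : measurableType d} (F : Om -> R -> R) :
  (forall r, 0 <= r < T -> measurable_fun setT (fun w => F w r)) ->
  measurable_fun setT (fun w => ext_fun (F w)).
Proof.
move=> mF; apply: (measurable_path T0) => r rT.
rewrite (_ : (fun w => _) = fun w => \1_[set w | ratcont (F w)] w * ext (F w) r).
  apply: measurable_funM; first by apply: measurable_indic; exact: ratcont_measurable.
  have rT' : 0 <= r <= T by move: rT; rewrite in_itv.
  rewrite /ext rT'; apply: (@measurable_flim _ _ R setT) => // n.
  by apply: mF; have [] := approxP n rT'.
apply/funext => w; rewrite indicE; have [h|h] := pselect (ratcont (F w)).
  by rewrite mem_set// mul1r ext_funE.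
rewrite memNset// mul0r /ext_fun; by case: pselect.
Qed.

Lemma path_ratcont (f : path_space T) : ratcont f.
Proof.
move=> n; have n0 : 0 < n.+1%:R^-1 :> R by rewrite invr_gt0.
have [dl dl0 h] := path_unif f n0; have [m hm] := natinv_lt dl0.
exists m => q /andP[a1 a2] /andP[b1 b2] ab; apply: ltW; apply: h.
- by rewrite in_itv/= a1 ltW.
- by rewrite in_itv/= b1 ltW.
- exact: lt_trans ab (hm m (leqnn m)).
Qed.
End rational_extension.

Lemma halfopen_measurable {R : realType} {T : R} (T0 : 0 < T) {d} {Om : measurableType d} (Y : Om -> path_space T) :
  measurable_fun setT (Y : g_sigma_algebraType
    (\bigcup_(r in `[0, T[%classic) preimage_set_system setT (fun w => Y w r) measurable) -> path_space T).
Proof.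
set SV := \bigcup_(i in _) _.
have mlt (r : R) : 0 <= r -> r < T -> measurable_fun setT (fun w : g_sigma_algebraType SV => Y w r).
  move=> r0 rT _ E mE; rewrite setTI; apply: sub_sigma_algebra.
  by exists r => /=; [rewrite in_itv/= r0|exists E => //; rewrite setTI].
apply: (measurable_path T0) => r; rewrite in_itv/= => /andP[r0].
rewrite le_eqVlt => /predU1P[->|]; last exact: mlt.
have TT : 0 <= T <= T by rewrite lexx ltW.
have mt n : measurable_fun setT (fun w : g_sigma_algebraType SV => Y w (ratr (approx T T n))).
  by have [/andP[h1 h2] _] := approxP T0 n TT; exact: mlt.
apply: (measurable_fun_cvg mt) => w _.
have TT' : T \in `[0, T] by rewrite in_itv/= lexx ltW.
apply/cvgrPdist_lt => e e0; have [dl dl0 H] := path_cvg (Y w) TT' e0.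
have [k hk] := natinv_lt dl0; exists k => // n /= kn.
have [/andP[h1 h2] h3] := approxP T0 n TT.
by apply: H; [rewrite in_itv/= h1 ltW|exact: lt_trans h3 (hk n kn)].
Qed.

Section conditional_expectation_unique.
Context {d} {Om : measurableType d} {R : realType} (P : probability Om R).

Lemma Ex_mul_indic (f : Om -> R) (E : set Om) : 
  Ex P (fun w => f w * \1_E w) = fine (\int[P]_(w in E) (f w)%:E)%E.
Proof.
rewrite -[RHS]/(\int[P]_(w in E) f w)%R [RHS]Rintegral_mkcond; apply: eq_Rintegral => w _.
by rewrite patchE indicE; case: (_ \in _); rewrite ?mulr1 ?mulr0.
Qed.

Lemma conditional_expectation_unique (Gen : set (set Om)) (U V Z : Om -> R) :
  Gen `<=` measurable -> int1 P U -> int1 P Z ->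
  measurable_fun setT (Z : g_sigma_algebraType Gen -> R) ->
  (forall E, <<s Gen>> E -> Ex P (fun w => (U w - Z w) * \1_E w) = 0) ->
  conditional_expectation P <<s Gen>> U V -> {ae P, forall w, V w = Z w}.
Proof.
move=> GM iU iZ mZ UZ [iV mV VE].
have GM' E : <<s Gen>> E -> measurable E.
  by apply: smallest_sub => //; exact: sigma_algebra_measurable.
have int1I f E : int1 P f -> <<s Gen>> E -> int1 P (fun w => f w * \1_E w).
  move=> i_f GE; apply: (@int1_le _ _ _ P _ (fun w => `|f w|)); last exact: int1_abs.
    by apply: measurable_funM; [exact: int1_meas i_f|apply: measurable_indic; exact: GM'].
  by move=> w; rewrite normrM ler_piMr// indicE; case: (_ \in _); rewrite ?normr1 ?normr0.
pose D w := V w - Z w.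
have iD : int1 P D by exact: int1B.
have D0 E : <<s Gen>> E -> Ex P (fun w => D w * \1_E w) = 0.
  move=> GE; rewrite (_ : (fun w => _) = fun w => V w * \1_E w - Z w * \1_E w); last first.
    by apply/funext => w; rewrite mulrBl.
  rewrite ExB; [|exact: int1I..].
  rewrite Ex_mul_indic VE// -Ex_mul_indic -ExB; [|exact: int1I..].
  by rewrite -[RHS](UZ E GE); congr (Ex _ _); apply/funext => w; rewrite mulrBl.
have mV' : measurable_fun setT (V : g_sigma_algebraType Gen -> R).
  by move=> _ B mB; rewrite setTI; exact: mV.
have mD : measurable_fun setT (D : g_sigma_algebraType Gen -> R) by exact: measurable_funB.
pose E1 := [set w | 0 <= D w].
have GE1 : <<s Gen>> E1.
  have := mD measurableT `[0, +oo[%classic (measurable_itv _); rewrite setTI.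
  by congr (_ _); apply/seteqP; split=> w /=; rewrite in_itv/= andbT.
have GT : <<s Gen>> setT by have := @measurableT _ (g_sigma_algebraType Gen).
have : Ex P (fun w => `|D w|) = 0.
  (* The absolute value is [2 D] on [E1] minus [D]; both integrals are over events of the
     sigma-algebra and vanish. *)
  rewrite (_ : (fun w => _) = fun w => 2 * (D w * \1_E1 w) - D w * \1_setT w); last first.
    apply/funext => w; rewrite !indicE in_setT mulr1.
    have [h|h] := leP 0 (D w).
      by rewrite mem_set//= ger0_norm//; ring.
    rewrite memNset /E1 /=; last by move=> h'; have := lt_le_trans h h'; rewrite ltxx.
    by rewrite ltr0_norm//; ring.
  rewrite ExB; [|by apply: int1Z; exact: int1I|exact: int1I].
  by rewrite ExZ ?D0// ?mulr0 ?subr0//; exact: int1I.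
move=> /(Ex_eq0 (int1_abs iD) (fun w => normr_ge0 _)); apply: filterS => w /= /eqP.
by rewrite normr_eq0 subr_eq0 => /eqP.
Qed.
End conditional_expectation_unique.

Section conditioned_law.
Context {R : realType} {T : R} (T0 : 0 < T) {d} {Om : measurableType d} (P : probability Om R).
Local Notation C := (path_space T).
Context (X : {RV P >-> C}) (GX : gfam P (fun b w => b (X w)) clf).
Context {N : nat} (a : 'I_N -> {scalar C}) (a_continuous : forall i, continuous (a i)).
Context (p : 'I_N -> C).
Hypothesis orth : forall b i, clf b -> ip P (fun w => b (shift a p (X w))) (fun w => a i (X w)) = 0.
Context {d'} {Om' : measurableType d'} (P' : probability Om' R) (XA : {RV P' >-> C}).
Hypothesis cond : conditioned_process P X a P' XA.

Let clfa i : clf (a i). Proof. by split=> //; exact: linearP. Qed.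

(** [Z] is a version of the conditional expectation of [b(X)]: it is a function of the conditions,
    and [b(X) - Z = b(shift p X)] is uncorrelated with each of them, hence orthogonal to every event
    they generate. So [b(XA)] has the law of [b(shift p X)]. *)
Lemma shift_eval_law b : clf b -> isG P' (ip P (fun w => b (shift a p (X w))) (fun w => b (shift a p (X w))))
  (fun w => b (XA w)).
Proof.
move=> Sb; have [bS Sb'] := clf_shift a_continuous p Sb.
have Sb2 := Sb; case: Sb2 => lb cb.
pose bL : {scalar C} := HB.pack b (GRing.isLinear.Build R C R _ b lb).
have [_ /(_ 1%N (fun=> bL) (fun=> cb))[Yc ce law]] := cond.
have LB := GX.1 _ Sb; have LS := GX.1 _ Sb'; have La i := GX.1 _ (clfa i).
pose Z w := \sum_(i < N) a i (X w) * b (p i).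
have LZ : L2 P Z.
  apply: L2_sum => i; rewrite (_ : (fun w => _) = fun w => b (p i) * a i (X w)); first exact: L2Z.
  by apply/funext => w; rewrite mulrC.
have G1 : isG P (ip P (fun w => b (shift a p (X w))) (fun w => b (shift a p (X w)))) (fun w => b (shift a p (X w))).
  exact: gfam_ospan GX (ospan_gen (GX.1 _ Sb') Sb').
have YZ : {ae P, forall w, Yc ord0 w = Z w}.
  set Gen := \big[setU/set0]_(i < N) preimage_set_system setT (a i \o X) measurable.
  have GenE : Gen = \bigcup_(i in [set: 'I_N]) preimage_set_system setT (fun w => a i (X w)) measurable.
    rewrite /Gen -bigcup_seq; congr (bigcup _ _).
    by apply/seteqP; split=> i //= _; rewrite mem_index_enum.
  apply: (@conditional_expectation_unique _ _ _ P Gen (fun w => b (X w))) (ce ord0).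
  - rewrite GenE => _ [i _ [B mB <-]]; rewrite setTI.
    have [mi _] := La i; by rewrite -[X in measurable X]setTI; exact: mi.
  - exact: L2_int1.
  - exact: L2_int1.
  - rewrite /Z; apply: measurable_sum => i; apply: measurable_funM => //.
    move=> _ B mB; rewrite setTI; apply: sub_sigma_algebra; rewrite GenE.
    by exists i => //; exists B => //; rewrite setTI.
  move=> E; rewrite GenE => GE.
  rewrite -[RHS](@orth_weight _ _ _ P _ _ _ GX _ (fun i w => a i (X w)) setT _ (fun w => b (shift a p (X w))) _ _ E GE).
  - by congr (Ex _ _); apply/funext => w; rewrite bS.
  - by move=> i _; exact: (ospan_gen (GX.1 _ (clfa i)) (clfa i)).
  - exact: (ospan_gen (GX.1 _ Sb') Sb').
  - by move=> i _; exact: orth.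
have mb : measurable_fun setT (fun w => b (XA w)).
  by apply: (measurableT_comp (continuous_borel cb)).
apply: (@isG_law _ _ _ _ _ P P' _ (fun w => b (X w) - Yc ord0 w)) => //.
  move=> A mA; have mB : measurable [set t : 1.-tuple R | A (tnth t ord0)].
    have m1 : measurable_fun setT (fun t : 1.-tuple R => tnth t ord0) by exact: measurable_tnth.
    have := m1 measurableT A mA; rewrite setTI.
    by [].
  have := law _ mB; set L := P' _; set Q := P _ => e.
  transitivity Q; first by congr (P _); apply/seteqP; split=> w /=; rewrite tnth_mktuple.
  rewrite -e; congr (P' _); apply/seteqP; split=> w /=; rewrite tnth_mktuple//.
apply: isG_ae G1.
  have [mB _] := LB; apply: measurable_funB => //.
  by have [iY _ _] := ce ord0; exact: int1_meas iY.
by apply: filterS YZ => w ->; rewrite bS.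
Qed.

Let mshift r : measurable_fun setT (fun w => shift a p (X w) r).
Proof. have [_ h] := clf_shift a_continuous p (clf_ev r); by have [] := GX.1 _ h. Qed.

Lemma shift_measurable : measurable_fun setT (fun w => shift a p (X w)).
Proof. by apply: (measurable_path T0) => r _; exact: mshift. Qed.

Theorem conditioned_law A : measurable A -> P ((fun w => shift a p (X w)) @^-1` A) = P' (XA @^-1` A).
Proof.
move=> mA.
apply: (@gaussian_law_eq R R C (fun r f => f r) `[0, T]%classic _ _ _ _ P P') (borel_past T0 mA).
- by move=> r _; exact: mshift.
- by move=> r _; apply: (measurableT_comp (@eval_measurable R T r)).
move=> s _; have Sb : clf (lc (fun r (f : C) => f r) s).
  by apply: (@clf_lc _ _ _ _ (fun=> True)) => // i _; exact: clf_ev.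
have [_ Sb'] := clf_shift a_continuous p Sb.
exists (ip P (fun w => lc (fun r (f : C) => f r) s (shift a p (X w))) (fun w => lc (fun r (f : C) => f r) s (shift a p (X w)))).
  exact: gfam_ospan GX (ospan_gen (GX.1 _ Sb') Sb').
exact: shift_eval_law.
Qed.
End conditioned_law.

Section brownian_law.
Context {R : realType} {T : R} (T0 : 0 < T).
Local Notation C := (path_space T).
Context {d1 d2} {O1 : measurableType d1} {O2 : measurableType d2} (P1 : probability O1 R) (P2 : probability O2 R).
Context (W1 : O1 -> C) (W2 : O2 -> C) (mW1 : measurable_fun setT W1) (mW2 : measurable_fun setT W2).
Hypothesis law : forall A, measurable A -> P1 (W1 @^-1` A) = P2 (W2 @^-1` A).

Lemma brownian_law : brownian_motion P1 W1 -> brownian_motion P2 W2.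
Proof.
have mev (r : R) : measurable_fun setT (fun f : C => f r) by exact: eval_measurable.
have mset (g : C -> R) (B : set R) : measurable_fun setT g -> measurable B -> measurable (g @^-1` B).
  by move=> mg mB; rewrite -[X in measurable X]setTI; exact: mg.
move=> [h1 h2 h3]; split.
- apply: (@law_ae _ _ _ _ _ _ _ P1 P2 W1 W2 [set f : C | f 0 = 0] mW2 law mW1) => //.
  exact: (mset _ [set 0]).
- move=> s t s0 st tT B mB; rewrite -h2//; apply/esym.
  apply: (law (A := (fun f : C => f t - f s) @^-1` B)); apply: mset => //.
  exact: measurable_funB.
move=> n t t0 tn tt s us B mB.
have mI (i : 'I_n) : measurable ((fun f : C => f (t i.+1) - f (t i)) @^-1` B i).
  by apply: mset => //; exact: measurable_funB.
have := h3 n t t0 tn tt s us B mB; set L := P1 _ => e.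
transitivity L.
  apply/esym; apply: (law (A := \bigcap_(i in [set` s]) ((fun f : C => f (t i.+1) - f (t i)) @^-1` B i))).
  by apply: fin_bigcap_measurable => // i _; exact: mI.
rewrite e; apply: eq_bigr => i _.
exact: (law (mI i)).
Qed.
End brownian_law.

Section innovation_path.
Context {R : realType} {T : R} (T0 : 0 < T).
Local Notation C := (path_space T).
Local Notation lam := (@lebesgue_measure R).
Context (alpha : R) (alpha0 : alpha != 0) (delta : R -> C -> R) (pd : progressively_measurable delta).
Local Notation wf := (noise alpha delta).

Definition innovation (f : C) : C := ext_fun T0 (fun t => wf t f).

Lemma noise_borel t : 0 <= t <= T -> measurable_fun setT (wf t).
Proof.
move=> tT; apply: (@noise_measurable _ _ alpha delta t _ C id) => // r _.
exact: eval_measurable.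
Qed.

Lemma innovation_measurable : measurable_fun setT innovation.
Proof.
apply: (@ext_fun_measurable R T T0 _ C (fun f t => wf t f)) => r /andP[r0 rT].
by apply: noise_borel; rewrite r0 ltW.
Qed.

Lemma drift_integral_continuous (f : C) (S : R) : 0 <= S < T ->
  (\int[lam]_(x in `[0%R, S]) `|delta x f|%:E < +oo)%E ->
  forall t : R, t \in `[0, S] -> forall e : R, 0 < e -> exists2 dl : R, 0 < dl & forall y : R, y \in `[0, S] ->
    `|t - y| < dl -> `|\int[lam]_(x in `[0, t]) delta x f - \int[lam]_(x in `[0, y]) delta x f| < e.
Proof.
move=> /andP[S0 ST] fin.
have iD : lam.-integrable `[0, S] (EFin \o delta^~ f).
  apply/integrableP; split=> //; apply/measurable_EFinP; apply: drift_section => //.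
  by rewrite S0 ltW.
pose J (y : R) : R := if 0 <= y <= S then \int[lam]_(x in `[0, y]) delta x f else 0.
have PJ : J \in is_pathb S.
  apply/asboolP; split.
    apply: (@subspace_eq_continuous _ _ _ (fun y => parameterized_integral lam 0 y (delta^~ f))).
      by move=> y; rewrite inE/= in_itv/= => yS; rewrite /from_subspace /= /J yS.
    exact: parameterized_integral_continuous.
  by apply/funext => y; rewrite patchE mem_setE in_itv/= /J; case: (_ && _).
have JE (y : R) : y \in `[0, S] -> PathSpace PJ y = \int[lam]_(x in `[0, y]) delta x f.
  by rewrite in_itv/= => yS; rewrite /= /J yS.
move=> t tS e e0; have [dl dl0 h] := path_cvg (PathSpace PJ) tS e0.
by exists dl => // y yS ty; rewrite -!JE//; exact: h.
Qed.

Lemma innovationE (f : C) : ratcont T (wf^~ f) ->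
  (forall S, 0 <= S < T -> (\int[lam]_(x in `[0%R, S]) `|delta x f|%:E < +oo)%E) ->
  forall t, 0 <= t < T -> innovation f t = wf t f.
Proof.
move=> U li t /andP[t0 tT]; rewrite /innovation ext_funE//.
have tT' : 0 <= t <= T by rewrite t0 ltW.
apply: ext_eq => // e e0.
pose S := (t + T) / 2; have tS : t < S by rewrite /S; lra.
have ST : S < T by rewrite /S; lra.
have S01 : 0 <= S < T by rewrite ST (le_trans t0 (ltW tS)).
have e1 : 0 < `|alpha| * e / 2 by rewrite divr_gt0// mulr_gt0// normr_gt0.
have tI : t \in `[0, T] by rewrite in_itv.
have tI' : t \in `[0, S] by rewrite in_itv/= t0 ltW.
have [d1 d10 h1] := path_cvg f tI e1.
have [d2 d20 h2] := drift_integral_continuous S01 (li S S01) tI' e1.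
exists (Num.min d1 (Num.min d2 (S - t))); first by rewrite !lt_min d10 d20 subr_gt0.
move=> y /andP[y0 yT]; rewrite !lt_min => /andP[a1 /andP[a2 a3]].
have yS : y <= S by move: a3; rewrite ltr_norml => /andP[]; lra.
have b1 : `|f t - f y| < `|alpha| * e / 2 by apply: h1 => //; rewrite in_itv/= y0 ltW.
have b2 := h2 y; rewrite in_itv/= y0 yS in b2; have {}b2 := b2 isT a2.
rewrite /noise -mulrBl normrM normfV ltr_pdivrMr ?normr_gt0// mulrC.
set I1 := \int[lam]_(x in `[0, t]) _; set I2 := \int[lam]_(x in `[0, y]) _.
rewrite (_ : f t - I1 - (f y - I2) = (f t - f y) - (I1 - I2)); last by ring.
apply: le_lt_trans (ler_normB _ _) _.
by move: b1 b2; rewrite -/I1 -/I2; set z := `|alpha| * e; set x1 := `|_|; set x2 := `|_|; lra.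
Qed.
End innovation_path.

Section solution.
Context {R : realType} {T : R} (T0 : 0 < T) {d} {Om : measurableType d} (P : probability Om R).
Local Notation C := (path_space T).
Local Notation lam := (@lebesgue_measure R).
Local Notation S := (fun t : R => 0 <= t < T).
Context (X : {RV P >-> C}) (GX : gfam P (fun b w => b (X w)) clf).
Local Notation amb := (ospan P (fun b w => b (X w)) clf).
Context (W : {RV P >-> C}) (BW : brownian_motion P W).
Context (Y : Om -> C) (mY : measurable_fun setT Y) (YA : forall b, clf b -> amb (fun w => b (Y w))).
Context (alpha : R) (alpha0 : alpha != 0) (delta : R -> C -> R) (gd : good P alpha delta Y).
Context (Q : probability C R) (QY : forall A, measurable A -> P (Y @^-1` A) = Q A).
Local Notation wf := (noise alpha delta).

Let pd : progressively_measurable delta. Proof. by case: gd. Qed.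
Let mW' r : r \in `[0, T] -> measurable_fun setT (fun w => W w r).
Proof. by move=> _; apply: (measurableT_comp (@eval_measurable R T r)). Qed.
Let GW := bm_gfam T0 mW' BW.
Let inn := innovation T0 alpha delta.
Let minn_ : measurable_fun setT inn. Proof. exact: innovation_measurable. Qed.

Let wfA t : S t -> amb (fun w => wf t (Y w)).
Proof.
move=> /andP[t0 tT]; have [_ _ _ /(_ t t0 tT) h _] := gd.
by apply: ospan_trans h => r _; exact: amb_ev.
Qed.
Let Lwf t : S t -> L2 P (fun w => wf t (Y w)). Proof. by move=> /wfA[]. Qed.
Let LW t : S t -> L2 P (fun w => W w t).
Proof. by move=> /andP[t0 tT]; apply: GW.1; rewrite in_itv/= t0 ltW. Qed.

Let gram s t : S s -> S t -> ip P (fun w => wf s (Y w)) (fun w => wf t (Y w)) = ip P (fun w => W w s) (fun w => W w t).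
Proof.
move=> /andP[s0 sT] /andP[t0 tT]; have [_ _ h _ _] := gd.
have [st|/ltW ts] := leP s t.
  by rewrite h// (bm_cov mW' BW)// ?s0//; exact: ltW.
by rewrite ipC [RHS]ipC h// (bm_cov mW' BW)// ?t0//; exact: ltW.
Qed.

(** The noise of [Y] and the given Brownian motion have equal covariances before [T], and both are
    Gaussian; [W] serves as a model from which properties of the law are copied. *)
Let same_gauss s : inS S s -> exists2 v, isG P v (lc (fun r w => wf r (Y w)) s) & isG P v (lc (fun r w => W w r) s).
Proof.
move=> sS; exists (ip P (lc (fun r w => wf r (Y w)) s) (lc (fun r w => wf r (Y w)) s)).
  have h : amb (lc (fun r w => wf r (Y w)) s).
    by apply: (@ospan_lc _ _ _ P _ _ _ _ (fun r w => wf r (Y w)) S _ _ sS) => r; exact: wfA.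
  exact: gfam_ospan GX h.
rewrite (iso_lc Lwf LW gram sS sS); apply: GW.2 => x xs.
by have /andP[x0 xT] := sS x xs; rewrite in_itv/= x0 ltW.
Qed.

Let S_itv (r : R) : `[0, T[%classic r -> S r. Proof. by rewrite /= in_itv. Qed.

(** Uniform continuity on rational times before [T] is an event determined by those values. It holds
    for the continuous path [W], hence almost surely for the noise, whose extension up to [T] is
    thereby defined. *)
Let rat_P : {ae P, forall w, ratcont T (wf^~ (Y w))}.
Proof.
pose ev (r : R) (g : R -> R) := g r.
have mU : <<s \bigcup_(r in `[0, T[%classic) preimage_set_system setT (ev r) measurable>> (~` [set g : R -> R | ratcont T g]).
  set G := \bigcup_(r in _) _.
  have mF r : 0 <= r < T -> measurable_fun setT (fun g : g_sigma_algebraType G => (g : R -> R) r).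
    move=> rS _ B mB; rewrite setTI; apply: sub_sigma_algebra.
    by exists r; [rewrite /= in_itv|exists B => //; rewrite setTI].
  by have := measurableC (@ratcont_measurable R T _ (g_sigma_algebraType G) (fun g => g) mF).
have e := @gaussian_law_eq R R (R -> R) ev `[0, T[%classic _ _ _ _ P P (fun w r => wf r (Y w)) (fun w r => W w r) _ _ _ _ mU.
have {}e : P ((fun w r => wf r (Y w)) @^-1` (~` [set g | ratcont T g])) = 0%E.
  rewrite e.
  - rewrite (_ : _ @^-1` _ = set0)//; apply/seteqP; split=> w //=.
    by apply; exact: path_ratcont.
  - by move=> r /S_itv rS; have [] := Lwf rS.
  - by move=> r /S_itv rS; have [] := LW rS.
  by move=> s sS; apply: same_gauss => x xs; exact: S_itv (sS x xs).
have : P.-negligible ((fun w r => wf r (Y w)) @^-1` (~` [set g | ratcont T g])).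
  apply/negligibleP => //.
  have := @ratcont_measurable R T _ Om (fun w r => wf r (Y w)).
  move=> /(_ _)/measurableC; apply.
  by move=> r rS; have [] := Lwf rS.
exact.
Qed.

Let to_Q (A : set C) : measurable A -> {ae P, forall w, A (Y w)} -> {ae Q, forall f, A f}.
Proof. by move=> mA; exact: (@law_ae _ _ _ _ _ _ _ P Q Y id A). Qed.

Lemma Q_drift : locally_integrable_drift Q delta idfun.
Proof.
apply: (locally_integrable_ae T0 pd) => t tT; have [_ li _ _ _] := gd.
apply: (to_Q (A := [set f | (\int[lam]_(x in `[0%R, t]) `|delta x f|%:E < +oo)%E])); last first.
  by apply: filterS li => w /(_ t tT).
have /andP[t0 t1] := tT; have tT' : 0 <= t <= T by rewrite t0 ltW.
have mid : measurable_fun setT (idfun : C -> g_sigma_algebraType (past (@idfun C) t)).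
  by apply: past_measurable => r _; exact: eval_measurable.
have := measurableT_comp (lint_past pd tT') mid.
move=> /(_ measurableT [set x | (x < +oo)%E]); rewrite setTI; apply.
by rewrite -set_itvNyo; exact: emeasurable_itv.
Qed.

Let rat_Q : {ae Q, forall f, ratcont T (wf^~ f)}.
Proof.
apply: (to_Q (A := [set f | ratcont T (wf^~ f)])); last exact: rat_P.
apply: (@ratcont_measurable R T _ C (fun f t => wf t f)) => r /andP[r0 rT].
by apply: noise_borel => //; rewrite r0 ltW.
Qed.

Let inn_P : {ae P, forall w, forall t, S t -> inn (Y w) t = wf t (Y w)}.
Proof.
have [_ li _ _ _] := gd; apply: filterS2 rat_P li => w h1 h2 t St.
exact: innovationE.
Qed.

Let inn_Q : {ae Q, forall f, forall t, S t -> inn f t = wf t f}.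
Proof.
apply: filterS2 rat_Q Q_drift => f h1 h2 t St.
exact: innovationE.
Qed.

Let inn_law A : measurable A -> P (W @^-1` A) = Q (inn @^-1` A).
Proof.
move=> mA; rewrite -QY; last by rewrite -[X in measurable X]setTI; exact: minn_.
have sA : <<s \bigcup_(r in `[0, T[%classic) preimage_set_system setT (fun f : C => f r) measurable>> A.
  by have := @halfopen_measurable R T T0 _ C (fun f => f) measurableT A mA; rewrite setTI.
apply: (@gaussian_law_eq R R C (fun r f => f r) `[0, T[%classic _ _ _ _ P P W (inn \o Y) _ _ _ _ sA).
- by move=> r /S_itv rS; have [] := LW rS.
- by move=> r _; apply: (measurableT_comp (@eval_measurable R T r)); exact: measurableT_comp.
move=> s sS; have sS' : inS S s by move=> x xs; exact: S_itv (sS x xs).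
have [v G1 G2] := same_gauss sS'; exists v => //.
apply: isG_ae G1.
  apply: (measurableT_comp (f := lc (fun r (f : C) => f r) s)).
    rewrite /lc; apply: measurable_sum => c; apply: measurable_funM => //; exact: eval_measurable.
  exact: measurableT_comp.
apply: filterS inn_P => w h; apply: eq_big_seq => c cs; congr (_ * _).
exact/h/sS'.
Qed.

Theorem law_solution : exists W' : {RV Q >-> C},
  brownian_motion Q W' /\ strong_solution Q W' alpha delta idfun.
Proof.
have [W' W'E] := mk_mfun minn_.
have mW2 : measurable_fun setT (W' : C -> C) by [].
have mW1 : measurable_fun setT (W : Om -> C) by [].
exists W'; split.
  apply: (brownian_law (P1 := P) mW1 mW2) BW => A mA.
  by rewrite inn_law//; congr (Q _); apply/seteqP; split=> f /=; rewrite W'E.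
have [_ _ cov _ rec] := gd.
split.
- apply: (to_Q (A := [set f : C | f 0 = 0])).
    have m0 : measurable_fun setT (fun f : C => f 0) := @eval_measurable R T 0.
    by have := m0 measurableT [set 0] (measurable_set1 _); rewrite setTI.
  (* The noise at time 0 is the initial value divided by [alpha], and its second moment is zero. *)
  have S0 : S 0 by rewrite lexx.
  apply: filterS (ip0_ae (Lwf S0) (cov 0 0 (lexx 0) (lexx 0) T0)) => w /eqP.
  rewrite /noise set_itv1 Rintegral_set1 subr0 mulf_eq0 invr_eq0 (negbTE alpha0) orbF.
  by move/eqP.
- apply: filterS inn_Q => f h t tT; rewrite W'E h// /noise.
  by set I := \int[lam]_(x in _) _; rewrite -[LHS]/(f t); field.
move=> t tT B mB; have /andP[t0 t1] := tT.
have St r : `[0, t]%classic r -> S r.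
  by rewrite /= in_itv/= => /andP[-> rt]; exact: le_lt_trans rt t1.
have Lwt r : `[0, t]%classic r -> L2 P (fun w => wf r (Y w)) by move=> /St; exact: Lwf.
(* For adaptedness, [Y_t] is an almost sure limit of combinations of its own noise up to [t]. Under
   [Q] the same combinations of [W'] converge to the coordinate at [t], and [g] is that limit as a
   function of the past of [W']. *)
have [l lS [ael _]] := ospan_approx Lwt (rec t t0 t1).
pose g f := flim (fun n => lc (fun r (f : C) => W' f r) (l n) f).
exists (g @^-1` B).
  have mWp : measurable_fun setT (W' : g_sigma_algebraType (past W' t) -> g_sigma_algebraType (past (@idfun C) t)).
    apply: past_measurable => r rt _ E mE; rewrite setTI; apply: sub_sigma_algebra.
    by exists r => //; exists E => //; rewrite setTI.
  have mg : measurable_fun setT (g : g_sigma_algebraType (past W' t) -> R).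
    apply: (@measurable_flim _ (g_sigma_algebraType (past W' t)) R setT (fun n f => lc (fun r (f : C) => W' f r) (l n) f)) => // n.
    exact: (measurableT_comp (lc_past_measurable (lS n)) mWp).
  by have := mg measurableT B mB; rewrite setTI.
pose h f := flim (fun n => lc (fun r (f : C) => wf r f) (l n) f).
have mlc n : measurable_fun setT (lc (fun r (f : C) => wf r f) (l n)).
  (* All times in [l n] satisfy the test, so inserting it changes nothing, while it makes every
     summand measurable. *)
  rewrite /lc (_ : (fun w => _) = fun f => \sum_(x <- l n) (if 0 <= x.2 <= T then x.1 * wf x.2 f else 0)).
    apply: measurable_sum => c; have [cT|_] := boolP (0 <= c.2 <= T) => //.
    by apply: measurable_funM => //; exact: noise_borel.
  apply/funext => f; apply: eq_big_seq => x xl; have /andP[x0 xT] := St _ (lS n x xl).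
  by rewrite x0 (ltW xT).
have hQ : {ae Q, forall f, h f - f t = 0}.
  apply: (to_Q (A := [set f | h f - f t = 0])).
    have mh : measurable_fun setT (fun f : C => h f - f t).
      apply: measurable_funB; last exact: eval_measurable.
      exact: (@measurable_flim _ C R setT (fun n f => lc (fun r (f : C) => wf r f) (l n) f)).
    by have := mh measurableT [set 0] (measurable_set1 _); rewrite setTI.
  by apply: filterS ael => w cw; rewrite /= /h (flimE cw) subrr.
have gQ : {ae Q, forall f, g f = f t}.
  apply: filterS2 hQ inn_Q => f /eqP; rewrite subr_eq0 => /eqP <- H.
  rewrite /g /h; congr flim; apply/funext => n; apply: eq_big_seq => x xl.
  by rewrite W'E H//; apply: St (lS n x xl).
have : Q.-negligible (~` [set f | g f = f t]) by exact: gQ.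
apply: negligibleS => f /= nf ef; move: nf; rewrite /setY /= ef.
by case=> -[].
Qed.
End solution.

Theorem theorem4p1 (R : realType) (T : R) (T_gt0 : 0 < T)
  (H : completeNormedModType R) (ip : {dot H for idfun})
  (norm_ip : forall h, `|h| ^+ 2 = ip h h)
  (H_separable : exists2 D : set H, countable D & dense D)
  (u : {linear H -> path_space T})
  (u_bounded : bounded_near u (nbhs 0))
  (d : measure_display) (Omega : measurableType d) (P : probability Omega R)
  (X : {RV P >-> path_space T})
  (X_gaussian : gaussian_process P X) (X_centered : centered P X)
  (X_generated : generated_by P ip u X)
  (N : nat) (a : 'I_N -> {scalar path_space T})
  (a_continuous : forall i, continuous (a i))
  (e : N.-tuple H)
  (e_basis : orthonormal_basis ip (detached_space ip u a) (nth 0 e))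
  (cond_i : sup [set s | 0 <= s <= T /\
      exists e' : 'I_N -> H, forall i, reduced_space u a (e' i) /\
        forall x, 0 <= x <= s -> u (e' i) x = u (tnth e i) x] = T)
  (W : {RV P >-> path_space T}) (alpha : R) (beta : R -> path_space T -> R)
  (W_brownian : brownian_motion P W)
  (alpha_neq0 : alpha != 0)
  (beta_progressive : progressively_measurable beta)
  (beta_integrable : locally_integrable_drift P beta X)
  (X_solution : strong_solution P W alpha beta X)
  (d' : measure_display) (Omega' : measurableType d')
  (P' : probability Omega' R) (XA : {RV P' >-> path_space T})
  (XA_conditioned : conditioned_process P X a P' XA) :
  let Q : probability (path_space T) R := distribution P' XA in
  exists (W' : {RV Q >-> path_space T}) (delta : R -> path_space T -> R),
    [/\ brownian_motion Q W',
        progressively_measurable delta,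
        locally_integrable_drift Q delta idfun &
        strong_solution Q W' alpha delta idfun].
Proof.
move=> Q.
have GX := functional_gfam T_gt0 norm_ip H_separable u_bounded X_generated W_brownian.
have gX := initial_good T_gt0 GX W_brownian alpha_neq0 beta_progressive beta_integrable X_solution.
have [p [delta [gY orth]]] := reduction T_gt0 norm_ip H_separable u_bounded X_generated
  W_brownian a_continuous e_basis cond_i alpha_neq0 gX.
have mY := shift_measurable T_gt0 GX a_continuous p.
have YA b : clf b -> ospan P (fun b w => b (X w)) clf (fun w => b (shift a p (X w))).
  by move=> Sb; have [_ h] := clf_shift a_continuous p Sb; apply: (ospan_gen (GX.1 _ h) h).
have QY A : measurable A -> P ((fun w => shift a p (X w)) @^-1` A) = Q A.
  by move=> mA; exact: (conditioned_law T_gt0 GX a_continuous orth XA_conditioned).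
have [W' [bW' sol]] := law_solution T_gt0 GX W_brownian mY YA alpha_neq0 gY QY.
exists W', delta; split => //; first by case: gY.
exact: (Q_drift T_gt0 mY gY QY).
Qed.
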